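(* Let $\mathcal{S}$ be the set of positive integers that can be written as $x^2+y^2$ with $x,y$ integers, and let $p_\mathcal{S}(n)$ denote the number of partitions of $n$ all of whose parts lie in $\mathcal{S}$. Then, as $n\to\infty$, \[ p_\mathcal{S}(n)\sim 2^{-9/8}\Big(\frac{K}{3}\Big)^{1/4}n^{-\frac{3}{4}}(\log n)^{-\frac{1}{8}} \exp\Bigg(2^{3/4}\pi\sqrt{\frac{K}{3}}\,n^{1/2}(\log n)^{-1/4}\big(1+o(1)\big)\Bigg), \] where $K$ is the Landau–Ramanujan constant.
   Context: A partition of $n$ is a non-increasing sequence of positive integers summing to $n$. The Landau–Ramanujan constant is $K=\frac{1}{\sqrt{2}}\prod_{p\equiv 3 \ (\mathrm{mod}\ 4)}\big(1-\frac{1}{p^2}\big)^{-1/2}\approx 0.7642236\ldots$, the product over primes $p\equiv 3 \pmod 4$. *)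

(* Defs.v *)
From HB Require Import structures.
From mathcomp Require Import all_boot all_order all_algebra.
From mathcomp Require Import finmap.
From mathcomp Require Import all_classical all_reals all_analysis.
From mathcomp Require Import ring lra.

Set Implicit Arguments.
Unset Strict Implicit.
Unset Printing Implicit Defensive.

Import Order.TTheory GRing.Theory Num.Theory.
Import numFieldNormedType.Exports.

Local Open Scope classical_set_scope.
Local Open Scope ring_scope.

Definition is_partition (n : nat) (s : seq nat) : bool :=
  [&& sorted geq s, all (leq 1) s & sumn s == n].

Definition sum_two_squares : set nat :=
  [set m : nat | (0 < m)%N /\ exists x y : int, m%:Z = x ^+ 2 + y ^+ 2].

Definition partitions_in (S : set nat) (n : nat) : set (seq nat) :=
  [set s : seq nat | is_partition n s /\ (forall m : nat, m \in s -> S m)].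

(* [fset_set] is the empty set on an infinite set; [finite_partitions_in]
   shows that this case does not occur. *)
Definition npartitions_in (S : set nat) (n : nat) : nat :=
  #|` fset_set (partitions_in S n)|.

Lemma finite_partitions_in (S : set nat) (n : nat) :
  finite_set (partitions_in S n).
Proof.
pose f (b : n.-bseq 'I_n.+1) : seq nat := map val b.
apply: (@sub_finite_set _ _ (f @` setT)); last exact/finite_image/finite_finset.
move=> s [/and3P[_ pos /eqP sn] _].
have szs : (size s <= n)%N.
  rewrite -sn; elim: s pos {sn} => //= x s IH /andP[x0 /IH].
  by rewrite -add1n; exact: leq_add.
have les x : x \in s -> (x < n.+1)%N.
  rewrite ltnS -sn; elim: s {pos sn szs} => //= y s IH.
  rewrite inE => /orP[/eqP->|/IH/leq_trans->//]; first exact: leq_addr.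
  exact: leq_addl.
have sz : (size (map (@inord n) s) <= n)%N by rewrite size_map.
exists (Bseq sz) => //; rewrite /f /= -map_comp -[RHS]map_id.
by apply/eq_in_map => x /les xn /=; rewrite inordK.
Qed.

Definition landau_ramanujan_prod (R : realType) (N : nat) : R :=
  \prod_(0 <= p < N | prime p && (p %% 4 == 3)%N)
    (1 - (p%:R ^+ 2)^-1) `^ (- (1 / 2)).

(* [lim] is unspecified on divergent sequences; [is_cvg_landau_ramanujan_prod]
   shows that this case does not occur. *)
Definition landau_ramanujan (R : realType) : R :=
  (Num.sqrt 2)^-1 * limn (@landau_ramanujan_prod R).

Lemma is_cvg_landau_ramanujan_prod (R : realType) :
  cvgn (@landau_ramanujan_prod R).
Proof.
have fbnd (p : nat) : (1 < p)%N ->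
    1 <= (1 - (p%:R ^+ 2)^-1 : R) `^ (- (1 / 2)) <= (1 - (p%:R ^+ 2)^-1)^-1.
  move=> p1; set x := 1 - _.
  have p1' : (1 < p%:R :> R) by rewrite ltr1n.
  have x0 : 0 < x by rewrite subr_gt0 invf_lt1 ?exprn_gt0 ?exprn_egt1 //; lra.
  have x1 : x <= 1 by rewrite lerBlDr lerDl invr_ge0 exprn_ge0 //; lra.
  have y0 : 0 < x `^ (1 / 2) by rewrite powR_gt0.
  have y1 : x `^ (1 / 2) <= 1.
    have e1 : 1 `^ (1 / 2) = 1 :> R by rewrite powR1.
    rewrite -[leRHS]e1.
    by apply: ge0_ler_powR; rewrite ?nnegrE ?(ltW x0) //; lra.
  rewrite powRN invf_ge1 // y1 /= lef_pV2 ?posrE //.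
  rewrite -[leLHS]powRr1 ?(ltW x0)//.
  by apply: ger_powR; rewrite ?x0 ?x1 //; lra.
have pos N : 0 <= @landau_ramanujan_prod R N.
  by apply: prodr_ge0 => p _; exact: powR_ge0.
have step N : @landau_ramanujan_prod R N.+1 = landau_ramanujan_prod R N *
   (if prime N && (N %% 4 == 3)%N
    then (1 - (N%:R ^+ 2)^-1) `^ (- (1 / 2)) else 1).
  by rewrite /landau_ramanujan_prod big_mkcond big_nat_recr //= -big_mkcond.
apply: nondecreasing_is_cvgn.
  apply/nondecreasing_seqP => N; rewrite step ler_peMr //.
  by case: ifP => // /andP[/prime_gt1/fbnd/andP[]].
exists 2 => _ [N _ <-].
suff H (n : nat) : @landau_ramanujan_prod R n.+2 <= 2 * n.+1%:R / n.+2%:R.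
  case: N => [|[|n]].
  - by rewrite /landau_ramanujan_prod big_geq // ler1n.
  - by rewrite step /landau_ramanujan_prod big_geq //= mul1r ler1n.
  - apply: le_trans (H n) _.
    by rewrite ler_pdivrMr ?ltr0n // ler_pM2l ?ltr0n // ler_nat.
elim: n => [|n IH].
  by rewrite 2!step /landau_ramanujan_prod big_geq //= !mul1r mulr1 divff.
rewrite step.
have -> : 2 * n.+2%:R / n.+3%:R =
    (2 * n.+1%:R / n.+2%:R) * (1 - (n.+2%:R ^+ 2)^-1)^-1 :> R.
  rewrite -[n.+3]addn3 -[n.+2]addn2 -[n.+1]addn1 !natrD.
  have n0 : 0 <= n%:R :> R by [].
  move: (n%:R : R) n0 => y y0.
  have -> : 1 - ((y + 2) ^+ 2)^-1 = (y + 1) * (y + 3) / (y + 2) ^+ 2.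
    by field; lra.
  by field; apply/and3P; split; lra.
apply: ler_pM => //; first by case: ifP => // _; exact: powR_ge0.
by have /andP[h1 h2] := fbnd n.+2 isT; case: ifP => // _; exact: le_trans h2.
Qed.

(* Main.v *)
(* Only the logarithm of the partition function matters: eps is free, so it can
   absorb the prefactor, and it is enough that ln p(n) is asymptotic to the
   leading exponent.

   Landau's theorem on the number M(e^v) of sums of two squares up to e^v is
   obtained without complex analysis.  With m(v) = e^(-v) M(e^v) and F(s) the
   Dirichlet series of the sums of two squares, F^2 is zeta(s) L(s, chi) times a
   product over p = 2 and p = 3 mod 4, which gives m * m = pi K^2 + O(e^(-v/4))
   for the convolution square.  The 3-4-1 inequality bounds the Laplace
   transform phi of m away from 0 near the line Re z = 0, so the identity for
   phi^2 bounds, in L^2 and by Parseval, the function v^(1/2) times the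
   derivative of v^(1/2) m_7(v), where m_7 is m smoothed seven times.  By Cauchy-Schwarz
   v^(1/2) m_7(v) varies slowly, and comparison with its Laplace transform
   yields its limit K; the smoothing is then undone by monotonicity.

   Partial summation turns this into
   sum over m of -ln (1 - e^(-mt)) ~ zeta(2) K / (t sqrt (ln (1/t))),
   whose exponential generates p(n).  Each term is at most the sum, giving the
   upper bound for p(n); the terms with n / mu^2 <= k <= n dominate the series
   at la t for 1 < la < mu, giving the lower bound because p is nondecreasing. *)
Require Import Defs.
From HB Require Import structures.
From mathcomp Require Import all_boot all_order all_algebra.
From mathcomp Require Import finmap.
From mathcomp Require Import all_classical all_reals all_analysis.
From mathcomp Require finfield.
From mathcomp Require Import complex measurable_realfun.
From mathcomp Require Import ring lra zify.
Set Implicit Arguments.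
Unset Strict Implicit.
Unset Printing Implicit Defensive.
Import Order.TTheory GRing.Theory Num.Theory.
Import numFieldNormedType.Exports.
Local Open Scope classical_set_scope.
Local Open Scope ring_scope.

(** * Integrals over the real line and Laplace transforms *)

(** Only phi^2 is explicit: phi^2 = c / z + r at z = d + i y, with r and r' bounded, and no analytic
    square root is taken. The operator 2 z phi' + phi annihilates the model z^(-1/2), and its
    product with phi is z r' + r, where the pole has cancelled; a lower bound for phi therefore
    controls it. The bound obtained is |phi|^2 >= b (1 + y)^(-10), so after j smoothings the squared
    modulus is O((1 + y)^(12 - 2 j)), and j = 7 is the first value for which this is integrable.
    Euler products are not formed at complex arguments: primes are removed one at a time from
    summatory functions, where dropping a local factor 1 / (1 - c p^(-s)) is the operator u(X) ->
    u(X) - c u(X / p) with integer division. The same device proves the identity for F^2, evaluates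
    the constant and carries the 3-4-1 inequality. The extra Euler product over p = 2 and p = 3 mod
    4 takes the value 4 K^2 at s = 1, and L(1, chi) = pi / 4, so c = pi K^2; the Laplace comparison
    then divides sqrt c by sqrt pi = Gamma(1/2). *)

Section Integrals.
Variable R : realType.
Implicit Types (f g h K A B : R -> R).
Notation mu := (@lebesgue_measure R).

Definition lint f : Prop := mu.-integrable setT (EFin \o f).
Definition Int f : R := \int[mu]_x f x.

Lemma lint_meas f : lint f -> measurable_fun setT f.
Proof. by move=> /integrableP[/measurable_EFinP]. Qed.

Lemma lint_le f g : measurable_fun setT f -> (forall x, `|f x| <= g x) ->
  lint g -> lint f.
Proof.
move=> mf fg ig; apply: (le_integrable _ _ _ ig) => //.
  exact/measurable_EFinP.
by move=> x _ /=; rewrite lee_fin (le_trans (fg x))// ler_norm.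
Qed.

Lemma eq_lint f g : (forall x, f x = g x) -> lint f -> lint g.
Proof. by move=> /funext ->. Qed.

Lemma eq_Int f g : (forall x, f x = g x) -> Int f = Int g.
Proof. by move=> /funext ->. Qed.

Lemma lint0 : lint (fun=> 0).
Proof. exact: integrable0. Qed.

Lemma lintD f g : lint f -> lint g -> lint (fun x => f x + g x).
Proof. by move=> lf lg; apply: (integrableD _ lf lg). Qed.

Lemma lintZ c f : lint f -> lint (fun x => c * f x).
Proof. by move=> lf; apply: (integrableZl _ c lf). Qed.

Lemma lintN f : lint f -> lint (fun x => - f x).
Proof. by move=> lf; apply: (integrableN lf). Qed.

Lemma lintB f g : lint f -> lint g -> lint (fun x => f x - g x).
Proof. by move=> lf lg; apply: (integrableB _ lf lg). Qed.

Lemma lint_abs f : lint f -> lint (fun x => `|f x|).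
Proof. by move=> lf; apply: (integrable_abse lf). Qed.

Lemma IntD f g : lint f -> lint g -> Int (fun x => f x + g x) = Int f + Int g.
Proof. by move=> ? ?; exact: RintegralD. Qed.

Lemma IntB f g : lint f -> lint g -> Int (fun x => f x - g x) = Int f - Int g.
Proof. by move=> ? ?; exact: RintegralB. Qed.

Lemma IntZ c f : lint f -> Int (fun x => c * f x) = c * Int f.
Proof. by move=> ?; exact: RintegralZl. Qed.

Lemma IntZr c f : lint f -> Int (fun x => f x * c) = Int f * c.
Proof. by move=> ?; exact: RintegralZr. Qed.

Lemma IntN f : lint f -> Int (fun x => - f x) = - Int f.
Proof.
by move=> lf; rewrite -[RHS]mulN1r -IntZ//; apply: eq_Int => x; rewrite mulN1r.
Qed.

Lemma Int0 : Int (fun=> 0) = 0.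
Proof. by rewrite /Int /Rintegral integral0. Qed.

Lemma Int_le f g : lint f -> lint g -> (forall x, f x <= g x) -> Int f <= Int g.
Proof. by move=> ? ? fg; apply: le_Rintegral. Qed.

Lemma Int_ge0 f : (forall x, 0 <= f x) -> 0 <= Int f.
Proof. by move=> f0; apply: Rintegral_ge0. Qed.

Lemma Int_abs f : lint f -> `|Int f| <= Int (fun x => `|f x|).
Proof. by move=> ?; apply: le_normr_Rintegral. Qed.

Lemma Int_abs_le f g : measurable_fun setT f -> (forall x, `|f x| <= g x) ->
  lint g -> `|Int f| <= Int g.
Proof.
move=> mf fg lg; have lf := lint_le mf fg lg.
by apply: le_trans (Int_abs lf) _; apply: Int_le => //; exact: lint_abs.
Qed.

Lemma lintM_bounded f K C : lint f -> measurable_fun setT K ->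
  (forall x, `|K x| <= C) -> lint (fun x => f x * K x).
Proof.
move=> lf mK KC; apply: (@lint_le _ (fun x => C * `|f x|)).
- by apply: measurable_funM => //; exact: lint_meas.
- by move=> x; rewrite normrM mulrC ler_wpM2r.
- exact/lintZ/lint_abs.
Qed.

Lemma EFin_Int f : lint f -> (\int[mu]_x (f x)%:E)%E = (Int f)%:E.
Proof. by move=> lf; rewrite /Int /Rintegral fineK//; exact: integrable_fin_num. Qed.

Lemma Int_eq_of f r : (\int[mu]_x (f x)%:E)%E = r%:E -> Int f = r.
Proof. by move=> H; rewrite /Int /Rintegral H. Qed.

Lemma lint_ge0 f : measurable_fun setT f -> (forall x, 0 <= f x) ->
  (\int[mu]_x (f x)%:E < +oo)%E -> lint f.
Proof.
move=> mf f0 H; apply/integrableP; split; first exact/measurable_EFinP.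
by under eq_integral => x _ do rewrite /= ger0_norm//.
Qed.

Lemma measurable_shift (a : R) :
  measurable_fun setT ((fun x : R => x + a) : measurableTypeR R -> measurableTypeR R).
Proof. by apply: measurable_funD. Qed.

Lemma lebesgue_measure_shift (a : R) (X : set R) : measurable X ->
  pushforward mu ((fun x => x + a) : _ -> measurableTypeR R) X = mu X.
Proof.
move=> mX; apply/esym/lebesgue_measure_unique => //=.
  exact: measurable_shift.
move=> ? _ [[x y]] _ <-.
rewrite /pushforward.
have -> : (fun x0 => x0 + a) @^-1` `]x, y]%classic = `]x-a, y-a]%classic.
  by apply/seteqP; split => z /=; rewrite !in_itv /=; lra.
rewrite !lebesgue_measure_itv /= !lte_fin ltrD2r; case: ifP => // _.
by rewrite -!EFinB; congr EFin; lra.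
Qed.

Lemma ge0_integral_shift (a : R) f : measurable_fun setT f ->
  (forall x, 0 <= f x) ->
  (\int[mu]_x (f (x + a))%:E = \int[mu]_x (f x)%:E)%E.
Proof.
move=> mf f0.
rewrite -[LHS](@ge0_integral_pushforward _ _ _ _ _ _ (measurable_shift a) mu setT (EFin \o f))//.
- apply: eq_measure_integral.
  exact: measurable_shift.
  by move=> ? X mX _; exact: lebesgue_measure_shift.
- exact/measurable_EFinP.
- by move=> x _; rewrite lee_fin.
Qed.

Lemma lint_shift (a : R) f : lint f -> lint (fun x => f (x + a)).
Proof.
move=> lf; have mf := lint_meas lf.
have ms := measurable_shift a.
apply/integrableP; split; first exact/measurable_EFinP/measurableT_comp.
rewrite (@ge0_integral_shift a (fun x => `|f x|))//; last exact: measurableT_comp.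
by case/integrableP: lf.
Qed.

Lemma Int_shift (a : R) f : lint f -> Int (fun x => f (x + a)) = Int f.
Proof.
move=> lf; have mf := lint_meas lf.
rewrite /Int /Rintegral; congr fine.
rewrite -[LHS](@integral_pushforward _ _ _ _ _ _ (measurable_shift a) mu setT (EFin \o f))//.
- apply: eq_measure_integral.
  exact: measurable_shift.
  by move=> ? X mX _; exact: lebesgue_measure_shift.
- exact/measurable_EFinP.
- exact: lint_shift lf.
Qed.

(** Integrability on the product is reduced to an integrable majorant [A] of the inner absolute
    integrals, which is the form in which every later use can verify it. *)
Lemma Int_fubini (F : R * R -> R) A : measurable_fun setT F ->
  (forall x, lint (fun y => F (x, y))) ->
  (forall y, lint (fun x => F (x, y))) ->
  (forall x, Int (fun y => `|F (x, y)|) <= A x) -> lint A ->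
  [/\ lint (fun x => Int (fun y => F (x, y))),
      lint (fun y => Int (fun x => F (x, y))) &
      Int (fun x => Int (fun y => F (x, y))) = Int (fun y => Int (fun x => F (x, y)))].
Proof.
move=> mF l1 l2 FA lA.
have iF : (mu \x mu)%E.-integrable setT (EFin \o F).
  apply/integrable12ltyP; first exact/measurable_EFinP.
  apply: (@le_lt_trans _ _ (\int[mu]_x (A x)%:E)%E); last by rewrite EFin_Int// ltry.
  apply: ge0_le_integral => //.
  - by move=> x _; exact: integral_ge0.
  - apply: (@measurable_fun_fubini_tonelli_F _ _ _ _ _ mu (abse \o (EFin \o F))).
      by apply: measurableT_comp => //; exact/measurable_EFinP.
    by move=> x /=; rewrite lee_fin.
  - by apply/measurable_EFinP; exact: lint_meas lA.
  move=> x _ /=; rewrite (@EFin_Int (fun y => `|F (x, y)|)) ?lee_fin//.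
  exact: lint_abs (l1 x).
have i1 := integrable_fubini_F iF.
have e1 : EFin \o (fun x => Int (fun y => F (x, y))) = fubini_F mu (EFin \o F).
  by apply/funext => x /=; rewrite -EFin_Int.
(* The second marginal is the first marginal of [F] with its coordinates exchanged. *)
have i2 : mu.-integrable setT (fubini_G mu (EFin \o F)).
  have mF' : measurable_fun setT (fun z : R * R => F (z.2, z.1)).
    by apply: (measurableT_comp mF); exact: measurable_fun_pair.
  have /integrable21ltyP H := iF.
  have : (mu \x mu)%E.-integrable setT (EFin \o (fun z : R * R => F (z.2, z.1))).
    apply/integrable12ltyP; first exact/measurable_EFinP.
    by apply: H; exact/measurable_EFinP.
  exact: integrable_fubini_F.
have e2 : EFin \o (fun y => Int (fun x => F (x, y))) = fubini_G mu (EFin \o F).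
  by apply/funext => x /=; rewrite -EFin_Int.
split; [by rewrite /lint e1|by rewrite /lint e2|].
have := Fubini iF; rewrite /=.
under eq_integral => x _ do rewrite (EFin_Int (l1 x)).
under [in RHS]eq_integral => x _ do rewrite (EFin_Int (l2 x)).
by rewrite /Int /Rintegral => ->.
Qed.

End Integrals.

(** * Integrals over the half-line of exponentials and trigonometric functions *)

Section HalfLine.
Variable R : realType.
Notation mu := (@lebesgue_measure R).
Implicit Types (f g F G a b : R -> R).

(** Extension by zero, so that all integrals are taken over the whole line and translations need no
    change of domain. *)
Definition half g : R -> R := fun v => if 0 <= v then g v else 0.

Lemma measurable_half g : measurable_fun setT g -> measurable_fun setT (half g).
Proof.
move=> mg; apply: measurable_fun_ifT => //.
by apply: measurable_fun_ler.
Qed.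

(** For a nonnegative integrand the finite value of the integral yields integrability as well;
    signed integrands are reached by adding a multiple of an integrable positive one. *)
Lemma half_FTC g F l : (forall x, 0 <= x -> 0 <= g x) -> continuous g ->
  (forall x : R, is_derive x 1 F (g x)) -> F x @[x --> +oo] --> l ->
  lint (half g) /\ Int (half g) = l - F 0.
Proof.
move=> g0 cg dF Fl.
have cF : continuous F.
  by move=> x; apply: differentiable_continuous; apply/derivable1_diffP; have [] := dF x.
have H : (\int[mu]_x (half g x)%:E = (l - F 0)%:E)%E.
  transitivity (\int[mu]_(x in `[0%R, +oo[) (g x)%:E)%E.
    rewrite [RHS]integral_mkcond; apply: eq_integral => x _.
    rewrite /half patchE; case: ifPn => x0; case: ifPn => //.
      by rewrite notin_setE /= in_itv/= x0.
    by rewrite inE /= in_itv /= andbT (negbTE x0).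
  rewrite (@ge0_continuous_FTC2y _ g F 0 l)//.
  - exact: continuous_subspaceT.
  - by apply: cvg_at_right_filter; exact: cF.
  - by move=> x _; rewrite derive1E; have [_ ->] := dF x.
split; last exact: Int_eq_of.
apply: lint_ge0.
- by apply: measurable_half; exact: continuous_measurable_fun.
- by move=> x; rewrite /half; case: ifP => // /g0.
- by rewrite H ltry.
Qed.

Lemma is_derive_expR_comp g (x b : R) : is_derive x 1 g b ->
  is_derive x 1 (fun v => expR (g v)) (expR (g x) * b).
Proof. by move=> H; exact: (is_derive1_comp (is_derive_expR (g x)) H). Qed.

Lemma is_derive_cos_comp g (x b : R) : is_derive x 1 g b ->
  is_derive x 1 (fun v => cos (g v)) (- sin (g x) * b).
Proof. by move=> H; exact: (is_derive1_comp (is_derive_cos (g x)) H). Qed.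

Lemma is_derive_sin_comp g (x b : R) : is_derive x 1 g b ->
  is_derive x 1 (fun v => sin (g v)) (cos (g x) * b).
Proof. by move=> H; exact: (is_derive1_comp (is_derive_sin (g x)) H). Qed.

Lemma is_deriveMl (d x : R) : is_derive x 1 (fun v : R => d * v) d.
Proof. by apply: is_derive_eq; rewrite /GRing.scale /=; ring. Qed.

Lemma is_derive_expRM (d x : R) :
  is_derive x 1 (fun v => expR (- (d * v))) (- d * expR (- (d * x))).
Proof.
have H : is_derive x 1 (fun v : R => - (d * v)) (- d).
  exact: is_deriveN (is_deriveMl d x).
by apply: is_derive_eq (is_derive_expR_comp H) _; ring.
Qed.

Lemma is_derive_cosM (y x : R) :
  is_derive x 1 (fun v => cos (y * v)) (- y * sin (y * x)).
Proof. by apply: is_derive_eq (is_derive_cos_comp (is_deriveMl y x)) _; ring. Qed.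

Lemma is_derive_sinM (y x : R) :
  is_derive x 1 (fun v => sin (y * v)) (y * cos (y * x)).
Proof. by apply: is_derive_eq (is_derive_sin_comp (is_deriveMl y x)) _; ring. Qed.

Lemma cvg_expRM (d : R) : 0 < d -> expR (- (d * v)) @[v --> +oo] --> (0 : R).
Proof.
move=> d0.
apply: (@cvg_comp _ _ _ (fun v : R => d * v) (fun v => expR (- v)) _ (pinfty_nbhs R)).
  by apply: gt0_cvgMry => //; exact: cvg_id.
exact: cvgr_expR.
Qed.

Lemma continuous_is_derive F f : (forall x : R, is_derive x 1 F (f x)) -> continuous F.
Proof.
by move=> dF x; apply: differentiable_continuous; apply/derivable1_diffP; have [] := dF x.
Qed.

Lemma half_exp (d : R) : 0 < d ->
  lint (half (fun v => expR (- (d * v)))) /\ Int (half (fun v => expR (- (d * v)))) = d^-1.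
Proof.
move=> d0.
have [||||l1 ->] := @half_FTC (fun v => expR (- (d * v))) (fun v => - d^-1 * expR (- (d * v))) 0.
- by move=> x _; exact: expR_ge0.
- by apply: continuous_is_derive; exact: is_derive_expRM.
- move=> x; have := is_derive_expRM d x => H.
  apply: is_derive_eq; rewrite /GRing.scale /=; field.
  by rewrite gt_eqF.
- rewrite -[X in _ --> X](mulr0 (- d^-1)).
  by apply: cvgM; [exact: cvg_cst|exact: cvg_expRM].
by split=> //; rewrite mulr0 oppr0 expR0; lra.
Qed.

Lemma continuous_cosM (y : R) : continuous (fun v => cos (y * v)).
Proof. by apply: continuous_is_derive; exact: is_derive_cosM. Qed.

Lemma continuous_sinM (y : R) : continuous (fun v => sin (y * v)).
Proof. by apply: continuous_is_derive; exact: is_derive_sinM. Qed.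

Lemma continuous_expRM (d : R) : continuous (fun v => expR (- (d * v))).
Proof. by apply: continuous_is_derive; exact: is_derive_expRM. Qed.

Lemma measurable_cosM (y : R) : measurable_fun setT (fun v => cos (y * v)).
Proof. by apply: continuous_measurable_fun; exact: continuous_cosM. Qed.

Lemma measurable_sinM (y : R) : measurable_fun setT (fun v => sin (y * v)).
Proof. by apply: continuous_measurable_fun; exact: continuous_sinM. Qed.

Lemma measurable_expRM (d : R) : measurable_fun setT (fun v => expR (- (d * v))).
Proof. by apply: continuous_measurable_fun; exact: continuous_expRM. Qed.

Lemma abs_cos_le1 (x : R) : `|cos x| <= 1.
Proof. by rewrite ler_norml cos_geN1 cos_le1. Qed.

Lemma abs_sin_le1 (x : R) : `|sin x| <= 1.
Proof. by rewrite ler_norml sin_geN1 sin_le1. Qed.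

Lemma cvg_expRM_bounded (d C : R) f : 0 < d -> (forall x, `|f x| <= C) ->
  expR (- (d * v)) * f v @[v --> +oo] --> (0 : R).
Proof.
move=> d0 fC.
apply: (@squeeze_cvgr _ _ _ _ (fun v => - (C * expR (- (d * v)))) (fun v => C * expR (- (d * v)))).
- near=> v; have := fC v; rewrite -ler_norml normrM (ger0_norm (expR_ge0 _)) mulrC => h.
  by apply: ler_wpM2r => //; exact: expR_ge0.
- rewrite -[X in _ --> X]oppr0 -[X in _ --> - X](mulr0 C).
  by apply: cvgN; apply: cvgM; [exact: cvg_cst|exact: cvg_expRM].
- rewrite -[X in _ --> X](mulr0 C).
  by apply: cvgM; [exact: cvg_cst|exact: cvg_expRM].
Unshelve. all: by end_near. Qed.

Lemma half_exp_trig (d y : R) : 0 < d ->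
  Int (fun v => half (fun v => expR (- (d * v))) v * cos (y * v)) = d / (d ^+ 2 + y ^+ 2) /\
  Int (fun v => half (fun v => expR (- (d * v))) v * sin (y * v)) = y / (d ^+ 2 + y ^+ 2).
Proof.
move=> d0; have [le Ie] := half_exp d0.
have dy : 0 < d ^+ 2 + y ^+ 2.
  by rewrite ltr_wpDr ?sqr_ge0// exprn_gt0.
have key (T G : R -> R) (c C : R) : measurable_fun setT T -> continuous T ->
  (forall x, `|T x| <= 1) -> (forall x, `|G x| <= C) ->
  (forall x : R, is_derive x 1 (fun v => expR (- (d * v)) * G v) (expR (- (d * x)) * T x)) ->
  - G 0 = c -> Int (fun v => half (fun v => expR (- (d * v))) v * T v) = c.
  move=> mT cT T1 GC dG c0.
  have lT : lint (fun v => half (fun v => expR (- (d * v))) v * T v).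
    exact: lintM_bounded le mT T1.
  (* [1 + T] is nonnegative where [T] alone is not; the integral of the plain exponential is
     subtracted afterwards. *)
  have [||||lh Ih] := @half_FTC (fun v => expR (- (d * v)) * (1 + T v))
     (fun v => - d^-1 * expR (- (d * v)) + expR (- (d * v)) * G v) 0.
  - move=> x _; apply: mulr_ge0; first exact: expR_ge0.
    by have := T1 x; rewrite ler_norml => /andP[]; lra.
  - move=> x; apply: cvgM; first exact: continuous_expRM.
    by apply: cvgD; [exact: cvg_cst|exact: cT].
  - move=> x; have H := is_derive_expRM d x; have H2 := dG x.
    apply: is_derive_eq; rewrite /GRing.scale /=; field.
    by rewrite gt_eqF.
  - rewrite -[X in _ --> X]addr0 -[X in _ --> X + _](mulr0 (- d^-1)).
    apply: cvgD; last exact: cvg_expRM_bounded GC.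
    by apply: cvgM; [exact: cvg_cst|exact: cvg_expRM].
  have -> : Int (fun v => half (fun v => expR (- (d * v))) v * T v) =
     Int (half (fun v => expR (- (d * v)) * (1 + T v))) - Int (half (fun v => expR (- (d * v)))).
    rewrite -IntB//; apply: eq_Int => x; rewrite /half; case: ifP => _; ring.
  rewrite Ih Ie -c0 mulr0 oppr0 expR0; lra.
split.
(* The two antiderivatives are the real and imaginary parts of exp ((- d + i y) v) / (- d + i y). *)
- apply: (key _ (fun v => (y * sin (y * v) - d * cos (y * v)) / (d ^+ 2 + y ^+ 2))
     _ ((`|y| + `|d|) / (d ^+ 2 + y ^+ 2))).
  + exact: measurable_cosM.
  + exact: continuous_cosM.
  + by move=> x; exact: abs_cos_le1.
  + move=> x; rewrite normrM (@ger0_norm _ (_^-1)) ?invr_ge0 ?(ltW dy)//.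
    rewrite ler_wpM2r ?invr_ge0 ?(ltW dy)//; apply: le_trans (ler_normB _ _) _.
    by rewrite !normrM lerD// ler_piMr// ?abs_cos_le1 ?abs_sin_le1.
  + move=> x; have H := is_derive_expRM d x; have H1 := is_derive_cosM y x; have H2 := is_derive_sinM y x.
    apply: is_derive_eq; rewrite /GRing.scale /=; field.
    by rewrite gt_eqF.
  + by rewrite mulr0 sin0 cos0; field; rewrite gt_eqF.
- apply: (key _ (fun v => - (d * sin (y * v) + y * cos (y * v)) / (d ^+ 2 + y ^+ 2))
     _ ((`|d| + `|y|) / (d ^+ 2 + y ^+ 2))).
  + exact: measurable_sinM.
  + exact: continuous_sinM.
  + by move=> x; exact: abs_sin_le1.
  + move=> x; rewrite normrM (@ger0_norm _ (_^-1)) ?invr_ge0 ?(ltW dy)//.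
    rewrite ler_wpM2r ?invr_ge0 ?(ltW dy)//; rewrite normrN; apply: le_trans (ler_normD _ _) _.
    by rewrite !normrM lerD// ler_piMr// ?abs_cos_le1 ?abs_sin_le1.
  + move=> x; have H := is_derive_expRM d x; have H1 := is_derive_cosM y x; have H2 := is_derive_sinM y x.
    apply: is_derive_eq; rewrite /GRing.scale /=; field.
    by rewrite gt_eqF.
  + by rewrite mulr0 sin0 cos0; field; rewrite gt_eqF.
Qed.

(** One term of the exponential series at [d * (1 + v)]; the factor [expR d] accounts for the shift
    by 1. *)
Lemma pow_exp_bound (d : R) (j : nat) : 0 < d ->
  exists2 C, 0 <= C & forall v, 0 <= v -> (1 + v) ^+ j <= C * expR (d * v).
Proof.
move=> d0; exists (j`!%:R / d ^+ j * expR d).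
  by rewrite mulr_ge0 ?expR_ge0// divr_ge0// exprn_ge0// ltW.
move=> v v0; rewrite -(mulrA _ (expR d)) -expRD.
have -> : d + d * v = d * (1 + v) by ring.
have h : 0 <= d * (1 + v) by rewrite mulr_ge0 ?ltW//; lra.
case: j => [|j].
  by rewrite !expr0 fact0 divr1 mul1r -[leLHS]expR0 ler_expR.
have H := expR_ge1Dxn j h.
have fj : 0 < (j.+1)`!%:R :> R by rewrite ltr0n fact_gt0.
have dj : 0 < d ^+ j.+1 by rewrite exprn_gt0.
have {}H : (d * (1 + v)) ^+ j.+1 / (j.+1)`!%:R <= expR (d * (1 + v)).
  by apply: le_trans H; rewrite ler_wpDl.
rewrite -ler_pdivrMl ?divr_gt0// invf_div.
by apply: le_trans H; rewrite exprMn mulrAC.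
Qed.

End HalfLine.

(** * Laplace transforms and convolutions of functions of polynomial growth *)

Section Transform.
Variable R : realType.
Implicit Types (a b g : R -> R).

Lemma measurable_reflect (w : R) b : measurable_fun setT b ->
  measurable_fun setT (fun u : R => b (w - u)).
Proof. by move=> mb; apply: measurableT_comp => //; exact: measurable_funB. Qed.

(** This class is stable under convolution, translation to the right and multiplication by [v], and
    any damping [expR (- (d * v))] with [d > 0] makes its members bounded and integrable. *)
Definition tempered a := [/\ measurable_fun setT a, (forall v, v < 0 -> a v = 0) &
  exists2 C, 0 <= C & exists j : nat, forall v, 0 <= v -> `|a v| <= C * (1 + v) ^+ j].

Definition damp (d : R) a : R -> R := fun v => a v * expR (- (d * v)).

Lemma measurable_damp (d : R) a : measurable_fun setT a -> measurable_fun setT (damp d a).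
Proof. by move=> ma; apply: measurable_funM => //; exact: measurable_expRM. Qed.

(** Half of the damping beats the polynomial; the other half stays as an integrable majorant. *)
Lemma tempered_damp_le a (d : R) : tempered a -> 0 < d ->
  exists2 C, 0 <= C & forall v, `|damp d a v| <= C * half (fun v => expR (- (d / 2 * v))) v.
Proof.
move=> [ma a0 [C C0 [j aC]]] d0.
have d2 : 0 < d / 2 by rewrite divr_gt0.
have [D D0 hD] := pow_exp_bound j d2.
exists (C * D); first exact: mulr_ge0.
move=> v; rewrite /damp /half; case: ifPn => v0; last first.
  by rewrite a0 ?ltNge// mul0r normr0 mulr0.
rewrite normrM (ger0_norm (expR_ge0 _)).
have -> : - (d * v) = - (d / 2 * v) - (d / 2 * v) by field.
rewrite expRD mulrA ler_wpM2r ?expR_ge0//.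
rewrite expRN ler_pdivrMr ?expR_gt0//.
by apply: le_trans (aC _ v0) _; rewrite -[leRHS]mulrA; apply: ler_wpM2l => //; exact: hD.
Qed.

Lemma lint_damp a (d : R) : tempered a -> 0 < d -> lint (damp d a).
Proof.
move=> ta d0; have [C C0 H] := tempered_damp_le ta d0.
have [ma _ _] := ta.
apply: (lint_le (measurable_damp d ma) H); apply: lintZ.
by case: (@half_exp _ (d / 2)) => //; rewrite divr_gt0.
Qed.

Lemma damp_bounded a (d : R) : tempered a -> 0 < d -> exists2 C, 0 <= C &
  forall v, `|damp d a v| <= C.
Proof.
move=> ta d0; have [C C0 H] := tempered_damp_le ta d0.
exists C => // v; apply: le_trans (H v) _.
rewrite ler_piMr// /half; case: ifPn => // v0.
rewrite -[leRHS]expR0 ler_expR oppr_le0 mulr_ge0// divr_ge0// ltW//.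
Qed.

Lemma lint_damp_cos a (d y : R) : tempered a -> 0 < d ->
  lint (fun v => damp d a v * cos (y * v)).
Proof.
move=> ta d0; apply: (lintM_bounded (lint_damp ta d0) (measurable_cosM y)).
by move=> x; exact: abs_cos_le1.
Qed.

Lemma lint_damp_sin a (d y : R) : tempered a -> 0 < d ->
  lint (fun v => damp d a v * sin (y * v)).
Proof.
move=> ta d0; apply: (lintM_bounded (lint_damp ta d0) (measurable_sinM y)).
by move=> x; exact: abs_sin_le1.
Qed.

(* the Laplace transform at [d + i y] of a function vanishing on the negatives *)
Definition Lt a (d y : R) : R[i] :=
  (Int (fun v => damp d a v * cos (y * v)) +i* - Int (fun v => damp d a v * sin (y * v)))%C.

Definition cnv a b (w : R) := Int (fun u => a u * b (w - u)).

(** The squared modulus as an element of [R]; the norm of [R[i]] takes its values in [R[i]]. *)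
Definition sqn (z : R[i]) : R := complex.Re z ^+ 2 + complex.Im z ^+ 2.

Lemma sqnM z w : sqn (z * w) = sqn z * sqn w.
Proof. by case: z => a b; case: w => c e; rewrite /sqn /=; ring. Qed.

Lemma sqn_ge0 z : 0 <= sqn z.
Proof. by rewrite addr_ge0// sqr_ge0. Qed.

Lemma sqnX z n : sqn (z ^+ n) = sqn z ^+ n.
Proof.
elim: n => [|n IH]; last by rewrite !exprS sqnM IH.
by rewrite !expr0 /sqn /= ; ring.
Qed.

Lemma sqn_eq0 z : (sqn z == 0) = (z == 0).
Proof.
case: z => a b; rewrite /sqn eq_complex /=.
by rewrite paddr_eq0 ?sqr_ge0// !sqrf_eq0.
Qed.

Lemma sqnD z w : sqn (z + w) <= 2 * sqn z + 2 * sqn w.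
Proof.
case: z => a b; case: w => c e; rewrite /sqn /=.
have := sqr_ge0 (a - c); have := sqr_ge0 (b - e); lra.
Qed.

Lemma sqnB z w : sqn (z - w) <= 2 * sqn z + 2 * sqn w.
Proof.
case: z => a b; case: w => c e; rewrite /sqn /=.
have := sqr_ge0 (a + c); have := sqr_ge0 (b + e); lra.
Qed.

Lemma temperedD a b : tempered a -> tempered b -> tempered (fun v => a v + b v).
Proof.
move=> [ma a0 [C C0 [j aC]]] [mb b0 [D D0 [k bD]]]; split.
- exact: measurable_funD.
- by move=> v v0; rewrite a0// b0// addr0.
- exists (C + D); first exact: addr_ge0.
  exists (j + k)%N => v v0; apply: le_trans (ler_normD _ _) _.
  have h1 : 1 <= 1 + v by lra.
  rewrite mulrDl lerD//.
    apply: le_trans (aC _ v0) _; apply: ler_wpM2l => //.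
    by rewrite ler_weXn2l// leq_addr.
  apply: le_trans (bD _ v0) _; apply: ler_wpM2l => //.
  by rewrite ler_weXn2l// leq_addl.
Qed.

Lemma temperedZ c a : tempered a -> tempered (fun v => c * a v).
Proof.
move=> [ma a0 [C C0 [j aC]]]; split.
- exact: measurable_funM.
- by move=> v v0; rewrite a0// mulr0.
- exists (`|c| * C); first exact: mulr_ge0.
  by exists j => v v0; rewrite normrM -mulrA ler_wpM2l// aC.
Qed.

Lemma temperedMv a : tempered a -> tempered (fun v => v * a v).
Proof.
move=> [ma a0 [C C0 [j aC]]]; split.
- exact: measurable_funM.
- by move=> v v0; rewrite a0// mulr0.
- exists C => //; exists j.+1 => v v0; rewrite normrM (ger0_norm v0) exprS.
  rewrite mulrCA ler_pM// ?aC//; lra.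
Qed.

Lemma Lt_Z c a (d y : R) : tempered a -> 0 < d ->
  Lt (fun v => c * a v) d y = (c%:C)%C * Lt a d y.
Proof.
move=> ta d0; rewrite /Lt; apply/eqP; rewrite eq_complex /=; apply/andP; split; apply/eqP.
- rewrite mul0r subr0 -IntZ; first by apply: eq_Int => v; rewrite /damp; ring.
  exact: lint_damp_cos.
- rewrite mul0r addr0 mulrN; congr (- _); rewrite -IntZ.
    by apply: eq_Int => v; rewrite /damp; ring.
  exact: lint_damp_sin.
Qed.

Lemma Lt_D a b (d y : R) : tempered a -> tempered b -> 0 < d ->
  Lt (fun v => a v + b v) d y = Lt a d y + Lt b d y.
Proof.
move=> ta tb d0; rewrite /Lt; apply/eqP; rewrite eq_complex /=; apply/andP; split; apply/eqP.
- rewrite -IntD; [|exact: lint_damp_cos|exact: lint_damp_cos].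
  by apply: eq_Int => v; rewrite /damp; ring.
- rewrite -opprD -IntD; [|exact: lint_damp_sin|exact: lint_damp_sin].
  by congr (- _); apply: eq_Int => v; rewrite /damp; ring.
Qed.

Lemma eq_Lt a b (d y : R) : (forall v, a v = b v) -> Lt a d y = Lt b d y.
Proof. by move=> /funext ->. Qed.

(* [expR (- (d * w))] factors over [u + (w - u)], so damping commutes with convolution *)
Lemma damp_cnv a b (d : R) w : tempered a -> tempered b -> 0 < d ->
  damp d (cnv a b) w = cnv (damp d a) (damp d b) w.
Proof.
move=> [ma a0 [C C0 [j aC]]] [mb b0 [D D0 [k bD]]] d0; rewrite /damp /cnv.
set e := expR (- (d * w)).
have E u : a u * expR (- (d * u)) * (b (w - u) * expR (- (d * (w - u)))) =
   e * (a u * b (w - u)).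
  rewrite /e; have -> : - (d * w) = - (d * u) + - (d * (w - u)) by ring.
  by rewrite expRD; ring.
rewrite (eq_Int E) mulrC.
have m1 := measurable_reflect w mb.
rewrite -IntZ//.
pose M := C * (1 + `|w|) ^+ j * (D * (1 + `|w|) ^+ k).
have [leM _] := @half_exp R 1 ltr01.
apply: (@lint_le _ _ (fun u => M * expR `|w| * half (fun v => expR (- (1 * v))) u)).
- exact: measurable_funM.
- have M0 : 0 <= M by rewrite !mulr_ge0// exprn_ge0// addr_ge0.
  move=> u; rewrite /half; case: ifPn => u0; last by rewrite a0 ?ltNge// mul0r normr0 mulr0.
  have [uw|uw] := ltP w u.
    by rewrite b0 ?subr_lt0// mulr0 normr0 mulr_ge0 ?expR_ge0// mulr_ge0 ?expR_ge0.
  have w0 : 0 <= w by exact: le_trans uw.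
  have aw : `|w| = w by rewrite ger0_norm.
  apply: (@le_trans _ _ M); last first.
    rewrite -mulrA -expRD ler_peMr// -[leLHS]expR0 ler_expR aw; lra.
  rewrite normrM /M aw; apply: ler_pM => //.
    apply: le_trans (aC _ u0) _; apply: ler_wpM2l => //.
    by apply: lerXn2r; rewrite ?nnegrE; lra.
  have wu0 : 0 <= w - u by lra.
  apply: le_trans (bD _ wu0) _; apply: ler_wpM2l => //.
  by apply: lerXn2r; rewrite ?nnegrE; lra.
- exact: lintZ.
Qed.

(** The integrand lives on [0, w], whose length costs one more power of [1 + w]. *)
Lemma cnv_bound a b C j D k : (forall v, v < 0 -> a v = 0) -> (forall v, v < 0 -> b v = 0) ->
  0 <= C -> 0 <= D -> measurable_fun setT a -> measurable_fun setT b ->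
  (forall v, 0 <= v -> `|a v| <= C * (1 + v) ^+ j) ->
  (forall v, 0 <= v -> `|b v| <= D * (1 + v) ^+ k) ->
  forall w, (w < 0 -> cnv a b w = 0) /\ (0 <= w -> `|cnv a b w| <= (C * D) * (1 + w) ^+ (j + k).+1).
Proof.
move=> a0 b0 C0 D0 ma mb aC bD w; split=> w0.
  rewrite /cnv -[RHS](@Int0 R); apply: eq_Int => u.
  have [u0|u0] := ltP u 0; first by rewrite a0// mul0r.
  by rewrite b0 ?mulr0//; lra.
have m1 := measurable_reflect w mb.
pose M := C * D * (1 + w) ^+ (j + k).
have M0 : 0 <= M by rewrite !mulr_ge0// exprn_ge0; lra.
have mi : measurable (`[0, w]%classic : set R) by exact: measurable_itv.
have Iw : (\int[@lebesgue_measure R]_x (\1_`[0, w] x)%:E = w%:E)%E.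
  rewrite integral_indic// setIT.
  transitivity (lebesgue_measure (`[0, w]%classic : set R)); first by [].
  rewrite lebesgue_measure_itv /= lte_fin.
  by case: ltP => [_|h]; [rewrite -EFinB subr0|congr EFin; lra].
have li : lint (\1_`[0, w] : R -> R).
  apply: lint_ge0; first exact: measurable_indic.
    by move=> x; rewrite indicE.
  by rewrite Iw ltry.
apply: (@le_trans _ _ (Int (fun u => M * \1_`[0, w] u))); last first.
  rewrite IntZ// (Int_eq_of Iw) /M exprS [X in _ <= _ * X]mulrC mulrA ler_wpM2l//; lra.
apply: Int_abs_le => //; first exact: measurable_funM.
- move=> u; rewrite indicE.
  have [u0|u0] := ltP u 0; first by rewrite a0// mul0r normr0 mulr_ge0.
  have [uw|uw] := ltP w u.
    by rewrite b0 ?subr_lt0// mulr0 normr0 mulr_ge0.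
  rewrite mem_set ?mulr1 /=; last by rewrite in_itv/= u0 uw.
  rewrite /M normrM exprD mulrACA; apply: ler_pM => //.
    apply: le_trans (aC _ u0) _; apply: ler_wpM2l => //.
    by apply: lerXn2r; rewrite ?nnegrE; lra.
  have wu0 : 0 <= w - u by lra.
  apply: le_trans (bD _ wu0) _; apply: ler_wpM2l => //.
  by apply: lerXn2r; rewrite ?nnegrE; lra.
- exact: lintZ.
Qed.

(** Fubini for a convolution tested against a bounded kernel: cosine and sine give transforms, and
    the constant 1 gives measurability of the convolution. *)
Lemma Int_cnv A B (K : R -> R) C : lint A -> lint B -> (forall v, `|B v| <= C) ->
  measurable_fun setT K -> (forall v, `|K v| <= 1) ->
  lint (fun w => cnv A B w * K w) /\
  Int (fun w => cnv A B w * K w) = Int (fun u => A u * Int (fun v => B v * K (v + u))).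
Proof.
move=> lA lB BC mK K1.
have mA := lint_meas lA; have mB := lint_meas lB.
pose F (z : R * R) := A z.1 * B (z.2 - z.1) * K z.2.
have mF : measurable_fun setT F.
  apply: measurable_funM; last exact: measurableT_comp.
  apply: measurable_funM; first exact: measurableT_comp.
  by apply: measurableT_comp => //; exact: measurable_funB.
have l1 u : lint (fun w => F (u, w)).
  apply: (@lintM_bounded _ (fun w => A u * B (w - u)) K 1) => //.
  by apply: lintZ; exact: lint_shift.
have l0 w : lint (fun u => A u * B (w - u)).
  by apply: (lintM_bounded lA (measurable_reflect w mB)) => x; exact: BC.
have l2 w : lint (fun u => F (u, w)).
  apply: (@lintM_bounded _ (fun u => A u * B (w - u)) (fun=> K w) 1) => //.
have [||_ lI e] := @Int_fubini _ F (fun u => `|A u| * Int (fun v => `|B v|)) mF l1 l2.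
- move=> u; rewrite -(@Int_shift _ (- u) (fun v => `|B v|)); last exact: lint_abs.
  have lB' : lint (fun x => `|B (x - u)|) by apply/lint_abs/lint_shift.
  rewrite -IntZ//; apply: Int_le; [exact/lint_abs/l1|exact: lintZ|] => w.
  by rewrite /F /= !normrM ler_piMr// mulr_ge0.
- have := lintZ (Int (fun v => `|B v|)) (lint_abs lA).
  by apply: eq_lint => x; rewrite mulrC.
have E1 w : Int (fun u => F (u, w)) = cnv A B w * K w.
  by rewrite /cnv -IntZr.
split; first by apply: eq_lint lI => w; rewrite E1.
rewrite -(eq_Int E1) -e; apply: eq_Int => u.
rewrite -(@Int_shift _ (- u) (fun v => B v * K (v + u))); last first.
  apply: (lintM_bounded lB _ (fun x => K1 (x + u))).
  by apply: measurableT_comp => //; exact: measurable_funD.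
rewrite -IntZ; first by apply: eq_Int => w; rewrite /F /= subrK mulrA.
rewrite (_ : (fun x => _) = (fun x => B (x - u) * K x)).
  by apply: (lintM_bounded (lint_shift _ lB) mK K1).
by apply/funext => x; rewrite subrK.
Qed.

Lemma tempered_cnv a b : tempered a -> tempered b -> tempered (cnv a b).
Proof.
move=> ta tb; have [ma a0 [C C0 [j aC]]] := ta; have [mb b0 [D D0 [k bD]]] := tb.
have H := cnv_bound a0 b0 C0 D0 ma mb aC bD.
have d0 : (0 : R) < 1 by [].
have [E E0 BE] := damp_bounded tb d0.
have n1 (v : R) : `|(fun=> 1 : R) v| <= 1 by rewrite normr1.
have [l1 _] := @Int_cnv (damp 1 a) (damp 1 b) (fun=> 1) E (lint_damp ta d0) (lint_damp tb d0)
   BE (measurable_cst _) n1.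
split.
(* The damped convolution is integrable, hence measurable, and the damping is then undone. *)
- have -> : cnv a b = (fun w => (cnv (damp 1 a) (damp 1 b) w * 1) * expR w).
    apply/funext => w; rewrite mulr1 -damp_cnv// /damp -mulrA -expRD mul1r addNr expR0 mulr1//.
  by apply: measurable_funM => //; exact: lint_meas l1.
- by move=> v v0; have [->] := H v.
- exists (C * D); first exact: mulr_ge0.
  by exists (j + k).+1 => v v0; have [_ ->] := H v.
Qed.

(** The addition formulas for [cos] and [sin] at [y * (v + u)] are complex multiplication in
    coordinates. *)
Lemma Lt_cnv a b (d y : R) : tempered a -> tempered b -> 0 < d ->
  Lt (cnv a b) d y = Lt a d y * Lt b d y.
Proof.
move=> ta tb d0.
have [E E0 BE] := damp_bounded tb d0.
have lA := lint_damp ta d0; have lB := lint_damp tb d0.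
have lAc := lint_damp_cos y ta d0; have lAs := lint_damp_sin y ta d0.
have lBc := lint_damp_cos y tb d0; have lBs := lint_damp_sin y tb d0.
have [_ ec] := @Int_cnv _ _ _ _ lA lB BE (measurable_cosM y) (fun x => abs_cos_le1 (y * x)).
have [_ es] := @Int_cnv _ _ _ _ lA lB BE (measurable_sinM y) (fun x => abs_sin_le1 (y * x)).
rewrite /Lt; apply/eqP; rewrite eq_complex /=; apply/andP; split; apply/eqP.
- under eq_Int => w do rewrite damp_cnv//.
  rewrite ec mulrN mulNr opprK -!IntZr// -IntB; last 2 first.
  + by have := lintZ (Int (fun v => damp d b v * cos (y * v))) lAc; apply: eq_lint => x; rewrite mulrC.
  + by have := lintZ (Int (fun v => damp d b v * sin (y * v))) lAs; apply: eq_lint => x; rewrite mulrC.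
  apply: eq_Int => u.
  have -> : Int (fun v => damp d b v * cos (y * (v + u))) =
     cos (y * u) * Int (fun v => damp d b v * cos (y * v)) -
     sin (y * u) * Int (fun v => damp d b v * sin (y * v)).
    rewrite -(IntZ _ lBc) -(IntZ _ lBs) -IntB; [|exact: lintZ|exact: lintZ].
    by apply: eq_Int => v; rewrite mulrDr cosD; ring.
  ring.
- under eq_Int => w do rewrite damp_cnv//.
  rewrite es mulrN mulNr -opprD; congr (- _); rewrite -!IntZr// -IntD; last 2 first.
  + by have := lintZ (Int (fun v => damp d b v * sin (y * v))) lAc; apply: eq_lint => x; rewrite mulrC.
  + by have := lintZ (Int (fun v => damp d b v * cos (y * v))) lAs; apply: eq_lint => x; rewrite mulrC.
  apply: eq_Int => u.
  have -> : Int (fun v => damp d b v * sin (y * (v + u))) =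
     cos (y * u) * Int (fun v => damp d b v * sin (y * v)) +
     sin (y * u) * Int (fun v => damp d b v * cos (y * v)).
    rewrite -(IntZ _ lBc) -(IntZ _ lBs) -IntD; [|exact: lintZ|exact: lintZ].
    by apply: eq_Int => v; rewrite mulrDr sinD; ring.
  ring.
Qed.

Lemma tempered_half_exp (c : R) : 0 <= c -> tempered (half (fun v => expR (- (c * v)))).
Proof.
move=> c0; split.
- by apply: measurable_half; exact: measurable_expRM.
- by move=> v v0; rewrite /half leNgt v0.
- exists 1 => //; exists 0%N => v v0; rewrite expr0 mulr1 /half v0 ger0_norm ?expR_ge0//.
  by rewrite -[leRHS]expR0 ler_expR oppr_le0 mulr_ge0.
Qed.

Lemma Lt_half_exp (c d y : R) : 0 <= c -> 0 < d ->
  Lt (half (fun v => expR (- (c * v)))) d y = (((c + d) +i* y)%C)^-1.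
Proof.
move=> c0 d0; have cd : 0 < c + d by lra.
have [e1 e2] := half_exp_trig y cd.
have E v : damp d (half (fun v => expR (- (c * v)))) v = half (fun v => expR (- ((c + d) * v))) v.
  rewrite /damp /half; case: ifP => _; last by rewrite mul0r.
  by rewrite -expRD; congr expR; ring.
rewrite /Lt.
rewrite (eq_Int (fun v => congr1 (fun r => r * cos (y * v)) (E v))).
rewrite (eq_Int (fun v => congr1 (fun r => r * sin (y * v)) (E v))).
rewrite e1 e2.
have n0 : (c + d) ^+ 2 + y ^+ 2 != 0.
  by rewrite gt_eqF// ltr_wpDr ?sqr_ge0// exprn_gt0.
have z0 : ((c + d) +i* y)%C != 0 by rewrite -sqn_eq0.
by apply: (mulfI z0); rewrite mulfV.
Qed.

(** Used with [h = ln p]: a delay by [ln p] is division of the counting variable by [p]. *)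
Lemma Lt_shift_scale a (c h d y : R) : tempered a -> 0 <= h -> 0 < d ->
  tempered (fun v => c * a (v - h)) /\
  Lt (fun v => c * a (v - h)) d y =
  (c * expR (- (d * h)))%:C%C * (cos (y * h) +i* - sin (y * h))%C * Lt a d y.
Proof.
move=> ta h0 d0; have [ma a0 [C C0 [j aC]]] := ta.
have ms : measurable_fun setT (fun v : R => a (v - h)).
  by apply: measurableT_comp => //; exact: measurable_funB.
split.
  apply: temperedZ; split => //; first by move=> v v0; rewrite a0//; lra.
  exists C => //; exists j => v v0.
  have [vh|vh] := ltP v h.
    rewrite a0 ?subr_lt0// normr0 mulr_ge0// exprn_ge0//; lra.
  have vh0 : 0 <= v - h by lra.
  apply: le_trans (aC _ vh0) _; apply: ler_wpM2l => //.
  by apply: lerXn2r; rewrite ?nnegrE; lra.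
have lc := lint_damp_cos y ta d0; have ls := lint_damp_sin y ta d0.
have E (K : R -> R) : lint (fun v => damp d a v * K v) ->
    Int (fun v => damp d (fun v => c * a (v - h)) v * K (v - h)) =
    c * expR (- (d * h)) * Int (fun v => damp d a v * K v).
  move=> lK; rewrite -(Int_shift (- h) lK) -IntZ; last exact: lint_shift lK.
  apply: eq_Int => v; rewrite /damp.
  have -> : - (d * v) = - (d * h) - d * (v - h) by ring.
  by rewrite expRD; ring.
have Ec := E _ lc; have Es := E _ ls.
pose q := c * expR (- (d * h)).
have lc' : lint (fun v => damp d (fun v => c * a (v - h)) v * cos (y * (v - h))).
  have := lintZ q (lint_shift (- h) lc); apply: eq_lint => v; rewrite /q /damp.
  have -> : - (d * v) = - (d * h) - d * (v - h) by ring.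
  by rewrite expRD; ring.
have ls' : lint (fun v => damp d (fun v => c * a (v - h)) v * sin (y * (v - h))).
  have := lintZ q (lint_shift (- h) ls); apply: eq_lint => v; rewrite /q /damp.
  have -> : - (d * v) = - (d * h) - d * (v - h) by ring.
  by rewrite expRD; ring.
rewrite /Lt; apply/eqP; rewrite eq_complex /=; apply/andP; split; apply/eqP.
- transitivity (cos (y * h) * Int (fun v => damp d (fun v => c * a (v - h)) v * cos (y * (v - h)))
    - sin (y * h) * Int (fun v => damp d (fun v => c * a (v - h)) v * sin (y * (v - h)))).
    rewrite -!IntZ// -IntB; [|exact: lintZ|exact: lintZ].
    apply: eq_Int => v; have -> : y * v = y * h + y * (v - h) by ring.
    by rewrite cosD; ring.
  by rewrite Ec Es; ring.
- transitivity (- (sin (y * h) * Int (fun v => damp d (fun v => c * a (v - h)) v * cos (y * (v - h)))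
    + cos (y * h) * Int (fun v => damp d (fun v => c * a (v - h)) v * sin (y * (v - h))))).
    rewrite -!IntZ// -IntD; [|exact: lintZ|exact: lintZ].
    congr (- _); apply: eq_Int => v; have -> : y * v = y * h + y * (v - h) by ring.
    by rewrite sinD; ring.
  by rewrite Ec Es; ring.
Qed.

End Transform.

(** * A Parseval inequality by Poisson averages *)

Section Parseval.
Variable R : realType.
Notation mu := (@lebesgue_measure R).
Implicit Types (g : R -> R).

Definition poisson (e x : R) := e / (e ^+ 2 + x ^+ 2).

Lemma poisson_ge0 (e x : R) : 0 < e -> 0 <= poisson e x.
Proof. by move=> e0; rewrite divr_ge0 ?(ltW e0)// addr_ge0// sqr_ge0. Qed.

Lemma poisson_den (e x : R) : 0 < e -> 0 < e ^+ 2 + x ^+ 2.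
Proof. by move=> e0; rewrite ltr_wpDr ?sqr_ge0// exprn_gt0. Qed.

Lemma is_derive_atan_scale (e x : R) : 0 < e ->
  is_derive x 1 (fun v => atan (e^-1 * v)) (poisson e x).
Proof.
move=> e0; have H : is_derive (e^-1 * x) 1 (@atan R) (1 + (e^-1 * x) ^+ 2)^-1.
  apply: DeriveDef; first exact: derivable_atan.
  by rewrite -derive1E derive1_atan.
apply: is_derive_eq (is_derive1_comp H (is_deriveMl e^-1 x)) _.
rewrite /poisson; have p := poisson_den x e0; field.
by rewrite !gt_eqF.
Qed.

Lemma continuous_poisson (e : R) : 0 < e -> continuous (poisson e).
Proof.
move=> e0 x; apply: cvgM; first exact: cvg_cst.
apply: cvgV; first by rewrite gt_eqF// poisson_den.
apply: cvgD; first exact: cvg_cst.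
exact: exprn_continuous.
Qed.

Lemma Int_poisson (e : R) : 0 < e -> lint (poisson e) /\ Int (poisson e) = pi.
Proof.
move=> e0.
have [||||lh Ih] := @half_FTC R (poisson e) (fun v => atan (e^-1 * v)) (pi / 2).
- by move=> x _; exact: poisson_ge0.
- exact: continuous_poisson.
- by move=> x; exact: is_derive_atan_scale.
- apply: (@cvg_comp _ _ _ (fun v : R => e^-1 * v) (@atan R) _ (pinfty_nbhs R)).
    by apply: gt0_cvgMry; [rewrite invr_gt0|exact: cvg_id].
  exact: cvgy_atan.
have H : (\int[mu]_x (poisson e x)%:E = (pi : R)%:E)%E.
  rewrite ge0_symfun_integralT.
  - have -> : (\int[mu]_(x in [set x | (0 <= x)%R]) (poisson e x)%:E = (pi / 2 : R)%:E)%E.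
      transitivity (\int[mu]_x (half (poisson e) x)%:E)%E.
        rewrite integral_mkcond; apply: eq_integral => x _.
        rewrite /half patchE; case: ifPn => x0; case: ifPn => //.
          by rewrite inE /= in x0; rewrite x0.
        by rewrite notin_setE /= in x0 => /x0.
      by rewrite EFin_Int// Ih mulr0 atan0 subr0.
    by rewrite -EFinM; congr EFin; field.
  - by move=> x; exact: poisson_ge0.
  - exact: continuous_poisson.
  - by move=> x; rewrite /poisson /= sqrrN.
split; last exact: Int_eq_of.
apply: lint_ge0; last by rewrite H ltry.
- by apply: continuous_measurable_fun; exact: continuous_poisson.
- by move=> x; exact: poisson_ge0.
Qed.

(** The integral equals 1; the bound [pi] is what comes from comparison with [poisson 1], and it
    cancels against the mass [pi] of the kernel in [parseval_le]. *)
Lemma Int_half_inv_sqr : lint (half (fun y : R => ((1 + y) ^+ 2)^-1)) /\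
  Int (half (fun y : R => ((1 + y) ^+ 2)^-1)) <= pi.
Proof.
have [lp Ip] := @Int_poisson 1 ltr01.
have m : measurable_fun setT (half (fun y : R => ((1 + y) ^+ 2)^-1)).
  have -> : half (fun y : R => ((1 + y) ^+ 2)^-1) = half (fun y : R => ((1 + `|y|) ^+ 2)^-1).
    by apply/funext => y; rewrite /half; case: ifP => // y0; rewrite ger0_norm.
  apply: measurable_half; apply: continuous_measurable_fun => x.
  apply: cvgV; first by rewrite gt_eqF// exprn_gt0// ltr_wpDr.
  apply: (@continuous_comp _ _ _ (fun y : R => 1 + `|y|) (fun y : R => y ^+ 2)).
    by apply: cvgD; [exact: cvg_cst|exact: norm_continuous].
  exact: exprn_continuous.
have b x : `|half (fun y : R => ((1 + y) ^+ 2)^-1) x| <= poisson 1 x.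
  rewrite /half /poisson; case: ifPn => x0.
    rewrite ger0_norm ?invr_ge0 ?sqr_ge0// expr1n mul1r lef_pV2 ?posrE.
    - by rewrite sqrrD expr1n mul1r; lra.
    - by rewrite exprn_gt0//; lra.
    - by rewrite ltr_wpDr ?sqr_ge0.
  by rewrite normr0 divr_ge0// addr_ge0// ?sqr_ge0.
split; first exact: lint_le m b lp.
by rewrite -Ip; apply: Int_le => // [|x]; [exact: lint_le m b lp|exact: le_trans (ler_norm _) (b x)].
Qed.

Section Fix.
Variable g : R -> R.
Hypothesis lg : lint g.
Variable M : R.
Hypothesis gM : forall x, `|g x| <= M.
Let Cg (y : R) := Int (fun v => g v * cos (y * v)).
Let Sg (y : R) := Int (fun v => g v * sin (y * v)).
(** The real part of exp (i y u) times the Fourier transform [Cg y - i Sg y]. *)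
Let Q (y u : R) := cos (y * u) * Cg y + sin (y * u) * Sg y.
Let E (e : R) := half (fun y : R => expR (- (e * y))).

Let mg : measurable_fun setT g. Proof. exact: lint_meas. Qed.

Let lgc y : lint (fun v => g v * cos (y * v)).
Proof. by apply: (lintM_bounded lg (measurable_cosM y)) => x; exact: abs_cos_le1. Qed.

Let lgs y : lint (fun v => g v * sin (y * v)).
Proof. by apply: (lintM_bounded lg (measurable_sinM y)) => x; exact: abs_sin_le1. Qed.

Let G1 := Int (fun v => `|g v|).
Let lag : lint (fun v => `|g v|). Proof. exact: lint_abs. Qed.

Let CgG y : `|Cg y| <= G1.
Proof.
apply: Int_abs_le lag => [|x]; first exact: lint_meas.
by rewrite normrM ler_piMr// abs_cos_le1.
Qed.

Let SgG y : `|Sg y| <= G1.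
Proof.
apply: Int_abs_le lag => [|x]; first exact: lint_meas.
by rewrite normrM ler_piMr// abs_sin_le1.
Qed.

Let QE y u : Q y u = Int (fun v => g v * cos (y * (u - v))).
Proof.
rewrite /Q /Cg /Sg -!IntZ// -IntD; [|exact: lintZ|exact: lintZ].
by apply: eq_Int => v; rewrite mulrBr cosB; ring.
Qed.

Let trig_fubini (T : R -> R) e u : 0 < e -> continuous T -> (forall x, `|T x| <= 1) ->
  [/\ lint (fun y => E e y * Int (fun v => g v * T (y * (u - v)))) &
  Int (fun y => E e y * Int (fun v => g v * T (y * (u - v)))) =
  Int (fun v => g v * Int (fun y => E e y * T (y * (u - v))))].
Proof.
move=> e0 cT T1; have [lE IE] := half_exp e0.
have mT : measurable_fun setT T by exact: continuous_measurable_fun.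
have mTu (c : R) : measurable_fun setT (fun y : R => T (y * c)).
  by apply: (measurableT_comp mT); exact: measurable_funM.
have mTv (y : R) : measurable_fun setT (fun v : R => T (y * (u - v))).
  apply: (measurableT_comp mT); apply: measurable_funM => //.
  exact: measurable_funB.
have ly (y : R) : lint (fun v => g v * T (y * (u - v))).
  exact: (lintM_bounded lg (mTv y) (fun x => T1 _)).
have lv (v : R) : lint (fun y => E e y * T (y * (u - v))).
  exact: (lintM_bounded lE (mTu _) (fun x => T1 _)).
pose F (z : R * R) := E e z.1 * (g z.2 * T (z.1 * (u - z.2))).
have [|||||lI _ eI] := @Int_fubini _ F (fun y => E e y * G1).
- apply: measurable_funM; first by apply: measurableT_comp => //; exact: lint_meas lE.
  apply: measurable_funM; first exact: measurableT_comp.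
  apply: (measurableT_comp mT); apply: measurable_funM => //.
  exact: measurable_funB.
- by move=> y; rewrite /F /=; apply: lintZ.
- move=> v; have := lintZ (g v) (lv v); apply: eq_lint => y; rewrite /F /=; ring.
- move=> y; have E0 : 0 <= E e y by rewrite /E /half; case: ifP => // _; exact: expR_ge0.
  rewrite -(IntZ _ lag); apply: Int_le => [||v]; [|exact: lintZ|].
    by apply: lint_abs; rewrite /F /=; exact: lintZ.
  by rewrite /F /= !normrM (ger0_norm E0) ler_wpM2l// ler_piMr.
- by have := lintZ G1 lE; apply: eq_lint => y; rewrite mulrC.
have E1 y : Int (fun v => F (y, v)) = E e y * Int (fun v => g v * T (y * (u - v))).
  by rewrite -IntZ.
split; first by apply: eq_lint lI => y; exact: E1.
rewrite -(eq_Int E1) eI; apply: eq_Int => v; rewrite -IntZ//.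
by apply: eq_Int => y; rewrite /F /=; ring.
Qed.

Let inner e u : 0 < e ->
  lint (fun y => E e y * Q y u) /\
  Int (fun y => E e y * Q y u) = Int (fun v => g v * poisson e (u - v)).
Proof.
move=> e0; have [l1 e1] := @trig_fubini (@cos R) e u e0 (@continuous_cos R) (@abs_cos_le1 R).
split; first by apply: eq_lint l1 => y; rewrite QE.
under eq_Int => y do rewrite QE.
rewrite e1; apply: eq_Int => v; congr (_ * _).
rewrite /poisson; have [<- _] := half_exp_trig (u - v) e0.
by apply: eq_Int => y; rewrite mulrC [y * _]mulrC mulrC.
Qed.

(** Two exchanges of integrals turn the weighted energy of the Fourier transform into [g] paired
    with its Poisson averages, without Fourier inversion; the weight [E e] makes both exchanges
    legitimate. *)
Lemma poisson_energy e : 0 < e ->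
  lint (fun y => E e y * (Cg y ^+ 2 + Sg y ^+ 2)) /\
  Int (fun y => E e y * (Cg y ^+ 2 + Sg y ^+ 2)) =
  Int (fun u => g u * Int (fun v => g v * poisson e (u - v))).
Proof.
move=> e0; have e2 : 0 < e / 2 by rewrite divr_gt0.
have [lE IE] := half_exp e0; have [lE2 _] := half_exp e2.
(* The weight is split because [Cg] and [Sg] are known to be measurable only after multiplication by
   such a weight. *)
have EE y : E e y = E (e / 2) y * E (e / 2) y.
  rewrite /E /half; case: ifP => _; last by rewrite mul0r.
  by rewrite -expRD; congr expR; field.
have mE2 : measurable_fun setT (E (e / 2)) by exact: lint_meas lE2.
have mEC : measurable_fun setT (fun y : R => E (e / 2) y * Cg y).
  have [l1 _] := @trig_fubini (@cos R) _ 0 e2 (@continuous_cos R) (@abs_cos_le1 R).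
  have := lint_meas l1; congr (measurable_fun _ _); apply/funext => y.
  by congr (_ * _); apply: eq_Int => v; rewrite sub0r mulrN cosN.
have mES : measurable_fun setT (fun y : R => E (e / 2) y * Sg y).
  have [l1 _] := @trig_fubini (@sin R) _ 0 e2 (@continuous_sin R) (@abs_sin_le1 R).
  have := measurable_funN (lint_meas l1); congr (measurable_fun _ _); apply/funext => y.
  rewrite /= -mulrN -IntN; last first.
    by apply: eq_lint (lintN (lgs y)) => v; rewrite sub0r mulrN sinN mulrN.
  by congr (_ * _); apply: eq_Int => v; rewrite sub0r mulrN sinN mulrN opprK.
pose F (z : R * R) := E e z.1 * (g z.2 * Q z.1 z.2).
have mF : measurable_fun setT F.
  have -> : F = (fun z : R * R => (E (e / 2) z.1 * (g z.2)) *
      (cos (z.1 * z.2) * (E (e / 2) z.1 * Cg z.1) + sin (z.1 * z.2) * (E (e / 2) z.1 * Sg z.1))).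
    by apply/funext => z; rewrite /F /Q EE; ring.
  have m12 : measurable_fun setT (fun z : R * R => z.1 * z.2) by exact: measurable_funM.
  apply: measurable_funM.
    by apply: measurable_funM; [exact: (measurableT_comp mE2)|exact: measurableT_comp].
  apply: measurable_funD; apply: measurable_funM.
  - apply: (@measurableT_comp _ _ _ _ _ _ (@cos R)) => //.
    by apply: continuous_measurable_fun; exact: continuous_cos.
  - exact: (measurableT_comp mEC).
  - apply: (@measurableT_comp _ _ _ _ _ _ (@sin R)) => //.
    by apply: continuous_measurable_fun; exact: continuous_sin.
  - exact: (measurableT_comp mES).
have QG y u : `|Q y u| <= 2 * G1.
  rewrite /Q; apply: le_trans (ler_normD _ _) _; rewrite !normrM.
  have := CgG y; have := SgG y; have := abs_cos_le1 (y * u); have := abs_sin_le1 (y * u).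
  have G10 : 0 <= G1 by apply: Int_ge0 => v.
  move=> s1 c1 sg cg; have -> : 2 * G1 = 1 * G1 + 1 * G1 by ring.
  by apply: lerD; apply: ler_pM.
have lQ y : lint (fun u => g u * Q y u).
  have -> : (fun u => g u * Q y u) = (fun u => Cg y * (g u * cos (y * u)) + Sg y * (g u * sin (y * u))).
    by apply/funext => u; rewrite /Q; ring.
  by apply: lintD; apply: lintZ.
have [||||lI _ eI] := @Int_fubini _ F (fun y => E e y * (2 * G1 * G1)) mF.
- by move=> y; rewrite /F /=; apply: lintZ; exact: lQ.
- move=> u; have [l1 _] := inner u e0; have := lintZ (g u) l1; apply: eq_lint => y; rewrite /F /=; ring.
- move=> y; have E0 : 0 <= E e y by rewrite /E /half; case: ifP => // _; exact: expR_ge0.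
  rewrite -(IntZ _ lag) -(IntZ (E e y)); last exact: lintZ.
  apply: Int_le => [||v]; [|by apply: lintZ; exact: lintZ|].
    by apply: lint_abs; rewrite /F /=; apply: lintZ; exact: lQ.
  rewrite /F /= !normrM (ger0_norm E0) ler_wpM2l// mulrC ler_wpM2r//.
- by have := lintZ (2 * G1 * G1) lE; apply: eq_lint => y; rewrite mulrC.
have E1 y : Int (fun u => F (y, u)) = E e y * (Cg y ^+ 2 + Sg y ^+ 2).
  rewrite /F /= (IntZ (E e y) (lQ y)); congr (_ * _).
  transitivity (Cg y * Cg y + Sg y * Sg y); last by ring.
  rewrite -[X in X * Cg y + _]/(Cg y) -[in LHS]/(Cg y).
  transitivity (Int (fun u => Cg y * (g u * cos (y * u)) + Sg y * (g u * sin (y * u)))).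
    by apply: eq_Int => u; rewrite /Q; ring.
  rewrite (IntD (lintZ (Cg y) (lgc y)) (lintZ (Sg y) (lgs y))).
  by rewrite (IntZ _ (lgc y)) (IntZ _ (lgs y)).
split; first by apply: eq_lint lI => y; exact: E1.
rewrite -(eq_Int E1) eI; apply: eq_Int => u.
have [l1 <-] := inner u e0; rewrite -(IntZ (g u) l1).
by apply: eq_Int => y; rewrite /F /=; ring.
Qed.

Hypothesis ug : forall k : R, 0 < k -> exists2 h : R, 0 < h &
  forall x u, `|x| <= h -> `|g (x + u) - g u| <= k.

(** As [e] tends to 0 the Poisson averages of [g] tend to [pi * g] uniformly, by uniform continuity,
    while the weighted energy stays below [D * pi]. Frequencies [y >= 0] carry half of the full
    energy, which is why the factor is [pi] and not 2 pi. *)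
Lemma parseval_le (D : R) : (forall y, 0 <= y -> Cg y ^+ 2 + Sg y ^+ 2 <= D / (1 + y) ^+ 2) ->
  lint (fun u => g u ^+ 2) /\ Int (fun u => g u ^+ 2) <= D.
Proof.
move=> HD.
have lg2 : lint (fun u => g u ^+ 2).
  by apply: eq_lint (lintM_bounded lg mg gM) => x; rewrite expr2.
split=> //.
have pi0 := pi_gt0 R.
have D0 : 0 <= D.
  have := HD 0 (lexx _); rewrite addr0 expr1n divr1; apply: le_trans.
  by rewrite addr_ge0// sqr_ge0.
have M0 : 0 <= M by exact: le_trans (gM 0).
have G10 : 0 <= G1 by apply: Int_ge0 => v.
suff H k : 0 < k -> pi * Int (fun u => g u ^+ 2) <= D * pi + G1 * (k * pi + k).
  rewrite leNgt; apply/negP => lt.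
  pose a := pi * (Int (fun u => g u ^+ 2) - D).
  have a0 : 0 < a by rewrite mulr_gt0// subr_gt0.
  have k0 : 0 < a / (2 * (G1 + 1) * (pi + 1)).
    by rewrite divr_gt0// mulr_gt0 ?mulr_gt0//; lra.
  have := H _ k0.
  set k := a / _ => Hk.
  have ek : k * (2 * (G1 + 1) * (pi + 1)) = a.
    by rewrite /k divfK// gt_eqF// mulr_gt0 ?mulr_gt0//; lra.
  have h1 : a <= G1 * k * (pi + 1) by rewrite /a; nra.
  have h2 : 0 <= k * (pi + 1) by rewrite mulr_ge0 ?ltW//; lra.
  have : a = 2 * (G1 + 1) * (k * (pi + 1)) by rewrite -ek; ring.
  nra.
move=> k0.
have [h h0 hh] := ug k0.
(* Where [|x| > h], [poisson e x] is at most [e * (1 + (h ^+ 2)^-1) * poisson 1 x]; this [e] keeps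
   the tail of the average below [k]. *)
pose e := k / (2 * (M + 1) * (1 + (h ^+ 2)^-1) * (pi + 1)).
have hh2 : 0 < 1 + (h ^+ 2)^-1 by rewrite ltr_wpDr// invr_ge0 sqr_ge0.
have e0 : 0 < e by rewrite /e divr_gt0// !mulr_gt0//; lra.
have [lJ eJ] := poisson_energy e0.
have [lp Ip] := Int_poisson e0.
have [lp1 Ip1] := @Int_poisson 1 ltr01.
have [li Ii] := Int_half_inv_sqr.
have J1 : Int (fun y => E e y * (Cg y ^+ 2 + Sg y ^+ 2)) <= D * pi.
  apply: (@le_trans _ _ (Int (fun y => D * half (fun y : R => ((1 + y) ^+ 2)^-1) y))).
    apply: Int_le => // [|y]; first exact: lintZ.
    rewrite /E /half; case: ifPn => y0; last by rewrite mul0r mulr0.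
    rewrite -[leRHS]mul1r; apply: ler_pM; rewrite ?expR_ge0 ?addr_ge0 ?sqr_ge0//.
      by rewrite -[leRHS]expR0 ler_expR oppr_le0 mulr_ge0// ltW.
    exact: HD.
  by rewrite IntZ// ler_wpM2l.
have lps u : lint (fun x => g (x + u) * poisson e x).
  by apply: eq_lint (lintM_bounded lp (lint_meas (lint_shift u lg)) (fun x => gM (x + u))) => x; rewrite mulrC.
have inn u : Int (fun v => g v * poisson e (u - v)) = Int (fun x => g (x + u) * poisson e x).
  rewrite -(@Int_shift _ (- u) (fun x => g (x + u) * poisson e x))//; apply: eq_Int => v.
  by rewrite subrK /poisson -(opprB u v) sqrrN.
have err u : `|Int (fun v => g v * poisson e (u - v)) - pi * g u| <= k * pi + k.
  rewrite inn -Ip -IntZr// -IntB//; last first.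
    by apply: eq_lint (lintZ (g u) lp) => x; rewrite mulrC.
  have lR : lint (fun x => k * poisson e x + 2 * M * e * (1 + (h ^+ 2)^-1) * poisson 1 x).
    by apply: lintD; exact: lintZ.
  have le2 : lint (fun x => g (x + u) * poisson e x - poisson e x * g u).
    by apply: lintB => //; apply: eq_lint (lintZ (g u) lp) => x; rewrite mulrC.
  apply: (@le_trans _ _ (Int (fun x => k * poisson e x + 2 * M * e * (1 + (h ^+ 2)^-1) * poisson 1 x))).
    apply: Int_abs_le lR => [|x]; first exact: lint_meas.
    have px := poisson_ge0 x e0; have px1 := poisson_ge0 x (@ltr01 R).
    have -> : g (x + u) * poisson e x - poisson e x * g u = (g (x + u) - g u) * poisson e x by ring.
    rewrite normrM (ger0_norm px).
    have [xh|xh] := leP `|x| h.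
      apply: (@le_trans _ _ (k * poisson e x)); first by rewrite ler_wpM2r// hh.
      by rewrite ler_wpDr// mulr_ge0// mulr_ge0 ?(ltW hh2)// mulr_ge0 ?(ltW e0)// mulr_ge0.
    apply: (@le_trans _ _ (2 * M * (e * (1 + (h ^+ 2)^-1) * poisson 1 x))); last first.
      rewrite [X in _ <= _ + X](_ : _ = 2 * M * (e * (1 + (h ^+ 2)^-1) * poisson 1 x)); last by ring.
      by rewrite lerDr mulr_ge0// ltW.
    apply: ler_pM => //.
      by apply: le_trans (ler_normB _ _) _; have := gM (x + u); have := gM u; lra.
    rewrite /poisson -mulrA ler_wpM2l ?(ltW e0)// expr1n mul1r.
    have x2 : h ^+ 2 <= x ^+ 2.
      by rewrite -[x ^+ 2]real_normK ?num_real//; apply: lerXn2r; rewrite ?nnegrE ?(ltW h0)// ltW.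
    have x0 : 0 < x ^+ 2 by apply: lt_le_trans x2; rewrite exprn_gt0.
    rewrite ler_pdivlMr; last by rewrite ltr_wpDr ?sqr_ge0.
    rewrite ler_pdivrMl; last by rewrite ltr_wpDl ?sqr_ge0.
    have xh1 : 1 <= x ^+ 2 * (h ^+ 2)^-1 by rewrite -ler_pdivrMr ?invr_gt0 ?exprn_gt0// invrK mul1r.
    have e20 : 0 <= e ^+ 2 by rewrite sqr_ge0.
    have hi : 0 <= (h ^+ 2)^-1 by rewrite invr_ge0 sqr_ge0.
    have := mulr_ge0 e20 hi; move: xh1; rewrite mulrDr mulr1 mulrDl; lra.
  rewrite IntD; [|exact: lintZ|exact: lintZ].
  rewrite (IntZ k lp) (IntZ _ lp1) Ip1 lerD2l /e.
  set X := 1 + _; set P := pi.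
  have -> : 2 * M * (k / (2 * (M + 1) * X * (P + 1))) * X * P = k * ((M / (M + 1)) * (P / (P + 1))).
    by field; rewrite /P !gt_eqF//; lra.
  rewrite ler_piMr ?(ltW k0)// mulr_ile1 ?divr_ge0 ?ler_pdivrMr//; rewrite /P; lra.
have lgI : lint (fun u => g u * Int (fun v => g v * poisson e (u - v))).
  have l0 : lint (fun u => (pi * M + (k * pi + k)) * `|g u|) by exact: lintZ.
  apply: lint_le l0; last first.
    move=> u; rewrite normrM mulrC ler_wpM2r//.
    have := err u; have := gM u; rewrite !ler_norml => /andP[a1 a2] /andP[b1 b2].
    apply/andP; split; nra.
  apply: measurable_funM => //.
  have [|||||_ l2 _] := @Int_fubini _ (fun z : R * R => g z.1 * poisson e (z.2 - z.1)) (fun x => `|g x| * pi).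
  - apply: measurable_funM; first exact: measurableT_comp.
    apply: (measurableT_comp (lint_meas lp)); exact: measurable_funB.
  - by move=> x /=; apply: lintZ; exact: lint_shift.
  - move=> y /=; have ml : measurable_fun setT (fun x : R => poisson e (y - x)) by exact: measurable_reflect (lint_meas lp).
    apply: (@lintM_bounded _ _ _ (e^-1) lg ml) => x.
    rewrite ger0_norm ?poisson_ge0// /poisson ler_pdivrMr ?poisson_den//.
    rewrite ler_pdivlMl// -expr2 lerDl sqr_ge0//.
  - move=> x /=; rewrite -Ip -(Int_shift (- x) lp) -IntZ; last exact: lint_shift.
    apply: Int_le => [||y].
    + by apply/lint_abs/lintZ/lint_shift.
    + exact/lintZ/lint_shift.
    + by rewrite normrM (ger0_norm (poisson_ge0 _ e0)).
  - by apply: eq_lint (lintZ pi lag) => x; rewrite mulrC.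
  exact: lint_meas l2.
have step : pi * Int (fun u => g u ^+ 2) - Int (fun u => g u * Int (fun v => g v * poisson e (u - v)))
    <= G1 * (k * pi + k).
  rewrite -IntZ// -IntB//; last exact: lintZ.
  rewrite mulrC -IntZ//; apply: Int_le => [||u].
  - by apply: lintB => //; exact: lintZ.
  - exact: lintZ.
  have -> : pi * g u ^+ 2 - g u * Int (fun v => g v * poisson e (u - v)) =
    - (Int (fun v => g v * poisson e (u - v)) - pi * g u) * g u by ring.
  apply: le_trans (ler_norm _) _; rewrite normrM normrN ler_wpM2r//.
move: step; rewrite -eJ; lra.
Qed.

End Fix.
End Parseval.

(** * From the square of a transform to slow variation *)

Section Smoothing.
Variable R : realType.
Implicit Types (a b m : R -> R).

Definition cabs (z : R[i]) : R := Num.sqrt (sqn z).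

Lemma cabs_ge0 (z : R[i]) : 0 <= cabs z. Proof. exact: sqrtr_ge0. Qed.

Lemma cabs_sqr (z : R[i]) : cabs z ^+ 2 = sqn z.
Proof. by rewrite sqr_sqrtr// sqn_ge0. Qed.

Lemma cabsM (z w : R[i]) : cabs (z * w) = cabs z * cabs w.
Proof. by rewrite /cabs sqnM sqrtrM// sqn_ge0. Qed.

Lemma cabsD (z w : R[i]) : cabs (z + w) <= cabs z + cabs w.
Proof.
have h : 0 <= cabs z + cabs w by rewrite addr_ge0// cabs_ge0.
rewrite -(ler_pXn2r (ltn0Sn 1)) ?nnegrE ?cabs_ge0// cabs_sqr sqrrD !cabs_sqr.
have H : (complex.Re z * complex.Re w + complex.Im z * complex.Im w) <= cabs z * cabs w.
  apply: le_trans (ler_norm _) _.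
  rewrite -(ler_pXn2r (ltn0Sn 1)) ?nnegrE ?mulr_ge0 ?cabs_ge0//.
  rewrite real_normK ?num_real// exprMn !cabs_sqr /sqn.
  have := sqr_ge0 (complex.Re z * complex.Im w - complex.Im z * complex.Re w); lra.
move: H {h}; case: z => x y; case: w => x' y'; rewrite /sqn /=; lra.
Qed.

Lemma cabsN (z : R[i]) : cabs (- z) = cabs z.
Proof. by case: z => x y; rewrite /cabs /sqn /= !sqrrN. Qed.

Lemma cabs_triB (z w : R[i]) : cabs z - cabs w <= cabs (z - w).
Proof. by rewrite lerBlDr -{1}(subrK w z) cabsD. Qed.

Lemma cabs_le (z : R[i]) (B : R) : `|complex.Re z| <= B -> `|complex.Im z| <= B -> cabs z <= 2 * B.
Proof.
move=> h1 h2; have B0 : 0 <= B by exact: le_trans h1.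
rewrite -(ler_pXn2r (ltn0Sn 1)) ?nnegrE ?cabs_ge0 ?mulr_ge0// cabs_sqr /sqn.
rewrite -(real_normK (num_real (complex.Re z))) -(real_normK (num_real (complex.Im z))).
have := normr_ge0 (complex.Re z); have := normr_ge0 (complex.Im z); nra.
Qed.

Lemma lint_cnv a b (w : R) : tempered a -> tempered b -> lint (fun u => a u * b (w - u)).
Proof.
move=> ta tb; have d0 : (0 : R) < 1 by [].
have [C C0 bC] := damp_bounded tb d0.
have [mb _ _] := tb.
have mB : measurable_fun setT (fun u : R => damp 1 b (w - u)).
  by apply: measurable_reflect; exact: measurable_damp.
have := lintZ (expR w) (lintM_bounded (lint_damp ta d0) mB (fun x => bC _)).
apply: eq_lint => u; rewrite /damp !mul1r.
have : expR w * expR (- u) * expR (- (w - u)) = 1 by rewrite -!expRD -[RHS]expR0; congr expR; ring.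
by move=> e; rewrite -[RHS]mulr1 -e; ring.
Qed.

(** The exponential density: convolving with it averages over the past and divides the transform by
    1 + d + i y. *)
Definition gam : R -> R := half (fun v => expR (- (1 * v))).
(** The unit step, written as an exponential of rate 0 so that the lemmas on half-line exponentials
    apply to it. *)
Definition heav : R -> R := half (fun v => expR (- (0 * v))).

Lemma tempered_gam : tempered gam.
Proof. exact: tempered_half_exp. Qed.

Lemma tempered_heav : tempered heav.
Proof. exact: tempered_half_exp. Qed.

Lemma gam_ge0 v : 0 <= gam v.
Proof. by rewrite /gam /half; case: ifP => // _; exact: expR_ge0. Qed.

Lemma lint_gam : lint gam. Proof. by have [] := @half_exp R 1 ltr01. Qed.

Lemma Int_gam : Int gam = 1.
Proof. by have [_ ->] := @half_exp R 1 ltr01; rewrite invr1. Qed.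

(* half-line exponentials are idempotent up to the factor [v]: [E_c * E_c = v E_c] *)
Lemma cnv_half_exp (c w : R) :
  cnv (half (fun v => expR (- (c * v)))) (half (fun v => expR (- (c * v)))) w =
  w * half (fun v => expR (- (c * v))) w.
Proof.
rewrite /cnv.
have E u : half (fun v => expR (- (c * v))) u * half (fun v => expR (- (c * v))) (w - u) =
   expR (- (c * w)) * \1_`[0, w] u.
  rewrite /half indicE; case: ifPn => u0; last first.
    by rewrite memNset ?mulr0 ?mul0r//= in_itv/= (negbTE u0).
  rewrite subr_ge0; case: ifPn => uw; last first.
    by rewrite memNset ?mulr0//= in_itv/= (negbTE uw) andbF.
  rewrite mem_set /= ?in_itv/= ?u0 ?uw// mulr1 -expRD; congr expR; ring.
rewrite (eq_Int E).
have mi : measurable (`[0, w]%classic : set R) by exact: measurable_itv.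
have Iw : (\int[@lebesgue_measure R]_x (\1_`[0, w] x)%:E = (Num.max 0 w)%:E)%E.
  rewrite integral_indic// setIT.
  transitivity (lebesgue_measure (`[0, w]%classic : set R)); first by [].
  rewrite lebesgue_measure_itv /= lte_fin.
  by case: (ltP 0 w) => [_|h]; rewrite ?oppr0 ?adde0.
have li : lint (\1_`[0, w] : R -> R).
  apply: lint_ge0; first exact: measurable_indic.
    by move=> x; rewrite indicE.
  by rewrite Iw ltry.
rewrite IntZ// (Int_eq_of Iw) /half mulrC; case: ifPn => w0.
  by rewrite max_r.
by rewrite max_l ?mul0r ?mulr0//; rewrite ltW// ltNge.
Qed.

(** On transforms this is minus the derivative in z; with it no transform has to be
    differentiated. *)
Definition Vm a : R -> R := fun v => v * a v.

Lemma tempered_Vm a : tempered a -> tempered (Vm a).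
Proof. exact: temperedMv. Qed.

Lemma Vm_cnv a b : tempered a -> tempered b ->
  Vm (cnv a b) = (fun w : R => cnv (Vm a) b w + cnv a (Vm b) w).
Proof.
move=> ta tb; apply/funext => w; rewrite /Vm /cnv -IntZ; last exact: lint_cnv.
rewrite -IntD; last 2 first.
- exact: (lint_cnv w (tempered_Vm ta) tb).
- exact: (lint_cnv w ta (tempered_Vm tb)).
by apply: eq_Int => u; ring.
Qed.

Lemma Lt_Vm_cnv a b (d y : R) : tempered a -> tempered b -> 0 < d ->
  Lt (Vm (cnv a b)) d y = Lt (Vm a) d y * Lt b d y + Lt a d y * Lt (Vm b) d y.
Proof.
move=> ta tb d0; rewrite Vm_cnv// Lt_D ?Lt_cnv//; try exact: tempered_Vm.
- by apply: tempered_cnv => //; exact: tempered_Vm.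
- by apply: tempered_cnv => //; exact: tempered_Vm.
Qed.

Lemma Lt_Vm_half_exp (c d y : R) : 0 <= c -> 0 < d ->
  Lt (Vm (half (fun v => expR (- (c * v))))) d y = (((c + d) +i* y)%C)^-1 ^+ 2.
Proof.
move=> c0 d0; rewrite expr2 -Lt_half_exp// -Lt_cnv//; try exact: tempered_half_exp.
by apply: eq_Lt => v; rewrite cnv_half_exp.
Qed.

Fixpoint sm m (j : nat) : R -> R := if j is j'.+1 then cnv (sm m j') gam else m.

Lemma tempered_sm m j : tempered m -> tempered (sm m j).
Proof.
by move=> tm; elim: j => //= j IH; apply: tempered_cnv => //; exact: tempered_gam.
Qed.

Lemma Lt_sm m j (d y : R) : tempered m -> 0 < d ->
  Lt (sm m j) d y = Lt m d y * ((((1 + d) +i* y)%C)^-1) ^+ j.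
Proof.
move=> tm d0; elim: j => [|j IH] /=; first by rewrite expr0 mulr1.
by rewrite Lt_cnv ?IH ?Lt_half_exp// ?exprSr ?mulrA//; [exact: tempered_sm|exact: tempered_gam].
Qed.

Lemma Lt_Vm_sm m j (d y : R) : tempered m -> 0 < d ->
  Lt (Vm (sm m j)) d y = Lt (Vm m) d y * ((((1 + d) +i* y)%C)^-1) ^+ j
    + j%:R * Lt m d y * ((((1 + d) +i* y)%C)^-1) ^+ j.+1.
Proof.
move=> tm d0; elim: j => [|j IH] /=; first by rewrite expr0 mulr1 mul0r mul0r addr0.
rewrite Lt_Vm_cnv//; [|exact: tempered_sm|exact: tempered_gam].
rewrite IH Lt_sm// Lt_half_exp// Lt_Vm_half_exp//.
rewrite !exprSr -[j.+1%:R]natr1; ring.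
Qed.

Lemma lint_opp a : lint a -> lint (fun x => a (- x)).
Proof.
move=> la; have ma := lint_meas la.
have mo : measurable_fun setT ((fun x => - x) : measurableTypeR R -> measurableTypeR R).
  by apply: measurableT_comp.
apply/integrableP; split; first by apply/measurable_EFinP; apply: (measurableT_comp ma).
rewrite -[ltLHS](@ge0_integral_pushforward _ _ _ _ _ _ mo (@lebesgue_measure R) setT (EFin \o (fun x => `|a x|)))//.
- rewrite (_ : integral _ _ _ = \int[@lebesgue_measure R]_x `|(a x)%:E|)%E; first by case/integrableP: la.
  apply: eq_measure_integral => //.
  by move=> X mX _; exact: lebesgue_measureN.
- by apply/measurable_EFinP; exact: measurableT_comp.
- by move=> x _; rewrite lee_fin.
Qed.

Lemma Int_opp a : lint a -> Int (fun x => a (- x)) = Int a.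
Proof.
move=> la; have ma := lint_meas la.
have mo : measurable_fun setT ((fun x => - x) : measurableTypeR R -> measurableTypeR R).
  by apply: measurableT_comp.
rewrite /Int /Rintegral; congr fine.
rewrite -[LHS](@integral_pushforward _ _ _ _ _ _ mo (@lebesgue_measure R) setT (EFin \o a))//.
- apply: eq_measure_integral => //.
  by move=> X mX _; exact: lebesgue_measureN.
- exact/measurable_EFinP.
- exact: lint_opp la.
Qed.

Lemma cnvC a b : tempered a -> tempered b -> cnv a b = cnv b a.
Proof.
move=> ta tb; apply/funext => w; rewrite /cnv.
have l1 := lint_cnv w ta tb.
rewrite -(Int_opp l1).
rewrite -(Int_shift (- w) (lint_opp l1)).
apply: eq_Int => u; rewrite mulrC; congr (b _ * a _); ring.
Qed.

Lemma cnv_gam_le a (C : R) : tempered a -> (forall v, `|a v| <= C) ->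
  forall w, `|cnv gam a w| <= C.
Proof.
move=> ta aC w; rewrite /cnv -[leRHS]mulr1 -Int_gam -(IntZ _ lint_gam).
apply: Int_abs_le => [|x|].
- exact: lint_meas (lint_cnv w tempered_gam ta).
- by rewrite normrM (ger0_norm (gam_ge0 _)) mulrC ler_wpM2r// gam_ge0.
- exact: lintZ lint_gam.
Qed.

(** Since [gam (x + h) >= expR (- h) * gam x], the difference splits at the latter into two pieces,
    each of integral [1 - expR (- h) <= h]. *)
Lemma gam_shift_Int (h : R) : 0 <= h -> Int (fun x => `|gam (x + h) - gam x|) <= 2 * h.
Proof.
move=> h0; have lh := lint_shift h lint_gam.
have e0 : expR (- h) <= 1 by rewrite -[leRHS]expR0 ler_expR oppr_le0.
have key x : `|gam (x + h) - gam x| <= (gam (x + h) - expR (- h) * gam x) + (1 - expR (- h)) * gam x.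
  have H : expR (- h) * gam x <= gam (x + h).
    rewrite /gam /half; case: ifPn => x0; last by rewrite mulr0; case: ifP => // _; exact: expR_ge0.
    by rewrite ifT ?addr_ge0// -expRD !mul1r opprD addrC.
  have := gam_ge0 x; move: H; set G := gam x; set G' := gam (x + h).
  move=> H G0; rewrite ler_norml; apply/andP; split; nra.
have l1 : lint (fun x => gam (x + h) - expR (- h) * gam x) by apply: lintB => //; exact: lintZ lint_gam.
have l2 : lint (fun x => (1 - expR (- h)) * gam x) by exact: lintZ lint_gam.
apply: (@le_trans _ _ (Int (fun x => (gam (x + h) - expR (- h) * gam x) + (1 - expR (- h)) * gam x))).
  apply: Int_le key; last exact: lintD.
  by apply/lint_abs/lintB => //; exact: lint_gam.
rewrite (IntD l1 l2) (IntB lh (lintZ _ lint_gam)) (Int_shift h lint_gam).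
rewrite (IntZ _ lint_gam) (IntZ _ lint_gam) Int_gam.
have := expR_ge1Dx (- h); lra.
Qed.

(** A single smoothing already turns a bounded function with jumps into a Lipschitz one. *)
Lemma cnv_gam_lip a (C : R) : tempered a -> (forall v, `|a v| <= C) ->
  forall w w', `|cnv gam a w - cnv gam a w'| <= 2 * C * `|w - w'|.
Proof.
move=> ta aC w w'.
have C0 : 0 <= C by exact: le_trans (aC 0).
wlog ww : w w' / w' <= w.
  move=> H; have [|/ltW] := leP w' w; first exact: H.
  by move=> /H; rewrite distrC (distrC w' w).
have E v : lint (fun u => gam (u + v) * a (- u)) /\ cnv gam a v = Int (fun u => gam (u + v) * a (- u)).
  have l := lint_cnv v tempered_gam ta.
  split.
    by apply: eq_lint (lint_shift v l) => u; rewrite opprD addrCA subrr addr0.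
  rewrite /cnv -(Int_shift v l); apply: eq_Int => u.
  by rewrite opprD addrCA subrr addr0.
have [lw ->] := E w; have [lw' ->] := E w'; rewrite -IntB//.
have h0 : 0 <= w - w' by rewrite subr_ge0.
have ld : lint (fun x => `|gam (x + (w - w')) - gam x|).
  by apply/lint_abs/lintB; [exact/lint_shift/lint_gam|exact: lint_gam].
rewrite (ger0_norm h0).
apply: (@le_trans _ _ (C * Int (fun x => `|gam (x + (w - w')) - gam x|))); last first.
  rewrite (_ : 2 * C * (w - w') = C * (2 * (w - w'))); last by ring.
  by rewrite ler_wpM2l// gam_shift_Int.
rewrite -(Int_shift w' ld) -(IntZ _ (lint_shift w' ld)).
apply: Int_abs_le => [|x|].
- by apply: lint_meas; exact: lintB.
- rewrite -mulrBl normrM mulrC -addrA [w' + _]addrC subrK.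
  by apply: ler_wpM2r => //.
- exact: (lintZ _ (lint_shift w' ld)).
Qed.

Lemma sm_bounds m : tempered m -> (forall v, 0 <= m v <= 1) ->
  forall j v, 0 <= sm m j v <= 1.
Proof.
move=> tm m01; elim=> [|j IH] //= w; apply/andP; split.
  by apply: Int_ge0 => u; rewrite mulr_ge0// ?gam_ge0//; case/andP: (IH u).
rewrite (cnvC (tempered_sm j tm) tempered_gam).
apply: le_trans (ler_norm _) _; apply: cnv_gam_le; first exact: tempered_sm.
by move=> v; case/andP: (IH v) => h1 h2; rewrite ger0_norm.
Qed.

Lemma sm_lip m : tempered m -> (forall v, 0 <= m v <= 1) ->
  forall j w w', `|sm m j.+1 w - sm m j.+1 w'| <= 2 * `|w - w'|.
Proof.
move=> tm m01 j w w'; rewrite /= (cnvC (tempered_sm j tm) tempered_gam).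
rewrite -[X in X * _]mulr1; apply: cnv_gam_lip; first exact: tempered_sm.
by move=> v; case/andP: (sm_bounds tm m01 j v) => h1 h2; rewrite ger0_norm.
Qed.

End Smoothing.

(** * Lower bound for the transform near the line Re z = 0, and the resulting energy bound *)

Section L2bound.
Variable R : realType.
Implicit Types (a b : R -> R).

Lemma Lt_bound a (K d y : R) : tempered a -> 0 < d ->
  (forall v, `|a v| <= K * half (fun v => expR (- (8^-1 * v))) v) ->
  cabs (Lt a d y) <= 16 * K.
Proof.
move=> ta d0 aK; have e8 : (0 : R) < 8^-1 by [].
have [l8 I8] := half_exp e8.
have lK : lint (fun v => K * half (fun v => expR (- (8^-1 * v))) v) by exact: lintZ.
have key (T : R -> R) : measurable_fun setT T -> (forall x, `|T x| <= 1) ->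
    `|Int (fun v => damp d a v * T v)| <= 8 * K.
  move=> mT T1; have -> : 8 * K = Int (fun v => K * half (fun v => expR (- (8^-1 * v))) v).
    by rewrite IntZ// I8 invrK mulrC.
  have [ma a0 _] := ta.
  apply: Int_abs_le lK => [|x].
    by apply: measurable_funM => //; exact: measurable_damp.
  apply: le_trans (aK x); rewrite /damp !normrM (ger0_norm (expR_ge0 _)).
  have [x0|x0] := ltP x 0; first by rewrite a0// normr0 !mul0r.
  have ex : expR (- (d * x)) <= 1 by rewrite -[leRHS]expR0 ler_expR oppr_le0 mulr_ge0// ltW.
  rewrite -mulrA ler_piMr// mulr_ile1// expR_ge0//.
have -> : 16 * K = 2 * (8 * K) by ring.
apply: cabs_le; rewrite /Lt /= ?normrN; apply: key.
- exact: measurable_cosM.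
- by move=> x; exact: abs_cos_le1.
- exact: measurable_sinM.
- by move=> x; exact: abs_sin_le1.
Qed.

Lemma expR_neg_lip (x y : R) : 0 <= x -> 0 <= y -> `|expR (- x) - expR (- y)| <= `|x - y|.
Proof.
move=> x0 y0; wlog xy : x y x0 y0 / x <= y.
  move=> H; have [|/ltW] := leP x y; first exact: H.
  by move=> /H; rewrite distrC (distrC y x); exact.
have e : expR (- y) <= expR (- x) by rewrite ler_expR lerN2.
rewrite ger0_norm ?subr_ge0// distrC ger0_norm ?subr_ge0//.
have -> : expR (- y) = expR (- x) * expR (x - y) by rewrite -expRD; congr expR; ring.
have h1 := expR_ge1Dx (x - y).
have h2 : expR (- x) <= 1 by rewrite -[leRHS]expR0 ler_expR oppr_le0.
have h3 := expR_ge0 (- x).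
have h4 : expR (x - y) <= 1 by rewrite -[leRHS]expR0 ler_expR; lra.
have -> : expR (- x) - expR (- x) * expR (x - y) = expR (- x) * (1 - expR (x - y)) by ring.
nra.
Qed.

(** Differentiation in [d] brings down a factor [v], so a majorant of [v * a v] gives the Lipschitz
    constant. *)
Lemma Lt_lip a (K d d' y : R) : tempered a -> 0 < d -> 0 < d' ->
  (forall v, `|v * a v| <= K * half (fun v => expR (- (8^-1 * v))) v) ->
  cabs (Lt a d y - Lt a d' y) <= 16 * K * `|d - d'|.
Proof.
move=> ta d0 d'0 aK; have e8 : (0 : R) < 8^-1 by [].
have [l8 I8] := half_exp e8.
have lK : lint (fun v => K * `|d - d'| * half (fun v => expR (- (8^-1 * v))) v) by exact: lintZ.
have key (T : R -> R) : measurable_fun setT T -> (forall x, `|T x| <= 1) ->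
    lint (fun v => damp d a v * T v) -> lint (fun v => damp d' a v * T v) ->
    `|Int (fun v => damp d a v * T v) - Int (fun v => damp d' a v * T v)| <= 8 * K * `|d - d'|.
  move=> mT T1 l1 l2.
  have -> : 8 * K * `|d - d'| = Int (fun v => K * `|d - d'| * half (fun v => expR (- (8^-1 * v))) v).
    by rewrite IntZ// I8 invrK; ring.
  have [ma a0 _] := ta.
  rewrite -IntB//; apply: Int_abs_le lK => [|x]; first by apply: lint_meas; exact: lintB.
  rewrite -mulrBl normrM; apply: (@le_trans _ _ `|damp d a x - damp d' a x|).
    by rewrite ler_piMr.
  have [x0|x0] := ltP x 0.
    rewrite /damp a0// !mul0r subrr normr0 mulr_ge0//; last first.
      by rewrite /half; case: ifP => // _; exact: expR_ge0.
    rewrite mulr_ge0//.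
    have := aK 0; rewrite mul0r normr0 /half lexx mulr0 oppr0 expR0 mulr1//.
  rewrite /damp -mulrBr normrM.
  have h : `|expR (- (d * x)) - expR (- (d' * x))| <= `|d - d'| * x.
    apply: le_trans (expR_neg_lip _ _) _; rewrite ?mulr_ge0// ?(ltW d0)// ?(ltW d'0)//.
    by rewrite -mulrBl normrM (ger0_norm x0).
  apply: le_trans (ler_wpM2l (normr_ge0 _) h) _.
  have := aK x; rewrite normrM (ger0_norm x0) => H.
  have -> : `|a x| * (`|d - d'| * x) = `|d - d'| * (x * `|a x|) by ring.
  by rewrite mulrAC [leRHS]mulrC ler_wpM2l.
have -> : 16 * K * `|d - d'| = 2 * (8 * K * `|d - d'|) by ring.
apply: cabs_le.
- exact: (key (fun v => cos (y * v)) (measurable_cosM y) (fun x => abs_cos_le1 _) (lint_damp_cos y ta d0) (lint_damp_cos y ta d'0)).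
- have -> : complex.Im (Lt a d y - Lt a d' y) =
      - (Int (fun v => damp d a v * sin (y * v)) - Int (fun v => damp d' a v * sin (y * v))).
    by rewrite opprD.
  rewrite normrN.
  exact: (key (fun v => sin (y * v)) (measurable_sinM y) (fun x => abs_sin_le1 _) (lint_damp_sin y ta d0) (lint_damp_sin y ta d'0)).
Qed.

(** Lowering the rate from 1/4 to 1/8 pays for a factor [v], so that [rho] and [v * rho v] get
    majorants of the same rate. *)
Lemma half_weight (C v : R) : 0 <= C ->
  [/\ C * half (fun v => expR (- (4^-1 * v))) v <= C * half (fun v => expR (- (8^-1 * v))) v &
   `|v| * (C * half (fun v => expR (- (4^-1 * v))) v) <= 8 * C * half (fun v => expR (- (8^-1 * v))) v].
Proof.
move=> C0; rewrite /half; case: ifPn => v0; last by rewrite !mulr0.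
have E : expR (- (4^-1 * v)) = expR (- (8^-1 * v)) * expR (- (8^-1 * v)).
  by rewrite -expRD; congr expR; field.
have h1 : expR (- (8^-1 * v)) <= 1 by rewrite -[leRHS]expR0 ler_expR oppr_le0 mulr_ge0.
have h0 := expR_ge0 (- (8^-1 * v)).
split; first by rewrite ler_wpM2l// E ler_piMr.
rewrite (ger0_norm v0) E.
have hv : v * expR (- (8^-1 * v)) <= 8.
  have := expR_ge1Dx (8^-1 * v) => h; rewrite expRN ler_pdivrMr ?expR_gt0//; lra.
have := mulr_ge0 C0 h0; set X := expR _ in hv *; nra.
Qed.

(* If [X] is [L]-Lipschitz and [X d ^ 4 >= k d ^ 3 Y ^ -10], then comparing [d] with the threshold [a Y ^ -10] bounds [X] below uniformly in [d] *)
Lemma lipschitz_lower (X : R -> R) (k L Y : R) : 0 < k -> 1 <= L -> 1 <= Y ->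
  (forall d, 0 < d -> d <= 1 -> 0 <= X d) ->
  (forall d, 0 < d -> d <= 1 -> k * d ^+ 3 <= X d ^+ 4 * Y ^+ 10) ->
  (forall d d', 0 < d -> d <= 1 -> 0 < d' -> d' <= 1 -> X d' - X d <= L * `|d' - d|) ->
  forall d, 0 < d -> d <= 1 -> L * Num.min (k / (16 * L ^+ 4)) 1 <= X d * Y ^+ 10.
Proof.
move=> k0 L1 Y1 X0 Xk XL d d0 d1.
have L0 : 0 < L by lra.
have Y0 : 0 < Y by lra.
set a := Num.min _ _.
have a0 : 0 < a by rewrite lt_min ltr01 andbT divr_gt0// mulr_gt0// exprn_gt0.
have a1 : a <= 1 by rewrite ge_min lexx orbT.
have ak : 16 * L ^+ 4 * a <= k.
  have : a <= k / (16 * L ^+ 4) by rewrite ge_min lexx.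
  by rewrite ler_pdivlMr ?mulr_gt0 ?exprn_gt0// mulrC.
have Y10 : 0 < Y ^+ 10 by rewrite exprn_gt0.
have Y10' : 1 <= Y ^+ 10 by rewrite exprn_ege1.
pose h := a / Y ^+ 10.
have h0 : 0 < h by rewrite divr_gt0.
have h1 : h <= 1 by rewrite ler_pdivrMr// mul1r (le_trans a1).
have hY : h * Y ^+ 10 = a by rewrite divfK// gt_eqF.
have big t : h <= t -> 0 < t -> t <= 1 -> 2 * L * a <= X t * Y ^+ 10.
  move=> ht t0 t1.
  have Xt := X0 _ t0 t1.
  rewrite -(ler_pXn2r (isT : (0 < 4)%N)) ?nnegrE; last 2 first.
  - by rewrite !mulr_ge0// ltW.
  - by rewrite mulr_ge0// ltW.
  apply: (@le_trans _ _ (k * a ^+ 3)).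
    rewrite !exprMn (_ : 2 ^+ 4 * L ^+ 4 * a ^+ 4 = 16 * L ^+ 4 * a * a ^+ 3); last by ring.
    by rewrite ler_wpM2r// exprn_ge0// ltW.
  have H := Xk _ t0 t1.
  have h3 : h ^+ 3 <= t ^+ 3 by apply: lerXn2r; rewrite ?nnegrE ?(ltW h0) ?(ltW t0).
  have : k * h ^+ 3 <= X t ^+ 4 * Y ^+ 10 by apply: le_trans H; rewrite ler_wpM2l// ltW.
  rewrite -(ler_pM2r (exprn_gt0 30 Y0)) => H2.
  have -> : k * a ^+ 3 = k * h ^+ 3 * Y ^+ 30 by rewrite -hY; ring.
  by apply: le_trans H2 _; rewrite le_eqVlt; apply/orP; left; apply/eqP; ring.
have [hd|hd] := leP h d; first by apply: le_trans (big _ hd d0 d1); have := mulr_gt0 L0 a0; lra.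
have H1 := big h (lexx _) h0 h1.
have := XL d h d0 d1 h0 h1.
rewrite ger0_norm ?subr_ge0 ?(ltW hd)// => H2.
have : (X h - X d) * Y ^+ 10 <= L * h * Y ^+ 10.
  rewrite ler_wpM2r ?(ltW Y10)//; apply: le_trans H2 _; rewrite ler_wpM2l ?(ltW L0)//; lra.
rewrite -(mulrA L h) hY mulrBl; lra.
Qed.

Lemma Lt_lin3 (a b a' : R -> R) (d y : R) : tempered a -> tempered b -> tempered a' -> 0 < d ->
  Lt (fun v => a v + (-1) * b v + 2^-1 * a' v) d y = Lt a d y - Lt b d y + 2^-1 * Lt a' d y.
Proof.
move=> ta tb ta' d0.
have e1 : ((-1 : R)%:C)%C = -1 :> R[i] by apply/eqP; rewrite eq_complex /= oppr0 !eqxx.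
have e2 : ((2^-1 : R)%:C)%C = 2^-1 :> R[i] by rewrite fmorphV rmorph_nat.
rewrite Lt_D//; last 2 first.
- by apply: temperedD => //; exact: temperedZ.
- exact: temperedZ.
rewrite Lt_D//; last exact: temperedZ.
by rewrite (Lt_Z _ _ tb d0) (Lt_Z _ _ ta' d0) e1 e2 mulN1r.
Qed.

(** With s = 1 + z, two consecutive smoothings differ by a factor z / s. The half of the last
    smoothing completes z times the transform of [Vm m] to 2 z D - phi, the combination that
    vanishes on z^(-1/2). *)
Lemma Lt_smoothed_error (m : R -> R) j (d y : R) : tempered m -> 0 < d ->
  Lt (fun v => Vm (sm m j) v + (-1) * Vm (sm m j.+1) v + 2^-1 * sm m j.+1 v) d y =
  (2 * (d +i* y)%C * Lt (Vm m) d y - Lt m d y) / (2 * ((1 + d) +i* y)%C ^+ j.+1) +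
  j.+1%:R * (d +i* y)%C * Lt m d y / ((1 + d) +i* y)%C ^+ j.+2.
Proof.
move=> tm d0.
have ns : ((1 + d) +i* y)%C != 0 :> R[i].
  by rewrite -sqn_eq0 /sqn /= gt_eqF// ltr_wpDr ?sqr_ge0// exprn_gt0// addr_gt0.
have tV i : tempered (Vm (sm m i)) by apply/tempered_Vm/tempered_sm.
rewrite Lt_lin3//; last exact: tempered_sm.
rewrite (Lt_Vm_sm j y tm d0) (Lt_Vm_sm j.+1 y tm d0) (Lt_sm j.+1 y tm d0).
have -> : (d +i* y)%C = ((1 + d) +i* y)%C - 1 by apply/eqP; rewrite eq_complex /= subr0 addrC addKr !eqxx.
move: ns; move: ((1 + d) +i* y)%C (Lt m d y) (Lt (Vm m) d y) => s f g ns.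
rewrite !exprVn !exprS -[j.+1%:R]natr1; field.
by rewrite expf_neq0//= ns.
Qed.

(** Bounded and Lipschitz: unlike the Lipschitz property alone this is stable under products, and it
    supplies the uniform continuity required by [parseval_le]. *)
Definition bl (g : R -> R) := exists2 K : R, 0 <= K &
  (forall x, `|g x| <= K) /\ forall x y, `|g x - g y| <= K * `|x - y|.

Lemma blD f g : bl f -> bl g -> bl (fun x => f x + g x).
Proof.
move=> [K K0 [fK fL]] [M M0 [gM gL]]; exists (K + M); first exact: addr_ge0.
split=> [x|x y]; first by apply: le_trans (ler_normD _ _) _; exact: lerD.
rewrite opprD addrACA mulrDl; apply: le_trans (ler_normD _ _) _; exact: lerD.
Qed.

Lemma blM f g : bl f -> bl g -> bl (fun x => f x * g x).
Proof.
move=> [K K0 [fK fL]] [M M0 [gM gL]]; exists (K * M + K * M); first by rewrite addr_ge0// mulr_ge0.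
split=> [x|x y].
  rewrite normrM; apply: (@le_trans _ _ (K * M)); first exact: ler_pM.
  by rewrite lerDl mulr_ge0.
have -> : f x * g x - f y * g y = f x * (g x - g y) + (f x - f y) * g y by ring.
apply: le_trans (ler_normD _ _) _; rewrite !normrM mulrDl -mulrA; apply: lerD.
  exact: ler_pM.
have -> : K * (M * `|x - y|) = (K * `|x - y|) * M by ring.
exact: ler_pM.
Qed.

Lemma blZ c' f : bl f -> bl (fun x => c' * f x).
Proof.
move=> bf; apply: (@blM (fun=> c') f) => //; exists `|c'| => //; split=> // x y.
by rewrite subrr normr0 mulr_ge0.
Qed.

Lemma max0_lip (x y : R) : `|Num.max 0 x - Num.max 0 y| <= `|x - y|.
Proof.
have h1 := ler_norm (x - y); have h2 := ler_norm (y - x); rewrite distrC in h2.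
by rewrite /Num.max ler_norml; case: (ltP 0 x) => x0; case: (ltP 0 y) => y0; apply/andP; split; lra.
Qed.

(** Clamping at 0 makes the damping weight bounded on the whole line and leaves it unchanged where a
    tempered function can be nonzero. *)
Lemma bl_pos_exp (d : R) : 0 < d -> bl (fun v => expR (- (d * Num.max 0 v))).
Proof.
move=> d0; exists (1 + d); first by rewrite addr_ge0// ltW.
have p v : 0 <= Num.max 0 v :> R by rewrite le_max lexx.
split=> [x|x y].
  rewrite ger0_norm ?expR_ge0//; apply: (@le_trans _ _ 1); last by rewrite lerDl ltW.
  by rewrite -[leRHS]expR0 ler_expR oppr_le0 mulr_ge0// ltW.
apply: le_trans (expR_neg_lip _ _) _; rewrite ?mulr_ge0// ?(ltW d0)//.
rewrite -mulrBr normrM (gtr0_norm d0); apply: ler_pM; rewrite ?(ltW d0)// ?lerDr//.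
exact: max0_lip.
Qed.

Lemma bl_pos_mul_exp (d : R) : 0 < d -> bl (fun v => Num.max 0 v * expR (- (d * Num.max 0 v))).
Proof.
move=> d0; exists (2 + d^-1); first by rewrite addr_ge0// invr_ge0 ltW.
have p v : 0 <= Num.max 0 v :> R by rewrite le_max lexx.
have B v : 0 <= v -> v * expR (- (d * v)) <= d^-1.
  move=> v0; rewrite expRN ler_pdivrMr ?expR_gt0// ler_pdivlMl//.
  by have := expR_ge1Dx (d * v); lra.
split=> [x|x y].
  rewrite ger0_norm ?mulr_ge0 ?expR_ge0//; apply: le_trans (B _ (p x)) _; lra.
have H := max0_lip x y.
apply: (@le_trans _ _ (2 * `|Num.max 0 x - Num.max 0 y|)); last first.
  by apply: ler_pM => //; rewrite lerDl invr_ge0 ltW.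
move: (Num.max 0 x) (Num.max 0 y) (p x) (p y) => {H}x' y' x0 y0.
wlog xy : x' y' x0 y0 / x' <= y'.
  move=> H; have [|/ltW] := leP x' y'; first exact: H.
  by move=> /H; rewrite distrC (distrC y' x'); exact.
set ex := expR (- (d * x')); set ey := expR (- (d * y')).
have -> : x' * ex - y' * ey = (x' - y') * ey + x' * (ex - ey) by ring.
apply: le_trans (ler_normD _ _) _.
have -> : 2 * `|x' - y'| = `|x' - y'| + `|x' - y'| by ring.
apply: lerD.
  rewrite normrM ler_piMr// ger0_norm ?expR_ge0// -[leRHS]expR0 ler_expR oppr_le0 mulr_ge0// ltW//.
have -> : ey = ex * expR (- (d * (y' - x'))) by rewrite -expRD; congr expR; ring.
have -> : x' * (ex - ex * expR (- (d * (y' - x')))) = (x' * ex) * (1 - expR (- (d * (y' - x')))) by ring.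
have h1 := expR_ge1Dx (- (d * (y' - x'))).
have h2 : 0 <= 1 - expR (- (d * (y' - x'))).
  by rewrite subr_ge0 -[leRHS]expR0 ler_expR oppr_le0 mulr_ge0 ?subr_ge0// ltW.
rewrite normrM (ger0_norm h2) ger0_norm ?mulr_ge0 ?expR_ge0// distrC ger0_norm ?subr_ge0//.
apply: (@le_trans _ _ (d^-1 * (d * (y' - x')))); last by rewrite mulrA mulVf ?mul1r// gt_eqF.
apply: ler_pM => //; first by rewrite mulr_ge0// expR_ge0.
  exact: B.
lra.
Qed.

#[local] Opaque sm cnv Lt.

Variables (m rho : R -> R) (c C kappa : R).
Hypothesis tm : tempered m.
Hypothesis m01 : forall v, 0 <= m v <= 1.
Hypothesis c0 : 0 < c.
Hypothesis trho : tempered rho.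
Hypothesis C0 : 0 <= C.
Hypothesis rhoC : forall v, `|rho v| <= C * half (fun v => expR (- (4^-1 * v))) v.
Hypothesis mm : forall w, cnv m m w = c * heav w + rho w.
Hypothesis kappa0 : 0 < kappa.

(** In the application this is the Dirichlet series at s = 1 + d + i y: s times the Mellin transform
    of its summatory function. *)
Let F (d y : R) : R[i] := ((1 + d) +i* y)%C * Lt m d y.
Hypothesis k341 : forall d y, 0 < d -> d <= 1 ->
  kappa <= sqn (F d 0) ^+ 3 * sqn (F d y) ^+ 4 * sqn (F d (2 * y)).

Let phi d y := Lt m d y.
Let D0 d y := Lt (Vm m) d y.
Let z (d y : R) : R[i] := (d +i* y)%C.
Let s (d y : R) : R[i] := ((1 + d) +i* y)%C.
Let r d y := Lt rho d y.
Let r1 d y := Lt (Vm rho) d y.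
Let X d y := cabs (phi d y ^+ 2).

Let z0 (d y : R) : 0 < d -> z d y != 0.
Proof.
move=> d0; rewrite -sqn_eq0 /sqn /= gt_eqF//.
by rewrite ltr_wpDr ?sqr_ge0// exprn_gt0.
Qed.

Let s0 (d y : R) : 0 < d -> s d y != 0.
Proof.
move=> d0; rewrite -sqn_eq0 /sqn /= gt_eqF//.
by rewrite ltr_wpDr ?sqr_ge0// exprn_gt0//; lra.
Qed.

Let qE d y : 0 < d -> phi d y ^+ 2 = (c%:C)%C / z d y + r d y.
Proof.
move=> d0; rewrite expr2 -(Lt_cnv _ tm tm)//.
rewrite (eq_Lt _ _ mm) Lt_D//; last by apply: temperedZ; exact: tempered_heav.
rewrite Lt_Z//; last exact: tempered_heav.
by rewrite Lt_half_exp// add0r.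
Qed.

Let DqE d y : 0 < d -> 2 * D0 d y * phi d y = (c%:C)%C / z d y ^+ 2 + r1 d y.
Proof.
move=> d0; transitivity (Lt (Vm (cnv m m)) d y).
  by rewrite Lt_Vm_cnv// -/(D0 d y) -/(phi d y); ring.
have e v : Vm (cnv m m) v = c * Vm (@heav R) v + Vm rho v by rewrite /Vm mm; ring.
have tV := tempered_Vm (@tempered_heav R).
rewrite (eq_Lt _ _ e) Lt_D//; [|exact: temperedZ|exact: tempered_Vm].
by rewrite Lt_Z// Lt_Vm_half_exp// add0r exprVn.
Qed.

(** The two pole terms c / z cancel, leaving only the transforms of [rho] and [Vm rho]. *)
Let numE d y : 0 < d ->
  2 * (phi d y * (2 * z d y * D0 d y - phi d y)) = 2 * (z d y * r1 d y - r d y).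
Proof.
move=> d0; have nz := z0 y d0.
have -> : 2 * (phi d y * (2 * z d y * D0 d y - phi d y)) =
  2 * (z d y * (2 * D0 d y * phi d y) - phi d y ^+ 2) by ring.
rewrite DqE// qE//; field; exact: nz.
Qed.

Let rB d y : 0 < d -> cabs (r d y) <= 16 * (8 * C).
Proof.
move=> d0; apply: Lt_bound => // v; apply: le_trans (rhoC v) _.
have [h1 _] := half_weight v C0; apply: le_trans h1 _.
rewrite ler_wpM2r//; last by have := C0; lra.
by rewrite /half; case: ifP => // _; exact: expR_ge0.
Qed.

Let VrhoC v : `|v * rho v| <= 8 * C * half (fun v => expR (- (8^-1 * v))) v.
Proof.
rewrite normrM; have [_ h2] := half_weight v C0; apply: le_trans h2.
by rewrite ler_wpM2l.
Qed.

Let r1B d y : 0 < d -> cabs (r1 d y) <= 16 * (8 * C).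
Proof. by move=> d0; apply: Lt_bound => //; exact: tempered_Vm. Qed.

Let rL d d' y : 0 < d -> 0 < d' -> cabs (r d y - r d' y) <= 16 * (8 * C) * `|d - d'|.
Proof. by move=> d0 d'0; apply: Lt_lip. Qed.

Let XE d y : 0 < d -> X d y = cabs ((c%:C)%C / z d y + r d y).
Proof. by move=> d0; rewrite /X qE. Qed.

Let cabsV (w : R[i]) : cabs w^-1 = (cabs w)^-1.
Proof.
have [->|w0] := eqVneq w 0; first by rewrite invr0 /cabs /sqn /= expr0n /= addr0 sqrtr0 invr0.
have n0 : cabs w != 0.
  by rewrite /cabs sqrtr_eq0 -ltNge lt_def sqn_ge0 sqn_eq0 w0.
apply: (mulfI n0); rewrite mulfV// -cabsM mulfV//.
by rewrite /cabs /sqn /= expr1n expr0n /= addr0 sqrtr1.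
Qed.

Let cabs_real (x : R) : 0 <= x -> cabs (x%:C)%C = x.
Proof. by move=> x0; rewrite /cabs /sqn /= expr0n /= addr0 sqrtr_sqr ger0_norm. Qed.

Let zd d y : 0 < d -> d <= cabs (z d y).
Proof.
move=> d0; rewrite -(ler_pXn2r (ltn0Sn 1)) ?nnegrE ?cabs_ge0 ?(ltW d0)// cabs_sqr /sqn /=.
by rewrite lerDl sqr_ge0.
Qed.

Let zy d y : 0 <= y -> y <= cabs (z d y).
Proof.
move=> y0; rewrite -(ler_pXn2r (ltn0Sn 1)) ?nnegrE ?cabs_ge0// cabs_sqr /sqn /=.
by rewrite lerDr sqr_ge0.
Qed.

Let zle d y : 0 < d -> 0 <= y -> cabs (z d y) <= d + y.
Proof.
move=> d0 y0; rewrite -(ler_pXn2r (ltn0Sn 1)) ?nnegrE ?cabs_ge0 ?addr_ge0 ?(ltW d0)//.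
rewrite cabs_sqr /sqn /=; have := mulr_ge0 (ltW d0) y0; nra.
Qed.

Let B := 16 * (8 * C) + 1.
Let B0 : 1 <= B. Proof. by rewrite /B lerDr !mulr_ge0. Qed.

Let rB' d y : 0 < d -> cabs (r d y) <= B.
Proof. by move=> d0; apply: le_trans (rB _ d0) _; rewrite /B lerDl. Qed.

Let r1B' d y : 0 < d -> cabs (r1 d y) <= B.
Proof. by move=> d0; apply: le_trans (r1B _ d0) _; rewrite /B lerDl. Qed.

Let Bp : 0 < B. Proof. exact: lt_le_trans ltr01 B0. Qed.

Let Xup d y : 0 < d -> X d y <= c / cabs (z d y) + B.
Proof.
move=> d0; rewrite XE//; apply: le_trans (cabsD _ _) _; apply: lerD.
  by rewrite cabsM cabsV cabs_real// ltW.
by apply: le_trans (rB _ d0) _; rewrite /B lerDl.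
Qed.

Let Xlow d y : 0 < d -> c / cabs (z d y) - B <= X d y.
Proof.
move=> d0; rewrite XE// lerBlDr.
have -> : c / cabs (z d y) = cabs ((c%:C)%C / z d y) by rewrite cabsM cabsV cabs_real// ltW.
rewrite -{1}(addrK (r d y) ((c%:C)%C / z d y)); apply: le_trans (cabsD _ _) _.
by rewrite cabsN lerD2l; apply: le_trans (rB _ d0) _; rewrite /B lerDl.
Qed.

Let sqnF d y : sqn (F d y) = sqn (s d y) * X d y.
Proof. by rewrite /F sqnM /X /cabs sqnX sqrtr_sqr ger0_norm ?sqn_ge0. Qed.

Let XL (y0 d d' y : R) : 0 < y0 -> y0 <= y -> 0 < d -> 0 < d' ->
  X d' y - X d y <= (c / y0 ^+ 2 + B) * `|d' - d|.
Proof.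
move=> y00 yy d0 d'0; rewrite !XE//; apply: le_trans (cabs_triB _ _) _.
have y1 : 0 <= y by lra.
have -> : (c%:C)%C / z d' y + r d' y - ((c%:C)%C / z d y + r d y) =
   ((c%:C)%C * ((d - d')%:C)%C) / (z d' y * z d y) + (r d' y - r d y).
  have h1 := z0 y d0; have h2 := z0 y d'0.
  have -> : ((d - d')%:C)%C = z d y - z d' y.
    by apply/eqP; rewrite eq_complex /= subrr eqxx eqxx.
  move: (z d y) (z d' y) (r d y) (r d' y) h1 h2 => p q s1 t1 h1 h2.
  by field; rewrite h1 h2.
apply: le_trans (cabsD _ _) _; rewrite mulrDl; apply: lerD; last first.
  by apply: le_trans (rL _ d'0 d0) _; rewrite ler_wpM2r// /B lerDl.
rewrite !cabsM cabsV cabs_real ?(ltW c0)// cabsM.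
have -> : cabs ((d - d')%:C)%C = `|d' - d|.
  by rewrite /cabs /sqn /= expr0n /= addr0 sqrtr_sqr distrC.
rewrite mulrAC ler_wpM2r// ler_wpM2l ?(ltW c0)//.
have hz d1 : 0 < d1 -> y0 <= cabs (z d1 y) by move=> _; apply: le_trans (zy d1 y1).
rewrite lef_pV2 ?posrE ?exprn_gt0// ?mulr_gt0//.
- by rewrite expr2; apply: ler_pM; rewrite ?hz// ltW.
- exact: lt_le_trans (hz _ d'0).
- exact: lt_le_trans (hz _ d0).
Qed.

(** For small [y] the pole dominates the remainder. Beyond [y0] the 3-4-1 inequality is used:
    [X d 0 = O(1 / d)] costs [d ^+ 3], [X d (2 * y)] is bounded, and the moduli of [s] contribute (1
    + y)^(8 + 2). [lipschitz_lower] then removes the dependence on [d]. *)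
Lemma Lt_lower : exists2 b, 0 < b & forall d y, 0 < d -> d <= 1 -> d <= c / (4 * B) -> 0 <= y ->
  b <= cabs (Lt m d y ^+ 2) * (1 + y) ^+ 10.
Proof.
clearbody B.
pose y0 := c / (4 * B).
have y00 : 0 < y0 by rewrite divr_gt0// mulr_gt0.
pose L := c / y0 ^+ 2 + B.
have L1 : 1 <= L by apply: le_trans B0 _; rewrite /L lerDr divr_ge0 ?sqr_ge0// ltW.
pose B2 := c / (2 * y0) + B.
have B20 : 0 < B2 by rewrite addr_gt0// divr_gt0// mulr_gt0.
pose K := (c + B) ^+ 3 * B2 * 4 ^+ 3 * 4 ^+ 4 * 4.
have cB : 0 < c + B by rewrite addr_gt0.
have K0 : 0 < K by rewrite /K !mulr_gt0 ?exprn_gt0.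
pose k := kappa / K.
have k0 : 0 < k by rewrite divr_gt0.
exists (Num.min B (L * Num.min (k / (16 * L ^+ 4)) 1)).
  rewrite lt_min Bp mulr_gt0 ?lt_min ?ltr01 ?andbT//; first lra.
  by rewrite divr_gt0// mulr_gt0// exprn_gt0//; lra.
move=> d y d0 d1 dy y1; rewrite -/(X d y).
have [yy|yy] := leP y y0.
  apply: (@le_trans _ _ B); first by rewrite ge_min lexx.
  have hz : cabs (z d y) <= 2 * y0 by apply: le_trans (zle d0 y1) _; rewrite -/y0 in dy; lra.
  have z1 : 0 < cabs (z d y) by exact: lt_le_trans (zd y d0).
  have h : 2 * B <= c / cabs (z d y).
    rewrite ler_pdivlMr//; apply: (@le_trans _ _ (2 * B * (2 * y0))).
      by rewrite ler_wpM2l// mulr_ge0// ltW.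
    by rewrite /y0 le_eqVlt; apply/orP; left; apply/eqP; field; rewrite gt_eqF.
  have hX : B <= X d y by apply: le_trans (Xlow y d0); lra.
  apply: le_trans hX _; rewrite ler_peMr ?cabs_ge0// exprn_ege1//; lra.
apply: (@le_trans _ _ (L * Num.min (k / (16 * L ^+ 4)) 1)); first by rewrite ge_min lexx orbT.
apply: (@lipschitz_lower (fun d => X d y) k L (1 + y) k0 L1) => //; first lra.
- by move=> *; exact: cabs_ge0.
- move=> {}d {}d0 {}d1 {dy}.
  have := k341 y d0 d1; rewrite !sqnF => H.
  have X0 : X d 0 <= (c + B) / d.
    apply: le_trans (Xup 0 d0) _; rewrite mulrDl; apply: lerD.
      by rewrite ler_wpM2l ?(ltW c0)// lef_pV2 ?posrE// ?zd//; exact: lt_le_trans (zd 0 d0).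
    by rewrite ler_pdivlMr// ler_piMr// ltW.
  have X2 : X d (2 * y) <= B2.
    apply: le_trans (Xup (2 * y) d0) _; rewrite /B2 lerD2r ler_wpM2l ?(ltW c0)//.
    have y2 : 0 <= 2 * y by lra.
    have := zy d y2 => h; have : 2 * y0 <= cabs (z d (2 * y)) by lra.
    by move=> h'; rewrite lef_pV2 ?posrE//; [apply: lt_le_trans h'; lra|lra].
  have s00 : sqn (s d 0) <= 4 by rewrite /sqn /=; nra.
  have s1 : sqn (s d y) <= 4 * (1 + y) ^+ 2 by rewrite /sqn /=; nra.
  have s2 : sqn (s d (2 * y)) <= 4 * (1 + y) ^+ 2 by rewrite /sqn /=; nra.
  have cX u v : 0 <= X u v by exact: cabs_ge0.
  have H2 : kappa <= (4 * ((c + B) / d)) ^+ 3 * (4 * (1 + y) ^+ 2 * X d y) ^+ 4 * (4 * (1 + y) ^+ 2 * B2).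
    apply: le_trans H _; apply: ler_pM.
    - by rewrite mulr_ge0// exprn_ge0// mulr_ge0// sqn_ge0.
    - by rewrite mulr_ge0// sqn_ge0.
    - apply: ler_pM; rewrite ?exprn_ge0 ?mulr_ge0 ?sqn_ge0//.
        have p : 0 <= (c + B) / d by exact: le_trans (cX d 0) X0.
        apply: lerXn2r; rewrite ?nnegrE; [by rewrite mulr_ge0// sqn_ge0|by rewrite mulr_ge0|].
        by apply: ler_pM; rewrite ?sqn_ge0.
      apply: lerXn2r; rewrite ?nnegrE; [by rewrite mulr_ge0// sqn_ge0|by rewrite mulr_ge0// mulr_ge0// sqr_ge0|].
      by apply: ler_pM; rewrite ?sqn_ge0.
    - by apply: ler_pM; rewrite ?sqn_ge0.
  rewrite /k mulrAC ler_pdivrMr// -ler_pdivlMr ?exprn_gt0//.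
  apply: le_trans H2 _; rewrite le_eqVlt; apply/orP; left; apply/eqP.
  by rewrite /K; field; rewrite gt_eqF.
- by move=> d2 d' d20 _ d'0 _; apply: XL => //; exact: ltW.
Qed.

(* [sm m 7] has derivative [sm m 6 - sm m 7], hence [efun v / sqrt v] is the
   derivative of [sqrt v * sm m 7 v]. *)
Definition efun : R -> R := fun v => Vm (sm m 6) v + (-1) * Vm (sm m 7) v + 2^-1 * sm m 7 v.

Lemma tempered_efun : tempered efun.
Proof.
apply: temperedD; last by apply/temperedZ/tempered_sm.
by apply: temperedD; [|apply: temperedZ]; apply/tempered_Vm/tempered_sm.
Qed.

Let LtE d y : 0 < d -> Lt efun d y =
  (2 * z d y * D0 d y - phi d y) / (2 * s d y ^+ 7) + 7 * z d y * phi d y / s d y ^+ 8.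
Proof.
by move=> d0; exact: Lt_smoothed_error.
Qed.

(** In the first term of [LtE] the powers of [Y] in the squared modulus are 2 from the numerator, 10
    from dividing by phi and -14 from the seven smoothings; the second term is smaller because z
    phi^2 is bounded by a multiple of [Y]. *)
Lemma efun_Lt_decay : exists2 D, 0 <= D & forall d y, 0 < d -> d <= 1 -> d <= c / (4 * B) -> 0 <= y ->
  sqn (Lt efun d y) <= D / (1 + y) ^+ 2.
Proof.
have [b b0 Hb] := Lt_lower.
clearbody B.
exists (2 ^+ 9 * B ^+ 2 / b + 2 ^+ 15 * 49 * (c + B)).
  have cB : 0 <= c + B by rewrite addr_ge0// ltW.
  by rewrite addr_ge0// ?divr_ge0 ?mulr_ge0 ?exprn_ge0 ?sqr_ge0// ltW.
move=> d y d0 d1 dB y0; have XY := Hb _ _ d0 d1 dB y0.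
rewrite -/(X d y) in XY.
set Y := 1 + y in XY *; have Y1 : 1 <= Y by rewrite /Y; lra.
have Yp : 0 < Y by lra.
have Y10 : 0 < Y ^+ 10 by rewrite exprn_gt0.
have Xp : 0 < X d y by rewrite -(pmulr_lgt0 _ Y10); exact: lt_le_trans XY.
have ns := s0 y d0; have nz := z0 y d0.
have ss : Y ^+ 2 / 2 <= sqn (s d y) by rewrite /sqn /= /Y; have := sqr_ge0 (1 - y); nra.
have sp : 0 < sqn (s d y) by rewrite lt_def sqn_ge0 sqn_eq0 ns.
have sz : sqn (z d y) <= Y ^+ 2 by rewrite /sqn /= /Y; nra.
have X1 : sqn (phi d y) = X d y by rewrite /X /cabs sqnX sqrtr_sqr ger0_norm ?sqn_ge0.
have sV (w : R[i]) : sqn w^-1 = (sqn w)^-1.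
  by rewrite -!cabs_sqr cabsV exprVn.
have sn (n : nat) : sqn (n%:R : R[i]) = n%:R ^+ 2.
  by rewrite -(rmorph_nat (real_complex R)) /sqn /= expr0n /= addr0.
rewrite LtE//; apply: le_trans (sqnD _ _) _.
rewrite [leRHS]mulrDl; apply: lerD.
  have num : sqn (2 * z d y * D0 d y - phi d y) * X d y <= 4 * B ^+ 2 * Y ^+ 2.
    have e : phi d y * (2 * z d y * D0 d y - phi d y) = z d y * r1 d y - r d y.
      by apply: (@mulfI _ 2) => //; exact: numE.
    rewrite mulrC -X1 -sqnM e; apply: le_trans (sqnB _ _) _; rewrite sqnM -!(cabs_sqr (r1 _ _)) -!(cabs_sqr (r _ _)).
    have hr : cabs (r d y) ^+ 2 <= B ^+ 2.
      apply: lerXn2r; rewrite ?nnegrE ?cabs_ge0 ?(ltW Bp)//.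
      exact: rB'.
    have hr1 : cabs (r1 d y) ^+ 2 <= B ^+ 2.
      apply: lerXn2r; rewrite ?nnegrE ?cabs_ge0 ?(ltW Bp)//.
      exact: r1B'.
    have Y2 : 1 <= Y ^+ 2 by rewrite exprn_ege1.
    have h1 : sqn (z d y) * cabs (r1 d y) ^+ 2 <= Y ^+ 2 * B ^+ 2.
      by apply: ler_pM; rewrite ?sqn_ge0 ?sqr_ge0.
    have h2 : B ^+ 2 <= Y ^+ 2 * B ^+ 2 by rewrite ler_peMl// sqr_ge0.
    lra.
  rewrite sqnM sV sqnM sqnX (sn 2).
  set N := sqn (_ - _) in num *.
  have N0 : 0 <= N by exact: sqn_ge0.
  have s7 : (Y ^+ 2 / 2) ^+ 7 <= sqn (s d y) ^+ 7.
    by apply: lerXn2r; rewrite ?nnegrE ?sqn_ge0// divr_ge0// sqr_ge0.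
  have NX : N * b <= 4 * B ^+ 2 * Y ^+ 12.
    apply: (@le_trans _ _ (N * (X d y * Y ^+ 10))); first by rewrite ler_wpM2l.
    have -> : 4 * B ^+ 2 * Y ^+ 12 = 4 * B ^+ 2 * Y ^+ 2 * Y ^+ 10 by ring.
    by rewrite mulrA ler_wpM2r// ltW.
  rewrite mulrA ler_pdivrMr; last by rewrite mulr_gt0 ?exprn_gt0.
  apply: (@le_trans _ _ (2 ^+ 9 * B ^+ 2 / b / Y ^+ 2 * (2 ^+ 2 * (Y ^+ 2 / 2) ^+ 7))); last first.
    rewrite ler_wpM2l//; first by rewrite !divr_ge0 ?mulr_ge0 ?sqr_ge0// ltW.
    by rewrite ler_wpM2l.
  have -> : 2 ^+ 9 * B ^+ 2 / b / Y ^+ 2 * (2 ^+ 2 * (Y ^+ 2 / 2) ^+ 7) = 2 * (4 * B ^+ 2 * Y ^+ 12) * 2 / b.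
    by field; rewrite !gt_eqF.
  rewrite ler_pdivlMr//; nra.
rewrite !sqnM sV sqnX X1 (sn 7).
have zX : sqn (z d y) * X d y <= (c + B) * Y ^+ 2.
  rewrite -cabs_sqr.
  have zp : 0 < cabs (z d y) by exact: lt_le_trans (zd y d0).
  have h : cabs (z d y) * X d y <= c + B * cabs (z d y).
    have := ler_wpM2l (ltW zp) (Xup y d0); rewrite mulrDr (mulrC c) mulrA mulfV ?gt_eqF// mul1r.
    by rewrite (mulrC B).
  have hz : cabs (z d y) <= Y by apply: le_trans (zle d0 y0) _; rewrite /Y; lra.
  have h' : cabs (z d y) * X d y <= (c + B) * Y.
    by apply: le_trans h _; rewrite mulrDl lerD ?ler_peMr ?(ltW c0)// ler_wpM2l// ltW.
  rewrite expr2 -mulrA; apply: (@le_trans _ _ (Y * ((c + B) * Y))); last first.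
    by rewrite le_eqVlt; apply/orP; left; apply/eqP; ring.
  by apply: ler_pM; rewrite ?cabs_ge0 ?mulr_ge0 ?cabs_ge0.
have s8 : (Y ^+ 2 / 2) ^+ 8 <= sqn (s d y) ^+ 8.
  by apply: lerXn2r; rewrite ?nnegrE ?sqn_ge0// divr_ge0// sqr_ge0.
rewrite mulrA ler_pdivrMr ?exprn_gt0//.
apply: (@le_trans _ _ (2 ^+ 15 * 49 * (c + B) / Y ^+ 2 * (Y ^+ 2 / 2) ^+ 8)); last first.
  have cB' : 0 <= c + B by rewrite addr_ge0// ltW.
  by rewrite ler_wpM2l// divr_ge0 ?sqr_ge0// mulr_ge0// mulr_ge0// exprn_ge0.
have -> : 2 ^+ 15 * 49 * (c + B) / Y ^+ 2 * (Y ^+ 2 / 2) ^+ 8 = 2 ^+ 7 * 49 * (c + B) * Y ^+ 14.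
  by field; rewrite gt_eqF.
have Y14 : Y ^+ 2 <= Y ^+ 14 by rewrite ler_weXn2l.
have -> : 2 * (7 ^+ 2 * sqn (z d y) * X d y) = 98 * (sqn (z d y) * X d y) by ring.
have cB : 0 <= c + B by rewrite addr_ge0// ltW.
have := ler_wpM2l cB Y14; have := mulr_ge0 cB (exprn_ge0 14 (ltW Yp)).
have -> : 2 ^+ 7 * 49 * (c + B) * Y ^+ 14 = 6272 * ((c + B) * Y ^+ 14) by ring.
lra.
Qed.

#[local] Transparent Lt.

Lemma bl_sm j : bl (sm m j.+1).
Proof.
exists 2 => //; split=> [x|x y]; last exact: sm_lip.
have /andP[h1 h2] := sm_bounds tm m01 j.+1 x.
by rewrite ger0_norm//; lra.
Qed.

Lemma bl_damp_efun (d : R) : 0 < d -> bl (damp d efun).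
Proof.
move=> d0.
have [_ z6 _] := tempered_sm 6 tm.
have [_ z7 _] := tempered_sm 7 tm.
have -> : damp d efun = (fun v => (Num.max 0 v * expR (- (d * Num.max 0 v))) * (sm m 6 v + (-1) * sm m 7 v)
   + expR (- (d * Num.max 0 v)) * (2^-1 * sm m 7 v)).
  apply/funext => v; rewrite /damp /efun /Vm /Num.max.
  move: (z6 v) (z7 v); move: (sm m 6 v) (sm m 7 v) => a6 a7 {}z6 {}z7.
  case: (ltP 0 v) => [v0|]; first by ring.
  by rewrite le_eqVlt => /predU1P[->|v0]; [ring|rewrite z6// z7//; ring].
apply: blD; apply: blM.
- exact: bl_pos_mul_exp.
- by apply: blD; [|apply: blZ]; exact: bl_sm.
- exact: bl_pos_exp.
- by apply: blZ; exact: bl_sm.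
Qed.

(** [D] is independent of [d], which lets [energy_itv] remove the damping on bounded intervals. *)
Lemma efun_energy : exists2 D, 0 <= D & exists2 d1, 0 < d1 & forall d, 0 < d -> d <= d1 ->
  lint (fun u => damp d efun u ^+ 2) /\ Int (fun u => damp d efun u ^+ 2) <= D.
Proof.
have [D Dge HD] := efun_Lt_decay.
have cB : 0 < c / (4 * B) by rewrite divr_gt0// mulr_gt0//; exact: Bp.
exists D => //; exists (Num.min 1 (c / (4 * B))); first by rewrite lt_min ltr01 cB.
move=> d d0; rewrite le_min => /andP[d1 d2].
have [K K0 [gK gL]] := bl_damp_efun d0.
apply: (@parseval_le _ _ (lint_damp tempered_efun d0) K gK).
- move=> k k0; exists (k / (K + 1)); first by rewrite divr_gt0// ltr_wpDl.
  move=> x u xk; apply: le_trans (gL _ _) _; rewrite addrK.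
  move: xk; rewrite ler_pdivlMr ?ltr_wpDl// => h.
  by have := normr_ge0 x; lra.
- move=> y y0; have := HD d y d0 d1 d2 y0.
  by rewrite /sqn /Lt /= sqrrN.
Qed.

End L2bound.

(** * The comparison kernel, and slow variation from an energy bound *)

Section SlowVariation.
Variable R : realType.
Notation mu := (@lebesgue_measure R).

Lemma half_FTC_ge0 (g F : R -> R) l : measurable_fun setT g ->
  (forall x, 0 <= x -> 0 <= g x) -> (forall x, 0 <= x -> {for x, continuous g}) ->
  (forall x : R, 0 <= x -> is_derive x 1 F (g x)) -> F x @[x --> +oo] --> l ->
  lint (half g) /\ Int (half g) = l - F 0.
Proof.
move=> mg g0 cg dF Fl.
have cF x : 0 <= x -> {for x, continuous F}.
  by move=> x0; apply: differentiable_continuous; apply/derivable1_diffP; have [] := dF x x0.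
have H : (\int[mu]_x (half g x)%:E = (l - F 0)%:E)%E.
  transitivity (\int[mu]_(x in `[0%R, +oo[) (g x)%:E)%E.
    rewrite [RHS]integral_mkcond; apply: eq_integral => x _.
    rewrite /half patchE; case: ifPn => x0; case: ifPn => //.
      by rewrite notin_setE /= in_itv/= x0.
    by rewrite inE /= in_itv /= andbT (negbTE x0).
  rewrite (@ge0_continuous_FTC2y _ g F 0 l)//.
  - apply: continuous_in_subspaceT => x; rewrite inE /= in_itv /= andbT; exact: cg.
  - by move=> x x0; have [] := dF x (ltW x0).
  - by apply: cvg_at_right_filter; apply: cF.
  - move=> x; rewrite in_itv /= andbT => x0; rewrite derive1E.
    by have [_ ->] := dF x (ltW x0).
split; last exact: Int_eq_of.
apply: lint_ge0.
- exact: measurable_half.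
- by move=> x; rewrite /half; case: ifP => // /g0.
- by rewrite H ltry.
Qed.

Definition G0 : R -> R := @gauss_integral_proof.integral0_gauss R.

Lemma cvg_G0 : G0 x @[x --> +oo] --> Num.sqrt pi / 2.
Proof.
have : Num.sqrt (G0 x ^+ 2) @[x --> +oo] --> Num.sqrt (pi / 4).
  apply: continuous_cvg => //; [exact: sqrt_continuous|exact: gauss_integral_proof.cvg_integral0_gauss_sqr].
rewrite sqrtrM ?pi_ge0// sqrtrV// (_ : 4 = 2 ^+ 2); last by rewrite expr2 -natrM.
rewrite sqrtr_sqr ger0_norm//.
have -> // : (fun x => Num.sqrt (G0 x ^+ 2)) = G0.
by apply/funext => r; rewrite sqrtr_sqr ger0_norm// gauss_integral_proof.integral0_gauss_ge0.
Qed.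

Lemma integrable_gauss_itv (a b : R) : mu.-integrable `[a, b] (EFin \o @gauss_fun R).
Proof.
apply: continuous_compact_integrable; first exact: segment_compact.
by apply: continuous_subspaceT; exact: continuous_gauss_fun.
Qed.

Lemma is_derive_G0 (x : R) : 0 < x -> is_derive x 1 G0 (expR (- x ^+ 2)).
Proof.
move=> x0; have x1 : x < x + 1 by rewrite ltrDl.
have [|d1 d2] := @continuous_FTC1_closed R (@gauss_fun R) 0 x (x + 1) x1 (integrable_gauss_itv _ _) x0.
  exact: continuous_gauss_fun.
apply: DeriveDef; first exact: d1.
by rewrite -derive1E d2.
Qed.

Lemma G0_ge0 x : 0 <= G0 x. Proof. exact: gauss_integral_proof.integral0_gauss_ge0. Qed.

Lemma G0_le x : 0 <= x -> G0 x <= x.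
Proof.
move=> x0; rewrite /G0 /gauss_integral_proof.integral0_gauss.
have fin : (mu `[0%R, x]%classic < +oo)%E.
  by rewrite lebesgue_measure_itv /=; case: ifP => _; rewrite ?ltry// -EFinB ltry.
apply: (@le_trans _ _ (\int[mu]_(t in `[0, x]) (cst 1 t))).
  apply: le_Rintegral => //.
  - exact: integrable_gauss_itv.
  - apply: continuous_compact_integrable; first exact: segment_compact.
    by apply: continuous_subspaceT; exact: cst_continuous.
  - by move=> t _; exact: gauss_fun_le1.
have E : mu (`[0%R, x]%classic : set R) = x%:E.
  rewrite lebesgue_measure_itv /= lte_fin.
  by case: ltP => [_|h]; [rewrite -EFinB subr0|congr EFin; lra].
rewrite Rintegral_cst// mul1r.
by move: E => /= ->.
Qed.

(** The Laplace kernel at 1 / u applied to the model v^(-1/2), with [1 + |v|] in place of [v] to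
    remove the singularity at 0. *)
Definition kern (u v : R) := (Num.sqrt (1 + `|v|))^-1 * expR (- (u^-1 * v)).

Lemma sqrt1_gt0 (v : R) : 0 < Num.sqrt (1 + `|v|).
Proof. by rewrite sqrtr_gt0 ltr_wpDr. Qed.

Lemma continuous_kern u : continuous (kern u).
Proof.
move=> x; apply: cvgM; last exact: continuous_expRM.
apply: cvgV; first by rewrite gt_eqF// sqrt1_gt0.
apply: (@continuous_comp _ _ _ (fun v : R => 1 + `|v|) (@Num.sqrt R)); last exact: sqrt_continuous.
by apply: cvgD; [exact: cvg_cst|exact: norm_continuous].
Qed.

Lemma kern_ge0 u v : 0 <= kern u v.
Proof. by rewrite mulr_ge0 ?expR_ge0// invr_ge0 ltW// sqrt1_gt0. Qed.

Definition I1 u := Int (half (kern u)).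

(** The substitution t^2 = (1 + v) / u turns the integral of [kern u] into a Gaussian one. *)
Let FK (u v : R) := 2 * Num.sqrt u * expR u^-1 * G0 (Num.sqrt (u^-1 * (1 + v))).

Let dFK (u x : R) : 0 < u -> 0 <= x -> is_derive x 1 (FK u) (kern u x).
Proof.
move=> u0 x0.
have p : 0 < u^-1 * (1 + x) by rewrite mulr_gt0 ?invr_gt0//; lra.
have su : 0 < Num.sqrt u by rewrite sqrtr_gt0.
have s1 : 0 < Num.sqrt (1 + x) by rewrite sqrtr_gt0; lra.
have d1 : is_derive x 1 (fun v : R => u^-1 * (1 + v)) u^-1.
  by apply: is_derive_eq; rewrite /GRing.scale /=; ring.
have d2 := @is_derive1_comp _ (@Num.sqrt R) (fun v : R => u^-1 * (1 + v)) _ _ _ (is_derive1_sqrt p) d1.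
have sp : 0 < Num.sqrt (u^-1 * (1 + x)) by rewrite sqrtr_gt0.
have d3 := @is_derive1_comp _ G0 (Num.sqrt \o (fun v : R => u^-1 * (1 + v))) _ _ _ (is_derive_G0 sp) d2.
have d4 : is_derive x 1 (FK u) (2 * Num.sqrt u * expR u^-1 *
   (expR (- Num.sqrt (u^-1 * (1 + x)) ^+ 2) * ((2 * Num.sqrt (u^-1 * (1 + x)))^-1 * u^-1))).
  by apply: is_derive_eq; rewrite /GRing.scale /=; ring.
apply: is_derive_eq d4 _.
rewrite /kern (ger0_norm x0) sqr_sqrtr ?(ltW p)//.
have -> : Num.sqrt (u^-1 * (1 + x)) = Num.sqrt (1 + x) / Num.sqrt u.
  by rewrite sqrtrM ?invr_ge0 ?(ltW u0)// sqrtrV ?(ltW u0)// mulrC.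
have -> : expR (- (u^-1 * x)) = expR u^-1 * expR (- (u^-1 * (1 + x))).
  by rewrite -expRD; congr expR; ring.
have eu : u = Num.sqrt u ^+ 2 by rewrite sqr_sqrtr// ltW.
move: su s1 eu; move: (expR _) (expR _) (Num.sqrt (1 + x)) (Num.sqrt u) => e1 e2 s1 s s0 s10 ->.
by field; rewrite !gt_eqF.
Qed.

Let FK_lim u : 0 < u -> FK u x @[x --> +oo] --> Num.sqrt u * expR u^-1 * Num.sqrt pi.
Proof.
move=> u0; have -> : Num.sqrt u * expR u^-1 * Num.sqrt pi = 2 * Num.sqrt u * expR u^-1 * (Num.sqrt pi / 2) :> R.
  by field.
apply: cvgM; first exact: cvg_cst.
apply: (@cvg_comp _ _ _ (fun v : R => Num.sqrt (u^-1 * (1 + v))) G0 _ (pinfty_nbhs R)); last exact: cvg_G0.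
apply/cvgryPge => A; near=> v.
have [A0|A0] := leP A 0; first exact: le_trans (sqrtr_ge0 _).
rewrite -(ger0_norm (ltW A0)) -sqrtr_sqr ler_wsqrtr// ler_pdivlMl//.
have : u * A ^+ 2 <= v by near: v; apply: nbhs_pinfty_ge; exact: num_real.
lra.
Unshelve. all: by end_near. Qed.

Lemma I1E u : 0 < u -> lint (half (kern u)) /\
  I1 u = Num.sqrt u * expR u^-1 * (Num.sqrt pi - 2 * G0 (Num.sqrt u^-1)).
Proof.
move=> u0.
have [|||||l1 e1] := @half_FTC_ge0 (kern u) (FK u) (Num.sqrt u * expR u^-1 * Num.sqrt pi).
- by apply: continuous_measurable_fun; exact: continuous_kern.
- by move=> x _; exact: kern_ge0.
- by move=> x _; exact: continuous_kern.
- by move=> x; exact: dFK.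
- exact: FK_lim.
by split=> //; rewrite /I1 e1 /FK addr0 mulr1; ring.
Qed.

Lemma sqrt_pi_le2 : Num.sqrt pi <= 2 :> R.
Proof.
have h := @pihalf_lt2 R.
rewrite -(ler_pXn2r (ltn0Sn 1)) ?nnegrE ?sqrtr_ge0// sqr_sqrtr ?pi_ge0//; lra.
Qed.

Lemma expR_inv_le (u : R) : 1 <= u -> expR u^-1 <= expR 1.
Proof. by move=> u1; rewrite ler_expR invf_le1//; lra. Qed.

Lemma I1_le u : 1 <= u -> I1 u <= expR 1 * 2 * Num.sqrt u.
Proof.
move=> u1; have u0 : 0 < u by lra.
have [_ ->] := I1E u0.
have -> : expR 1 * 2 * Num.sqrt u = Num.sqrt u * expR 1 * 2 by ring.
apply: (@le_trans _ _ (Num.sqrt u * expR u^-1 * 2)).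
  rewrite ler_wpM2l ?mulr_ge0 ?sqrtr_ge0 ?expR_ge0//.
  have := G0_ge0 (Num.sqrt u^-1); have := sqrt_pi_le2; lra.
by rewrite ler_wpM2r// ler_wpM2l ?sqrtr_ge0// expR_inv_le.
Qed.

(** The corrections come from [expR u^-1] and from the Gaussian mass below [Num.sqrt u^-1]; both are
    at most of relative size u^(-1/2). *)
Lemma I1_asymp u : 1 <= u -> `|I1 u / Num.sqrt u - Num.sqrt pi| <= expR 1 * 4 / Num.sqrt u.
Proof.
move=> u1; have u0 : 0 < u by lra.
have su : 0 < Num.sqrt u by rewrite sqrtr_gt0.
have su1 : 1 <= Num.sqrt u by rewrite -[leLHS]sqrtr1 ler_wsqrtr.
have [_ ->] := I1E u0.
set e := expR u^-1; set p := Num.sqrt pi; set g := G0 _.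
have -> : Num.sqrt u * e * (p - 2 * g) / Num.sqrt u - p = (e - 1) * p - e * 2 * g.
  by field; rewrite gt_eqF.
have ui : 0 <= u^-1 by rewrite invr_ge0 ltW.
have us : u^-1 <= (Num.sqrt u)^-1.
  by rewrite lef_pV2 ?posrE// -{2}(sqr_sqrtr (ltW u0)) expr2 ler_peMl// ltW.
have e1 : 1 <= e by rewrite /e -[leLHS]expR0 ler_expR.
have eE : e <= expR 1 by exact: expR_inv_le.
have h1 : e - 1 <= u^-1 * e.
  have := expR_ge1Dx (- u^-1) => h.
  have := ler_wpM2r (expR_ge0 u^-1) h; rewrite -expRD addNr expR0 -/e; lra.
have p0 : 0 <= p by exact: sqrtr_ge0.
have p2 : p <= 2 by exact: sqrt_pi_le2.
have g0 : 0 <= g by exact: G0_ge0.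
have gs : g <= (Num.sqrt u)^-1 by rewrite -sqrtrV ?(ltW u0)//; apply: G0_le; exact: sqrtr_ge0.
have si : 0 <= (Num.sqrt u)^-1 by rewrite invr_ge0 ltW.
have E0 := expR_ge0 (1 : R).
have a1 : (e - 1) * p <= expR 1 * 2 / Num.sqrt u.
  have : (e - 1) * p <= (u^-1 * e) * 2 by apply: ler_pM => //; lra.
  have : u^-1 * e <= (Num.sqrt u)^-1 * expR 1 by apply: ler_pM => //; lra.
  lra.
have a2 : e * 2 * g <= expR 1 * 2 / Num.sqrt u by apply: ler_pM => //; lra.
have a3 : 0 <= (e - 1) * p by rewrite mulr_ge0//; lra.
have a4 : 0 <= e * 2 * g by rewrite !mulr_ge0//; lra.
rewrite ler_norml; apply/andP; split; lra.
Qed.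

Section Variation.
Variables (w w6 : R -> R) (D : R).
Hypothesis cw : continuous w.
Hypothesis cw6 : continuous w6.
Hypothesis dw : forall v : R, 0 < v -> is_derive v 1 w (w6 v - w v).
Hypothesis w01 : forall v, 0 <= w v <= 1.
Let e v := v * (w6 v - w v) + 2^-1 * w v.
Let E2 v := \int[mu]_(t in `[0, v]) (e t ^+ 2).
Hypothesis E2D : forall v, 0 <= v -> E2 v <= D.

Let ce2 : continuous (fun t => e t ^+ 2).
Proof.
move=> x; apply: (@continuous_comp _ _ _ e (fun y : R => y ^+ 2)); last exact: exprn_continuous.
apply: cvgD; apply: cvgM; [exact: cvg_id| |exact: cvg_cst|exact: cw].
by apply: cvgB; [exact: cw6|exact: cw].
Qed.

Let ie2 (a b : R) : mu.-integrable `[a, b] (EFin \o (fun t => e t ^+ 2)).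
Proof.
apply: continuous_compact_integrable; first exact: segment_compact.
exact: continuous_subspaceT.
Qed.

Let dE2 (v : R) : 0 < v -> is_derive v 1 E2 (e v ^+ 2).
Proof.
move=> v0; have v1 : v < v + 1 by rewrite ltrDl.
have [|d1 d2] := @continuous_FTC1_closed R (fun t => e t ^+ 2) 0 v (v + 1) v1 (ie2 _ _) v0.
  exact: ce2.
apply: DeriveDef; first exact: d1.
by rewrite -derive1E d2.
Qed.

Let l v := Num.sqrt v * w v.

Let dl (v : R) : 0 < v -> is_derive v 1 l (e v / Num.sqrt v).
Proof.
move=> v0; have h1 := dw v0; have h2 := is_derive1_sqrt v0.
have s0 : 0 < Num.sqrt v by rewrite sqrtr_gt0.
apply: (is_derive_eq (is_deriveM h2 h1)); rewrite /GRing.scale /= /e.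
have ev : v = Num.sqrt v ^+ 2 by rewrite sqr_sqrtr// ltW.
move: ev s0; move: (Num.sqrt v) (w v) (w6 v) => s a b ev s0.
by rewrite ev; field; rewrite gt_eqF.
Qed.

(* AM-GM: [|e| / sqrt v <= (k / v + e ^ 2 / k) / 2], the derivative of the majorant *)
Lemma variation_bound (k a b : R) : 0 < k -> 0 < a -> a <= b ->
  `|l b - l a| <= 2^-1 * (k * (ln b - ln a) + (E2 b - E2 a) / k).
Proof.
move=> k0 a0 ab.
have main (s : R) : s ^+ 2 = 1 -> s * (l b - l a) <= 2^-1 * (k * (ln b - ln a) + (E2 b - E2 a) / k).
  move=> s2.
  pose h v := s * l v - 2^-1 * (k * ln v + k^-1 * E2 v).
  have dh (v : R) : 0 < v -> is_derive v 1 h (s * (e v / Num.sqrt v) - 2^-1 * (k / v + k^-1 * e v ^+ 2)).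
    move=> v0; have h1 := dl v0; have h2 := dE2 v0; have h3 := is_derive1_ln v0.
    have h4 := is_deriveZ s h1; have h5 := is_deriveZ k h3; have h6 := is_deriveZ k^-1 h2.
    apply: (is_derive_eq (is_deriveB h4 (is_deriveZ 2^-1 (is_deriveD h5 h6)))).
    by rewrite /GRing.scale /=; ring.
  have H : h b <= h a.
    apply: (@ler0_derive1_nincr R h a b) => //.
    - move=> x; rewrite in_itv /= => /andP[x0 _].
      by have [] := dh x (lt_trans a0 x0).
    - move=> x; rewrite in_itv /= => /andP[x0 _]; have xp := lt_trans a0 x0.
      rewrite derive1E; have [_ ->] := dh x xp.
      have s0 : 0 < Num.sqrt x by rewrite sqrtr_gt0.
      have ev : x = Num.sqrt x ^+ 2 by rewrite sqr_sqrtr// ltW.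
      have := sqr_ge0 (k / Num.sqrt x - s * e x).
      have -> : k / x = k * (Num.sqrt x)^-1 ^+ 2 by rewrite exprVn -ev.
      move: (e x) (Num.sqrt x)^-1 => y r.
      rewrite sqrrB !exprMn s2 mul1r => sq.
      have -> : s * (y * r) - 2^-1 * (k * r ^+ 2 + k^-1 * y ^+ 2) =
        - (2^-1 * k^-1 * (k ^+ 2 * r ^+ 2 - k * r * (s * y) *+ 2 + y ^+ 2)).
        by field; rewrite gt_eqF.
      by rewrite oppr_le0 mulr_ge0// mulr_ge0// invr_ge0 ltW.
    - apply: derivable_within_continuous => x; rewrite in_itv /= => /andP[x0 _].
      by have [] := dh x (lt_le_trans a0 x0).
  by move: H; rewrite /h; lra.
have m1 := main 1 (expr1n _ _).
have m2 := main (-1); rewrite sqrrN expr1n in m2.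
have {}m2 := m2 erefl.
by rewrite ler_norml; apply/andP; split; lra.
Qed.

Let E2nd a b : 0 <= a -> a <= b -> E2 a <= E2 b.
Proof.
move=> a0; rewrite le_eqVlt => /predU1P[->//|ab].
have [->|an0] := eqVneq a 0.
  by rewrite /E2 set_itv1 Rintegral_set1; apply: Rintegral_ge0 => t _; exact: sqr_ge0.
have ap : 0 < a by rewrite lt_def an0.
apply: (@ger0_derive1_ndecr R E2 a b) => //; last exact: ltW.
- by move=> x; rewrite in_itv /= => /andP[x0 _]; have [] := dE2 (lt_trans ap x0).
- move=> x; rewrite in_itv /= => /andP[x0 _]; rewrite derive1E.
  by have [_ ->] := dE2 (lt_trans ap x0); exact: sqr_ge0.
- apply: derivable_within_continuous => x; rewrite in_itv /= => /andP[x0 _].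
  by have [] := dE2 (lt_le_trans ap x0).
Qed.

(** [E2] is nondecreasing and bounded, so beyond some [T] its increments are below [ep ^+ 2]; with
    [k = ep] in [variation_bound] both terms are of order [ep]. *)
Lemma slow_variation (ep : R) : 0 < ep -> exists2 T, 0 < T & forall a b, T <= a -> a <= b ->
  `|l b - l a| <= ep * (1 + (ln b - ln a)).
Proof.
move=> ep0.
pose S := [set E2 v | v in [set v : R | 1 <= v]].
have hS : has_sup S.
  split; first by exists (E2 1), 1 => //=.
  by exists D => _ [v /= v1 <-]; apply: E2D; lra.
have e20 : 0 < ep ^+ 2 by rewrite exprn_gt0.
have [_ [T /= T1 <-] HT] := sup_adherent e20 hS.
exists T; first lra.
move=> a b Ta ab.
have a0 : 0 < a by lra.
apply: le_trans (variation_bound ep0 a0 ab) _.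
have : E2 b <= sup S by apply: ub_le_sup; [exact: hS.2|exists b => //=; lra].
have : E2 T <= E2 a by apply: E2nd => //; lra.
move=> h1 h2; have h3 : E2 b - E2 a <= ep ^+ 2 by lra.
have h4 : (E2 b - E2 a) / ep <= ep by rewrite ler_pdivrMr// -expr2.
have h5 : 0 <= ln b - ln a by rewrite subr_ge0 ler_ln ?posrE//; lra.
have := mulr_ge0 (ltW ep0) h5; lra.
Qed.

End Variation.
End SlowVariation.

(** * From the Laplace transform to the limit of a slowly varying function *)

Section Tauberian.
Variable R : realType.
Notation mu := (@lebesgue_measure R).
Implicit Types (m : R -> R).

Definition tendsto (f : R -> R) (l : R) :=
  forall ep, 0 < ep -> exists2 T, 1 <= T & forall x, T <= x -> `|f x - l| <= ep.

Lemma dist_tri (x y z e1 e2 : R) : `|x - y| <= e1 -> `|y - z| <= e2 -> `|x - z| <= e1 + e2.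
Proof. by move=> h1 h2; apply: le_trans (ler_distD y _ _) _; exact: lerD. Qed.

Lemma Int_indic_itv (a b : R) : a <= b -> lint (\1_`[a, b] : R -> R) /\ Int (\1_`[a, b]) = b - a.
Proof.
move=> ab; have mi : measurable (`[a, b]%classic : set R) by exact: measurable_itv.
have E : (\int[mu]_x (\1_`[a, b] x)%:E = (b - a)%:E)%E.
  rewrite integral_indic// setIT.
  transitivity (lebesgue_measure (`[a, b]%classic : set R)); first by [].
  rewrite lebesgue_measure_itv /= lte_fin.
  case: ltP => [_|ba]; first by rewrite -EFinB.
  by congr EFin; apply/eqP; rewrite eq_sym subr_eq0 eq_le ba.
split; last exact: Int_eq_of.
apply: lint_ge0; first exact: measurable_indic.
  by move=> x; rewrite indicE.
by rewrite E ltry.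
Qed.

Lemma lint_itv (f : R -> R) (a b : R) : continuous f -> lint (f \_ `[a, b]).
Proof.
move=> cf; rewrite /lint.
have -> : EFin \o f \_ `[a, b] = (EFin \o f) \_ `[a, b].
  by apply/funext => x; rewrite /= !patchE; case: ifP.
have mi : measurable (`[a, b]%classic : set (measurableTypeR R)) by exact: measurable_itv.
apply: (@integrable_mkcond _ (measurableTypeR R) R mu `[a, b]%classic (EFin \o f) mi).1.
apply: continuous_compact_integrable; first exact: segment_compact.
exact: continuous_subspaceT.
Qed.

Lemma lipschitz_is_continuous (f : R -> R) (K : R) :
  (forall x y, `|f x - f y| <= K * `|x - y|) -> continuous f.
Proof.
move=> H x; apply/cvgrPdist_le => e e0.
have k0 : 0 < 1 + `|K| by rewrite ltr_pwDl.
have d0 : 0 < e / (1 + `|K|) by rewrite divr_gt0.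
apply/nbhs_ballP; exists (e / (1 + `|K|)) => //= y /ltW xy.
apply: le_trans (H x y) _.
apply: (@le_trans _ _ ((1 + `|K|) * `|x - y|)).
  by rewrite ler_wpM2r//; have := ler_norm K; lra.
by rewrite mulrC -ler_pdivlMr.
Qed.

Lemma continuous_sm m j : tempered m -> (forall v, 0 <= m v <= 1) -> continuous (sm m j.+1).
Proof. by move=> tm m01; exact: lipschitz_is_continuous (sm_lip tm m01 j). Qed.

Lemma cnv_gamE (a : R -> R) (x : R) : continuous a -> (forall v, v < 0 -> a v = 0) ->
  cnv a (@gam R) x = expR (- x) * \int[mu]_(u in `[0, x]) (a u * expR u).
Proof.
move=> ca a0; rewrite -RintegralZl//; last first.
  apply: continuous_compact_integrable; first exact: segment_compact.
  apply: continuous_subspaceT => y; apply: cvgM; [exact: ca|exact: continuous_expR].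
rewrite Rintegral_mkcond /cnv /Int; apply: eq_Rintegral => u _.
rewrite patchE /gam /half subr_ge0; case: ifPn => [ux|/negbTE ux].
  case: ifPn => [|nu]; first by rewrite mul1r opprB expRD => _; ring.
  rewrite a0 ?mul0r//; rewrite ltNge; apply: contra nu => u0.
  by rewrite inE /= in_itv /= u0.
by rewrite memNset ?mulr0//= in_itv/= ux andbF.
Qed.

(** A convolution w = a * gam solves w' = a - w: it is [expR (- x)] times a running integral. The
    index starts at 2 because [a] must be continuous, which takes one smoothing. *)
Lemma is_derive_sm m j (v : R) : tempered m -> (forall v, 0 <= m v <= 1) -> 0 < v ->
  is_derive v 1 (sm m j.+2) (sm m j.+1 v - sm m j.+2 v).
Proof.
move=> tm m01 v0.
have ca := @continuous_sm m j tm m01.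
have [_ a0 _] := tempered_sm j.+1 tm.
have E : sm m j.+2 = (fun x : R => expR (- (1 * x)) * \int[mu]_(u in `[0, x]) (sm m j.+1 u * expR u)).
  by apply/funext => x; rewrite mul1r -cnv_gamE.
have cf : continuous (fun u => sm m j.+1 u * expR u).
  by move=> y; apply: cvgM; [exact: ca|exact: continuous_expR].
have v1 : v < v + 1 by rewrite ltrDl.
have li : mu.-integrable `[0, v + 1] (EFin \o (fun u => sm m j.+1 u * expR u)).
  apply: continuous_compact_integrable; first exact: segment_compact.
  exact: continuous_subspaceT.
have [|d1 d2] := @continuous_FTC1_closed R (fun u => sm m j.+1 u * expR u) 0 v (v + 1) v1 li v0.
  exact: cf.
have d3 : is_derive v 1 (fun x : R => \int[mu]_(u in `[0, x]) (sm m j.+1 u * expR u)) (sm m j.+1 v * expR v).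
  apply: DeriveDef; first exact: d1.
  by rewrite -derive1E d2.
have Ev : sm m j.+2 v = expR (- (1 * v)) * \int[mu]_(u in `[0, v]) (sm m j.+1 u * expR u) by rewrite E.
rewrite {1}E; apply: (is_derive_eq (is_deriveM (is_derive_expRM 1 v) d3)).
rewrite /GRing.scale /= -/(sm m j.+1) -/(sm m j.+2) Ev mul1r.
have e1 : expR (- v) * expR v = 1 :> R by rewrite -expRD addNr expR0.
move: (\int[mu]_(_ in _) _) => I.
rewrite mulrCA e1; ring.
Qed.

(** With [d <= 1 / (v + 1)] the damping on [0, v] is at least exp (-1), so removing its square costs
    [expR 2]. *)
Lemma energy_itv (e : R -> R) (D d1 : R) : continuous e -> 0 <= D -> 0 < d1 ->
  (forall d, 0 < d -> d <= d1 -> lint (fun u => damp d e u ^+ 2) /\ Int (fun u => damp d e u ^+ 2) <= D) ->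
  forall v, 0 <= v -> \int[mu]_(t in `[0, v]) (e t ^+ 2) <= expR 2 * D.
Proof.
move=> ce D0 d10 H v v0.
pose d := Num.min d1 (v + 1)^-1.
have d0 : 0 < d by rewrite lt_min d10 invr_gt0; lra.
have [l1 i1] := H d d0 ltac:(by rewrite ge_min lexx).
apply: (@le_trans _ _ (expR 2 * Int (fun u => damp d e u ^+ 2))); last by rewrite ler_wpM2l ?expR_ge0.
rewrite -(IntZ (expR 2) l1) Rintegral_mkcond.
have ce2 : continuous (fun t => e t ^+ 2).
  by move=> x; apply: (@continuous_comp _ _ _ e (fun y : R => y ^+ 2)); [exact: ce|exact: exprn_continuous].
have mi : measurable (`[0, v]%classic : set R) by exact: measurable_itv.
apply: Int_le.
- exact: lint_itv.
- exact: lintZ.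
- move=> x; rewrite patchE; case: ifPn; last by rewrite mulr_ge0 ?expR_ge0 ?sqr_ge0.
  rewrite inE /= in_itv /= => /andP[x0 xv].
  have dx : d * x <= 1.
    apply: (@le_trans _ _ ((v + 1)^-1 * (v + 1))); last by rewrite mulVf//; lra.
    by apply: ler_pM => //; [exact: ltW|rewrite ge_min lexx orbT|lra].
  rewrite /damp exprMn mulrCA ler_peMr ?sqr_ge0// expr2 -!expRD -[leLHS]expR0 ler_expR.
  clear -dx; lra.
Qed.

(** The weight is the one of [kern], so that the damped integral is an average of this function;
    [sqrt1w_near] returns to sqrt v. *)
Definition sqrt1w (w : R -> R) (v : R) := Num.sqrt (1 + `|v|) * w v.

Lemma sqrtV_small (ep : R) : 0 < ep -> exists2 T, 1 <= T & forall x, T <= x -> (Num.sqrt x)^-1 <= ep.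
Proof.
move=> e0; exists (1 + (ep ^+ 2)^-1); first by rewrite lerDl invr_ge0 sqr_ge0.
have e20 : 0 < (ep ^+ 2)^-1 by rewrite invr_gt0 exprn_gt0.
move=> x Tx; rewrite invf_ple ?posrE//; last by rewrite sqrtr_gt0; lra.
have h : 0 <= ep^-1 by rewrite invr_ge0 ltW.
rewrite -(ger0_norm h) -sqrtr_sqr ler_wsqrtr//; rewrite exprVn; lra.
Qed.

Section Core.
Variables (w : R -> R) (A : R).
Hypothesis tw : tempered w.
Hypothesis w01 : forall v, 0 <= w v <= 1.
Hypothesis sv : forall ep : R, 0 < ep -> exists2 T, 0 < T & forall a b, T <= a -> a <= b ->
  `|Num.sqrt b * w b - Num.sqrt a * w a| <= ep * (1 + (ln b - ln a)).
Hypothesis lapl : tendsto (fun u => Int (damp u^-1 w) / Num.sqrt u) A.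

Local Notation l1 := (sqrt1w w).
Local Notation l v := (Num.sqrt v * w v).

Lemma sqrt1w_near (v : R) : 0 < v -> `|l1 v - l v| <= (Num.sqrt v)^-1.
Proof.
move=> v0; have /andP[h1 h2] := w01 v.
have s0 : 0 < Num.sqrt v by rewrite sqrtr_gt0.
have s1 := sqr_sqrtr (ltW v0).
have s2 : Num.sqrt (1 + v) ^+ 2 = 1 + v by rewrite sqr_sqrtr//; lra.
have s3 : Num.sqrt v <= Num.sqrt (1 + v) by rewrite ler_wsqrtr// lerDr.
rewrite /sqrt1w (ger0_norm (ltW v0)) -mulrBl normrM !ger0_norm ?subr_ge0//.
apply: (@le_trans _ _ (Num.sqrt (1 + v) - Num.sqrt v)).
  by rewrite ler_piMr// subr_ge0.
rewrite -[leRHS]mul1r ler_pdivlMr//.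
move: s0 s1 s2 s3; move: (Num.sqrt v) (Num.sqrt (1 + v)) => a b a0 s1 s2 ab.
nra.
Qed.

Lemma sqrt1w_slow (ep : R) : 0 < ep -> exists2 T, 1 <= T & forall a b, T <= a -> a <= b ->
  `|l1 b - l1 a| <= ep * (1 + (ln b - ln a)).
Proof.
move=> e0; have e2 : 0 < ep / 4 by lra.
have [T T0 HT] := sv e2; have [T' T'1 HT'] := sqrtV_small e2.
exists (T + T'); first lra.
move=> a b Ta ab.
have a0 : 0 < a by lra. have b0 : 0 < b by lra.
have h1 := HT a b ltac:(lra) ab.
have h2 := sqrt1w_near a0; have h3 := sqrt1w_near b0.
have h4 := HT' a ltac:(lra); have h5 := HT' b ltac:(lra).
have h6 : 0 <= ln b - ln a by rewrite subr_ge0 ler_ln ?posrE.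
have h7 := mulr_ge0 (ltW e0) h6.
have -> : l1 b - l1 a = (l1 b - l b) + (l b - l a) - (l1 a - l a) by ring.
apply: le_trans (ler_normB _ _) _; apply: le_trans (lerD (ler_normD _ _) (lexx _)) _.
lra.
Qed.

Lemma lint_dampV u : 0 < u -> lint (damp u^-1 w).
Proof. by move=> u0; apply: lint_damp => //; rewrite invr_gt0. Qed.

Lemma sqrt1w_ge0 v : 0 <= l1 v.
Proof. by rewrite /sqrt1w mulr_ge0 ?sqrtr_ge0//; have /andP[] := w01 v. Qed.

Lemma damp_kern u v : damp u^-1 w v = half (fun v => l1 v * kern u v) v.
Proof.
rewrite /damp /half; case: ifPn => v0; last first.
  have [_ z _] := tw; by rewrite z ?mul0r// ltNge.
have := @sqrt1_gt0 R v => s0.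
rewrite /sqrt1w /kern; move: (expR _) => E; field; by rewrite gt_eqF.
Qed.

(** By slow variation a large value at [v] persists on [v, 2 v] up to a loss of 2, and would
    contribute too much to the Laplace integral at 1 / v, which is O(sqrt v). *)
Lemma sqrt1w_bounded : exists2 B, 0 <= B & forall v, 0 <= v -> l1 v <= B.
Proof.
have [T T1 HT] := sqrt1w_slow ltr01.
have [T' T'1 HT'] := lapl ltr01.
pose B := 2 + 2 * expR 2 * (`|A| + 1).
have B0 : 0 <= B by rewrite addr_ge0// !mulr_ge0 ?expR_ge0// addr_ge0.
exists (B + Num.sqrt (1 + (T + T'))); first by rewrite addr_ge0 ?sqrtr_ge0.
move=> v v0; have [vT|Tv] := leP v (T + T').
  have /andP[h1 h2] := w01 v.
  apply: (@le_trans _ _ (Num.sqrt (1 + (T + T')))); last by rewrite lerDr.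
  apply: (@le_trans _ _ (Num.sqrt (1 + v))).
    by rewrite /sqrt1w ger0_norm// ler_piMr// sqrtr_ge0.
  by rewrite ler_wsqrtr//; lra.
apply: (@le_trans _ _ B); last by rewrite lerDl sqrtr_ge0.
have vp : 0 < v by lra.
have := HT' v ltac:(lra).
set P := Int _ => hP.
have sp : 0 < Num.sqrt v by rewrite sqrtr_gt0.
have P1 : P <= (`|A| + 1) * Num.sqrt v.
  rewrite -ler_pdivrMr//; have := ler_norm (P / Num.sqrt v - A); have := ler_norm A; lra.
have [h|h] := leP (l1 v) 2; first by rewrite (le_trans h)// lerDl !mulr_ge0 ?expR_ge0// addr_ge0.
(* On [v, 2 v] the weight sqrt (1 + x) is at most [2 * Num.sqrt v] and the damping at least
   [expR (- 2)]. *)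
have lo : (l1 v - 2) / (2 * Num.sqrt v) * expR (- 2) * v <= P.
  set k := _ / _ * _.
  have mi : measurable (`[v, 2 * v]%classic : set R) by exact: measurable_itv.
  have k0 : 0 <= k.
    by rewrite mulr_ge0 ?expR_ge0// divr_ge0 ?subr_ge0 ?(ltW h)// mulr_ge0// ltW.
  have [|li Iw] := @Int_indic_itv v (2 * v); first lra.
  have {1}-> : v = Int (\1_`[v, 2 * v]) by rewrite Iw; ring.
  rewrite -(IntZ k li); apply: Int_le; [exact: lintZ|exact: lint_dampV|].
  move=> x; rewrite damp_kern indicE.
  case: (boolP (x \in _)); last first.
    rewrite mulr0 => _; rewrite /half; case: ifP => // _.
    by apply: mulr_ge0; [exact: sqrt1w_ge0|exact: kern_ge0].
  rewrite inE /= in_itv /= => /andP[vx xv]; rewrite mulr1.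
  have x0 : 0 <= x by lra.
  rewrite /half x0.
  have H := HT v x ltac:(lra) vx.
  have ll : ln x - ln v <= 1.
    rewrite -ln_div ?posrE//; last lra.
    have q : x / v <= 2 by rewrite ler_pdivrMr.
    have q0 : 0 < x / v by rewrite divr_gt0//; lra.
    have := @le_ln1Dx R (x / v - 1); rewrite subrKC => /(_ ltac:(lra)); lra.
  have l2 : l1 v - 2 <= l1 x.
    have := ler_norm (l1 v - l1 x); rewrite distrC; lra.
  have s1 := @sqrt1_gt0 R x.
  have s4 : Num.sqrt (1 + `|x|) <= 2 * Num.sqrt v.
    have -> : 2 * Num.sqrt v = Num.sqrt (4 * v).
      by rewrite sqrtrM// (_ : 4 = 2 ^+ 2) ?sqrtr_sqr ?ger0_norm//; rewrite expr2 -natrM.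
    by rewrite ler_wsqrtr// ger0_norm//; lra.
  move: l2; move: (l1 x) => L l2.
  rewrite /k /kern -!mulrA; apply: ler_pM.
  - by rewrite subr_ge0 ltW.
  - by rewrite mulr_ge0 ?expR_ge0// invr_ge0 mulr_ge0// ltW.
  - exact: l2.
  apply: ler_pM => //; rewrite ?invr_ge0 ?mulr_ge0 ?expR_ge0 ?(ltW sp)//.
    by rewrite lef_pV2 ?posrE// mulr_gt0.
  by rewrite ler_expR lerN2 mulrC ler_pdivrMr.
have lo2 : (l1 v - 2) * expR (- 2) <= 2 * (`|A| + 1).
  have -> : (l1 v - 2) * expR (- 2) = ((l1 v - 2) / (2 * Num.sqrt v) * expR (- 2) * v) * 2 / Num.sqrt v.
    have := sqr_sqrtr (ltW vp).
    move: sp; move: (expR _) (Num.sqrt v) (l1 v) => E s L s0 <-.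
    by field; rewrite gt_eqF.
  rewrite ler_pdivrMr//; lra.
have := ler_wpM2r (expR_ge0 2) lo2.
rewrite -mulrA -expRD addNr expR0 mulr1 /B; lra.
Qed.

(** Below [eta * u] only boundedness is used, and [kern u <= expR 1 * kern (eta * u)] has small mass
    there. Above, slow variation gives |ln (v / u)|, bounded by [- ln eta] for v <= u and by v / u
    for v > u; this last factor is absorbed by passing to [kern (2 * u)]. *)
Lemma laplace_kern_le (B eta ep T u : R) : 0 <= B -> (forall v, 0 <= v -> l1 v <= B) ->
  0 < ep -> 1 <= T -> (forall a b, T <= a -> a <= b -> `|l1 b - l1 a| <= ep * (1 + (ln b - ln a))) ->
  0 < eta -> eta <= 1 -> T <= eta * u ->
  `|Int (damp u^-1 w) - l1 u * I1 u| <=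
    ep * (1 - ln eta) * I1 u + 2 * ep * I1 (2 * u) + B * expR 1 * I1 (eta * u).
Proof.
move=> B0 HB ep0 T1 HT eta0 eta1 Tu.
have u0 : 0 < u by have := ler_pM (ltW eta0) (ltW ltr01) eta1 (lexx 1); nra.
have u20 : 0 < 2 * u by rewrite mulr_gt0.
have eu0 : 0 < eta * u by rewrite mulr_gt0.
have [k1 _] := I1E u0; have [k2 _] := I1E u20; have [k3 _] := I1E eu0.
rewrite /I1 -2!(IntZ _ k1) -(IntZ _ k2) -(IntZ _ k3) -IntB; [|exact: lint_dampV|exact: lintZ].
rewrite -IntD; [|exact: lintZ|exact: lintZ].
rewrite -IntD; [|apply: lintD; exact: lintZ|exact: lintZ].
apply: Int_abs_le; last by apply: lintD; [apply: lintD|]; exact: lintZ.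
  by apply: lint_meas; apply: lintB; [exact: lint_dampV|exact: lintZ].
move=> v; rewrite damp_kern /half; case: ifPn => v0; last by rewrite !mulr0 subrr normr0 !addr0.
rewrite -mulrBl normrM (ger0_norm (kern_ge0 u v)).
have ln0 : ln eta <= 0 by exact: ln_le0.
have K0 := kern_ge0 u v; have K2 := kern_ge0 (2 * u) v; have K3 := kern_ge0 (eta * u) v.
have lu := sqrt1w_ge0 u; have lv := sqrt1w_ge0 v.
have hB := mulr_ge0 (mulr_ge0 B0 (expR_ge0 1)) K3.
have h2 : 0 <= 2 * ep * kern (2 * u) v by rewrite mulr_ge0// mulr_ge0// ltW.
have [vl|vg] := ltP v (eta * u).
  have a1 : `|l1 v - l1 u| * kern u v <= B * kern u v.
    rewrite ler_wpM2r//; have := HB v v0; have := HB u (ltW u0).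
    by move=> ? ?; rewrite ler_norml; apply/andP; split; lra.
  have a2 : kern u v <= expR 1 * kern (eta * u) v.
    rewrite /kern mulrCA ler_wpM2l ?invr_ge0 ?sqrtr_ge0// -expRD ler_expR.
    have : (eta * u)^-1 * v <= 1 by rewrite ler_pdivrMl// mulr1 ltW.
    have : 0 <= u^-1 * v by rewrite mulr_ge0// invr_ge0 ltW.
    lra.
  have a3 := ler_wpM2l B0 a2.
  have a4 : 0 <= ep * (1 - ln eta) * kern u v by rewrite !mulr_ge0//; lra.
  lra.
have vp : 0 < v by lra.
have a1 : `|l1 v - l1 u| <= ep * (1 - ln eta + v / u).
  have vu0 : 0 <= v / u by rewrite divr_ge0// ltW.
  have [vu|uv] := leP v u.
    rewrite distrC; apply: le_trans (HT v u ltac:(lra) vu) _.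
    rewrite ler_pM2l//.
    have : ln (eta * u) <= ln v by rewrite ler_ln ?posrE.
    rewrite lnM ?posrE//; lra.
  apply: le_trans (HT u v _ (ltW uv)) _.
    by apply: le_trans Tu _; rewrite ler_piMl// ltW.
  rewrite ler_pM2l// -ln_div ?posrE//.
  have q0 : 0 < v / u by rewrite divr_gt0.
  have : ln (v / u) <= v / u - 1.
    have := @le_ln1Dx R (v / u - 1); rewrite subrKC; apply; lra.
  lra.
have a2 := ler_wpM2r K0 a1.
have a3 : v / u * kern u v <= 2 * kern (2 * u) v.
  rewrite /kern mulrCA [leRHS]mulrCA ler_wpM2l ?invr_ge0 ?sqrtr_ge0//.
  have -> : (2 * u)^-1 * v = u^-1 * v / 2 by rewrite invfM; ring.
  rewrite (mulrC v) ; set x := u^-1 * v.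
  have := expR_ge1Dx (x / 2) => h.
  have h' := ler_wpM2r (expR_ge0 (- x)) h.
  rewrite -expRD in h'.
  have -> : - (x / 2) = x / 2 - x by lra.
  have := expR_ge0 (- x); lra.
have a4 := ler_wpM2l (ltW ep0) a3.
lra.
Qed.

End Core.

Lemma laplace_error_arith (E b s L ep q e i1 i2 i3 X : R) : 0 <= E -> 0 <= b -> 0 <= ep -> 0 <= 1 - L -> 0 <= q ->
  i1 <= E * 2 * q -> i2 <= E * 2 * (2 * q) -> i3 <= E * 2 * (s * q) ->
  X <= ep * (1 - L) * i1 + 2 * ep * i2 + b * E * i3 ->
  2 * E * (b * E) * s <= e -> 2 * E * (1 - L + 4) * ep <= e -> X <= 2 * e * q.
Proof.
move=> E0 b0 ep0 L0 q0 h1 h2 h3 hX hs he.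
have j1 := ler_wpM2l (mulr_ge0 ep0 L0) h1.
have j2 := ler_wpM2l ep0 h2.
have j3 := ler_wpM2l (mulr_ge0 b0 E0) h3.
have j4 := ler_wpM2r q0 hs; have j5 := ler_wpM2r q0 he.
clear -hX j1 j2 j3 j4 j5; lra.
Qed.

(** The cut is [eta = s ^+ 2], so that [I1 (eta * u)] is of order [s * Num.sqrt u]. [s] is chosen
    first, then [ep] against [ln eta]. *)
Lemma laplace_error_params (B e : R) : 0 <= B -> 0 < e -> exists s ep : R, [/\ 0 < s, s <= 1, 0 < ep,
  2 * expR 1 * (B * expR 1) * s <= e & 2 * expR 1 * (1 - ln (s ^+ 2) + 4) * ep <= e].
Proof.
move=> B0 e0; have E0 := expR_gt0 (1 : R).
have K0 : 0 < 2 * expR 1 * (B * expR 1) + 1 by rewrite ltr_wpDl// !mulr_ge0// ltW.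
pose s := Num.min 1 (e / (2 * expR 1 * (B * expR 1) + 1)).
have s0 : 0 < s by rewrite lt_min ltr01 divr_gt0.
have s1 : s <= 1 by rewrite ge_min lexx.
have L0 : ln (s ^+ 2) <= 0 by apply: ln_le0; rewrite exprn_ile1// ltW.
have Q0 : 0 < 2 * expR 1 * (1 - ln (s ^+ 2) + 4) by rewrite !mulr_gt0//; clear -L0; lra.
exists s, (e / (2 * expR 1 * (1 - ln (s ^+ 2) + 4))); split=> //; first by rewrite divr_gt0.
- apply: (@le_trans _ _ ((2 * expR 1 * (B * expR 1) + 1) * s)).
    by rewrite ler_wpM2r ?(ltW s0)// lerDl.
  by rewrite mulrC -ler_pdivlMr// ge_min lexx orbT.
- by rewrite mulrC divfK// gt_eqF.
Qed.

(** The Laplace integral at 1 / u is [sqrt1w w u * I1 u] up to a small multiple of sqrt u, and I1 u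
    ~ sqrt (pi u) identifies the limit. *)
Theorem tauberian (w : R -> R) (A : R) : tempered w -> (forall v, 0 <= w v <= 1) ->
  (forall ep : R, 0 < ep -> exists2 T, 0 < T & forall a b, T <= a -> a <= b ->
    `|Num.sqrt b * w b - Num.sqrt a * w a| <= ep * (1 + (ln b - ln a))) ->
  tendsto (fun u => Int (damp u^-1 w) / Num.sqrt u) A ->
  tendsto (fun v => Num.sqrt v * w v) (A / Num.sqrt pi).
Proof.
move=> tw w01 sv lapl.
have [B B0 HB] := sqrt1w_bounded tw w01 sv lapl.
move=> e e0.
have E0 := expR_gt0 (1 : R).
have e80 : 0 < e / 8 by clear -e0; lra.
have [s [ep [s0 s1 ep0 sK epK]]] := laplace_error_params B0 e80.
have [T T1 HT] := sqrt1w_slow w01 sv ep0.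
have [T2 T21 HT2] := lapl _ e80.
have Q0 : 0 < B * (expR 1 * 4) + 1 by rewrite ltr_wpDl// !mulr_ge0// ltW.
have [T3 T31 HT3] := @sqrtV_small (e / 8 / (B * (expR 1 * 4) + 1)) ltac:(by rewrite divr_gt0).
have eta0 : 0 < s ^+ 2 by rewrite exprn_gt0.
have eta1 : s ^+ 2 <= 1 by rewrite exprn_ile1// ltW.
have Tse : 0 < T / s ^+ 2 by rewrite divr_gt0//; clear -T1; lra.
exists (T / s ^+ 2 + T2 + T3 + 1); first by clear -Tse T21 T31; lra.
move=> u hu.
have u1 : 1 <= u by clear -hu Tse T21 T31; lra.
have u0 : 0 < u by clear -u1; lra.
have eu : T <= s ^+ 2 * u by rewrite mulrC -ler_pdivrMr//; clear -hu T21 T31; lra.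
have eu1 : 1 <= s ^+ 2 * u by exact: le_trans eu.
have su : 0 < Num.sqrt u by rewrite sqrtr_gt0.
have cmp := laplace_kern_le tw w01 B0 HB ep0 T1 HT eta0 eta1 eu.
have p1 : `|Int (damp u^-1 w) / Num.sqrt u - A| <= e / 8 by apply: HT2; clear -hu Tse T31; lra.
have p2 : (Num.sqrt u)^-1 <= e / 8 / (B * (expR 1 * 4) + 1) by apply: HT3; clear -hu Tse T21; lra.
have p3 : (Num.sqrt u)^-1 <= e / 8.
  apply: le_trans p2 _; rewrite ler_pdivrMr// ler_peMr//; first exact: ltW.
  by rewrite lerDr !mulr_ge0// ltW.
have p4 : B * (expR 1 * 4 / Num.sqrt u) <= e / 8.
  move: p2; rewrite ler_pdivlMr// => p2.
  have : 0 <= (Num.sqrt u)^-1 by rewrite invr_ge0 ltW.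
  clear -p2; lra.
have c1 : `|Int (damp u^-1 w) / Num.sqrt u - sqrt1w w u * (I1 u / Num.sqrt u)| <= e / 4.
  rewrite mulrA -mulrBl normrM (@ger0_norm _ (Num.sqrt u)^-1) ?invr_ge0 ?(ltW su)// ler_pdivrMr//.
  rewrite (_ : e / 4 = 2 * (e / 8)); last by clear; field.
  apply: (laplace_error_arith (ltW E0) B0 (ltW ep0) _ (ltW su) (I1_le u1) _ _ cmp sK epK).
  - by rewrite subr_ge0 (le_trans (ln_le0 eta1)).
  - apply: le_trans (I1_le _) _; first by clear -u1; lra.
    rewrite ler_wpM2l ?mulr_ge0 ?expR_ge0// sqrtrM// ler_wpM2r ?sqrtr_ge0//.
    by rewrite -[leRHS]ger0_norm// -sqrtr_sqr ler_wsqrtr//; rewrite expr2; clear; lra.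
  - apply: le_trans (I1_le eu1) _.
    by rewrite sqrtrM ?(ltW eta0)// sqrtr_sqr ger0_norm// ltW.
have c2 : `|sqrt1w w u * (I1 u / Num.sqrt u) - sqrt1w w u * Num.sqrt pi| <= e / 8.
  rewrite -mulrBr normrM (ger0_norm (sqrt1w_ge0 w01 u)); apply: le_trans p4.
  by apply: ler_pM => //; [exact: sqrt1w_ge0|apply: HB; exact: ltW|exact: I1_asymp].
have c3 : `|sqrt1w w u * Num.sqrt pi - A| <= e / 2.
  rewrite distrC in c1; rewrite distrC in c2.
  by apply: le_trans (dist_tri c2 (dist_tri c1 p1)) _; clear; lra.
have sp1 : 1 <= Num.sqrt pi :> R.
  rewrite -[leLHS]sqrtr1 ler_wsqrtr//; have := pi_ge2 R; clear; lra.
have sp0 : 0 < Num.sqrt pi :> R by exact: lt_le_trans sp1.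
have c4 : `|sqrt1w w u - A / Num.sqrt pi| <= e / 2.
  have -> : sqrt1w w u - A / Num.sqrt pi = (sqrt1w w u * Num.sqrt pi - A) / Num.sqrt pi by rewrite mulrBl mulfK// gt_eqF.
  rewrite normrM (@ger0_norm _ (Num.sqrt pi)^-1) ?invr_ge0 ?sqrtr_ge0// ler_pdivrMr//.
  apply: le_trans c3 _; rewrite ler_peMr//; clear -e0; lra.
have c5 := sqrt1w_near w01 u0.
rewrite distrC in c5.
apply: le_trans (dist_tri c5 c4) _; clear -p3 e0; lra.
Qed.

End Tauberian.

(** * Undoing one smoothing by monotonicity *)

Section Desmoothing.
Variable R : realType.

Lemma Int_indic_itvoc (a b : R) : a <= b -> lint (\1_`]a, b] : R -> R) /\ Int (\1_`]a, b]) = b - a.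
Proof.
move=> ab; have mi : measurable (`]a, b]%classic : set R) by exact: measurable_itv.
have E : (\int[@lebesgue_measure R]_x (\1_`]a, b] x)%:E = (b - a)%:E)%E.
  rewrite integral_indic// setIT.
  transitivity (lebesgue_measure (`]a, b]%classic : set R)); first by [].
  rewrite lebesgue_measure_itv /= lte_fin.
  case: ltP => [_|ba]; first by rewrite -EFinB.
  by congr EFin; apply/eqP; rewrite eq_sym subr_eq0 eq_le ba.
split; last exact: Int_eq_of.
apply: lint_ge0; first exact: measurable_indic.
  by move=> x; rewrite indicE.
by rewrite E ltry.
Qed.

Lemma expR_upper (h : R) : 0 <= h -> h <= 2^-1 -> expR h <= 1 + h + 2 * h ^+ 2.
Proof.
move=> h0 h1; have e0 := expR_gt0 h.
have e1 : (1 - h) * expR h <= 1.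
  have := ler_wpM2r (ltW e0) (expR_ge1Dx (- h)).
  by rewrite -expRD addNr expR0.
have h2 : 1 <= (1 - h) * (1 + h + 2 * h ^+ 2).
  have : 0 <= h ^+ 2 * (1 - 2 * h) by rewrite mulr_ge0 ?sqr_ge0//; lra.
  by rewrite !exprS expr0; lra.
have p : 0 < 1 - h by lra.
by rewrite -(ler_pM2l p) (le_trans e1).
Qed.

Lemma expRN_upper (h : R) : 0 <= h -> expR (- h) <= 1 - h + h ^+ 2.
Proof.
move=> h0; have e0 := expR_gt0 (- h).
have e1 : (1 + h) * expR (- h) <= 1.
  have := ler_wpM2r (ltW e0) (expR_ge1Dx h).
  by rewrite -expRD subrr expR0.
have h2 : 1 <= (1 + h) * (1 - h + h ^+ 2).
  have : 0 <= h ^+ 3 by rewrite exprn_ge0.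
  by rewrite !exprS expr0; lra.
have p : 0 < 1 + h by lra.
by rewrite -(ler_pM2l p) (le_trans e1).
Qed.

(** Here [S] and [S'] are the smoother function at v and v + h, [s] the rougher one at v, and [q] is
    sqrt v. Expanding exp h costs a term in h K, dividing the difference by the step a term in d /
    h. *)
Lemma desmooth_upper_arith (K d h s S S' q : R) : 0 <= K -> 0 <= d -> 0 < h -> h <= 2^-1 ->
  h * s <= expR h * S' - S -> q * S' <= K + d -> K - d <= q * S -> 0 <= q ->
  q * s <= K + 2 * h * K + 4 * d / h.
Proof.
move=> K0 d0 h0 h1 H H1 H2 q0.
have eu := expR_upper (ltW h0) h1.
have e3 : expR h <= 2 by apply: le_trans eu _; rewrite expr2; nra.
have a1 := ler_wpM2l q0 H.
have a2 := ler_wpM2l (expR_ge0 h) H1.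
have a3 : K * expR h <= K * (1 + h + 2 * h ^+ 2) by rewrite ler_wpM2l.
have a4 : d * expR h <= d * 2 by rewrite ler_wpM2l.
have : h * (q * s) <= h * (K + 2 * h * K + 4 * d / h).
  have -> : h * (K + 2 * h * K + 4 * d / h) = h * K + 2 * h ^+ 2 * K + 4 * d by field; rewrite gt_eqF.
  by clear -a1 a2 a3 a4 H1 H2 d0; lra.
by rewrite ler_pM2l.
Qed.

(** The mirror estimate on [v - h, v]: [q'] is sqrt (v - h), and [y = (v - h)^-1] measures by how
    much sqrt v can exceed it. *)
Lemma desmooth_lower_arith (K d h s S S' q q' y : R) : 0 <= K -> 0 <= d -> 0 < h ->
  S - expR (- h) * S' <= h * s -> q' * S' <= K + d -> K - d <= q * S -> 0 <= q -> 0 <= S' ->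
  q <= (1 + h * y) * q' -> 0 <= y ->
  K - h * K - 2 * d / h - y * (K + d) <= q * s.
Proof.
move=> K0 d0 h0 H H1 H2 q0 S0 qq y0.
have eu := expRN_upper (ltW h0).
have e1 : expR (- h) <= 1 by rewrite -[leRHS]expR0 ler_expR oppr_le0 ltW.
have a1 := ler_wpM2l q0 H.
have a2 : q * S' <= (1 + h * y) * (K + d).
  apply: le_trans (ler_wpM2r S0 qq) _; by rewrite -mulrA ler_wpM2l// addr_ge0// mulr_ge0// ltW.
have a3 := ler_wpM2l (expR_ge0 (- h)) a2.
have Kd : 0 <= K + d by rewrite addr_ge0.
have a4 : K * expR (- h) <= K * (1 - h + h ^+ 2) by rewrite ler_wpM2l.
have a5 : d * expR (- h) <= d by rewrite ler_piMr.
have a6 : h * y * (K + d) * expR (- h) <= h * y * (K + d).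
  by rewrite ler_piMr// mulr_ge0// mulr_ge0// ltW.
have : h * (K - h * K - 2 * d / h - y * (K + d)) <= h * (q * s).
  have -> : h * (K - h * K - 2 * d / h - y * (K + d)) = h * K - h ^+ 2 * K - 2 * d - h * y * (K + d).
    by field; rewrite gt_eqF.
  by clear -a1 a3 a4 a5 a6 H2; lra.
by rewrite ler_pM2l.
Qed.

Section Step.
Variable m : R -> R.
Hypothesis tm : tempered m.
Hypothesis m01 : forall v, 0 <= m v <= 1.
Hypothesis mono : forall s t : R, s <= t -> expR s * m s <= expR t * m t.

(** In the application [expR s * m s] is the counting function; smoothing replaces it by an average
    of translates with positive weights, which stays nondecreasing. *)
Lemma sm_mono j s t : s <= t -> expR s * sm m j s <= expR t * sm m j t.
Proof.
elim: j s t => [|j IH] s t st /=; first exact: mono.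
have tj := tempered_sm j tm.
have E (w : R) : cnv (sm m j) (@gam R) w = Int (fun u => gam u * sm m j (w - u)).
  by rewrite (cnvC tj (@tempered_gam R)).
have L (w : R) : lint (fun u => gam u * sm m j (w - u)).
  by apply: lint_cnv => //; exact: tempered_gam.
rewrite !E -!IntZ//; apply: Int_le; try exact: lintZ.
move=> u; rewrite !(mulrCA (expR _)) ler_wpM2l ?gam_ge0//.
have := IH (s - u) (t - u) ltac:(lra).
move=> H; have := ler_wpM2l (expR_ge0 u) H.
by rewrite !mulrA -!expRD !subrKC.
Qed.

(** [expR v * sm m j.+1 v] has derivative [expR v * sm m j v], which is nondecreasing; its integral
    over a step of length [h] lies between the endpoint values times [h]. *)
Lemma sm_step j (v h : R) : 0 <= h ->
  h * (expR v * sm m j v) <= expR (v + h) * sm m j.+1 (v + h) - expR v * sm m j.+1 v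
  <= h * (expR (v + h) * sm m j (v + h)).
Proof.
move=> h0; have tj := tempered_sm j tm.
have s01 := sm_bounds tm m01 j.
have L (w : R) : lint (fun u => expR w * (sm m j u * gam (w - u))).
  by apply: lintZ; apply: lint_cnv => //; exact: tempered_gam.
have L' (w : R) : lint (fun u => sm m j u * gam (w - u)).
  by apply: lint_cnv => //; exact: tempered_gam.
rewrite /= /cnv -!IntZ// -IntB//.
have vh : v <= v + h by rewrite lerDl.
have [li Ii] := Int_indic_itvoc vh.
have Ih : h = Int (\1_`]v, v + h] : R -> R) by rewrite Ii; ring.
have E u : expR (v + h) * (sm m j u * gam (v + h - u)) - expR v * (sm m j u * gam (v - u))
    = expR u * sm m j u * \1_`]v, v + h] u.
  rewrite /gam /half !subr_ge0 !mul1r !opprB indicE.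
  have e (w : R) : expR w * (sm m j u * expR (u - w)) = expR u * sm m j u.
    by rewrite mulrCA -expRD subrKC mulrC.
  case: (leP u v) => uv.
    by rewrite (le_trans uv vh) memNset ?e ?subrr ?mulr0//= in_itv/= ltNge uv.
  case: (leP u (v + h)) => uh.
    by rewrite mem_set ?e ?mulr0 ?subr0 ?mulr1//= in_itv/= uv.
  by rewrite memNset ?mulr0 ?subr0//= in_itv/= leNgt uh andbF.
have LE : lint (fun u => expR u * sm m j u * \1_`]v, v + h] u : R).
  by apply: eq_lint (lintB (L (v + h)) (L v)) => u; rewrite E.
have K (k : R) : h * k = Int (fun u => k * \1_`]v, v + h] u) by rewrite (IntZ k li) -Ih mulrC.
rewrite (eq_Int E) !K.
apply/andP; split; apply: Int_le => //; try exact: lintZ.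
  move=> u; rewrite indicE; case: (boolP (u \in _)); last by rewrite !mulr0.
  by rewrite inE /= in_itv /= => /andP[vu uh]; rewrite !mulr1; apply: sm_mono; exact: ltW.
move=> u; rewrite indicE; case: (boolP (u \in _)); last by rewrite !mulr0.
by rewrite inE /= in_itv /= => /andP[vu uh]; rewrite !mulr1; apply: sm_mono.
Qed.

End Step.

(** The errors are of order h K and d / h, so [h] is fixed of size ep / (K + 1) before the accuracy
    [d] of size ep h. *)
Lemma desmooth (m : R -> R) j (K : R) : tempered m -> (forall v, 0 <= m v <= 1) ->
  (forall s t : R, s <= t -> expR s * m s <= expR t * m t) -> 0 <= K -> tendsto (fun v => Num.sqrt v * sm m j.+1 v) K ->
  tendsto (fun v => Num.sqrt v * sm m j v) K.
Proof.
move=> tm m01 mono K0 H ep ep0.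
have K1 : 0 < K + 1 by lra.
pose h := Num.min 2^-1 (ep / (8 * (K + 1))).
have h0 : 0 < h by rewrite lt_min invr_gt0 ltr0n divr_gt0// mulr_gt0.
have h2 : h <= 2^-1 by rewrite ge_min lexx.
have hK : 8 * (h * (K + 1)) <= ep.
  have : h <= ep / (8 * (K + 1)) by rewrite ge_min lexx orbT.
  by rewrite ler_pdivlMr ?mulr_gt0//; clear; lra.
pose d := Num.min 1 (ep * h / 16).
have d0 : 0 < d by rewrite lt_min ltr01 divr_gt0// mulr_gt0.
have d1 : d <= 1 by rewrite ge_min lexx.
have dh : 16 * (d / h) <= ep.
  have : d <= ep * h / 16 by rewrite ge_min lexx orbT.
  by move=> dd; rewrite mulrA ler_pdivrMr//; clear -dd; lra.
clearbody h d.
have [T T1 HT] := H d d0.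
have y00 : 0 < 4 * (K + 1) / ep by rewrite divr_gt0// mulr_gt0.
(* The last summand makes the passage from sqrt v to sqrt (v - h) cost at most [ep / 4]. *)
exists (T + 1 + 4 * (K + 1) / ep); first by clear -T1 y00; lra.
move=> v Tv.
have v0 : 0 < v by clear -T1 y00 Tv; lra.
have vh0 : 0 < v - h by clear -T1 y00 Tv h2; lra.
have B := sm_bounds tm m01.
have [s1 _] := andP (@sm_step m tm m01 mono j v h (ltW h0)).
have [_ s2] := andP (@sm_step m tm m01 mono j (v - h) h (ltW h0)).
rewrite subrK in s2.
have e0 := expR_gt0 v.
have u1 : h * sm m j v <= expR h * sm m j.+1 (v + h) - sm m j.+1 v.
  by rewrite -(ler_pM2l e0) mulrBr !mulrA -expRD -(mulrA (expR v)) mulrCA mulrA -mulrA.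
have u2 : sm m j.+1 v - expR (- h) * sm m j.+1 (v - h) <= h * sm m j v.
  by rewrite -(ler_pM2l e0) mulrBr !mulrA -expRD -(mulrA (expR v) h) [X in _ <= X]mulrCA.
have p1 := HT v ltac:(by clear -Tv y00; lra).
have p2 := HT (v + h) ltac:(by clear -Tv y00 h0; lra).
have p3 := HT (v - h) ltac:(by clear -Tv y00 h2; lra).
have {}p1 := ler_distlCBl p1; have {}p2 := ler_distlDr p2; have {}p3 := ler_distlDr p3.
have q1 : Num.sqrt v * sm m j.+1 (v + h) <= K + d.
  apply: le_trans p2; rewrite ler_wpM2r//; first by have /andP[] := B j.+1 (v + h).
  by rewrite ler_wsqrtr// lerDl ltW.
have U := desmooth_upper_arith K0 (ltW d0) h0 h2 u1 q1 p1 (sqrtr_ge0 _).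
have y0 : 0 < (v - h)^-1 by rewrite invr_gt0.
have q2 : Num.sqrt v <= (1 + h * (v - h)^-1) * Num.sqrt (v - h).
  have r0 : 1 <= 1 + h * (v - h)^-1 by rewrite lerDl mulr_ge0// ltW.
  have r1 : 0 <= 1 + h * (v - h)^-1 by exact: le_trans r0.
  rewrite -[X in X * _](ger0_norm r1) -sqrtr_sqr -sqrtrM ?sqr_ge0// ler_wsqrtr//.
  have -> : v = (1 + h * (v - h)^-1) * (v - h) by field; rewrite gt_eqF.
  rewrite [in leRHS]mulrDl.
  have E : 1 * (v - h) + h * (v - h)^-1 * (v - h) - h = v - h by field; rewrite gt_eqF.
  rewrite -mulrDl.
  have E' : (1 + h * (v - h)^-1) * (v - h) - h = v - h by field; rewrite gt_eqF.
  rewrite E' ler_wpM2r ?(ltW vh0)// expr2 ler_peMr//.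
have S0 : 0 <= sm m j.+1 (v - h) by have /andP[] := B j.+1 (v - h).
have L := desmooth_lower_arith K0 (ltW d0) h0 u2 p3 p1 (sqrtr_ge0 _) S0 q2 (ltW y0).
have yK : (v - h)^-1 * (K + d) <= ep / 4.
  apply: (@le_trans _ _ ((v - h)^-1 * (K + 1))); first by rewrite ler_pM2l//; clear -d1; lra.
  rewrite ler_pdivrMl// -ler_pdivrMr; last by clear -ep0; lra.
  rewrite (_ : (K + 1) / (ep / 4) = 4 * (K + 1) / ep); first by clear -Tv T1 h2; lra.
  by field; rewrite gt_eqF.
have hK' : 8 * (h * K) <= ep by clear -hK h0; lra.
rewrite ler_distl; apply/andP; split.
  by apply: le_trans L; clear -dh hK' yK ep0; lra.
by apply: le_trans U _; clear -dh hK' ep0; lra.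
Qed.

End Desmoothing.

(** * The limit deduced from the convolution square *)

Section LandauFromSquare.
Variable R : realType.
Variables (m rho : R -> R) (c C kappa : R).
Hypothesis tm : tempered m.
Hypothesis m01 : forall v, 0 <= m v <= 1.
Hypothesis c0 : 0 < c.
Hypothesis trho : tempered rho.
Hypothesis C0 : 0 <= C.
Hypothesis rhoC : forall v, `|rho v| <= C * half (fun v => expR (- (4^-1 * v))) v.
Hypothesis mm : forall w, cnv m m w = c * heav w + rho w.

Lemma Int_damp_rho (d : R) : 0 < d -> `|Int (damp d rho)| <= 4 * C.
Proof.
move=> d0; have [h1 h2] := @half_exp R 4^-1 ltac:(by rewrite invr_gt0).
rewrite invrK in h2; rewrite mulrC -h2 -(IntZ C h1).
have [mr _ _] := trho.
apply: Int_abs_le; [exact: measurable_damp| |exact: lintZ].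
move=> x; rewrite /damp normrM.
have [x0|x0] := ltP x 0.
  have [_ z _] := trho; rewrite z// normr0 mul0r.
  by apply: mulr_ge0 => //; rewrite /half; case: ifP => // _; exact: expR_ge0.
rewrite -[leRHS]mulr1; apply: ler_pM => //.
by rewrite ger0_norm ?expR_ge0// -[leRHS]expR0 ler_expR oppr_le0 mulr_ge0// ltW.
Qed.

Lemma Lt0 (a : R -> R) (d : R) : tempered a -> 0 < d -> Lt a d 0 = (Int (damp d a))%:C%C.
Proof.
move=> ta d0; rewrite /Lt; apply/eqP; rewrite eq_complex /=; apply/andP; split; apply/eqP.
  by apply: eq_Int => v; rewrite mul0r cos0 mulr1.
by rewrite (eq_Int (g := fun=> 0)) ?Int0 ?oppr0// => v; rewrite mul0r sin0 mulr0.
Qed.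

(** At [y = 0] all transforms are real, so the complex identities specialise to this real one. *)
Lemma Int_damp_sm_sqr j (d : R) : 0 < d ->
  Int (damp d (sm m j)) ^+ 2 = (c / d + Int (damp d rho)) / (1 + d) ^+ (2 * j).
Proof.
move=> d0.
have e1 : (Int (damp d (sm m j)))%:C%C = (Int (damp d m))%:C%C * (((1 + d) +i* 0)%C^-1) ^+ j.
  by rewrite -!Lt0// ?Lt_sm//; exact: tempered_sm.
have e2 : (Int (damp d m))%:C%C ^+ 2 = (c / d + Int (damp d rho))%:C%C.
  rewrite expr2 -!Lt0// -Lt_cnv//.
  have tch : tempered (fun v => c * heav v) by apply/temperedZ/tempered_heav.
  have th := tempered_heav R.
  rewrite (eq_Lt _ _ mm) Lt_D// (Lt_Z _ _ th)// (Lt0 trho)//.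
  by rewrite Lt_half_exp// add0r rmorphD rmorphM fmorphV.
have e3 : ((1 + d) +i* 0)%C = (1 + d)%:C%C by [].
have e4 : (Int (damp d (sm m j)) ^+ 2)%:C%C = ((c / d + Int (damp d rho)) / (1 + d) ^+ (2 * j))%:C%C.
  rewrite rmorphXn /= e1 exprMn e2 e3 -exprM -exprVn rmorphM; congr (_ * _).
  by rewrite rmorphXn fmorphV mulnC.
by have := congr1 (@complex.Re R) e4.
Qed.

(** On the real axis the square root is unambiguous: the transform of a nonnegative function is
    nonnegative, and [|Y - sqrt c| * sqrt c <= |Y ^+ 2 - c|]. *)
Lemma laplace_sm j : tendsto (fun u => Int (damp u^-1 (sm m j)) / Num.sqrt u) (Num.sqrt c).
Proof.
move=> ep ep0.
have sc : 0 < Num.sqrt c by rewrite sqrtr_gt0.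
have tsm := tempered_sm j tm.
pose K := (4 * C + c * (2 * j)%:R).
have K0 : 0 <= K by rewrite addr_ge0// mulr_ge0// ltW.
have Ks : 0 <= K / (ep * Num.sqrt c) by rewrite divr_ge0// mulr_ge0// ltW.
exists (1 + K / (ep * Num.sqrt c)); first by rewrite lerDl.
move=> u hu.
have u1 : 1 <= u by lra.
have u0 : 0 < u by lra.
have d0 : 0 < u^-1 by rewrite invr_gt0.
have sq := Int_damp_sm_sqr j d0.
have hr := Int_damp_rho d0.
set X := Int (damp u^-1 (sm m j)) in sq *.
set r := Int (damp u^-1 rho) in sq hr.
have X0 : 0 <= X.
  apply: Int_ge0 => v; rewrite /damp mulr_ge0 ?expR_ge0//.
  by have /andP[] := sm_bounds tm m01 j v.
have su : 0 < Num.sqrt u by rewrite sqrtr_gt0.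
set Y := X / Num.sqrt u.
have Y0 : 0 <= Y by rewrite divr_ge0// ltW.
have Y2 : Y ^+ 2 = (c + r / u) / (1 + u^-1) ^+ (2 * j).
  rewrite expr_div_n sq sqr_sqrtr ?(ltW u0)// invrK; field.
  by rewrite !gt_eqF ?exprn_gt0//; lra.
pose q := (1 + u^-1) ^- (2 * j).
have q1 : q <= 1 by rewrite invf_le1 ?exprn_gt0 ?exprn_ege1//; lra.
have q2 : 1 - (2 * j)%:R / u <= q.
  have H (n : nat) : 1 - n%:R / u <= (1 + u^-1) ^- n.
    elim: n => [|n IH]; first by rewrite mul0r subr0 expr0 invr1.
    have p0 : 0 < (1 + u^-1) ^- n by rewrite invr_gt0 exprn_gt0//; lra.
    have p1 : (1 + u^-1) ^- n <= 1 by rewrite invf_le1 ?exprn_gt0 ?exprn_ege1//; lra.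
    rewrite exprS invfM.
    have : 1 - u^-1 <= (1 + u^-1)^-1 by rewrite -[leRHS]mul1r ler_pdivlMr; [nra|lra].
    move=> h; have := ler_wpM2r (ltW p0) h.
    have : (1 + u^-1) ^- n * u^-1 <= u^-1 by rewrite ler_piMl// ltW.
    rewrite -[n.+1]addn1 natrD; lra.
  exact: H.
have Yc : `|Y ^+ 2 - c| <= K / u.
  rewrite Y2 -/q.
  have -> : (c + r / u) / (1 + u^-1) ^+ (2 * j) - c = r / u * q - c * (1 - q) by rewrite /q; ring.
  have q0 : 0 <= q by rewrite invr_ge0 exprn_ge0//; lra.
  apply: le_trans (ler_normB _ _) _.
  rewrite /K mulrDl; apply: lerD.
    rewrite normrM (ger0_norm q0) normrM (@ger0_norm _ u^-1) ?(ltW d0)//.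
    by rewrite -[leRHS]mulr1 ler_pM// ?mulr_ge0// ?(ltW d0)// ler_wpM2r// ltW.
  rewrite normrM (ger0_norm (ltW c0)) ger0_norm; last lra.
  by rewrite -mulrA ler_wpM2l ?(ltW c0)//; lra.
have Ysum : (Y - Num.sqrt c) * (Y + Num.sqrt c) = Y ^+ 2 - c.
  by rewrite -{3}(sqr_sqrtr (ltW c0)); ring.
have : `|Y - Num.sqrt c| * Num.sqrt c <= K / u.
  apply: le_trans Yc; rewrite -Ysum normrM ler_wpM2l//.
  by rewrite ger0_norm; lra.
move=> h; rewrite -(ler_pM2r sc); apply: le_trans h _.
rewrite ler_pdivrMr// mulrC -ler_pdivrMr ?mulr_gt0//; lra.
Qed.

Hypothesis kappa0 : 0 < kappa.
Hypothesis k341 : forall d y, 0 < d -> d <= 1 ->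
  kappa <= sqn (((1 + d) +i* 0)%C * Lt m d 0) ^+ 3 * sqn (((1 + d) +i* y)%C * Lt m d y) ^+ 4
    * sqn (((1 + d) +i* (2 * y))%C * Lt m d (2 * y)).

Lemma sm_asymp : tendsto (fun v => Num.sqrt v * sm m 7 v) (Num.sqrt (c / pi)).
Proof.
have -> : Num.sqrt (c / pi) = Num.sqrt c / Num.sqrt pi.
  by rewrite sqrtrM ?(ltW c0)// sqrtrV// pi_ge0.
apply: tauberian; [exact: tempered_sm|exact: sm_bounds| |exact: laplace_sm].
have [D D0 [d1 d10 HD]] := efun_energy tm m01 c0 trho C0 rhoC mm kappa0 k341.
have c6 := @continuous_sm _ m 5 tm m01; have c7 := @continuous_sm _ m 6 tm m01.
have ce : continuous (efun m).
  have cv : continuous (fun v : R => v) by move=> x; exact: cvg_id.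
  have h6 : continuous (Vm (sm m 6)) by move=> x; apply: (cvgM (cv x) (c6 x)).
  have h7 : continuous (Vm (sm m 7)) by move=> x; apply: (cvgM (cv x) (c7 x)).
  move=> x; apply: (cvgD (cvgD (h6 x) (cvgM (cvg_cst _) (h7 x))) (cvgM (cvg_cst _) (c7 x))).
have E := energy_itv ce D0 d10 HD.
apply: (@slow_variation _ (sm m 7) (sm m 6) (expR 2 * D)) => //.
- by move=> v v0; exact: is_derive_sm.
- move=> v v0; apply: le_trans (E v v0); rewrite le_eqVlt; apply/orP; left; apply/eqP.
  by apply: eq_Rintegral => t _; rewrite /efun /Vm; move: (sm m 6 t) (sm m 7 t) => a b; rewrite mulN1r mulrBr.
Qed.

End LandauFromSquare.

Theorem landau_of_square (R : realType) (m rho : R -> R) (c C kappa : R) :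
  tempered m -> (forall v, 0 <= m v <= 1) -> 0 < c -> tempered rho -> 0 <= C ->
  (forall v, `|rho v| <= C * half (fun v => expR (- (4^-1 * v))) v) ->
  (forall w, cnv m m w = c * heav w + rho w) -> 0 < kappa ->
  (forall d y, 0 < d -> d <= 1 ->
    kappa <= sqn (((1 + d) +i* 0)%C * Lt m d 0) ^+ 3 * sqn (((1 + d) +i* y)%C * Lt m d y) ^+ 4
      * sqn (((1 + d) +i* (2 * y))%C * Lt m d (2 * y))) ->
  (forall s t : R, s <= t -> expR s * m s <= expR t * m t) ->
  tendsto (fun v => Num.sqrt v * m v) (Num.sqrt (c / pi)).
Proof.
move=> tm m01 c0 tr C0 rC mm k0 k341 mono.
have := sm_asymp tm m01 c0 tr C0 rC mm k0 k341.
by do 7!move/(desmooth tm m01 mono (sqrtr_ge0 _)).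
Qed.

(** * Sums of two squares *)

Section TwoSquares.

Definition is_sumsq (n : nat) := exists x y : int, n%:Z = x ^+ 2 + y ^+ 2.

Lemma Fp_int_eq0 p (x : int) : prime p -> (x%:~R == 0 :> 'F_p) = (p %| x)%Z.
Proof. by move=> pp; rewrite (dvdz_pcharf (pchar_Fp pp)). Qed.

Lemma Fp_expf p (x : 'F_p) : prime p -> x != 0 -> x ^+ p.-1 = 1.
Proof.
move=> pp x0; apply: (mulfI x0); rewrite -exprS prednK ?prime_gt0// mulr1.
transitivity (x ^+ #|'F_p|); last exact: finfield.expf_card.
by congr (x ^+ _); rewrite card_Fp.
Qed.

(** With p - 1 = 4 k, the polynomial X^(2 k) - 1 has too few roots to vanish on all units; a unit
    [x] with [x ^+ (2 * k) != 1] has [x ^+ (2 * k) = -1]. *)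
Lemma sqrt_minus1 p : prime p -> (p %% 4 = 1)%N -> exists r : 'F_p, r ^+ 2 = -1.
Proof.
move=> pp p4; have p1 := prime_gt1 pp.
pose k := (p %/ 4)%N.
have pk : p.-1 = (4 * k)%N by rewrite {1}(divn_eq p 4) p4 addn1 mulnC.
have k0 : (0 < k)%N by case: k pk => // e; move: pp p1; rewrite muln0 in e; lia.
have [/forallP H|] := boolP [forall x : 'F_p, (x == 0) || (x ^+ (2 * k) == 1)].
  have pn0 : ('X^(2 * k) - 1 : {poly 'F_p}) != 0.
    by rewrite -size_poly_eq0 size_XnsubC// muln_gt0.
  have ar : all (root ('X^(2 * k) - 1)) [seq x <- enum 'F_p | x != 0].
    apply/allP => x; rewrite mem_filter => /andP[x0 _].
    by have := H x; rewrite (negbTE x0) /= rootE !hornerE subr_eq0.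
  have := max_poly_roots pn0 ar (filter_uniq _ (enum_uniq _)).
  rewrite size_XnsubC ?muln_gt0// ltnS.
  have -> : size [seq x <- enum 'F_p | x != 0] = p.-1.
    rewrite -(card_uniqP (filter_uniq _ (enum_uniq _))) -[in RHS](card_Fp pp) -(cardC1 (0 : 'F_p)).
    by apply: eq_card => x; rewrite mem_filter mem_enum andbT.
  by rewrite pk; move: k0; clear; lia.
rewrite negb_forall => /existsP[x]; rewrite negb_or => /andP[x0 x2].
exists (x ^+ k); have := Fp_expf pp x0; rewrite pk => x4.
have : (x ^+ (2 * k) - 1) * (x ^+ (2 * k) + 1) = 0.
  by rewrite -subr_sqr expr1n -exprM (_ : 2 * k * 2 = 4 * k)%N ?x4 ?subrr//; lia.
move/eqP; rewrite mulf_eq0 subr_eq0 (negbTE x2) /= addr_eq0 => /eqP <-.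
by rewrite -exprM mulnC.
Qed.

(** Otherwise b / a squares to -1 in the field, and raising this to the odd power (p - 1) / 2
    contradicts Fermat's little theorem. *)
Lemma dvd_sumsq_3mod4 p (x y : int) : prime p -> (p %% 4 = 3)%N ->
  (p %| x ^+ 2 + y ^+ 2)%Z -> (p %| x)%Z.
Proof.
move=> pp p4; rewrite -!Fp_int_eq0// rmorphD !rmorphXn /=.
move: (x%:~R) (y%:~R) => a b e; apply/negPn/negP => a0.
have e1 : (b / a) ^+ 2 = -1.
  rewrite expr_div_n; apply/eqP; rewrite -subr_eq0 opprK.
  by rewrite -(divff (expf_neq0 2 a0)) -mulrDl mulf_eq0 addrC e.
have b0 : b / a != 0.
  by apply/eqP => e0; move: e1; rewrite e0 expr0n => /eqP; rewrite eq_sym oppr_eq0 oner_eq0.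
have pk : p.-1 = (2 * (2 * (p %/ 4)).+1)%N by rewrite {1}(divn_eq p 4) p4; lia.
have := Fp_expf pp b0; rewrite pk exprM e1 -signr_odd /= oddM /= expr1 => h.
have p2 : p != 2%N by apply/eqP => e2; rewrite e2 in p4.
have : (2%:R : 'F_p) == 0.
  by rewrite -[2%:R]/(1 + 1) -{1}h addNr.
rewrite -(dvdn_pcharf (pchar_Fp pp)) dvdn_prime2//.
by rewrite (negbTE p2).
Qed.

Lemma prime_not_square p k : prime p -> (k * k)%N != p.
Proof.
move=> pp; apply/eqP => e; have : (k %| p)%N by rewrite -e dvdn_mulr.
case/primeP: pp => p1 H /H /orP[/eqP k1|/eqP kp]; first by move: p1; rewrite -e k1.
by move: e p1; rewrite kp; nia.
Qed.

(* Thue: among the pairs (u, v) below sqrt p two agree on [u + r v] mod p *)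
Lemma fermat_two_squares p : prime p -> (p %% 4 = 1)%N -> exists a b : int, p%:Z = a ^+ 2 + b ^+ 2.
Proof.
move=> pp p4; have [r r2] := sqrt_minus1 pp p4.
have [k k1 k2] : exists2 k, (k * k < p)%N & (p < k.+1 * k.+1)%N.
  have ex : exists k, (k * k < p)%N by exists 0%N; rewrite muln0 prime_gt0.
  have ub k : (k * k < p)%N -> (k <= p)%N by nia.
  case: (ex_maxnP ex ub) => k k1 kM; exists k => //.
  rewrite ltn_neqAle eq_sym prime_not_square//= leqNgt; apply/negP => /kM; lia.
pose h (z : 'I_k.+1 * 'I_k.+1) : 'F_p := (z.1 : nat)%:R + r * (z.2 : nat)%:R.
have : ~~ injectiveb h.
  apply/negP => /injectiveP /leq_card; rewrite card_prod card_ord card_Fp//; lia.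
case/injectivePn => -[u v] [[u' v'] ne e].
pose a : int := (u : nat)%:Z - (u' : nat)%:Z; pose b : int := (v : nat)%:Z - (v' : nat)%:Z.
have ab : a%:~R = - (r * b%:~R) :> 'F_p.
  move: e; rewrite /h /a /b /= !rmorphB /= -!pmulrn => e.
  apply/eqP; rewrite -addr_eq0; apply/eqP.
  transitivity ((u%:R + r * v%:R) - (u'%:R + r * v'%:R) : 'F_p); first by ring.
  by rewrite e subrr.
have : (p %| a ^+ 2 + b ^+ 2)%Z.
  rewrite -Fp_int_eq0// rmorphD !rmorphXn /= ab sqrrN exprMn r2 mulN1r addNr//.
case/dvdzP => c hc.
have ulk := ltn_ord u; have vlk := ltn_ord v; have ulk' := ltn_ord u'; have vlk' := ltn_ord v'.
have a2 : a ^+ 2 <= (k * k)%:Z by rewrite /a expr2; nia.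
have b2 : b ^+ 2 <= (k * k)%:Z by rewrite /b expr2; nia.
have ab0 : 0 < a ^+ 2 + b ^+ 2.
  rewrite lt_def addr_ge0 ?sqr_ge0// andbT paddr_eq0 ?sqr_ge0// !sqrf_eq0.
  apply: contra ne; rewrite /a /b !subr_eq0 !eqz_nat => /andP[/eqP e1 /eqP e2].
  by apply/eqP; congr pair; apply: val_inj.
exists a, b; rewrite hc.
have p0 := prime_gt0 pp.
have : c = 1 by nia.
by move->; rewrite mul1r.
Qed.

Lemma sumsq_double n : is_sumsq (2 * n) <-> is_sumsq n.
Proof.
split=> [[x [y e]]|[x [y e]]]; last first.
  by exists (x + y), (x - y); rewrite PoszM e; ring.
have [c [d [ex ey]]] : exists c d : int, x + y = 2 * c /\ x - y = 2 * d.
  have [c hc] : exists c : int, x + y = 2 * c.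
    have : (2 %| (x + y) ^+ 2)%Z.
      apply/dvdzP; exists (n%:Z + x * y); rewrite PoszM in e; nia.
    rewrite -Fp_int_eq0// rmorphXn sqrf_eq0 /= Fp_int_eq0// => /dvdzP[c ->].
    by exists c; rewrite mulrC.
  by exists c, (c - y); split=> //; lia.
exists c, d; rewrite PoszM in e; nia.
Qed.

Lemma sumsq_mul p n : is_sumsq p -> is_sumsq n -> is_sumsq (p * n).
Proof.
move=> [a [b e]] [x [y e']]; exists (a * x - b * y), (a * y + b * x).
by rewrite PoszM e e'; ring.
Qed.

(** Descent with p = a^2 + b^2: [p] divides (a x - b y)(a x + b y), so for one sign of [b] it
    divides a x - b y, hence also a y + b x, and the quotients represent [n]. *)
Lemma sumsq_1mod4 p n : prime p -> (p %% 4 = 1)%N -> is_sumsq (p * n) <-> is_sumsq n.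
Proof.
move=> pp p4; have [a [b pab]] := fermat_two_squares pp p4.
split=> [[x [y e]]|]; last by apply: sumsq_mul; exists a, b.
have p0 := prime_gt0 pp.
have key (b' : int) : p%:Z = a ^+ 2 + b' ^+ 2 -> (p %| a * x - b' * y)%Z -> is_sumsq n.
  move=> pab' d1.
  have : (p %| (a * y + b' * x) ^+ 2)%Z.
    have -> : (a * y + b' * x) ^+ 2 = p%:Z * (p * n)%:Z - (a * x - b' * y) ^+ 2 by rewrite e pab'; ring.
    by apply: rpredB; [exact: dvdz_mulr|rewrite expr2; exact: dvdz_mulr].
  rewrite -Fp_int_eq0// rmorphXn sqrf_eq0 /= Fp_int_eq0// => d2.
  case/dvdzP: d1 => u hu; case/dvdzP: d2 => v hv; exists u, v.
  have : p%:Z ^+ 2 * n%:Z = p%:Z ^+ 2 * (u ^+ 2 + v ^+ 2).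
    transitivity ((a * x - b' * y) ^+ 2 + (a * y + b' * x) ^+ 2).
      by rewrite expr2 -mulrA -PoszM e pab'; ring.
    by rewrite hu hv; ring.
  by apply: mulfI; rewrite expf_neq0// eqz_nat -lt0n.
have : (p %| (a * x - b * y) * (a * x - (- b) * y))%Z.
  have -> : (a * x - b * y) * (a * x - (- b) * y) = p%:Z * (a ^+ 2 * n%:Z - y ^+ 2).
    transitivity (a ^+ 2 * (x ^+ 2 + y ^+ 2) - y ^+ 2 * (a ^+ 2 + b ^+ 2)); first by ring.
    by rewrite -e -pab PoszM; ring.
  exact: dvdz_mulr.
rewrite -Fp_int_eq0// rmorphM mulf_eq0 /= !Fp_int_eq0// => /orP[]; first exact: key.
by apply: key; rewrite sqrrN.
Qed.

Lemma sumsq_3mod4_dvd p n : prime p -> (p %% 4 = 3)%N -> is_sumsq (p * n) -> (p %| n)%N.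
Proof.
move=> pp p4 [x [y e]].
have d : (p %| x ^+ 2 + y ^+ 2)%Z by rewrite -e PoszM dvdz_mulr.
have /dvdzP[u hu] := dvd_sumsq_3mod4 pp p4 d.
rewrite addrC in d; have /dvdzP[v hv] := dvd_sumsq_3mod4 pp p4 d.
have p0 : p%:Z != 0 by rewrite eqz_nat -lt0n prime_gt0.
have : n%:Z = p%:Z * (u ^+ 2 + v ^+ 2).
  by apply: (mulfI p0); rewrite -PoszM e hu hv; ring.
by move=> h; rewrite -[(p %| n)%N]/(p%:Z %| n%:Z)%Z h dvdz_mulr.
Qed.

Lemma sumsq_3mod4 p n : prime p -> (p %% 4 = 3)%N -> is_sumsq (p * (p * n)) <-> is_sumsq n.
Proof.
move=> pp p4; split=> [[x [y e]]|[x [y e]]]; last first.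
  by exists (p%:Z * x), (p%:Z * y); rewrite !PoszM e; ring.
have d : (p %| x ^+ 2 + y ^+ 2)%Z by rewrite -e PoszM dvdz_mulr.
have /dvdzP[u hu] := dvd_sumsq_3mod4 pp p4 d.
rewrite addrC in d; have /dvdzP[v hv] := dvd_sumsq_3mod4 pp p4 d.
have p0 : p%:Z != 0 by rewrite eqz_nat -lt0n prime_gt0.
exists u, v; apply: (mulfI p0); apply: (mulfI p0).
by rewrite -!PoszM e hu hv; ring.
Qed.

End TwoSquares.

(** * Sieving summatory functions prime by prime *)

Section Sieve.
Variable R : realType.
Implicit Types (a h u v : nat -> R).

(** When [h] is the summatory function of b, this is the summatory function of the Dirichlet
    convolution of [a] and b; nested [sig] stand for products of Dirichlet series. *)
Definition sig a h (X : nat) : R := \sum_(1 <= i < X.+1) a i * h (X %/ i)%N.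

(* [rough N 0] holds, as [primes 0] is empty *)
Definition rough (N n : nat) : bool := all (fun q => N <= q)%N (primes n).

Definition restr (N : nat) a (n : nat) : R := a n * (rough N n)%:R.

Lemma roughP N n : reflect (forall q, prime q -> (0 < n)%N -> (q %| n)%N -> (N <= q)%N) (rough N n).
Proof.
apply: (iffP allP) => [H q pq n0 qn|H q]; first by apply: H; rewrite mem_primes pq n0.
by rewrite mem_primes => /and3P[]; exact: H.
Qed.

Lemma rough_prime p n : prime p -> (0 < n)%N -> rough p.+1 n = rough p n && ~~ (p %| n)%N.
Proof.
move=> pp n0; apply/roughP/andP => [H|[/roughP H pn] q pq _ qn].
  split; last by apply/negP => /(H p pp n0); rewrite ltnn.
  by apply/roughP => q pq _ qn; rewrite ltnW// H.
by rewrite ltn_neqAle H// andbT; apply: contra pn => /eqP ->.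
Qed.

Lemma rough_nonprime p n : ~~ prime p -> rough p.+1 n = rough p n.
Proof.
move=> pp; apply/roughP/roughP => H q pq n0 qn; first by rewrite ltnW// H.
by rewrite ltn_neqAle H// andbT; apply: contra pp => /eqP ->.
Qed.

Lemma rough_mul p n : prime p -> (0 < n)%N -> rough p (p * n) = rough p n.
Proof.
move=> pp n0; apply/roughP/roughP => H q pq q0 qn.
  by apply: H => //; [rewrite muln_gt0 prime_gt0|rewrite dvdn_mull].
by move: qn; rewrite Euclid_dvdM// dvdn_prime2// => /orP[/eqP ->//|]; exact: H.
Qed.

Lemma rough_small N n : (0 < n)%N -> (n < N)%N -> rough N n = (n == 1)%N.
Proof.
move=> n0 nN; apply/roughP/eqP => [H|-> q pq _].
  apply/eqP; rewrite eqn_leq n0 andbT leqNgt; apply/negP => /pdivP[q pq qn].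
  by have := H q pq n0 qn; rewrite leqNgt (leq_ltn_trans _ nN)// dvdn_leq.
by rewrite dvdn1 => /eqP q1; rewrite q1 in pq.
Qed.

Lemma rough2 n : rough 2 n.
Proof. by apply/roughP => q /prime_gt1. Qed.

Lemma restr2 a : restr 2 a = a.
Proof. by apply/funext => n; rewrite /restr rough2 mulr1. Qed.

Lemma sum_multiples (F : nat -> R) p X : (0 < p)%N ->
  \sum_(1 <= i < X.+1 | (p %| i)%N) F i = \sum_(1 <= i < (X %/ p).+1) F (p * i)%N.
Proof.
move=> p0; elim: X => [|X IH]; first by rewrite div0n !big_geq.
rewrite big_mkcond big_nat_recr //= -big_mkcond IH divnS//; case: ifPn => d.
  have e : X.+1 = (p * (X %/ p).+1)%N by have := divnK d; rewrite divnS// d add1n mulnC => ->.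
  by rewrite -[(true + _)%N]/((X %/ p).+1) [RHS]big_nat_recr //= -e.
by rewrite add0n addr0.
Qed.

(** On Dirichlet series this is multiplication by 1 - c p^(-s). *)
Definition lag (c : R) p u (X : nat) : R := u X - c * u (X %/ p)%N.

Lemma sig0 a h : sig a h 0%N = 0.
Proof. by rewrite /sig big_geq. Qed.

Lemma sig_split a h p X : prime p -> sig (restr p a) h X =
  sig (restr p.+1 a) h X + \sum_(1 <= i < (X %/ p).+1) restr p a (p * i)%N * h (X %/ p %/ i)%N.
Proof.
move=> pp; rewrite /sig (bigID (fun i => p %| i)%N) /= addrC; congr (_ + _).
  rewrite [LHS]big_mkcond !big_nat; apply: eq_bigr => i /andP[i0 _].
  rewrite /restr (rough_prime pp i0); case: (p %| i)%N => /=; last by rewrite andbT.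
  by rewrite andbF mulr0 mul0r.
rewrite (sum_multiples _ _ (prime_gt0 pp)); apply: eq_bigr => i _.
by rewrite divnMA.
Qed.

(** The local factor is 1 / (1 - c p^(-s)), and dropping the multiples of [p] removes it. *)
Lemma sig_typeI a c h p : prime p -> (forall n, (0 < n)%N -> a (p * n)%N = c * a n) ->
  sig (restr p.+1 a) h = lag c p (sig (restr p a) h).
Proof.
move=> pp H; apply/funext => X; rewrite /lag (sig_split a h X pp).
rewrite (_ : \sum_(1 <= i < _) _ = c * sig (restr p a) h (X %/ p)%N) ?addrK//.
rewrite /sig mulr_sumr !big_nat; apply: eq_bigr => i /andP[i0 _].
by rewrite /restr H// rough_mul// !mulrA.
Qed.

(** The local factor is 1 / (1 - c^2 p^(-2 s)); its inverse splits into the lags with [c] and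
    [- c]. *)
Lemma sig_typeII a c h p : prime p -> (forall n, (0 < n)%N -> ~~ (p %| n)%N -> a (p * n)%N = 0) ->
  (forall n, (0 < n)%N -> a (p * (p * n))%N = c ^+ 2 * a n) ->
  sig (restr p.+1 a) h = lag c p (lag (- c) p (sig (restr p a) h)).
Proof.
move=> pp H H2; apply/funext => X; rewrite /lag (sig_split a h X pp).
rewrite (_ : \sum_(1 <= i < _) _ = c ^+ 2 * sig (restr p a) h (X %/ p %/ p)%N); first by ring.
rewrite (bigID (fun i => p %| i)%N) /= [X in _ + X]big1_seq ?addr0; last first.
  move=> i /andP[pi]; rewrite mem_index_iota => /andP[i0 _].
  by rewrite /restr H// !mul0r.
rewrite (sum_multiples _ _ (prime_gt0 pp)) /sig mulr_sumr !big_nat; apply: eq_bigr => i /andP[i0 _].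
have pi0 : (0 < p * i)%N by rewrite muln_gt0 prime_gt0.
by rewrite divnMA /restr H2// !(rough_mul pp)// !mulrA.
Qed.

(** Lags on inner factors can be moved outside. [h 0 = 0] kills the terms with [i > X %/ p]. *)
Lemma sig_lag a c p h : h 0%N = 0 -> (0 < p)%N -> sig a (lag c p h) = lag c p (sig a h).
Proof.
move=> h0 p0; apply/funext => X; rewrite /lag /sig.
rewrite (@big_cat_nat _ _ _ (X %/ p).+1 1 X.+1)//=; last by rewrite ltnS leq_div.
rewrite [X in _ = X - _](@big_cat_nat _ _ _ (X %/ p).+1 1 X.+1)//=; last by rewrite ltnS leq_div.
rewrite -addrAC; congr (_ + _); last first.
  rewrite !big_nat; apply: eq_bigr => i /andP[i1 _].
  by rewrite (_ : X %/ i %/ p = 0)%N ?h0 ?mulr0 ?subr0// divnAC divn_small.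
rewrite mulr_sumr -sumrB; apply: eq_bigr => i _.
by rewrite mulrBr divnAC mulrCA.
Qed.

(** Strong induction, because [X %/ p < X]; this is how a local factor is restored. *)
Lemma lag_inj c p B u v : (1 < p)%N -> u 0%N = v 0%N ->
  (forall X, (X <= B)%N -> lag c p u X = lag c p v X) -> forall X, (X <= B)%N -> u X = v X.
Proof.
move=> p1 uv0 H X; elim/ltn_ind: X => -[//|X] IH XB.
have := H _ XB; rewrite /lag (IH (X.+1 %/ p)%N) ?ltn_Pdiv//; first by move/addIr.
by rewrite (leq_trans _ XB)// leq_div.
Qed.

Lemma lag_0 c p u : u 0%N = 0 -> lag c p u 0%N = 0.
Proof. by move=> u0; rewrite /lag div0n u0 mulr0 subr0. Qed.

Lemma lag0 p u : lag 0 p u = u.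
Proof. by apply/funext => X; rewrite /lag mul0r subr0. Qed.

Lemma sig_small N a h X : a 1%N = 1 -> (X < N)%N -> h 0%N = 0 -> sig (restr N a) h X = h X.
Proof.
move=> a1 XN h0; case: X XN => [|X] XN; first by rewrite sig0.
have r1 : restr N a 1 = 1 by rewrite /restr a1 rough_small ?mulr1//; lia.
rewrite /sig big_ltn// r1 mul1r divn1 big1_seq ?addr0// => i.
rewrite mem_index_iota => /andP[i1 iX].
by rewrite /restr rough_small// ?(ltnW i1)// ?gtn_eqF ?mulr0 ?mul0r//; lia.
Qed.

Definition sqf (n : nat) : R := (`[< is_sumsq n >])%:R.
Definition chi (n : nat) : R := if (n %% 4 == 1)%N then 1 else if (n %% 4 == 3)%N then -1 else 0.
Definition gcond q e := [|| q == 2, (q %% 4 == 3) && ~~ odd e | e == 0]%N.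
(** The indicator of the integers 2^a b^2 with b a product of primes 3 mod 4: the coefficients of
    F^2 / (zeta L(chi)). *)
Definition gsq (n : nat) : R := (`[< forall q, prime q -> gcond q (logn q n) >])%:R.
Definition one1 (n : nat) : R := 1.
Definition heav1 (n : nat) : R := (0 < n)%N%:R.

Lemma prime_mod4 p : prime p -> [\/ p = 2, p %% 4 = 1 | p %% 4 = 3]%N.
Proof.
move=> pp; have := prime_oddPn pp; have : (p %% 4 < 4)%N by rewrite ltn_mod.
have := divn_eq p 4; case E : (p %% 4)%N => [|[|[|[|//]]]] e _ H.
- constructor 1; apply: H; rewrite e; lia.
- by constructor 2.
- constructor 1; apply: H; rewrite e; lia.
- by constructor 3.
Qed.

Lemma sqf_double n : sqf (2 * n) = sqf n.
Proof. by rewrite /sqf; congr (_ %:R); congr nat_of_bool; apply: asbool_equiv_eq; exact: sumsq_double. Qed.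

Lemma sqf_1mod4 p n : prime p -> (p %% 4 = 1)%N -> sqf (p * n) = sqf n.
Proof.
by move=> pp p4; rewrite /sqf; congr (_ %:R); congr nat_of_bool; apply: asbool_equiv_eq; exact: sumsq_1mod4.
Qed.

Lemma sqf_3mod4 p n : prime p -> (p %% 4 = 3)%N -> sqf (p * (p * n)) = sqf n.
Proof.
by move=> pp p4; rewrite /sqf; congr (_ %:R); congr nat_of_bool; apply: asbool_equiv_eq; exact: sumsq_3mod4.
Qed.

Lemma sqf_3mod4_0 p n : prime p -> (p %% 4 = 3)%N -> ~~ (p %| n)%N -> sqf (p * n) = 0.
Proof.
move=> pp p4 pn; rewrite /sqf asboolF// => /(sumsq_3mod4_dvd pp p4).
exact/negP.
Qed.

Lemma chi_double n : chi (2 * n) = 0 * chi n.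
Proof.
have e : (2 * n %% 4 = 2 * (n %% 2))%N by rewrite muln_modr.
by rewrite mul0r /chi e modn2; case: (odd n).
Qed.

Lemma chi_1mod4 p n : (p %% 4 = 1)%N -> chi (p * n) = 1 * chi n.
Proof. by move=> p4; rewrite mul1r /chi -modnMml p4 mul1n. Qed.

Lemma chi_3mod4 p n : (p %% 4 = 3)%N -> chi (p * n) = -1 * chi n.
Proof.
move=> p4; rewrite mulN1r /chi -modnMml p4 -modnMmr.
have : (n %% 4 < 4)%N by rewrite ltn_mod.
by case: (n %% 4)%N => [|[|[|[|//]]]] _ /=; rewrite ?oppr0 ?opprK.
Qed.

Lemma gsq_mul p n b : prime p -> (0 < n)%N ->
  (gcond p (b + logn p n)%N <-> gcond p (logn p n)) -> gsq (p ^ b * n) = gsq n.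
Proof.
move=> pp n0 H; rewrite /gsq; congr (_ %:R); congr nat_of_bool; apply: asbool_equiv_eq.
have E q : prime q -> logn q (p ^ b * n) = (b * (q == p) + logn q n)%N.
  by move=> pq; rewrite lognM// ?expn_gt0 ?prime_gt0// lognX logn_prime.
split=> G q pq; have := G q pq; rewrite E//.
  by case: eqP => [->|_]; rewrite ?muln1 ?muln0 ?add0n// => /H.
by case: eqP => [->|_]; rewrite ?muln1 ?muln0 ?add0n// => /H.
Qed.

Lemma gsq_mul0 p n b : prime p -> (0 < n)%N -> ~~ gcond p (b + logn p n)%N -> gsq (p ^ b * n) = 0.
Proof.
move=> pp n0 H; rewrite /gsq asboolF// => /(_ p pp).
by rewrite lognM// ?expn_gt0 ?prime_gt0// lognX logn_prime// eqxx muln1; exact/negP.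
Qed.

Lemma gsq_double n : (0 < n)%N -> gsq (2 * n) = 1 * gsq n.
Proof. by move=> n0; rewrite mul1r -[2%N in LHS]expn1 gsq_mul. Qed.

Lemma gsq_1mod4 p n : prime p -> (p %% 4 = 1)%N -> (0 < n)%N -> gsq (p * n) = 0 * gsq n.
Proof.
move=> pp p4 n0; rewrite mul0r -[p in LHS]expn1 gsq_mul0// /gcond p4 add1n /= orbF.
by apply/eqP => p2; rewrite p2 in p4.
Qed.

Lemma gsq_3mod4 p n : prime p -> (p %% 4 = 3)%N -> (0 < n)%N -> gsq (p * (p * n)) = gsq n.
Proof.
move=> pp p4 n0; rewrite mulnA mulnn gsq_mul// /gcond p4 /= negbK.
case: (p == 2)%N => //=; case: (logn p n) => [|e]//=; rewrite !orbF negbK//.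
Qed.

Lemma gsq_3mod4_0 p n : prime p -> (p %% 4 = 3)%N -> (0 < n)%N -> ~~ (p %| n)%N -> gsq (p * n) = 0.
Proof.
move=> pp p4 n0 pn; rewrite -[p in LHS]expn1 gsq_mul0// /gcond p4 add1n /= orbF.
rewrite (_ : logn p n = 0)%N /= ?andbF ?orbF; first by apply/eqP => p2; rewrite p2 in p4.
by rewrite lognE pp n0 (negbTE pn).
Qed.

Lemma sqf1 : sqf 1 = 1.
Proof. by rewrite /sqf asboolT//; exists 1, 0. Qed.

Lemma gsq1 : gsq 1 = 1.
Proof. by rewrite /gsq asboolT// => q pq; rewrite logn1 /gcond eqxx !orbT. Qed.

Let F N := sig (restr N sqf) (sig (restr N sqf) heav1).
Let G N := sig (restr N gsq) (sig (restr N one1) (sig (restr N chi) heav1)).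

(** Descent on [N] from beyond [X], where only the term 1 survives on both sides. Passing from a
    prime [N] to [N.+1] applies the same lags to both sides, and lags can be cancelled. *)
Lemma sig_sqf_rough N X : F N X = G N X.
Proof.
(* One bound [B] serves the whole descent, since a lag at [X] looks only at arguments up to [X]. *)
suff main B k : forall N, (N + k = B.+1)%N -> forall X, (X <= B)%N -> F N X = G N X.
  have [NX|XN] := leqP N X; first by apply: (@main X (X.+1 - N)%N) => //; lia.
  by apply: (@main N.-1 0%N) => //; lia.
elim: k => [|k IH] {X}N NB X XB.
  rewrite addn0 in NB; rewrite /F /G !sig_small ?sqf1 ?gsq1// ?sig0// NB ltnS//.
have {}IH := IH N.+1 ltac:(lia).
have [pN|pN] := boolP (prime N); last first.
  have E a : restr N.+1 a = restr N a by apply/funext => n; rewrite /restr rough_nonprime.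
  by have := IH X XB; rewrite /F /G !E.
have p0 := prime_gt0 pN; have p1 := prime_gt1 pN.
have F0 : F N 0%N = G N 0%N by rewrite /F /G !sig0.
have tI1 h : sig (restr N.+1 one1) h = lag 1 N (sig (restr N one1) h).
  by apply: sig_typeI => // n _; rewrite mul1r.
have z0 c a h : lag c N (sig a h) 0%N = 0 by rewrite lag_0// sig0.
case: (prime_mod4 pN) => p4.
- have EF : F N.+1 = lag 1 N (lag 1 N (F N)).
    have H h : sig (restr N.+1 sqf) h = lag 1 N (sig (restr N sqf) h).
      by apply: sig_typeI => // n _; rewrite p4 sqf_double mul1r.
    by rewrite /F !H sig_lag ?sig0.
  have EG : G N.+1 = lag 1 N (lag 1 N (G N)).
    have H h : sig (restr N.+1 gsq) h = lag 1 N (sig (restr N gsq) h).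
      by apply: sig_typeI => // n n0; rewrite p4 gsq_double.
    have H' h : sig (restr N.+1 chi) h = sig (restr N chi) h.
      by rewrite (@sig_typeI chi 0) ?lag0// => n n0; rewrite p4 chi_double.
    by rewrite /G H tI1 H' sig_lag ?sig0.
  apply: (lag_inj p1 F0 (c := 1) _ XB) => Y YB; apply: (lag_inj p1 _ (c := 1) _ YB).
    by rewrite !lag_0// /F /G sig0.
  by move=> Z ZB; rewrite -EF -EG; exact: IH.
- have EF : F N.+1 = lag 1 N (lag 1 N (F N)).
    have H h : sig (restr N.+1 sqf) h = lag 1 N (sig (restr N sqf) h).
      by apply: sig_typeI => // n _; rewrite sqf_1mod4// mul1r.
    by rewrite /F !H sig_lag ?sig0.
  have EG : G N.+1 = lag 1 N (lag 1 N (G N)).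
    have H h : sig (restr N.+1 gsq) h = sig (restr N gsq) h.
      by rewrite (@sig_typeI gsq 0) ?lag0// => n n0; rewrite gsq_1mod4.
    have H' h : sig (restr N.+1 chi) h = lag 1 N (sig (restr N chi) h).
      by apply: sig_typeI => // n _; rewrite chi_1mod4.
    by rewrite /G H tI1 H' !sig_lag ?lag_0 ?sig0.
  apply: (lag_inj p1 F0 (c := 1) _ XB) => Y YB; apply: (lag_inj p1 _ (c := 1) _ YB).
    by rewrite !lag_0// /F /G sig0.
  by move=> Z ZB; rewrite -EF -EG; exact: IH.
- have EF : F N.+1 = lag 1 N (lag (-1) N (lag 1 N (lag (-1) N (F N)))).
    have H h : sig (restr N.+1 sqf) h = lag 1 N (lag (-1) N (sig (restr N sqf) h)).
      by apply: sig_typeII => // n _; [exact: sqf_3mod4_0|rewrite expr1n mul1r; exact: sqf_3mod4].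
    by rewrite /F !H sig_lag ?z0// sig_lag// sig0.
  have EG : G N.+1 = lag 1 N (lag (-1) N (lag 1 N (lag (-1) N (G N)))).
    have H h : sig (restr N.+1 gsq) h = lag 1 N (lag (-1) N (sig (restr N gsq) h)).
      by apply: sig_typeII => // n n0; [exact: gsq_3mod4_0|rewrite expr1n mul1r; exact: gsq_3mod4].
    have H' h : sig (restr N.+1 chi) h = lag (-1) N (sig (restr N chi) h).
      by apply: sig_typeI => // n _; rewrite chi_3mod4.
    by rewrite /G H tI1 H' !sig_lag ?lag_0 ?sig0.
  have z (H : nat -> R) : H 0%N = 0 -> forall c, lag c N H 0%N = 0 by move=> h c; exact: lag_0.
  have zF : F N 0%N = 0 by rewrite /F sig0.
  have zG : G N 0%N = 0 by rewrite /G sig0.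
  apply: (lag_inj p1 F0 (c := -1) _ XB) => Y YB.
  apply: (lag_inj p1 _ (c := 1) _ YB); first by rewrite !z.
  move=> Z ZB; apply: (lag_inj p1 _ (c := -1) _ ZB); first by rewrite !z.
  move=> W WB; apply: (lag_inj p1 _ (c := 1) _ WB); first by rewrite !z.
  by move=> V VB; rewrite -EF -EG; exact: IH.
Qed.

(* [F(s)^2 = zeta(s) L(s, chi) prod_(p = 2 or 3 mod 4) ...], summed up to X *)
Lemma sig_sqf_sqf X : sig sqf (sig sqf heav1) X = sig gsq (sig one1 (sig chi heav1)) X.
Proof. by have := sig_sqf_rough 2 X; rewrite /F /G !restr2. Qed.

End Sieve.

(** * Limits of sequences in epsilon form *)

Section SeqLimits.
Variable R : realType.
Implicit Types u v : nat -> R.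

Definition seqto u (l : R) := forall ep, 0 < ep -> exists N, forall n, (N <= n)%N -> `|u n - l| <= ep.

Lemma seqtoP u l : seqto u l <-> u @ \oo --> l.
Proof.
split=> [H|/cvgrPdist_le H ep /H [N _ HN]].
  apply/cvgrPdist_le => ep /H [N HN]; exists N => // n /= Nn.
  by rewrite distrC; exact: HN.
by exists N => n Nn; rewrite distrC; exact: HN.
Qed.

Lemma seqto_div u l p : (0 < p)%N -> seqto u l -> seqto (fun n => u (n %/ p)%N) l.
Proof.
move=> p0 H ep /H [N HN]; exists (N * p)%N => n Nn; apply: HN.
by rewrite leq_divRL.
Qed.

Lemma seqto_unique u l l' : seqto u l -> seqto u l' -> l = l'.
Proof. by move=> /seqtoP h /seqtoP h'; exact: (cvg_unique _ h h'). Qed.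

Lemma eq_seqto u v l : (forall n, u n = v n) -> seqto u l -> seqto v l.
Proof. by move=> e; rewrite (_ : v = u)//; apply/funext. Qed.

Lemma seqtoB u v l k : seqto u l -> seqto v k -> seqto (fun n => u n - v n) (l - k).
Proof. by move=> /seqtoP h /seqtoP h'; apply/seqtoP; exact: cvgB. Qed.

Lemma seqtoM u v l k : seqto u l -> seqto v k -> seqto (fun n => u n * v n) (l * k).
Proof. by move=> /seqtoP h /seqtoP h'; apply/seqtoP; exact: cvgM. Qed.

Lemma seqto_cst c : seqto (fun=> c) c.
Proof. by move=> ep ep0; exists 0%N => n _; rewrite subrr normr0 ltW. Qed.

Lemma seqto_le u l b N : seqto u l -> (forall n, (N <= n)%N -> u n <= b) -> l <= b.
Proof.
move=> H ub; apply/ler_addgt0Pr => ep /H [M HM].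
have := HM (maxn N M) (leq_maxr _ _); have := ub (maxn N M) (leq_maxl _ _).
rewrite ler_distl => h /andP[h1 h2]; lra.
Qed.

Lemma seqto_ge u l b N : seqto u l -> (forall n, (N <= n)%N -> b <= u n) -> b <= l.
Proof.
move=> H ub; apply/ler_addgt0Pr => ep /H [M HM].
have := HM (maxn N M) (leq_maxr _ _); have := ub (maxn N M) (leq_maxl _ _).
rewrite ler_distl => h /andP[h1 h2]; lra.
Qed.

Lemma seqto_monotone u b : (forall n, u n <= u n.+1) -> (forall n, u n <= b) -> exists l, seqto u l.
Proof.
move=> mono ub; have c : cvgn u.
  apply: nondecreasing_is_cvgn; first exact/nondecreasing_seqP.
  by exists b => _ [n _ <-].
by exists (limn u); apply/seqtoP.
Qed.

End SeqLimits.

(** * The Euler product over 2 and the primes 3 mod 4, and the Landau-Ramanujan constant *)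

Section GSum.
Variable R : realType.
Implicit Types (phi : nat -> R).

Definition rt4 (x : R) := Num.sqrt (Num.sqrt x).

Lemma rt4_ge0 x : 0 <= rt4 x. Proof. exact: sqrtr_ge0. Qed.

Lemma rt4_gt0 x : 0 < x -> 0 < rt4 x.
Proof. by move=> x0; rewrite !sqrtr_gt0. Qed.

Lemma rt4_X4 x : 0 <= x -> rt4 x ^+ 4 = x.
Proof. by move=> x0; rewrite (exprM _ 2 2) !sqr_sqrtr ?sqrtr_ge0. Qed.

Lemma rt4_X2 x : rt4 x ^+ 2 = Num.sqrt x.
Proof. by rewrite sqr_sqrtr ?sqrtr_ge0. Qed.

Lemma rt4_le x y : x <= y -> rt4 x <= rt4 y.
Proof. by move=> xy; rewrite !ler_wsqrtr. Qed.

Lemma rt4_ge1 x : 1 <= x -> 1 <= rt4 x.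
Proof. by move=> x1; rewrite -(sqrtr1 R) -[in leLHS](sqrtr1 R) rt4_le. Qed.

Lemma gsqP k : (0 < k)%N -> gsq R k != 0 -> exists2 c, (0 < c)%N & (k = c * c \/ k = 2 * (c * c))%N.
Proof.
elim/ltn_ind: k => k IH k0 gk.
have [->|k1] := eqVneq k 1%N; first by exists 1%N => //; left.
have k2 : (1 < k)%N by rewrite ltn_neqAle eq_sym k1.
have [p pp /dvdnP[n kn]] := pdivP k2.
have n0 : (0 < n)%N by move: k0; rewrite kn muln_gt0 => /andP[].
have kn' : (k = p * n)%N by rewrite kn mulnC.
case: (prime_mod4 pp) => p4.
- have gn : gsq R n != 0 by move: gk; rewrite kn' p4 gsq_double// mul1r.
  have [|c c0 [e|e]] := IH n _ n0 gn; first by rewrite kn' p4; lia.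
    by exists c => //; right; rewrite kn' p4 e.
  by exists (2 * c)%N; [lia|left; rewrite kn' p4 e; lia].
- by move: gk; rewrite kn' gsq_1mod4// mul0r eqxx.
- have [/dvdnP[j nj]|pn] := boolP (p %| n)%N; last first.
    by move: gk; rewrite kn' gsq_3mod4_0// eqxx.
  have j0 : (0 < j)%N by move: n0; rewrite nj muln_gt0 => /andP[].
  have kj : (k = p * (p * j))%N by rewrite kn' nj (mulnC j).
  have p0 := prime_gt0 pp.
  have gj : gsq R j != 0 by move: gk; rewrite kj gsq_3mod4.
  have [|c c0 [e|e]] := IH j _ j0 gj; first by rewrite kj; have := prime_gt1 pp; nia.
    by exists (p * c)%N; [rewrite muln_gt0 p0|left; rewrite kj e; lia].
  by exists (p * c)%N; [rewrite muln_gt0 p0|right; rewrite kj e; lia].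
Qed.

Lemma gsq01 k : 0 <= gsq R k <= 1.
Proof. by rewrite /gsq; case: `[< _ >]; rewrite /= ?lexx ?ler01. Qed.

(** The support of [gsq] consists of squares and doubled squares, so each square is charged at most
    twice. *)
Lemma sum_gsq_le phi X : (forall k, 0 <= phi k) -> (forall c, (0 < c)%N -> phi (2 * (c * c))%N <= phi (c * c)%N) ->
  \sum_(1 <= k < X.+1) gsq R k * phi k <= 2 * \sum_(1 <= c < X.+1) phi (c * c)%N.
Proof.
move=> p0 p2.
apply: (@le_trans _ _ (\sum_(1 <= k < X.+1) \sum_(1 <= c < X.+1)
   ((k == c * c)%N%:R * phi (c * c)%N + (k == 2 * (c * c))%N%:R * phi (2 * (c * c))%N))).
  rewrite !big_nat; apply: ler_sum => k /andP[k0 kX].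
  have pos c : 0 <= (k == c * c)%N%:R * phi (c * c)%N + (k == 2 * (c * c))%N%:R * phi (2 * (c * c))%N.
    by rewrite addr_ge0// mulr_ge0.
  have [g0|gk] := eqVneq (gsq R k) 0; first by rewrite g0 mul0r; apply: sumr_ge0 => c _; exact: pos.
  have [c c0 ec] := gsqP k0 gk.
  rewrite (bigD1_seq c) ?iota_uniq//=; last first.
    by rewrite mem_index_iota c0 ltnS (leq_trans _ (kX : (k <= X)%N))//; case: ec => ->; nia.
  apply: ler_wpDr; first by apply: sumr_ge0 => i _; exact: pos.
  have /andP[_ g1] := gsq01 k.
  apply: (@le_trans _ _ (phi k)); first by rewrite ler_piMl.
  case: ec => e; [rewrite -e eqxx mul1r lerDl mulr_ge0//|].
  by rewrite -e eqxx mul1r lerDr mulr_ge0.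
rewrite exchange_big /= mulr_sumr !big_nat; apply: ler_sum => c /andP[c0 cX].
rewrite big_split /=.
have one (P : nat) (y : R) : 0 <= y -> \sum_(1 <= k < X.+1) (k == P)%N%:R * y <= y.
  move=> y0; rewrite -mulr_suml -{2}[y]mul1r ler_wpM2r//.
  have [PX|PX] := boolP (P \in index_iota 1 X.+1).
    rewrite (bigD1_seq P) ?iota_uniq//= eqxx big1_seq ?addr0// => i /andP[/negbTE->//].
  by rewrite big1_seq// => i /andP[_ iX]; case: eqP => // e; rewrite -e iX in PX.
have a1 := one (c * c)%N _ (p0 (c * c)%N).
have a2 := one (2 * (c * c))%N _ (p0 (2 * (c * c))%N).
have a3 := p2 c c0.
have -> : 2 * phi (c * c)%N = phi (c * c)%N + phi (c * c)%N by ring.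
by apply: lerD => //; apply: le_trans a3.
Qed.

(** A telescoping majorant modelled on the integral of x^(-3/2). *)
Lemma sum_inv32 X : \sum_(1 <= c < X.+2) ((Num.sqrt c%:R : R) ^+ 3)^-1 <= 3 - 2 / Num.sqrt X.+1%:R.
Proof.
elim: X => [|X IH].
  by rewrite big_nat1 sqrtr1 expr1n; lra.
rewrite big_nat_recr //=; apply: le_trans (lerD IH (lexx _)) _.
have s0 : 0 < Num.sqrt X.+1%:R :> R by rewrite sqrtr_gt0 ltr0n.
have t0 : 0 < Num.sqrt X.+2%:R :> R by rewrite sqrtr_gt0 ltr0n.
have t2 : (Num.sqrt X.+2%:R : R) ^+ 2 = (Num.sqrt X.+1%:R : R) ^+ 2 + 1.
  by rewrite !sqr_sqrtr// -[X.+2]addn1 natrD.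
move: s0 t0 t2; move: (Num.sqrt X.+1%:R : R) (Num.sqrt X.+2%:R : R) => s t s0 t0 t2.
rewrite -subr_ge0.
have -> : 3 - 2 / t - (3 - 2 / s + (t ^+ 3)^-1) = (2 * t ^+ 3 - 2 * t ^+ 2 * s - s * (t ^+ 2 - s ^+ 2)) / (s * t ^+ 3).
  by rewrite {2}t2; field; rewrite !gt_eqF.
have -> : 2 * t ^+ 3 - 2 * t ^+ 2 * s - s * (t ^+ 2 - s ^+ 2) = (t - s) ^+ 2 * (2 * t + s) by ring.
have s0' := ltW s0; have t0' := ltW t0.
apply: divr_ge0; last by rewrite mulr_ge0// exprn_ge0.
by apply: mulr_ge0; [exact: sqr_ge0|rewrite addr_ge0// mulr_ge0].
Qed.

Lemma sum_inv32_le X : \sum_(1 <= c < X.+1) ((Num.sqrt c%:R : R) ^+ 3)^-1 <= 3.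
Proof.
case: X => [|X]; first by rewrite big_geq.
by apply: le_trans (sum_inv32 X) _; rewrite gerBl divr_ge0 ?sqrtr_ge0.
Qed.

(** The exponent 3/4 leaves tails of order N^(-1/4) in the sum of [gdiv]; this is the source of the
    rate exp (- v / 4) in the convolution square. *)
Lemma sum_gsq34 X : \sum_(1 <= k < X.+1) gsq R k * (rt4 k%:R ^+ 3)^-1 <= 6.
Proof.
apply: le_trans (sum_gsq_le _ _ _) _.
- by move=> k; rewrite invr_ge0 exprn_ge0// rt4_ge0.
- move=> c c0; have p : (0 < c * c)%N by rewrite muln_gt0 c0.
  rewrite lef_pV2 ?posrE ?exprn_gt0 ?rt4_gt0 ?ltr0n ?muln_gt0 ?c0//.
  by rewrite lerXn2r ?nnegrE ?rt4_ge0// rt4_le// ler_nat; lia.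
rewrite (_ : 6 = 2 * 3); last by rewrite -natrM.
rewrite ler_pM2l//; apply: le_trans (sum_inv32_le X).
rewrite le_eqVlt; apply/orP; left; apply/eqP; apply: eq_bigr => c _.
by rewrite /rt4 natrM -expr2 sqrtr_sqr ger0_norm.
Qed.

Definition gdiv (k : nat) : R := gsq R k / k%:R.

Lemma gdiv_ge0 k : 0 <= gdiv k.
Proof. by rewrite divr_ge0//; have /andP[] := gsq01 k. Qed.

Lemma gdiv_tail N X : (0 < N)%N -> \sum_(N <= k < X.+1) gdiv k <= 6 / rt4 N%:R.
Proof.
move=> N0; have r0 : 0 < rt4 N%:R by rewrite rt4_gt0 ?ltr0n.
have [XN|NX] := ltnP X N.
  by rewrite big_geq// divr_ge0// ltW.
apply: (@le_trans _ _ (\sum_(N <= k < X.+1) gsq R k * (rt4 k%:R ^+ 3)^-1 / rt4 N%:R)).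
  rewrite !big_nat; apply: ler_sum => k /andP[Nk _].
  have k0 : 0 < k%:R :> R by rewrite ltr0n (leq_trans N0).
  have rk := rt4_gt0 k0.
  have /andP[g0 _] := gsq01 k; rewrite /gdiv -[leRHS]mulrA; apply: (ler_wpM2l g0).
  rewrite -{1}(rt4_X4 (ltW k0)) -invfM lef_pV2 ?posrE ?mulr_gt0 ?exprn_gt0//.
  by rewrite [leRHS]exprSr ler_pM2l ?exprn_gt0// rt4_le// ler_nat.
rewrite -mulr_suml ler_wpM2r ?invr_ge0 ?(ltW r0)//.
apply: le_trans (sum_gsq34 X).
rewrite [leRHS](@big_cat_nat _ _ _ N)//=; last exact: leqW.
by rewrite lerDr; apply: sumr_ge0 => k _; rewrite mulr_ge0 ?invr_ge0 ?exprn_ge0 ?rt4_ge0.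
Qed.

Definition GN (N X : nat) : R := sig (restr N gdiv) (@heav1 R) X.

Lemma GNE N X : GN N X = \sum_(1 <= k < X.+1) restr N gdiv k.
Proof.
rewrite /GN /sig !big_nat; apply: eq_bigr => i /andP[i0 iX].
by rewrite /heav1 divn_gt0// -ltnS iX mulr1.
Qed.

Lemma restr_gdiv_ge0 N k : 0 <= restr N gdiv k.
Proof. by rewrite mulr_ge0// gdiv_ge0. Qed.

Lemma restr_gdiv_le N k : restr N gdiv k <= gdiv k.
Proof. by rewrite /restr; case: (rough N k); rewrite ?mulr1// mulr0 gdiv_ge0. Qed.

Lemma GN_cvg N : exists l, seqto (GN N) l.
Proof.
apply: (@seqto_monotone _ _ 6) => X; rewrite !GNE.
  by rewrite [leRHS]big_nat_recr //= lerDl restr_gdiv_ge0.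
apply: (@le_trans _ _ (\sum_(1 <= k < X.+1) gdiv k)).
  by apply: ler_sum => k _; exact: restr_gdiv_le.
apply: le_trans (gdiv_tail X (ltn0Sn 0)) _.
by rewrite ler_pdivrMr ?ler_peMr ?rt4_ge1// rt4_gt0.
Qed.

Lemma gdiv1 : gdiv 1 = 1. Proof. by rewrite /gdiv gsq1 divr1. Qed.

(** Among the [N]-rough integers only 1 lies below [N], so all but the first term sits in the tail;
    the bound is uniform in [X]. *)
Lemma GN_near1 N X : (1 < N)%N -> (0 < X)%N -> `|GN N X - 1| <= 6 / rt4 N%:R.
Proof.
move=> N1 X0; rewrite GNE big_ltn// /restr gdiv1 (_ : rough N 1) ?mulr1; last first.
  by rewrite rough_small.
rewrite addrC addKr ger0_norm; last by apply: sumr_ge0 => k _; exact: restr_gdiv_ge0.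
have [XN|NX] := ltnP X N.
  rewrite big1_seq ?divr_ge0 ?rt4_ge0// => k /=; rewrite mem_index_iota => /andP[k1 kX].
  by rewrite rough_small ?gtn_eqF ?mulr0//; lia.
rewrite (@big_cat_nat _ _ _ N)//=; last exact: leqW.
rewrite [X in X + _]big1_seq ?add0r; last first.
  move=> k /=; rewrite mem_index_iota => /andP[k1 kX].
  by rewrite rough_small ?gtn_eqF ?mulr0//; lia.
apply: le_trans (gdiv_tail X _); last by rewrite ltnW.
by apply: ler_sum => k _; exact: restr_gdiv_le.
Qed.

Lemma seqto_lag (u : nat -> R) c p l : (0 < p)%N -> seqto u l -> seqto (lag c p u) (l - c * l).
Proof.
move=> p0 H; apply: seqtoB => //; apply: seqtoM; first exact: seqto_cst.
exact: seqto_div.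
Qed.

Lemma gdiv_mul p n : gdiv (p * n) = gsq R (p * n) / p%:R / n%:R.
Proof. by rewrite /gdiv natrM invfM mulrA. Qed.

Lemma GN_step N l : (1 < N)%N -> seqto (GN N) l ->
  seqto (GN N.+1) (l * (if prime N then if N == 2 then 2^-1 else if (N %% 4 == 3)%N then 1 - (N%:R ^+ 2)^-1 else 1 else 1)).
Proof.
move=> N1 H; have N0 := ltnW N1.
case: ifPn => [pN|pN]; last first.
  rewrite mulr1; apply: eq_seqto H => X; rewrite !GNE; apply: eq_bigr => k _.
  by rewrite /restr rough_nonprime.
have nN : N%:R != 0 :> R by rewrite pnatr_eq0 -lt0n.
case: (prime_mod4 pN) => p4.
- have -> : GN N.+1 = lag 2^-1 N (GN N).
    apply: sig_typeI => // n n0; rewrite p4 gdiv_mul gsq_double//; rewrite /gdiv; field.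
    by rewrite pnatr_eq0 -lt0n n0.
  rewrite p4 in H *; rewrite eqxx /= (_ : l * 2^-1 = l - 2^-1 * l); last by field.
  exact: seqto_lag.
- have -> : GN N.+1 = lag 0 N (GN N).
    apply: sig_typeI => // n n0; rewrite gdiv_mul gsq_1mod4//; rewrite /gdiv; ring.
  rewrite lag0 p4 /=; case: eqP => [e|_]; first by rewrite e in p4.
  by rewrite mulr1.
- have -> : GN N.+1 = lag (N%:R^-1) N (lag (- N%:R^-1) N (GN N)).
    apply: sig_typeII => // n n0 => [Nn|].
      by rewrite gdiv_mul gsq_3mod4_0// !mul0r.
    rewrite /gdiv gsq_3mod4// !natrM; field.
    by rewrite nN pnatr_eq0 -lt0n n0.
  rewrite p4 /=; case: eqP => [e|_]; first by rewrite e in p4.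
  have -> : l * (1 - (N%:R ^+ 2)^-1) = (l - - N%:R^-1 * l) - N%:R^-1 * (l - - N%:R^-1 * l) by field.
  by apply: seqto_lag => //; exact: seqto_lag.
Qed.

Definition P34 (N : nat) : R := \prod_(0 <= p < N | prime p && (p %% 4 == 3)%N) (1 - (p%:R ^+ 2)^-1).

Lemma P34S N : P34 N.+1 = P34 N * (if prime N && (N %% 4 == 3)%N then 1 - (N%:R ^+ 2)^-1 else 1).
Proof. by rewrite /P34 big_mkcond big_nat_recr //= -big_mkcond. Qed.

Lemma GN_product l N : seqto (GN 2) l -> seqto (GN N.+3) (l / 2 * P34 N.+3).
Proof.
move=> H; elim: N => [|N IH].
  have := GN_step (isT : (1 < 2)%N) H; rewrite eqxx /=.
  suff -> : P34 3 = 1 by rewrite mulr1.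
  by rewrite !P34S /P34 big_geq//= !mulr1.
have := GN_step _ IH => /(_ isT); rewrite [P34 N.+4]P34S (mulrA (l / 2)).
by case: ifPn => [pN|pN] //=; case: eqP => [//|_] //.
Qed.

Lemma landau_P34 N : landau_ramanujan_prod R N ^+ 2 * P34 N = 1.
Proof.
elim: N => [|N IH]; first by rewrite /landau_ramanujan_prod /P34 !big_geq// expr1n mul1r.
have -> : landau_ramanujan_prod R N.+1 = landau_ramanujan_prod R N *
   (if prime N && (N %% 4 == 3)%N then (1 - (N%:R ^+ 2)^-1) `^ (- (1 / 2)) else 1).
  by rewrite /landau_ramanujan_prod big_mkcond big_nat_recr //= -big_mkcond.
rewrite P34S exprMn mulrACA IH [LHS]mul1r.
case: (boolP (prime N && _)) => [/andP[pN _]|_]; last by rewrite expr1n mulr1.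
have N1 : (1 < N%:R :> R) by rewrite ltr1n prime_gt1.
set x := 1 - _.
have x0 : 0 < x by rewrite subr_gt0 invf_lt1 ?exprn_gt0 ?exprn_egt1 //; lra.
rewrite -powR_mulrn ?powR_ge0// -powRrM (_ : - (1 / 2) * 2%:R = -1); last by field.
by rewrite powR_inv1 ?(ltW x0)// mulVf// gt_eqF.
Qed.

(** Stripping the primes below N multiplies the full sum l by 1/2 and by the product of 1 - p^(-2),
    and what remains tends to 1. Hence l / 2 is the square of the limiting product, which is 2
    K^2. *)
Lemma landau_sqr : seqto (GN 2) (4 * landau_ramanujan R ^+ 2).
Proof.
have [l H] := GN_cvg 2.
suff -> : 4 * landau_ramanujan R ^+ 2 = l by [].
have cK := @is_cvg_landau_ramanujan_prod R.
pose L := limn (@landau_ramanujan_prod R).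
have LL : seqto (fun N => landau_ramanujan_prod R N.+3 ^+ 2) (L ^+ 2).
  have h : seqto (fun N => landau_ramanujan_prod R N.+3) L.
    move: cK => /seqtoP H' ep /H' [N HN]; exists N => n Nn; apply: HN; lia.
  by rewrite expr2; apply: eq_seqto (seqtoM h h) => n; rewrite expr2.
have L2 : l / 2 = 1 * L ^+ 2.
  apply: (@seqto_unique _ (fun=> l / 2)); first exact: seqto_cst.
  have H1 : seqto (fun N => l / 2 * P34 N.+3) 1.
    move=> ep ep0; exists (Num.truncn ((6 / ep) ^+ 4)) => N hN.
    have gN := GN_product N H.
    have r0 : 0 < rt4 N.+3%:R by rewrite rt4_gt0// ltr0n.
    have rl : 6 / rt4 N.+3%:R <= ep.
      have e0 : 0 < 6 / ep by rewrite divr_gt0.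
      rewrite ler_pdivrMr// mulrC -ler_pdivrMr// -(ler_pXn2r (n := 4))// ?nnegrE ?(ltW e0) ?(ltW r0)//.
      rewrite rt4_X4//; apply: (le_trans (ltW (truncnS_gt _))).
      by rewrite ler_nat ltnS (leq_trans hN)//; lia.
    apply: le_trans rl.
    have gN1 : seqto (fun X => GN N.+3 X - 1) (l / 2 * P34 N.+3 - 1).
      by apply: seqtoB => //; exact: seqto_cst.
    rewrite ler_norml; apply/andP; split.
      apply: (@seqto_ge _ _ _ _ 1%N gN1) => X X0.
      by have := @GN_near1 N.+3 X isT X0; rewrite ler_norml => /andP[].
    apply: (@seqto_le _ _ _ _ 1%N gN1) => X X0.
    by have := @GN_near1 N.+3 X isT X0; rewrite ler_norml => /andP[].
  apply: eq_seqto (seqtoM H1 LL) => N.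
  by rewrite -mulrA (mulrC (P34 _)) landau_P34 mulr1.
rewrite /landau_ramanujan -/L exprMn exprVn sqr_sqrtr//.
have -> : l = 2 * (l / 2) by field.
by rewrite L2; field.
Qed.

Lemma landau_gt0 : 0 < landau_ramanujan R.
Proof.
have L1 : 1 <= limn (@landau_ramanujan_prod R).
  have h : landau_ramanujan_prod R 0 = 1 by rewrite /landau_ramanujan_prod big_geq.
  rewrite -h; apply: (@nondecreasing_cvgn_le _ (@landau_ramanujan_prod R)) => //; last exact: is_cvg_landau_ramanujan_prod.
  apply/nondecreasing_seqP => N.
  have -> : landau_ramanujan_prod R N.+1 = landau_ramanujan_prod R N *
     (if prime N && (N %% 4 == 3)%N then (1 - (N%:R ^+ 2)^-1) `^ (- (1 / 2)) else 1).
    by rewrite /landau_ramanujan_prod big_mkcond big_nat_recr //= -big_mkcond.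
  rewrite ler_peMr//; first by apply: prodr_ge0 => p _; exact: powR_ge0.
  case: ifPn => // /andP[pN _].
  have N1 : (1 < N%:R :> R) by rewrite ltr1n prime_gt1.
  set x := 1 - _.
  have x0 : 0 < x by rewrite subr_gt0 invf_lt1 ?exprn_gt0 ?exprn_egt1 //; lra.
  have x1 : x <= 1 by rewrite gerBl invr_ge0 exprn_ge0.
  rewrite powRN invf_ge1 ?powR_gt0// -[leRHS](powRr0 x).
  by apply: ger_powR; rewrite ?x0 ?x1//.
by rewrite /landau_ramanujan mulr_gt0 ?invr_gt0 ?sqrtr_gt0//; lra.
Qed.

Lemma GN2_rate X : (0 < X)%N -> `|GN 2 X - 4 * landau_ramanujan R ^+ 2| <= 6 / rt4 X%:R.
Proof.
move=> X0; have H := landau_sqr.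
have mono Y : (X <= Y)%N -> GN 2 X <= GN 2 Y <= GN 2 X + 6 / rt4 X%:R.
  move=> XY; rewrite !GNE [X in _ <= X <= _](@big_cat_nat _ _ _ X.+1)//=.
  rewrite lerDl lerD2l; apply/andP; split; first by apply: sumr_ge0 => k _; exact: restr_gdiv_ge0.
  have := gdiv_tail Y X0; apply: le_trans.
  rewrite [leRHS]big_ltn ?ltnS//; apply: ler_wpDl; first exact: gdiv_ge0.
  by apply: ler_sum => k _; exact: restr_gdiv_le.
rewrite distrC ler_distl; apply/andP; split.
  rewrite lerBlDr; apply: ler_wpDr; first by rewrite divr_ge0// rt4_ge0.
  by apply: (@seqto_ge _ _ _ _ X H) => Y /mono /andP[].
by apply: (@seqto_le _ _ _ _ X H) => Y /mono /andP[].
Qed.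

End GSum.

(** * Leibniz's series, and the summatory function of the Dirichlet square *)

Section Leibniz.
Variable R : realType.

Lemma is_derive_power n (x : R) : is_derive x 1 (fun y : R => y ^+ n.+1) (n.+1%:R * x ^+ n).
Proof.
have h := @is_deriveX R R id n.+1 x 1 1 (is_derive_id _ _); rewrite exprfctE in h.
by apply: is_derive_eq h _; rewrite /GRing.scale /= mulr1.
Qed.

Let leib n (x : R) : R := \sum_(0 <= k < n) (-1) ^+ k * (x ^+ k.*2.+1 / k.*2.+1%:R).

Let dleib n (x : R) : is_derive x 1 (leib n) ((1 - (- x ^+ 2) ^+ n) / (1 + x ^+ 2)).
Proof.
have x20 : 1 + x ^+ 2 != 0 by rewrite gt_eqF// ltr_wpDr// sqr_ge0.
elim: n => [|n IH].
  rewrite expr0 subrr mul0r (_ : leib 0 = cst 0); first exact: is_derive_cst.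
  by apply/funext => y; rewrite /leib big_geq.
have -> : leib n.+1 = fun y => leib n y + ((-1) ^+ n / n.*2.+1%:R) * y ^+ n.*2.+1.
  by apply/funext => y; rewrite /leib big_nat_recr //=; congr (_ + _); ring.
have d1 : is_derive x 1 (fun y : R => y ^+ n.*2.+1) (n.*2.+1%:R * x ^+ n.*2).
  exact: is_derive_power.
apply: (is_derive_eq (is_deriveD IH (is_deriveZ ((-1) ^+ n / n.*2.+1%:R) d1))).
rewrite /GRing.scale /= mulrA divfK ?pnatr_eq0//.
have -> : x ^+ n.*2 = (x ^+ 2) ^+ n by rewrite -exprM mul2n.
rewrite -exprMn mulN1r [(- x ^+ 2) ^+ n.+1]exprS.
by move: ((- x ^+ 2) ^+ n) => y; field.
Qed.

(** The derivative of the Taylor polynomial of [atan] differs from that of [atan] by at most x^(2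
    n), whose integral is the bound; [s = 1] and [s = -1] give the two signs. *)
Lemma leibniz_error n : `|\sum_(0 <= k < n) (-1) ^+ k / k.*2.+1%:R - pi / 4 :> R| <= (n.*2.+1%:R)^-1.
Proof.
have E1 : leib n 1 = \sum_(0 <= k < n) (-1) ^+ k / k.*2.+1%:R.
  by apply: eq_bigr => k _; rewrite expr1n mul1r.
have E0 : leib n 0 = 0.
  by rewrite /leib big1// => k _; rewrite expr0n /= mul0r mulr0.
have main (s : R) : s ^+ 2 = 1 -> s * (leib n 1 - atan 1) <= (n.*2.+1%:R)^-1.
  move=> s2; pose h (y : R) := s * (leib n y - atan y) - n.*2.+1%:R^-1 * y ^+ n.*2.+1.
  have dh (x : R) : is_derive x 1 h (s * (- (- x ^+ 2) ^+ n / (1 + x ^+ 2)) - x ^+ n.*2).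
    have x20 : 1 + x ^+ 2 != 0 by rewrite gt_eqF// ltr_wpDr// sqr_ge0.
    have d1 : is_derive x 1 (fun y : R => y ^+ n.*2.+1) (n.*2.+1%:R * x ^+ n.*2).
      exact: is_derive_power.
    have d2 := is_deriveZ s (is_deriveB (dleib n x) (is_derive1_atan x)).
    apply: (is_derive_eq (is_deriveB d2 (is_deriveZ (n.*2.+1%:R^-1) d1))).
    rewrite /GRing.scale /= mulKf ?pnatr_eq0//.
    by move: ((- x ^+ 2) ^+ n) => y; field.
  have : h 1 <= h 0.
    apply: (@ler0_derive1_nincr R h 0 1) => //.
    - move=> x _; rewrite derive1E; have [_ ->] := dh x.
      rewrite subr_le0; apply: le_trans (ler_norm _) _.
      have s1 : `|s| = 1 by apply/eqP; rewrite -sqrp_eq1// -normrX s2 normr1.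
      rewrite normrM s1 mul1r normrM normrN normrX normrN normrX.
      rewrite -exprM mul2n -[leRHS]mulr1 ler_pM//; rewrite ?exprn_ge0//.
        by rewrite -(ger0_norm (exprn_even_ge0 x _)) ?odd_double// normrX.
      by rewrite normfV invf_le1 ger0_norm ?addr_ge0 ?sqr_ge0// ?lerDl ?sqr_ge0// ltr_wpDr ?sqr_ge0.
    - by apply: derivable_within_continuous => x _; have [] := dh x.
  rewrite /h E0 atan0 expr1n expr0n /=.
  by move: (n.*2.+1%:R^-1) (leib n 1) (atan 1) => a b c; lra.
have m1 := main 1 (expr1n _ _).
have m2 := main (-1); rewrite sqrrN expr1n in m2; have {}m2 := m2 erefl.
rewrite -E1 -atan1 ler_norml; move: m1 m2.
move: (n.*2.+1%:R^-1) (leib n 1) (atan 1) => a b c m1 m2; apply/andP; split; lra.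
Qed.

Notation chi := (chi R).

Definition chisum (n : nat) : R := \sum_(1 <= b < n.+1) chi b.

Lemma chisumE n : chisum n = (n %% 4 \in [:: 1; 2])%N%:R.
Proof.
elim: n => [|n IH]; first by rewrite /chisum big_geq.
rewrite /chisum big_nat_recr //= -/(chisum n) IH /chi -(addn1 n) -modnDml.
have : (n %% 4 < 4)%N by rewrite ltn_mod.
case: (n %% 4)%N => [|[|[|[|//]]]] _ /=; rewrite ?addr0 ?add0r//.
by rewrite addrN.
Qed.

Lemma chisum01 n : 0 <= chisum n <= 1.
Proof. by rewrite chisumE; case: (_ \in _); rewrite ?lexx ?ler01. Qed.

(* Abel summation against the partial sums of chi, which stay in [0, 1] *)
Lemma chi_abel (w : nat -> R) m n : (0 < m)%N -> (m <= n)%N -> (forall b, (m <= b)%N -> w b.+1 <= w b) ->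
  (forall b, (m <= b)%N -> 0 <= w b) -> `|\sum_(m <= b < n) chi b * w b| <= w m.
Proof.
move=> m0 mn mono pos.
have inv : forall n, (m <= n)%N ->
   - w m * chisum m.-1 <= \sum_(m <= b < n) chi b * w b - w n * chisum n.-1
   <= - w m * chisum m.-1 + (w m - w n).
  elim=> [|k IH]; first by rewrite leqNgt m0.
  rewrite leq_eqVlt => /predU1P[<-|mk]; first by rewrite big_geq// subrr addr0 sub0r mulNr lexx.
  have {}IH := IH mk; rewrite big_nat_recr //=.
  have k0 : (0 < k)%N by exact: leq_trans m0 mk.
  have Ek : chisum k = chisum k.-1 + chi k by rewrite -{1}(prednK k0) /chisum big_nat_recr //= prednK.
  have /andP[c0 c1] := chisum01 k; have := mono k mk => h.
  have h1 : 0 <= (w k - w k.+1) * chisum k by rewrite mulr_ge0// subr_ge0.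
  have h2 : (w k - w k.+1) * chisum k <= w k - w k.+1 by rewrite ler_piMr// subr_ge0.
  have e : chi k * w k = w k * chisum k - w k * chisum k.-1 by rewrite Ek; ring.
  by rewrite e; move: IH => /andP[? ?]; apply/andP; split; lra.
have /andP[h1 h2] := inv n mn.
have /andP[c0 c1] := chisum01 m.-1; have /andP[c0' c1'] := chisum01 n.-1.
have pm := pos m (leqnn m); have pn := pos n mn.
have b1 : 0 <= w m * chisum m.-1 <= w m by rewrite mulr_ge0//= ler_piMr.
have b2 : 0 <= w n * chisum n.-1 <= w n by rewrite mulr_ge0//= ler_piMr.
move: b1 b2 => /andP[? ?] /andP[? ?].
by rewrite ler_norml; apply/andP; split; lra.
Qed.

Lemma leibniz_odd n : \sum_(0 <= k < n) (-1) ^+ k / k.*2.+1%:R = \sum_(1 <= b < n.*2.+1) chi b / b%:R :> R.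
Proof.
elim: n => [|n IH]; first by rewrite !big_geq.
rewrite big_nat_recr //= IH doubleS [RHS]big_nat_recr//= [X in _ = X + _]big_nat_recr//=.
have -> : chi n.*2.+2 = 0.
  by rewrite -doubleS -mul2n chi_double mul0r.
rewrite mul0r addr0; congr (_ + _ / _).
rewrite /chi -signr_odd -(addn1 n.*2) -modnDml -muln2 -[4%N]/(2 * 2)%N -muln_modl modn2.
by case: (odd n).
Qed.

Lemma chi_pi4 s : `|\sum_(1 <= b < s.+1) chi b / b%:R - pi / 4| <= 2 / s.+1%:R.
Proof.
have Hs n : (s.+1 <= n)%N -> `|\sum_(1 <= b < s.+1) chi b / b%:R - \sum_(1 <= b < n) chi b / b%:R| <= (s.+1%:R)^-1.
  move=> sn; rewrite [X in _ - X](@big_cat_nat _ _ _ s.+1)//= opprD addNKr normrN.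
  apply: (@chi_abel (fun b => b%:R^-1)) => // b sb.
  by rewrite lef_pV2 ?posrE ?ltr0n ?ler_nat// (leq_trans _ sb).
have h1 := Hs (s.+1).*2.+1 ltac:(lia).
have h2 := leibniz_error s.+1; rewrite leibniz_odd in h2.
apply: le_trans (dist_tri h1 h2) _.
have : ((s.+1).*2.+1%:R)^-1 <= (s.+1%:R)^-1 :> R.
  by rewrite lef_pV2 ?posrE ?ltr0n// ler_nat; lia.
move: ((s.+1).*2.+1%:R^-1) (s.+1%:R^-1) => a b; lra.
Qed.

(** The summatory function of 1 * chi, that is of a quarter of the number of representations by two
    squares. *)
Definition Dsum Y : R := sig (@one1 R) (sig chi (@heav1 R)) Y.

Lemma DsumE Y : Dsum Y = \sum_(1 <= b < Y.+1) chi b * (Y %/ b)%N%:R.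
Proof.
rewrite /Dsum /sig /one1 /heav1.
transitivity (\sum_(1 <= a < Y.+1) \sum_(1 <= b < Y.+1) (a * b <= Y)%N%:R * chi b).
  rewrite !big_nat; apply: eq_bigr => a /andP[a0 aY]; rewrite mul1r.
  rewrite [RHS](@big_cat_nat _ _ _ (Y %/ a).+1)//=; last by rewrite ltnS leq_div.
  rewrite [X in _ = _ + X]big1_seq ?addr0; last first.
    move=> b /=; rewrite mem_index_iota => /andP[Yb _].
    by rewrite leqNgt mulnC -ltn_divLR// Yb mul0r.
  rewrite !big_nat; apply: eq_bigr => b /andP[b0 bY].
  by rewrite divn_gt0// -ltnS bY mulr1 mulnC -leq_divRL// -ltnS bY mul1r.
rewrite exchange_big /= !big_nat; apply: eq_bigr => b /andP[b0 bY].
rewrite -mulr_suml mulrC; congr (_ * _).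
rewrite (@big_cat_nat _ _ _ (Y %/ b).+1)//=; last by rewrite ltnS leq_div.
rewrite [X in _ + X]big1_seq ?addr0; last first.
  move=> a /=; rewrite mem_index_iota => /andP[Ya _].
  by rewrite leqNgt -ltn_divLR// Ya.
rewrite big_nat (eq_bigr (fun=> 1)); last first.
  by move=> a /andP[a0 aY]; rewrite -leq_divRL// -ltnS aY.
by rewrite -big_nat sumr_const_nat subn1.
Qed.

Lemma floor_div (x y : nat) : (0 < y)%N -> 
  (x%:R / y%:R - 1 <= (x %/ y)%N%:R :> R) && ((x %/ y)%N%:R <= x%:R / y%:R :> R).
Proof.
move=> y0; have yp : 0 < y%:R :> R by rewrite ltr0n.
rewrite ler_pdivlMr// -natrM ler_nat leq_trunc_div andbT.
rewrite lerBlDr ler_pdivrMr// natr1 -natrM ler_nat.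
by rewrite mulSn; have := divn_eq x y; have := ltn_pmod x y0; lia.
Qed.

Lemma pi4_01 : 0 <= pi / 4 :> R /\ pi / 4 <= 1 :> R.
Proof. by have := @pihalf_lt2 R; have := @pi_ge2 R; split; lra. Qed.

(** The sum over [b] is cut at [s], the integer square root of [Y]. Below, each floor costs at most
    1 and Leibniz's series is truncated with error 2 / (s + 1); above, Abel summation against the
    decreasing [Y %/ b] leaves its first value. *)
Lemma Dsum_asymp Y (x : R) : Y%:R <= x -> x < Y%:R + 1 -> 1 <= x -> `|Dsum Y - pi / 4 * x| <= 10 * Num.sqrt x.
Proof.
move=> Yx xY x1.
have sx1 : 1 <= Num.sqrt x by rewrite -[leLHS]sqrtr1 ler_wsqrtr.
have sx2 : Num.sqrt x ^+ 2 = x by rewrite sqr_sqrtr//; lra.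
have Y0 : (0 < Y)%N by case: (posnP Y) => // e; rewrite e in xY; lra.
have [s s1 s2] : exists2 s, (s * s <= Y)%N & (Y < s.+1 * s.+1)%N.
  have ex : exists k, (k * k <= Y)%N by exists 0%N.
  have ub k : (k * k <= Y)%N -> (k <= Y)%N by nia.
  by case: (ex_maxnP ex ub) => k k1 kM; exists k => //; rewrite ltnNge; apply/negP => /kM; lia.
have sY : (s <= Y)%N by nia.
have ss : s%:R <= Num.sqrt x.
  rewrite -(ler_pXn2r (n := 2)) ?nnegrE ?sqrtr_ge0// sx2; apply: le_trans Yx.
  by rewrite -natrX ler_nat.
have xs : x <= (s.+1%:R) ^+ 2.
  by apply: le_trans (ltW xY) _; rewrite -natrX natr1 ler_nat; move: s2; rewrite expnS expn1.
have Ys : Y%:R / s.+1%:R <= Num.sqrt x.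
  rewrite ler_pdivrMr ?ltr0n//; apply: le_trans Yx _.
  rewrite -{1}sx2 expr2 ler_wpM2l ?sqrtr_ge0//.
  by rewrite -[leRHS]ger0_norm// -sqrtr_sqr ler_wsqrtr.
rewrite DsumE (@big_cat_nat _ _ _ s.+1)//=.
set A := \sum_(1 <= b < s.+1) _; set B := \sum_(s.+1 <= b < _) _.
have hB : `|B| <= Num.sqrt x.
  apply: le_trans Ys; apply: le_trans (_ : (Y %/ s.+1)%N%:R <= _).
    apply: (@chi_abel (fun b => (Y %/ b)%N%:R)) => // b sb.
    by rewrite ler_nat leq_div2l// (leq_trans _ sb).
  by have /andP[] := floor_div Y (ltn0Sn s).
have hA : `|A - Y%:R * \sum_(1 <= b < s.+1) chi b / b%:R| <= s%:R.
  rewrite /A mulr_sumr -sumrB.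
  apply: le_trans (ler_norm_sum _ _ _) _.
  apply: (@le_trans _ _ (\sum_(1 <= b < s.+1) 1)); last by rewrite sumr_const_nat subn1.
  rewrite !big_nat; apply: ler_sum => b /andP[b0 _].
  have -> : chi b * (Y %/ b)%N%:R - Y%:R * (chi b / b%:R) = chi b * ((Y %/ b)%N%:R - Y%:R / b%:R) by ring.
  rewrite normrM -[leRHS]mulr1 ler_pM//.
    by rewrite /chi; case: ifP => _; [|case: ifP => _]; rewrite ?normrN ?normr1 ?normr0.
  have /andP[h1 h2] := floor_div Y b0.
  by rewrite ler_norml; apply/andP; split; lra.
have hC := chi_pi4 s.
set C := \sum_(1 <= b < s.+1) chi b / b%:R in hA hC.
have hD : `|Y%:R * C - Y%:R * (pi / 4)| <= 2 * Num.sqrt x.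
  rewrite -mulrBr normrM ger0_norm//.
  apply: le_trans (ler_wpM2l (ler0n _ _) hC) _.
  by rewrite mulrCA ler_pM2l.
have [p0 p1] := pi4_01.
have hE : `|Y%:R * (pi / 4) - pi / 4 * x| <= 1.
  rewrite (mulrC Y%:R) -mulrBr normrM ger0_norm//.
  by rewrite -[leRHS]mul1r ler_pM// ler_norml; apply/andP; split; lra.
have -> : A + B - pi / 4 * x = (A - Y%:R * C) + (Y%:R * C - Y%:R * (pi / 4)) + (Y%:R * (pi / 4) - pi / 4 * x) + B by ring.
move: hA hB hD hE; rewrite !ler_norml => /andP[? ?] /andP[? ?] /andP[? ?] /andP[? ?].
by apply/andP; split; lra.
Qed.

Definition Hsum X : R := sig (@sqf R) (sig (@sqf R) (@heav1 R)) X.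

(** Summing [Dsum (X %/ k)] over [gsq], the main terms give (pi / 4) x 4 K^2. The error sqrt (x / k)
    is relaxed to (x / k)^(3/4) so that [sum_gsq34] sums it. *)
Lemma Hsum_asymp X (x : R) : X%:R <= x -> x < X%:R + 1 -> 1 <= x ->
  `|Hsum X - pi * landau_ramanujan R ^+ 2 * x| <= 100 * rt4 x ^+ 3.
Proof.
move=> Xx xX x1.
have X0 : (0 < X)%N by case: (posnP X) => // e; rewrite e in xX; lra.
have x0 : 0 <= x by lra.
have r0 := rt4_ge0 x; have r1 := rt4_ge1 x1.
rewrite /Hsum sig_sqf_sqf.
pose S := \sum_(1 <= k < X.+1) gsq R k * (pi / 4 * (x / k%:R)).
have h1 : `|sig (@gsq R) (sig (@one1 R) (sig chi (@heav1 R))) X - S| <= 60 * rt4 x ^+ 3.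
  have -> : sig (@gsq R) (sig (@one1 R) (sig chi (@heav1 R))) X = \sum_(1 <= k < X.+1) gsq R k * Dsum (X %/ k) by [].
  rewrite /S -sumrB.
  apply: le_trans (ler_norm_sum _ _ _) _.
  apply: (@le_trans _ _ (10 * rt4 x ^+ 3 * \sum_(1 <= k < X.+1) gsq R k * (rt4 k%:R ^+ 3)^-1)).
    rewrite mulr_sumr !big_nat; apply: ler_sum => k /andP[k0 kX].
    have kp : 0 < k%:R :> R by rewrite ltr0n.
    have /andP[g0 _] := gsq01 R k.
    have kx : k%:R <= x by apply: le_trans Xx; rewrite ler_nat.
    have xk1 : 1 <= x / k%:R by rewrite ler_pdivlMr ?mul1r.
    rewrite -mulrBr normrM (ger0_norm g0) [leRHS]mulrCA ler_wpM2l//.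
    apply: (@le_trans _ _ (10 * Num.sqrt (x / k%:R))).
      apply: Dsum_asymp => //.
        have /andP[_ h] := floor_div X k0; apply: le_trans h _.
        by rewrite ler_pM2r ?invr_gt0.
      rewrite ltr_pdivrMr// natr1 -natrM.
      apply: lt_le_trans xX _; rewrite natr1 ler_nat.
      by rewrite mulSn; have := divn_eq X k; have := ltn_pmod X k0; lia.
    rewrite -mulrA ler_pM2l//.
    rewrite sqrtrM// sqrtrV ?(ltW kp)// -!rt4_X2.
    have rk := rt4_gt0 kp; have rkx : rt4 k%:R <= rt4 x by exact: rt4_le.
    rewrite ler_pdivlMr ?exprn_gt0// (_ : _ / _ * _ = rt4 x ^+ 2 * rt4 k%:R); last first.
      by field; rewrite gt_eqF.
    by rewrite [leRHS]exprSr ler_wpM2l// exprn_ge0.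
  apply: le_trans (ler_wpM2l _ (sum_gsq34 R X)) _; first by rewrite mulr_ge0// exprn_ge0.
  by rewrite mulrAC -natrM.
have ES : S = pi / 4 * x * GN R 2 X.
  rewrite GNE /S mulr_sumr; apply: eq_bigr => k _; rewrite restr2 /gdiv; ring.
have h2 : `|S - pi * landau_ramanujan R ^+ 2 * x| <= 40 * rt4 x ^+ 3.
  have -> : S - pi * landau_ramanujan R ^+ 2 * x = pi / 4 * x * (GN R 2 X - 4 * landau_ramanujan R ^+ 2).
    by rewrite ES; field.
  have [p0 p1] := pi4_01.
  rewrite normrM (ger0_norm (mulr_ge0 p0 x0)).
  apply: le_trans (ler_wpM2l (mulr_ge0 p0 x0) (GN2_rate R X0)) _.
  have rX : 0 < rt4 X%:R :> R by rewrite rt4_gt0 ?ltr0n.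
  have rx2 : rt4 x <= 2 * rt4 X%:R.
    rewrite -(ler_pXn2r (n := 4)) ?nnegrE ?mulr_ge0 ?rt4_ge0// exprMn !rt4_X4//.
    have X1 : 1 <= X%:R :> R by rewrite ler1n.
    by rewrite -natrX; lra.
  apply: (@le_trans _ _ (x * (6 / rt4 X%:R))).
    by rewrite -(mulrA (pi / 4)) ler_piMl// mulr_ge0// divr_ge0// rt4_ge0.
  rewrite mulrA ler_pdivrMr// -{1}(rt4_X4 x0) exprSr.
  have r3 : 0 <= rt4 x ^+ 3 by rewrite exprn_ge0.
  have := ler_wpM2l r3 rx2.
  have := mulr_ge0 r3 (ltW rX); lra.
apply: le_trans (dist_tri h1 h2) _; lra.
Qed.

End Leibniz.

(** * Landau's theorem *)

Section CountingTransform.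
Variable R : realType.
Implicit Types (u : nat -> R).

Definition fl (v : R) : nat := Num.truncn (expR v).

Definition ms u (v : R) : R := expR (- v) * u (fl v).

Lemma fl_itv v : (fl v)%:R <= expR v < (fl v).+1%:R.
Proof. by apply: truncn_itv; exact: expR_ge0. Qed.

Lemma fl_ge v n : (n <= fl v)%N = (n%:R <= expR v).
Proof. by rewrite truncn_ge_nat ?expR_ge0. Qed.

Lemma fl_lt0 v : v < 0 -> fl v = 0%N.
Proof.
move=> v0; apply/eqP; rewrite -leqn0 leqNgt fl_ge -ltNge.
by rewrite -[ltRHS]expR0 ltr_expR.
Qed.

Lemma fl_gt0 v : 0 <= v -> (0 < fl v)%N.
Proof. by move=> v0; rewrite fl_ge -[leLHS]expR0 ler_expR. Qed.

Lemma le_fl s t : s <= t -> (fl s <= fl t)%N.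
Proof. by move=> st; apply: le_truncn; rewrite ler_expR. Qed.

Lemma fl_div v p : (0 < p)%N -> (fl v %/ p)%N = fl (v - ln p%:R).
Proof.
move=> p0; have pp : 0 < p%:R :> R by rewrite ltr0n.
have E : expR (v - ln p%:R) = expR v / p%:R by rewrite expRD expRN lnK.
apply/esym/truncn_def; rewrite E ler_pdivlMr// ltr_pdivrMr// -!natrM.
have /andP[h1 h2] := fl_itv v.
apply/andP; split; first by apply: le_trans h1; rewrite ler_nat leq_trunc_div.
apply: lt_le_trans h2 _; rewrite ler_nat mulSn.
by have := divn_eq (fl v) p; have := ltn_pmod (fl v) p0; lia.
Qed.

(** Integer division by [p] is a translation by [ln p] in the logarithmic variable, without rounding
    error. *)
Lemma ms_lag u c p v : (0 < p)%N ->
  ms (lag c p u) v = ms u v + (- (c / p%:R)) * ms u (v - ln p%:R).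
Proof.
move=> p0; have pp : 0 < p%:R :> R by rewrite ltr0n.
rewrite /ms /lag fl_div// opprB expRD lnK// mulrBr; congr (_ + _).
by field; rewrite gt_eqF.
Qed.

Lemma ms01 u v : (forall n, 0 <= u n <= n%:R) -> 0 <= ms u v <= 1.
Proof.
move=> H; have /andP[h1 h2] := H (fl v); have /andP[h3 _] := fl_itv v.
rewrite /ms mulr_ge0 ?expR_ge0//= expRN ler_pdivrMl ?expR_gt0// mulr1.
exact: le_trans h3.
Qed.

Lemma ms_lt0 u v : u 0%N = 0 -> v < 0 -> ms u v = 0.
Proof. by move=> u0 v0; rewrite /ms fl_lt0// u0 mulr0. Qed.

Lemma ms_mono u s t : (forall m n, (m <= n)%N -> u m <= u n) -> s <= t ->
  expR s * ms u s <= expR t * ms u t.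
Proof.
move=> H st; rewrite /ms !mulrA -!expRD !subrr expR0 !mul1r.
exact/H/le_fl.
Qed.

Lemma tempered_ms u : (forall n, 0 <= u n <= n%:R) -> (forall m n, (m <= n)%N -> u m <= u n) ->
  tempered (ms u).
Proof.
move=> H mono; have u0 : u 0%N = 0 by apply: le_anti; have := H 0%N; rewrite andbC.
split.
- apply: measurable_funM.
    by have := measurable_expRM (1 : R); apply: eq_measurable_fun => v _; rewrite mul1r.
  by apply: nondecreasing_measurable => // s t st; exact/mono/le_fl.
- by move=> v; exact: ms_lt0.
- exists 1 => //; exists 0%N => v _; rewrite expr0 mulr1.
  by have /andP[h1 h2] := ms01 v H; rewrite ger0_norm.
Qed.

Definition Mr N : nat -> R := sig (restr N (@sqf R)) (@heav1 R).

Lemma sig_heav1 a X : sig a (@heav1 R) X = \sum_(1 <= i < X.+1) a i.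
Proof.
rewrite /sig !big_nat; apply: eq_bigr => i /andP[i0 iX].
by rewrite /heav1 divn_gt0// -ltnS iX mulr1.
Qed.

Lemma MrE N X : Mr N X = \sum_(1 <= i < X.+1) restr N (@sqf R) i.
Proof. exact: sig_heav1. Qed.

Lemma restr_sqf01 N i : 0 <= restr N (@sqf R) i <= 1.
Proof. by rewrite /restr /sqf; case: `[< _ >]; case: (rough _ _); rewrite /= ?mulr1 ?mulr0 ?mul0r ?lexx ?ler01. Qed.

Lemma Mr_bound N n : 0 <= Mr N n <= n%:R.
Proof.
rewrite MrE sumr_ge0 /=; last by move=> i _; have /andP[] := restr_sqf01 N i.
apply: (@le_trans _ _ (\sum_(1 <= i < n.+1) 1)); last by rewrite sumr_const_nat subn1.
by apply: ler_sum => i _; have /andP[] := restr_sqf01 N i.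
Qed.

Lemma Mr_mono N m n : (m <= n)%N -> Mr N m <= Mr N n.
Proof.
move=> mn; rewrite !MrE [leRHS](@big_cat_nat _ _ _ m.+1)//= lerDl sumr_ge0// => i _.
by have /andP[] := restr_sqf01 N i.
Qed.

Lemma tempered_Mr N : tempered (ms (Mr N)).
Proof. by apply: tempered_ms; [exact: Mr_bound|exact: Mr_mono]. Qed.

(** The number r e^(- i t); for r = c p^(-1 - d) and t = y ln p it is the term c p^(-s) of a local
    factor at s = 1 + d + i y. *)
Definition echar (r t : R) : R[i] := (r%:C * (cos t +i* - sin t))%C.

Lemma Lt_lag u c p d y : (0 < p)%N -> tempered (ms u) -> 0 < d ->
  tempered (ms (lag c p u)) /\
  Lt (ms (lag c p u)) d y = (1 - echar (c * (p%:R^-1 * expR (- (d * ln p%:R)))) (y * ln p%:R)) * Lt (ms u) d y.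
Proof.
move=> p0 tu d0.
have l0 : 0 <= ln p%:R :> R by rewrite ln_ge0// ler1n.
have [ts Ls] := Lt_shift_scale (- (c / p%:R)) y tu l0 d0.
have E : ms (lag c p u) = fun v => ms u v + (- (c / p%:R)) * ms u (v - ln p%:R).
  by apply/funext => v; exact: ms_lag.
rewrite E; split; first exact: temperedD.
rewrite Lt_D// Ls mulrBl mul1r; congr (_ + _).
rewrite /echar -[RHS]mulNr; congr (_ * _); rewrite -[RHS]mulNr -rmorphN /=; congr (_%:C%C * _); ring.
Qed.

Lemma echar_sqr r t : (1 - echar r t) * (1 - echar (- r) t) = 1 - echar (r ^+ 2) (2 * t).
Proof.
apply/eqP; rewrite eq_complex /=; apply/andP; split; apply/eqP.
  rewrite (_ : cos (2 * t) = cos t ^+ 2 - sin t ^+ 2); first by ring.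
  by rewrite mulr_natl mulr2n cosD -!expr2.
rewrite (_ : sin (2 * t) = 2 * (sin t * cos t)); first by ring.
by rewrite mulr_natl mulr2n sinD mulr_natl mulr2n (mulrC (cos _)).
Qed.

Lemma sqn_echar r t : sqn (1 - echar r t) = 1 - 2 * r * cos t + r ^+ 2.
Proof.
rewrite /sqn /echar /=; have := sin2cos2 t; rewrite !mul0r !subr0 !addr0 ?oppr0 ?add0r => h.
transitivity ((1 - r * cos t) ^+ 2 + r ^+ 2 * sin t ^+ 2); first by ring.
by rewrite h; ring.
Qed.

Lemma sqn_echar_le r t : sqn (1 - echar r t) <= expR (- (2 * r * cos t) + r ^+ 2).
Proof. rewrite sqn_echar; apply: le_trans (expR_ge1Dx _); lra. Qed.

(* the weights 3, 4, 1 make the exponents add up to [-4 r (1 + cos t) ^ 2 + 8 r ^ 2] *)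
Lemma echar341 r t : 0 <= r ->
  sqn (1 - echar r 0) ^+ 3 * sqn (1 - echar r t) ^+ 4 * sqn (1 - echar r (2 * t)) <= expR (8 * r ^+ 2).
Proof.
move=> r0.
have h1 := sqn_echar_le r 0; have h2 := sqn_echar_le r t; have h3 := sqn_echar_le r (2 * t).
have p (a b : R) n : 0 <= a -> a <= expR b -> a ^+ n <= expR (n%:R * b).
  move=> a0 ab; rewrite expRM_natl; apply: lerXn2r => //; rewrite nnegrE//; exact: expR_ge0.
have q1 := p _ _ 3 (sqn_ge0 _) h1; have q2 := p _ _ 4 (sqn_ge0 _) h2.
apply: le_trans (ler_pM _ _ (ler_pM _ _ q1 q2) h3) _; rewrite ?mulr_ge0 ?exprn_ge0 ?sqn_ge0//.
rewrite -!expRD ler_expR cos0 (_ : cos (2 * t) = 2 * cos t ^+ 2 - 1); last first.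
  by rewrite mulr_natl mulr2n cosD -!expr2; have := sin2cos2 t; lra.
have : 0 <= r * (1 + cos t) ^+ 2 by rewrite mulr_ge0// sqr_ge0.
by rewrite sqrrD expr1n mul1r; lra.
Qed.

(** The Dirichlet series of the [N]-rough sums of two squares at 1 + d + i y. *)
Definition FN N (d y : R) : R[i] := (((1 + d) +i* y)%C * Lt (ms (Mr N)) d y).

Definition PN N (d y : R) := sqn (FN N d 0) ^+ 3 * sqn (FN N d y) ^+ 4 * sqn (FN N d (2 * y)).

Lemma PN_ge0 N d y : 0 <= PN N d y.
Proof. by rewrite !mulr_ge0 ?exprn_ge0 ?sqn_ge0. Qed.

(** Removing the prime [N] multiplies [FN] by the inverse of its local factor, whose 3-4-1 product
    is controlled by [echar341]. *)
Lemma PN_step N d y : (1 < N)%N -> 0 < d -> PN N.+1 d y <= PN N d y * expR (8 / N%:R ^+ 2).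
Proof.
move=> N1 d0; have N0 := ltnW N1; have Np : 0 < N%:R :> R by rewrite ltr0n.
have e1 : 1 <= expR (8 / N%:R ^+ 2) :> R.
  by rewrite -[leLHS]expR0 ler_expR divr_ge0// exprn_ge0.
(* Both shapes of local factor fit: [a] is a linear angle, and [r ^+ 2] is at most 1 / N^2. *)
have key r (a : R -> R) : 0 <= r -> r ^+ 2 <= (N%:R ^+ 2)^-1 -> a 0 = 0 -> a (2 * y) = 2 * a y ->
    (forall x, FN N.+1 d x = (1 - echar r (a x)) * FN N d x) ->
    PN N.+1 d y <= PN N d y * expR (8 / N%:R ^+ 2).
  move=> r0 rN a0 a2 H; have := @echar341 r (a y) r0; rewrite /PN !H a0 a2.
  move: (FN N d) {H} => G; rewrite !sqnM !exprMn.
  set A := sqn (1 - echar r 0) ^+ 3; set B := sqn (1 - echar r (a y)) ^+ 4; set C := sqn (1 - echar r (2 * a y)) => h.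
  have -> : A * sqn (G 0) ^+ 3 * (B * sqn (G y) ^+ 4) * (C * sqn (G (2 * y))) =
    sqn (G 0) ^+ 3 * sqn (G y) ^+ 4 * sqn (G (2 * y)) * (A * B * C) by ring.
  rewrite ler_wpM2l ?mulr_ge0 ?exprn_ge0 ?sqn_ge0//; apply: le_trans h _.
  by rewrite ler_expR ler_pM2l.
have [pN|pN] := boolP (prime N); last first.
  have E : Mr N.+1 = Mr N.
    by apply/funext => X; rewrite !MrE; apply: eq_bigr => i _; rewrite /restr rough_nonprime.
  by rewrite /PN /FN E -/(FN N d 0) -/(FN N d y) -/(FN N d (2 * y)) -/(PN N d y) ler_peMr// PN_ge0.
pose r := N%:R^-1 * expR (- (d * ln N%:R)) : R.
have l0 : 0 <= ln N%:R :> R by rewrite ln_ge0// ler1n.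
have r0 : 0 <= r by rewrite mulr_ge0 ?invr_ge0// expR_ge0.
have rN : r <= N%:R^-1.
  by rewrite ler_piMr ?invr_ge0// -[leRHS]expR0 ler_expR oppr_le0 mulr_ge0// ltW.
have rN2 : r ^+ 2 <= (N%:R ^+ 2)^-1 by rewrite -exprVn; apply: lerXn2r; rewrite ?nnegrE ?invr_ge0.
have typeI : (forall n, (0 < n)%N -> sqf R (N * n) = 1 * sqf R n) -> PN N.+1 d y <= PN N d y * expR (8 / N%:R ^+ 2).
  move=> H; apply: (@key r (fun x => x * ln N%:R)) => //; [by rewrite mul0r|by rewrite mulrA|].
  move=> x; rewrite /FN (_ : Mr N.+1 = lag 1 N (Mr N)); last exact: sig_typeI.
  have [_ ->] := Lt_lag 1 x N0 (tempered_Mr N) d0.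
  by rewrite mul1r -/r mulrCA.
case: (prime_mod4 pN) => p4.
- by apply: typeI => n _; rewrite mul1r p4 sqf_double.
- by apply: typeI => n _; rewrite mul1r sqf_1mod4.
(* For p = 3 mod 4 the two lags merge into one factor with [r ^+ 2] and the doubled angle. *)
- have r1 : r <= 1 by apply: le_trans rN _; rewrite invf_le1// ler1n.
  have r41 : (r ^+ 2) ^+ 2 <= (N%:R ^+ 2)^-1.
    by apply: le_trans rN2; rewrite [leLHS]expr2 ler_piMl ?sqr_ge0// exprn_ile1.
  apply: (@key (r ^+ 2) (fun x => 2 * (x * ln N%:R))) => //.
  + by rewrite sqr_ge0.
  + by rewrite mul0r mulr0.
  + by rewrite !mulrA.
  move=> x; rewrite /FN (_ : Mr N.+1 = lag 1 N (lag (-1) N (Mr N))); last first.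
    apply: sig_typeII => // n _; first exact: sqf_3mod4_0.
    by rewrite expr1n mul1r sqf_3mod4.
  have [t1 E1] := Lt_lag (-1) x N0 (tempered_Mr N) d0.
  have [_ ->] := Lt_lag 1 x N0 t1 d0.
  rewrite E1 mul1r mulN1r -/r -echar_sqr.
  move: (1 - echar r _) (1 - echar (- r) _) (Lt _ _ _) ((1 + d) +i* x)%C => a b L z; ring.
Qed.

Lemma Int_heav_shift (d h : R) : 0 < d -> lint (fun v => heav (v - h) * expR (- (d * v))) /\
  Int (fun v => heav (v - h) * expR (- (d * v))) = expR (- (d * h)) / d.
Proof.
move=> d0; have [l1 e1] := half_exp d0.
have E v : heav (v - h) * expR (- (d * v)) = expR (- (d * h)) * half (fun v => expR (- (d * v))) (v - h).
  rewrite /heav /half; case: ifP => _; last by rewrite mul0r mulr0.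
  by rewrite mul0r oppr0 expR0 mul1r -expRD; congr expR; ring.
have ls := lint_shift (- h) l1; have es := Int_shift (- h) l1.
split; first by apply: eq_lint (lintZ (expR (- (d * h))) ls) => v; rewrite E.
by rewrite (eq_Int E) (IntZ _ ls) es e1.
Qed.

(** Below [ln N] only the integer 1 is counted, so the normalised counting function coincides there
    with [gam], whose transform is 1 / s. *)
Lemma FN_near1 N (d y : R) : (1 < N)%N -> 0 < d ->
  cabs (FN N d y - 1) <= cabs ((1 + d) +i* y)%C * (2 * (expR (- (d * ln N%:R)) / d)).
Proof.
move=> N1 d0.
have tg := tempered_gam R; have tM := tempered_Mr N.
have tD : tempered (fun v => ms (Mr N) v + (-1) * gam v) by apply: temperedD => //; exact: temperedZ.
have z0 : ((1 + d) +i* y)%C != 0.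
  by rewrite -sqn_eq0 /sqn /= gt_eqF// ltr_wpDr ?sqr_ge0// exprn_gt0//; lra.
have E : FN N d y - 1 = ((1 + d) +i* y)%C * Lt (fun v => ms (Mr N) v + (-1) * gam v) d y.
  rewrite Lt_D//; last exact: temperedZ.
  rewrite (Lt_Z _ _ tg)// Lt_half_exp// mulrDr /FN rmorphN1 mulN1r mulrN mulfV//.
rewrite E cabsM ler_wpM2l ?cabs_ge0//.
have Np : 0 < N%:R :> R by rewrite ltr0n ltnW.
have l0 : 0 <= ln N%:R :> R by rewrite ln_ge0// ler1n ltnW.
have D v : `|ms (Mr N) v + (-1) * gam v| <= heav (v - ln N%:R).
  have [vN|Nv] := ltP v (ln N%:R).
    have -> : heav (v - ln N%:R) = 0 by rewrite /heav /half leNgt subr_lt0 vN.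
    have [v0|v0] := ltP v 0.
      have g0 : gam v = 0 by rewrite /gam /half leNgt v0.
      by rewrite ms_lt0// ?/Mr ?sig0// g0 mulr0 addr0 normr0.
    have fN : (fl v < N)%N.
      by rewrite ltnNge fl_ge -ltNge -[ltRHS](lnK Np) ltr_expR.
    rewrite /ms MrE big_ltn ?ltnS ?fl_gt0// big1_seq ?addr0; last first.
      move=> i /=; rewrite mem_index_iota => /andP[i1 iX].
      by rewrite /restr rough_small ?gtn_eqF ?mulr0//; lia.
    rewrite /restr sqf1 rough_small//= mulr1 mulr1 /gam /half v0 mul1r mulN1r subrr normr0//.
  have v0 : 0 <= v by exact: le_trans Nv.
  have -> : heav (v - ln N%:R) = 1 by rewrite /heav /half subr_ge0 Nv mul0r oppr0 expR0.
  have M1 : expR (- v) <= ms (Mr N) v.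
    rewrite /ms -[leLHS]mulr1 ler_wpM2l ?expR_ge0// MrE big_ltn ?ltnS ?fl_gt0//.
    rewrite /restr sqf1 rough_small// mulr1 lerDl sumr_ge0// => i _.
    by have /andP[] := restr_sqf01 N i.
  have /andP[_ M2] := ms01 v (Mr_bound N).
  rewrite /gam /half v0 mul1r mulN1r ger0_norm ?subr_ge0//.
  have := expR_ge0 (- v); lra.
have [l1 e1] := Int_heav_shift (ln N%:R) d0.
have mD : measurable_fun setT (damp d (fun v => ms (Mr N) v + (-1) * gam v)).
  by apply: measurable_damp; have [] := tD.
have B (K : R -> R) : measurable_fun setT K -> (forall x, `|K x| <= 1) ->
   `|Int (fun v => damp d (fun v => ms (Mr N) v + (-1) * gam v) v * K v)| <= expR (- (d * ln N%:R)) / d.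
  move=> mK K1; rewrite -e1; apply: Int_abs_le => //; first exact: measurable_funM.
  move=> v; rewrite /damp !normrM (ger0_norm (expR_ge0 _)) -[leRHS]mulr1.
  by rewrite !ler_pM ?mulr_ge0 ?expR_ge0.
apply: cabs_le; rewrite /Lt /=.
  by apply: B; [exact: measurable_cosM|move=> x; exact: abs_cos_le1].
by rewrite normrN; apply: B; [exact: measurable_sinM|move=> x; exact: abs_sin_le1].
Qed.

Lemma PN_large (d y : R) : 0 < d -> exists N, forall n, (N <= n)%N -> (4^-1 : R) ^+ 8 <= PN n d y.
Proof.
move=> d0.
pose S := 1 + cabs ((1 + d) +i* 0)%C + cabs ((1 + d) +i* y)%C + cabs ((1 + d) +i* (2 * y))%C.
have c1 := cabs_ge0 ((1 + d) +i* 0)%C; have c2 := cabs_ge0 ((1 + d) +i* y)%C; have c3 := cabs_ge0 ((1 + d) +i* (2 * y))%C.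
have S0 : 0 < S by rewrite /S; lra.
(* At [ln n >= T] the bound of [FN_near1] is at most 1/2, hence each of the eight factors of [PN] is
   at least 1/4. *)
pose T := ln (4 * S / d) / d.
exists (fl T).+2 => n nT.
have n1 : (1 < n)%N by apply: leq_trans nT.
have np : 0 < n%:R :> R by rewrite ltr0n ltnW.
have Tn : T <= ln n%:R.
  rewrite -ler_expR lnK//; apply: ltW; have /andP[_ h] := fl_itv T; apply: lt_le_trans h _.
  by rewrite ler_nat; lia.
have Sd : 0 < 4 * S / d by rewrite divr_gt0// mulr_gt0.
have small : S * (2 * (expR (- (d * ln n%:R)) / d)) <= 2^-1.
  have h : expR (- (d * ln n%:R)) <= d / (4 * S).
    rewrite expRN -[leRHS]invrK invf_div lef_pV2 ?posrE ?expR_gt0//.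
    by rewrite -[leLHS](lnK Sd) ler_expR -ler_pdivrMl// mulrC.
  have := ler_wpM2l (ltW S0) (ler_wpM2r (ltW (_ : 0 < d^-1)) h) => /(_ ltac:(by rewrite invr_gt0)).
  have -> : S * (d / (4 * S) / d) = 4^-1 by field; rewrite !gt_eqF.
  lra.
have low x : cabs ((1 + d) +i* x)%C <= S -> 4^-1 <= sqn (FN n d x).
  move=> xS; have h := FN_near1 x n1 d0.
  have e0 : 0 <= 2 * (expR (- (d * ln n%:R)) / d) by rewrite mulr_ge0// divr_ge0 ?expR_ge0// ltW.
  have h2 := ler_wpM2r e0 xS.
  have h3 := cabs_triB 1 (FN n d x).
  have c11 : cabs (1 : R[i]) = 1 by rewrite /cabs /sqn /= expr1n expr0n /= addr0 sqrtr1.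
  have h4 : cabs (1 - FN n d x) = cabs (FN n d x - 1) by rewrite -cabsN opprB.
  have h5 : 2^-1 <= cabs (FN n d x) by lra.
  rewrite -cabs_sqr (_ : 4^-1 = 2^-1 ^+ 2); last by rewrite expr2; field.
  by apply: lerXn2r; rewrite ?nnegrE// ?invr_ge0// cabs_ge0.
have l1 := low 0 ltac:(rewrite /S; lra).
have l2 := low y ltac:(rewrite /S; lra).
have l3 := low (2 * y) ltac:(rewrite /S; lra).
have i4 : (0 : R) <= 4^-1 by rewrite invr_ge0.
rewrite /PN (_ : (4^-1 : R) ^+ 8 = 4^-1 ^+ 3 * 4^-1 ^+ 4 * 4^-1); last by rewrite -exprD -exprSr.
by apply: ler_pM => //; rewrite ?mulr_ge0 ?exprn_ge0//; apply: ler_pM; rewrite ?exprn_ge0//; apply: lerXn2r; rewrite ?nnegrE ?sqn_ge0.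
Qed.

(** The losses exp (8 / N^2) telescope to at most exp 8 over all N, so a bound valid for large N,
    with a threshold depending on [d] and [y], becomes uniform at N = 2. *)
Lemma PN_lower (d y : R) : 0 < d -> (4^-1 : R) ^+ 8 * expR (- 8) <= PN 2 d y.
Proof.
move=> d0.
have H n : PN n.+2 d y <= PN 2 d y * expR (8 * (1 - (n.+1%:R)^-1)).
  elim: n => [|n IH]; first by rewrite invr1 subrr mulr0 expR0 mulr1.
  apply: le_trans (PN_step y (isT : (1 < n.+2)%N) d0) _.
  apply: le_trans (ler_wpM2r (expR_ge0 _) IH) _.
  rewrite -mulrA -expRD ler_wpM2l ?PN_ge0// ler_expR -mulrDr ler_pM2l//.
  have n1 : 0 < n.+1%:R :> R by rewrite ltr0n.
  have -> : n.+2%:R = n.+1%:R + 1 :> R by rewrite natr1.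
  move: (n.+1%:R : R) n1 => x x0.
  rewrite -subr_ge0 (_ : _ - _ = (x * (x + 1) ^+ 2)^-1); last by field; rewrite !gt_eqF//; lra.
  by rewrite invr_ge0 mulr_ge0 ?sqr_ge0// ltW.
have [N HN] := PN_large y d0.
have h1 := HN N.+2 ltac:(lia); have h2 := H N.
have h3 : PN N.+2 d y <= PN 2 d y * expR 8.
  apply: le_trans h2 _; rewrite ler_wpM2l ?PN_ge0// ler_expR ler_piMr// gerBl invr_ge0//.
have := ler_wpM2r (expR_ge0 (- 8)) (le_trans h1 h3).
by rewrite -[leRHS]mulrA -expRD subrr expR0 mulr1.
Qed.

End CountingTransform.

(** * The convolution square of the normalised counting function, and Landau's theorem *)

Section LandauTheorem.
Variable R : realType.
Implicit Types (a g : R -> R).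

Lemma half_lt0 g (v : R) : v < 0 -> half g v = 0.
Proof. by move=> v0; rewrite /half leNgt v0. Qed.

Lemma lint_sum (I : Type) (s : seq I) (P : pred I) (g : I -> R -> R) :
  (forall i, P i -> lint (g i)) -> lint (fun x => \sum_(i <- s | P i) g i x).
Proof.
move=> H; elim: s => [|i s IH]; first by apply: eq_lint (@lint0 R) => x; rewrite big_nil.
apply: eq_lint (_ : lint (fun x => (if P i then g i x else 0) + \sum_(i <- s | P i) g i x)).
  by move=> x; rewrite big_cons; case: ifP; rewrite ?add0r.
by apply: lintD => //; case E: (P i); [exact: H|exact: lint0].
Qed.

Lemma Int_sum (I : Type) (s : seq I) (P : pred I) (g : I -> R -> R) :
  (forall i, P i -> lint (g i)) ->
  Int (fun x => \sum_(i <- s | P i) g i x) = \sum_(i <- s | P i) Int (g i).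
Proof.
move=> H; elim: s => [|i s IH].
  by rewrite big_nil -[RHS](@Int0 R); apply: eq_Int => x; rewrite big_nil.
rewrite big_cons -IH; have ls := lint_sum s H.
have [Pi|Pi] := boolP (P i).
  by rewrite -IntD//; [apply: eq_Int => x; rewrite big_cons Pi|exact: H].
by apply: eq_Int => x; rewrite big_cons (negbTE Pi).
Qed.

Lemma Int_reflect (w : R) a : lint a -> lint (fun t => a (w - t)) /\ Int (fun t => a (w - t)) = Int a.
Proof.
move=> la; have l1 := lint_shift w la; have e1 := Int_shift w la.
have E t : a (- t + w) = a (w - t) by rewrite addrC.
split; first by apply: eq_lint (lint_opp l1) => t; rewrite E.
by rewrite -e1 -(Int_opp l1); apply: eq_Int => t; rewrite E.
Qed.

Lemma Int_indic_max (a b : R) : lint (\1_`[a, b] : R -> R) /\ Int (\1_`[a, b]) = Num.max 0 (b - a).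
Proof.
have [ab|ba] := leP a b.
  by have [l ->] := Int_indic_itv ab; split=> //; rewrite max_r// subr_ge0.
have E x : (fun=> 0) x = \1_`[a, b] x :> R.
  rewrite indicE memNset//= in_itv/= => /andP[h1 h2]; lra.
split; first exact: eq_lint E (@lint0 R).
by rewrite -(eq_Int E) Int0 max_l// subr_le0 ltW.
Qed.

Notation f := (@sqf R).
Notation m := (ms (@Mr R 2)).

Lemma Mr2E X : Mr R 2 X = \sum_(1 <= i < X.+1) f i.
Proof. by rewrite MrE restr2. Qed.

Lemma sum_cut (F : nat -> R) X N : (X <= N)%N ->
  \sum_(1 <= i < X.+1) F i = \sum_(1 <= i < N.+1) F i * (i <= X)%N%:R.
Proof.
move=> XN; rewrite [RHS](@big_cat_nat _ _ _ X.+1)//= [X in _ = _ + X]big1_seq ?addr0.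
  by rewrite !big_nat; apply: eq_bigr => i /andP[_ iX]; rewrite -ltnS iX mulr1.
by move=> i /=; rewrite mem_index_iota => /andP[Xi _]; rewrite leqNgt Xi mulr0.
Qed.

Lemma fl_geln (t : R) i : (0 < i)%N -> (i <= fl t)%N = (ln i%:R <= t).
Proof. by move=> i0; rewrite fl_ge -[in RHS]ler_expR lnK// posrE ltr0n. Qed.

Lemma Hsum_pairs X N : (X <= N)%N ->
  Hsum R X = \sum_(1 <= i < N.+1) \sum_(1 <= j < N.+1) f i * f j * (i * j <= X)%N%:R.
Proof.
move=> XN; rewrite /Hsum {1}/sig (sum_cut _ XN) !big_nat; apply: eq_bigr => i /andP[i0 iN].
have XiN : (X %/ i <= N)%N by exact: leq_trans (leq_div _ _) XN.
rewrite sig_heav1 (sum_cut _ XiN) mulr_sumr mulr_suml !big_nat; apply: eq_bigr => j /andP[j0 jN].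
rewrite leq_divRL// (mulnC j) -!mulrA; congr (_ * (_ * _)).
case: (leqP (i * j) X) => h; last by rewrite mul0r.
by rewrite mul1r (leq_trans _ h)// leq_pmulr.
Qed.

Lemma ln_nat_ge0 i : 0 <= ln i%:R :> R.
Proof. by case: i => [|i]; [rewrite ln0|rewrite ln_ge0// ler1n]. Qed.

Let G (w t : R) : R := \sum_(1 <= i < (fl w).+1) \sum_(1 <= j < (fl w).+1)
  f i * f j * \1_`[ln i%:R + ln j%:R, w] t.

(** A pair (i, j) contributes the length of [ln i, w - ln j], which is also that of
    [ln i + ln j, w]; the second form integrates the number of weighted pairs with i j <= exp t. *)
Lemma cnv_m_pairs (w : R) : 0 <= w -> cnv m m w = expR (- w) * Int (G w) /\ lint (G w).
Proof.
move=> w0.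
pose A (t : R) : R := \sum_(1 <= i < (fl w).+1) \sum_(1 <= j < (fl w).+1)
  f i * f j * \1_`[ln i%:R, w - ln j%:R] t.
have lA i : lint (fun t => \sum_(1 <= j < (fl w).+1) f i * f j * \1_`[ln i%:R, w - ln j%:R] t).
  by apply: lint_sum => j _; apply: lintZ; have [] := Int_indic_max (ln i%:R) (w - ln j%:R).
have lG i : lint (fun t => \sum_(1 <= j < (fl w).+1) f i * f j * \1_`[ln i%:R + ln j%:R, w] t).
  by apply: lint_sum => j _; apply: lintZ; have [] := Int_indic_max (ln i%:R + ln j%:R) w.
have lGw : lint (G w) by exact: lint_sum.
split=> //.
have -> : Int (G w) = Int A.
  rewrite !Int_sum//; apply: eq_bigr => i _; rewrite !Int_sum; first last.
  - by move=> j _; apply: lintZ; have [] := Int_indic_max (ln i%:R + ln j%:R) w.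
  - by move=> j _; apply: lintZ; have [] := Int_indic_max (ln i%:R) (w - ln j%:R).
  apply: eq_bigr => j _.
  have [l1 e1] := Int_indic_max (ln i%:R + ln j%:R) w.
  have [l2 e2] := Int_indic_max (ln i%:R) (w - ln j%:R).
  rewrite (IntZ _ l1) (IntZ _ l2) e1 e2; congr (_ * Num.max _ _); ring.
have lAw : lint A by exact: lint_sum.
rewrite -(IntZ _ lAw); apply: eq_Int => u.
have z i j : u < 0 \/ w < u -> \1_`[ln i%:R, w - ln j%:R] u = 0 :> R.
  move=> h; rewrite indicE memNset//= in_itv/= => /andP[h1 h2].
  have := ln_nat_ge0 i; have := ln_nat_ge0 j; case: h => h; lra.
have zA : u < 0 \/ w < u -> A u = 0.
  by move=> h; apply: big1 => i _; apply: big1 => j _; rewrite z ?mulr0.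
have [u0|u0] := ltP u 0.
  by rewrite zA ?mulr0; [rewrite ms_lt0 ?mul0r// /Mr sig0|left].
have [wu|uw] := ltP w u.
  rewrite zA ?mulr0; [|by right].
  by rewrite [X in _ * X]ms_lt0 ?mulr0 ?subr_lt0// /Mr sig0.
have wu0 : 0 <= w - u by lra.
have fu : (fl u <= fl w)%N by exact: le_fl.
have fwu : (fl (w - u) <= fl w)%N by apply: le_fl; lra.
rewrite /ms !Mr2E (sum_cut _ fu) (sum_cut _ fwu) mulrACA -expRD; congr (expR _ * _); first by ring.
rewrite /A big_distrl /= !big_nat; apply: eq_bigr => i /andP[i0 _].
rewrite big_distrr /= !big_nat; apply: eq_bigr => j /andP[j0 _].
rewrite mulrACA; congr (_ * _); rewrite !fl_geln// -natrM indicE; congr (_%:R).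
rewrite mulnb; congr nat_of_bool; apply/andP/idP => [[h1 h2]|].
  by rewrite mem_set//= in_itv /= h1; lra.
by rewrite inE /= in_itv /= => /andP[h1 h2]; split=> //; lra.
Qed.

Notation c := (pi * landau_ramanujan R ^+ 2).

Lemma c_gt0 : 0 < c.
Proof. by rewrite mulr_gt0 ?pi_gt0// exprn_gt0// landau_gt0. Qed.

Lemma rt4_expR (t : R) : rt4 (expR t) = expR (4^-1 * t).
Proof.
rewrite /rt4 (_ : expR t = (expR (4^-1 * t) ^+ 2) ^+ 2); last first.
  by rewrite -exprM -expRM_natl; congr expR; field.
by rewrite sqrtr_sqr ger0_norm ?sqr_ge0// sqrtr_sqr ger0_norm ?expR_ge0.
Qed.

(** The model is [c * expR t] on ]0, w] and 0 elsewhere; written through [gam], its integral is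
    immediate. *)
Lemma G_asymp (w t : R) : 0 <= w ->
  `|G w t - c * (expR w * gam (w - t) - gam (0 - t))| <=
  100 * expR (3 / 4 * w) * half (fun v => expR (- (3 / 4 * v))) (w - t).
Proof.
move=> w0.
have z (i j : nat) : t < 0 \/ w < t -> \1_`[ln i%:R + ln j%:R, w] t = 0 :> R.
  move=> h; rewrite indicE memNset//= in_itv/= => /andP[h1 h2].
  have := ln_nat_ge0 i; have := ln_nat_ge0 j; case: h => h; lra.
have zG : t < 0 \/ w < t -> G w t = 0.
  by move=> h; apply: big1 => i _; apply: big1 => j _; rewrite z ?mulr0.
have pos : 0 <= 100 * expR (3 / 4 * w) * half (fun v => expR (- (3 / 4 * v))) (w - t).
  rewrite mulr_ge0 ?mulr_ge0 ?expR_ge0// /half; case: ifP => // _; exact: expR_ge0.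
have gE (s : R) : t <= s -> gam (s - t) = expR (t - s).
  by move=> ts; rewrite /gam /half subr_ge0 ts mul1r opprB.
have g0 (s : R) : s < t -> gam (s - t) = 0.
  by move=> ts; rewrite /gam /half subr_ge0 leNgt ts.
have [t0|t0] := ltP t 0.
  rewrite zG; [|by left]; rewrite !gE; [|lra|lra].
  by rewrite -expRD subrKC subr0 subrr mulr0 subrr normr0.
have [wt|tw] := ltP w t.
  by rewrite zG; [|by right]; rewrite !g0 ?mulr0 ?subr0 ?mulr0 ?subr0 ?normr0//; lra.
have GE : G w t = Hsum R (fl t).
  rewrite (Hsum_pairs (le_fl tw)) /G !big_nat; apply: eq_bigr => i /andP[i0 _].
  rewrite !big_nat; apply: eq_bigr => j /andP[j0 _].
  congr (_ * _); rewrite indicE; congr (_%:R); congr nat_of_bool.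
  rewrite fl_geln ?muln_gt0 ?i0// natrM lnM ?posrE ?ltr0n//.
  apply/idP/idP => [|h]; first by rewrite inE /= in_itv /= => /andP[].
  by rewrite mem_set//= in_itv /= h.
have -> : 100 * expR (3 / 4 * w) * half (fun v => expR (- (3 / 4 * v))) (w - t) = 100 * expR (3 / 4 * t).
  by rewrite /half subr_ge0 tw -mulrA -expRD; congr (_ * expR _); ring.
have et : rt4 (expR t) ^+ 3 = expR (3 / 4 * t).
  by rewrite rt4_expR -expRM_natl; congr expR; ring.
rewrite GE -et gE// -expRD subrKC.
have /andP[f1 f2] := fl_itv t.
have e1 : 1 <= expR t by rewrite -[leLHS]expR0 ler_expR.
(* At [t = 0] both [gam] terms are present and the model vanishes, while the sum is 1. *)
move: t0; rewrite le_eqVlt => /predU1P[t00|t0]; last first.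
  by rewrite g0// subr0; apply: Hsum_asymp => //; rewrite natr1.
rewrite gE ?t00// -t00 subr0 subrr mulr0 subr0 /fl expR0 truncn1.
rewrite /Hsum /sig !big_nat1 divn1 ?big_nat1 sqf1 /heav1 /= !mulr1 normr1.
have := rt4_ge1 (lexx (1 : R)) => r1.
have := exprn_ege1 3 r1; lra.
Qed.

Definition rho (w : R) := cnv m m w + (- c) * heav w.

(** 134 rounds up 100 * 4/3, from integrating the error of [G_asymp]; the summand [c] comes from the
    lower end of the integral of [c * expR t] over [0, w]. *)
Lemma rho_bound (w : R) : `|rho w| <= (c + 134) * half (fun v => expR (- (4^-1 * v))) w.
Proof.
have tm := tempered_Mr R 2.
have [w0|w0] := ltP w 0.
  have [_ z _] := tempered_cnv tm tm.
  by rewrite /rho z// /heav !half_lt0// !mulr0 addr0 normr0.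
have h2 : expR (- w) <= expR (- (4^-1 * w)) by rewrite ler_expR; lra.
have h3 : expR (- w) * expR (3 / 4 * w) = expR (- (4^-1 * w)) by rewrite -expRD; congr expR; field.
have h4 : expR (- w) * (100 * expR (3 / 4 * w) * (3 / 4)^-1) <= 134 * expR (- (4^-1 * w)).
  rewrite -h3 (_ : (3 / 4)^-1 = 4 / 3); last by field.
  have := mulr_ge0 (expR_ge0 (- w)) (expR_ge0 (3 / 4 * w)); lra.
have [E lG] := cnv_m_pairs w0.
have lg := lint_gam R; have ig := Int_gam R.
have [l1 e1] := Int_reflect w lg; have [l2 e2] := Int_reflect 0 lg.
have lA : lint (fun t => c * (expR w * gam (w - t) - gam (0 - t))).
  by apply: lintZ; apply: lintB => //; exact: lintZ.
have iA : Int (fun t => c * (expR w * gam (w - t) - gam (0 - t))) = c * (expR w - 1).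
  rewrite (IntZ c (lintB (lintZ (expR w) l1) l2)) (IntB (lintZ (expR w) l1) l2) (IntZ _ l1).
  by rewrite e1 e2 ig mulr1.
have a0 : 0 < 3 / 4 :> R by rewrite divr_gt0.
have [l3 e3] := half_exp a0; have [l4 e4] := Int_reflect w l3.
have B : `|Int (G w) - c * (expR w - 1)| <= 100 * expR (3 / 4 * w) * (3 / 4)^-1.
  rewrite -iA -(IntB lG lA) -e3 -e4 -(IntZ (100 * expR (3 / 4 * w)) l4).
  apply: Int_abs_le; [by apply: lint_meas; exact: lintB| |exact: lintZ].
  by move=> t; exact: G_asymp.
have -> : rho w = expR (- w) * (Int (G w) - c * (expR w - 1)) - c * expR (- w).
  have e : expR (- w) * expR w = 1 by rewrite -expRD addNr expR0.
  rewrite /rho E /heav /half w0 mul0r oppr0 expR0 mulrBr [expR (- w) * (c * _)]mulrCA mulrBr e; ring.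
rewrite /half w0.
have c0 := c_gt0.
apply: le_trans (ler_normB _ _) _; rewrite normrM (ger0_norm (expR_ge0 (- w))).
rewrite (ger0_norm (mulr_ge0 (ltW c0) (expR_ge0 _))).
have h1 := ler_wpM2l (expR_ge0 (- w)) B.
have h5 := ler_wpM2l (ltW c0) h2.
rewrite [leRHS]mulrDl [leRHS]addrC; apply: lerD; [exact: le_trans h1 h4|exact: h5].
Qed.

Theorem landau : tendsto (fun v => Num.sqrt v * m v) (landau_ramanujan R).
Proof.
have tm := tempered_Mr R 2; have c0 := c_gt0.
have K0 := landau_gt0 R.
have -> : landau_ramanujan R = Num.sqrt (c / pi).
  by rewrite mulrC mulKf ?gt_eqF ?pi_gt0// sqrtr_sqr ger0_norm// ltW.
apply: (@landau_of_square R m rho c (c + 134) ((4^-1 : R) ^+ 8 * expR (- 8))) => //.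
- by move=> v; exact/ms01/Mr_bound.
- by apply: temperedD; [exact: tempered_cnv|apply: temperedZ; exact: tempered_heav].
- by rewrite addr_ge0// ltW.
- exact: rho_bound.
- by move=> w; rewrite /rho; ring.
- by move=> d y d0 _; exact: PN_lower.
- by move=> s t; apply: ms_mono; exact: Mr_mono.
Qed.

End LandauTheorem.

(** * The logarithm of the Euler product *)

Section Zeta2.
Variable R : realType.

Lemma sin_le (x : R) : 0 <= x -> sin x <= x.
Proof.
move=> x0; pose h (y : R) := sin y - y.
have dh (y : R) : is_derive y 1 h (cos y - 1) by apply: is_deriveB.
have : h x <= h 0.
  apply: (@ler0_derive1_nincr R h 0 x) => //.
  - by move=> y _; rewrite derive1E; have [_ ->] := dh y; rewrite subr_le0 cos_le1.
  - by apply: derivable_within_continuous => y _; have [] := dh y.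
by rewrite /h sin0 subrr subr_le0.
Qed.

Lemma mulcos_le_sin (x : R) : 0 <= x -> x <= pi -> x * cos x <= sin x.
Proof.
move=> x0 xp; pose h (y : R) := y * cos y - sin y.
have dh (y : R) : is_derive y 1 h (- (y * sin y)).
  apply: (is_derive_eq (is_deriveB (is_deriveM (is_derive_id y 1) (is_derive_cos y)) (is_derive_sin y))).
  by rewrite /GRing.scale /=; ring.
have : h x <= h 0.
  apply: (@ler0_derive1_nincr R h 0 x) => //.
  - move=> y; rewrite in_itv /= => /andP[y0 yx]; rewrite derive1E; have [_ ->] := dh y.
    rewrite oppr_le0 mulr_ge0 ?(ltW y0)// sin_ge0_pi// (ltW y0)/=; lra.
  - by apply: derivable_within_continuous => y _; have [] := dh y.
by rewrite /h sin0 mul0r subr0 subr_le0.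
Qed.

Let g (x : R) := (sin x ^+ 2)^-1.

(** The duplication formula for the sine, together with sin^2 + cos^2 = 1; iterated from x = pi / 2
    it sums [g] over the odd multiples of pi / 2^(n + 2). *)
Let g_halve (x : R) : 0 < x -> x < pi -> g x = 4^-1 * (g (x / 2) + g ((pi - x) / 2)).
Proof.
move=> x0 xp; rewrite /g.
have -> : sin ((pi - x) / 2) = cos (x / 2).
  rewrite (_ : (pi - x) / 2 = pi / 2 - x / 2); last by field.
  by rewrite sinB sin_pihalf cos_pihalf mul1r mul0r subr0.
have -> : sin x = 2 * (sin (x / 2) * cos (x / 2)).
  rewrite {1}(_ : x = x / 2 + x / 2); last by field.
  by rewrite sinD (mulrC (cos _)); ring.
have s0 : 0 < sin (x / 2) by apply: sin_gt0_pi; apply/andP; split; lra.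
have c0 : 0 < cos (x / 2) by apply: cos_gt0_pihalf; apply/andP; split; lra.
have := sin2cos2 (x / 2).
move: (sin (x / 2)) (cos (x / 2)) s0 c0 => s c s0 c0 sc.
have e : s ^+ 2 + c ^+ 2 = 1 by rewrite sc; ring.
have -> : (s ^+ 2)^-1 + (c ^+ 2)^-1 = (s ^+ 2 + c ^+ 2) / (s ^+ 2 * c ^+ 2) by field; rewrite !gt_eqF.
by rewrite e; field; rewrite !gt_eqF.
Qed.

Let y n k : R := k.*2.+1%:R * pi / 2 ^+ n.+2.

Let y_gt0 n k : 0 < y n k.
Proof. by rewrite divr_gt0 ?exprn_gt0// mulr_gt0 ?pi_gt0// ltr0n. Qed.

Let y_lt n k : (k < 2 ^ n)%N -> y n k < pi / 2.
Proof.
move=> kn; rewrite /y ltr_pdivrMr ?exprn_gt0//.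
have -> : pi / 2 * 2 ^+ n.+2 = 2 ^+ n.+1 * pi :> R by rewrite exprS; field.
rewrite ltr_pM2r ?pi_gt0// -natrX ltr_nat expnS; lia.
Qed.

Let gsum n : \sum_(0 <= k < 2 ^ n) g (y n k) = 2 * 4 ^+ n.
Proof.
elim: n => [|n IH].
  rewrite expn0 big_nat1 expr0 mulr1.
  rewrite /g /y /= (_ : 1%:R * pi / 2 ^+ 2 = pi / 4); last by rewrite mul1r expr2 -natrM.
  have e := g_halve (pi_gt0 R) => {e}.
  have := @g_halve (pi / 2) ltac:(have := pi_gt0 R; lra) ltac:(have := pi_gt0 R; lra).
  rewrite /g sin_pihalf expr1n invr1.
  have -> : pi / 2 / 2 = pi / 4 :> R by field.
  have -> : (pi - pi / 2) / 2 = pi / 4 :> R by field.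
  lra.
have split : \sum_(0 <= k < 2 ^ n.+1) g (y n.+1 k) =
    \sum_(0 <= k < 2 ^ n) (g (y n k / 2) + g ((pi - y n k) / 2)).
  rewrite (@big_cat_nat _ _ _ (2 ^ n)%N)//=; last by rewrite leq_exp2l.
  rewrite big_split /=; congr (_ + _).
    by apply: eq_bigr => k _; congr g; rewrite /y [in LHS]exprS; field; rewrite expf_neq0.
  (* Read backwards, the upper half of the index range gives the reflected points (pi - y) / 2. *)
  rewrite -{1}[(2 ^ n)%N]add0n big_addn expnS mul2n -addnn addnK big_nat_rev /= add0n.
  rewrite !big_nat; apply: eq_bigr => k /andP[_ kn]; congr g.
  have e : (((2 ^ n - k.+1 + 2 ^ n).*2.+1)%:R : R) = 2 ^+ n.+2 - k.*2.+1%:R.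
    apply/eqP; rewrite eq_sym subr_eq -natrD -natrX eqr_nat !expnS; apply/eqP.
    by move: kn; move: (2 ^ n)%N => N; lia.
  by rewrite /y e !exprS; field; rewrite expf_neq0.
rewrite split exprS mulrCA -IH mulr_sumr !big_nat; apply: eq_bigr => k /andP[_ kn].
rewrite (g_halve (y_gt0 n k)); last by have := y_lt kn; have := pi_gt0 R; lra.
by rewrite mulrA divff// mul1r.
Qed.

Definition oddsum (n : nat) : R := \sum_(0 <= k < n) ((k.*2.+1%:R) ^+ 2)^-1.

Let ysum n : \sum_(0 <= k < 2 ^ n) ((y n k) ^+ 2)^-1 = 16 * 4 ^+ n / pi ^+ 2 * oddsum (2 ^ n).
Proof.
rewrite /oddsum mulr_sumr; apply: eq_bigr => k _; rewrite /y.
have -> : (4 : R) ^+ n = (2 ^+ n) ^+ 2 by rewrite -exprM mulnC exprM expr2 -natrM.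
have e : k.*2.+1%:R != 0 :> R by rewrite pnatr_eq0.
have pn : pi != 0 :> R by rewrite gt_eqF// pi_gt0.
have h : 2 ^+ n != 0 :> R by rewrite expf_neq0.
rewrite !exprS expr0; move: (k.*2.+1%:R : R) e (pi : R) pn (2 ^+ n : R) h => a a0 p q b b0.
by field; rewrite a0 q b0.
Qed.

(** From cot^2 y <= 1 / y^2 <= 1 / sin^2 y, whose ends differ by 1: the 2^n points cost 2^n against
    a total of 2 * 4^n. *)
Lemma oddsum_bounds n : pi ^+ 2 / 8 * (1 - (2 ^+ n)^-1) <= oddsum (2 ^ n) <= pi ^+ 2 / 8.
Proof.
have p0 := pi_gt0 R; have p20 : 0 < pi ^+ 2 :> R by rewrite exprn_gt0.
have n4 : 0 < 4 ^+ n :> R by rewrite exprn_gt0.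
have c0 : 0 < 16 * 4 ^+ n / pi ^+ 2 :> R by rewrite divr_gt0// mulr_gt0.
have bnd k : (k < 2 ^ n)%N -> g (y n k) - 1 <= ((y n k) ^+ 2)^-1 <= g (y n k).
  move=> kn; have y0 := y_gt0 n k; have yl := y_lt kn; rewrite /g.
  have s0 : 0 < sin (y n k) by apply: sin_gt0_pi; apply/andP; split; lra.
  have k0 : 0 < cos (y n k) by apply: cos_gt0_pihalf; apply/andP; split; lra.
  have h1 := sin_le (ltW y0); have h2 := @mulcos_le_sin (y n k) (ltW y0) ltac:(lra).
  apply/andP; split; last first.
    rewrite lef_pV2 ?posrE ?exprn_gt0//; apply: lerXn2r => //; rewrite nnegrE ltW//.
  have -> : (sin (y n k) ^+ 2)^-1 - 1 = (cos (y n k) / sin (y n k)) ^+ 2.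
    have := sin2cos2 (y n k); move: (sin _) (cos _) s0 => s c s0 sc.
    have c2 : c ^+ 2 = 1 - s ^+ 2 by rewrite sc; ring.
    by rewrite expr_div_n c2; field; rewrite gt_eqF.
  rewrite -exprVn; apply: lerXn2r; rewrite ?nnegrE ?invr_ge0 ?(ltW y0)//.
    by rewrite divr_ge0// ltW.
  by rewrite ler_pdivrMr// ler_pdivlMl.
have up : \sum_(0 <= k < 2 ^ n) ((y n k) ^+ 2)^-1 <= 2 * 4 ^+ n.
  rewrite -gsum !big_nat; apply: ler_sum => k /andP[_ kn].
  by have /andP[] := bnd k kn.
have lo : 2 * 4 ^+ n - 2 ^+ n <= \sum_(0 <= k < 2 ^ n) ((y n k) ^+ 2)^-1.
  rewrite -gsum (_ : 2 ^+ n = \sum_(0 <= k < 2 ^ n) 1 :> R); last first.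
    by rewrite sumr_const_nat subn0 natrX.
  rewrite -sumrB !big_nat; apply: ler_sum => k /andP[_ kn].
  by have /andP[] := bnd k kn.
rewrite ysum in up lo.
apply/andP; split.
  rewrite -(ler_pM2l c0); apply: le_trans lo.
  have -> : 16 * 4 ^+ n / pi ^+ 2 * (pi ^+ 2 / 8 * (1 - (2 ^+ n)^-1)) = 2 * 4 ^+ n - 2 * (4 ^+ n / 2 ^+ n) :> R.
    have : 2 ^+ n != 0 :> R by rewrite expf_neq0.
    move: (4 ^+ n : R) (2 ^+ n : R) (pi : R) p0 => a b p p0 b0.
    by field; rewrite b0 gt_eqF.
  have -> : 4 ^+ n / 2 ^+ n = 2 ^+ n :> R.
    have -> : (4 : R) ^+ n = 2 ^+ n * 2 ^+ n by rewrite -exprMn -natrM.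
    by rewrite mulfK// expf_neq0.
  by have := exprn_gt0 n (ltr0n R 2); lra.
rewrite -(ler_pM2l c0); apply: le_trans up _.
rewrite le_eqVlt; apply/orP; left; apply/eqP.
by move: (4 ^+ n : R) (pi : R) p0 => a p p0; field; rewrite gt_eqF.
Qed.

Definition zsum (n : nat) : R := \sum_(1 <= j < n.+1) ((j%:R) ^+ 2)^-1.

Lemma zsum_double n : zsum n.*2 = oddsum n + 4^-1 * zsum n.
Proof.
elim: n => [|n IH]; first by rewrite /zsum /oddsum !big_geq// mulr0 addr0.
have zS k : zsum k.+1 = zsum k + (k.+1%:R ^+ 2)^-1 by rewrite /zsum big_nat_recr.
rewrite doubleS !zS IH /oddsum big_nat_recr//=.
have -> : n.*2.+2%:R = 2 * n.+1%:R :> R by rewrite -natrM mul2n doubleS.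
have e : n.+1%:R != 0 :> R by rewrite pnatr_eq0.
move: (n.+1%:R : R) e => a a0.
have -> : ((2 * a) ^+ 2)^-1 = 4^-1 * (a ^+ 2)^-1 by field.
by rewrite mulrDr -!addrA; congr (_ + _); rewrite addrCA.
Qed.

Lemma zsumS_ge n : zsum n <= zsum n.+1.
Proof. by rewrite /zsum [leRHS]big_nat_recr //= lerDl invr_ge0 sqr_ge0. Qed.

Lemma zsum_le2 n : zsum n <= 2.
Proof.
suff H : zsum n.+1 <= 2 - n.+1%:R^-1.
  by apply: le_trans (zsumS_ge n) _; apply: le_trans H _; rewrite gerBl invr_ge0.
elim: n => [|n IH]; first by rewrite /zsum big_nat1 expr1n invr1; lra.
rewrite /zsum big_nat_recr //=; apply: le_trans (lerD IH (lexx _)) _.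
have n1 : 0 < n.+1%:R :> R by rewrite ltr0n.
have -> : n.+2%:R = n.+1%:R + 1 :> R by rewrite natr1.
move: (n.+1%:R : R) n1 => x x0; rewrite -subr_ge0.
have -> : 2 - (x + 1)^-1 - (2 - x^-1 + ((x + 1) ^+ 2)^-1) = (x * (x + 1) ^+ 2)^-1.
  by field; rewrite !gt_eqF//; lra.
by rewrite invr_ge0 mulr_ge0 ?sqr_ge0// ltW.
Qed.

(** Removing the even terms leaves l - l / 4, evaluated along powers of 2 as pi^2 / 8. *)
Theorem zeta2 : seqto zsum (pi ^+ 2 / 6).
Proof.
have zmono n : zsum n <= zsum n.+1.
  by rewrite /zsum [leRHS]big_nat_recr //= lerDl invr_ge0 sqr_ge0.
have zle m n : (m <= n)%N -> zsum m <= zsum n by exact: (homo_leq (@lexx _ _) (@le_trans _ _)).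
have [l Hl] := seqto_monotone zmono zsum_le2.
suff -> : pi ^+ 2 / 6 = l by [].
have sub (u : nat -> nat) : (forall n, (n <= u n)%N) -> seqto (fun n => zsum (u n)) l.
  by move=> un ep /Hl [N HN]; exists N => n Nn; apply: HN; exact: leq_trans (un n).
have h1 : seqto (fun n => zsum (2 ^ n).*2) l.
  by apply: sub => n; have := ltn_expl n (ltnSn 1); lia.
have h2 : seqto (fun n => zsum (2 ^ n)) l by apply: sub => n; exact/ltnW/ltn_expl.
have h3 : seqto (fun n => oddsum (2 ^ n)) (pi ^+ 2 / 8).
  move=> ep ep0.
  have p20 : 0 < pi ^+ 2 / 8 :> R by rewrite divr_gt0// exprn_gt0// pi_gt0.
  exists (Num.truncn (pi ^+ 2 / 8 / ep)).+1 => n hn.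
  have /andP[a1 a2] := oddsum_bounds n.
  rewrite distrC ger0_norm ?subr_ge0//.
  apply: (@le_trans _ _ (pi ^+ 2 / 8 * (2 ^+ n)^-1)); first lra.
  rewrite ler_pdivrMr ?exprn_gt0// -ler_pdivrMl// mulrC.
  apply: ltW; apply: lt_le_trans (truncnS_gt _) _.
  rewrite -natrX ler_nat; apply: leq_trans hn _.
  exact/ltnW/ltn_expl.
have h4 : seqto (fun n => zsum (2 ^ n).*2 - 4^-1 * zsum (2 ^ n)) (l - 4^-1 * l).
  by apply: seqtoB => //; apply: seqtoM => //; exact: seqto_cst.
have : l - 4^-1 * l = pi ^+ 2 / 8.
  apply: (seqto_unique h4); apply: eq_seqto h3 => n.
  by rewrite zsum_double addrK.
lra.
Qed.

Lemma zsum_le n : zsum n <= pi ^+ 2 / 6.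
Proof.
apply: (@seqto_ge _ _ _ _ n zeta2) => k nk.
apply: (homo_leq (@lexx _ _) (@le_trans _ _) _ nk) => i.
by rewrite /zsum [leRHS]big_nat_recr //= lerDl invr_ge0 sqr_ge0.
Qed.

End Zeta2.

(** * Asymptotics of the logarithm of the generating product *)

Section EulerProductLog.
Variable R : realType.

Definition hlog (y : R) : R := - ln (1 - expR (- y)).

Let lser J (x : R) : R := \sum_(1 <= j < J.+1) x ^+ j / j%:R.

Let dlser J (x : R) : x < 1 -> is_derive x 1 (lser J) ((1 - x ^+ J) / (1 - x)).
Proof.
move=> x1; have x0 : 1 - x != 0 by rewrite gt_eqF// subr_gt0.
elim: J => [|J IH].
  rewrite expr0 subrr mul0r (_ : lser 0 = cst 0); first exact: is_derive_cst.
  by apply/funext => y; rewrite /lser big_geq.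
have -> : lser J.+1 = fun y => lser J y + (J.+1%:R)^-1 * y ^+ J.+1.
  by apply/funext => y; rewrite /lser big_nat_recr //= (mulrC _^-1).
apply: (is_derive_eq (is_deriveD IH (is_deriveZ (J.+1%:R^-1) (is_derive_power J x)))).
rewrite /GRing.scale /= mulKf ?pnatr_eq0// exprS.
by move: (x ^+ J) => y; field.
Qed.

Lemma ln_series J (x : R) : 0 <= x -> x < 1 ->
  lser J x <= - ln (1 - x) <= lser J x + (J.+1%:R * (1 - x))^-1.
Proof.
move=> x0 x1; have xp : 0 < 1 - x by rewrite subr_gt0.
have dl (y : R) : y < 1 -> is_derive y 1 (fun z => ln (1 - z)) (- (1 - y)^-1).
  move=> y1; have d1 : is_derive y 1 (fun z : R => 1 - z) (-1).
    by apply: (is_derive_eq (is_deriveB (is_derive_cst (1 : R) y 1) (is_derive_id y 1))); rewrite sub0r.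
  have y1' : 0 < 1 - y by rewrite subr_gt0.
  by have := @is_derive1_comp _ (@ln R) (fun z : R => 1 - z) _ _ _ (is_derive1_ln y1') d1; rewrite mulrN1.
pose h1 (y : R) := lser J y + ln (1 - y).
have d1 (y : R) : y < 1 -> is_derive y 1 h1 (- (y ^+ J / (1 - y))).
  move=> y1; apply: (is_derive_eq (is_deriveD (dlser J y1) (dl y y1))).
  by move: (y ^+ J) => z; field; rewrite gt_eqF// subr_gt0.
(* The coefficient is frozen at the endpoint [x], where 1 / (1 - y) is largest on [0, x]. *)
pose k := (J.+1%:R * (1 - x))^-1.
pose h2 (y : R) := - ln (1 - y) - lser J y - k * y ^+ J.+1.
have d2 (y : R) : y < 1 -> is_derive y 1 h2 (y ^+ J / (1 - y) - y ^+ J / (1 - x)).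
  move=> y1.
  apply: (is_derive_eq (is_deriveB (is_deriveB (is_deriveN (dl y y1)) (dlser J y1)) (is_deriveZ k (is_derive_power J y)))).
  have a0 : J.+1%:R != 0 :> R by rewrite pnatr_eq0.
  rewrite /GRing.scale /= /k; move: (y ^+ J) (J.+1%:R : R) a0 => z a a0.
  by field; rewrite a0 !gt_eqF// subr_gt0.
have H1 : h1 x <= h1 0.
  apply: (@ler0_derive1_nincr R h1 0 x) => //.
  - by move=> y; rewrite in_itv /= => /andP[_ yx]; have [] := d1 y (lt_trans yx x1).
  - move=> y; rewrite in_itv /= => /andP[y0 yx]; rewrite derive1E.
    have [_ ->] := d1 y (lt_trans yx x1).
    by rewrite oppr_le0 divr_ge0 ?exprn_ge0 ?(ltW y0)// subr_ge0 ltW// (lt_trans yx).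
  - apply: derivable_within_continuous => y; rewrite in_itv /= => /andP[_ yx].
    by have [] := d1 y (le_lt_trans yx x1).
have H2 : h2 x <= h2 0.
  apply: (@ler0_derive1_nincr R h2 0 x) => //.
  - by move=> y; rewrite in_itv /= => /andP[_ yx]; have [] := d2 y (lt_trans yx x1).
  - move=> y; rewrite in_itv /= => /andP[y0 yx]; rewrite derive1E.
    have [_ ->] := d2 y (lt_trans yx x1).
    rewrite subr_le0 ler_wpM2l ?exprn_ge0 ?(ltW y0)// lef_pV2 ?posrE ?subr_gt0//.
      by rewrite lerD2l lerN2 ltW.
    exact: lt_trans x1.
  - apply: derivable_within_continuous => y; rewrite in_itv /= => /andP[_ yx].
    by have [] := d2 y (le_lt_trans yx x1).
have l0 : lser J 0 = 0.
  by rewrite /lser big_nat big1// => j /andP[j0 _]; rewrite expr0n gtn_eqF// mul0r.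
move: H1 H2; rewrite /h1 /h2 l0 subr0 ln1 expr0n /= mulr0 => H1 H2.
apply/andP; split; first lra.
have k0 : 0 <= k by rewrite invr_ge0 mulr_ge0// ltW.
have : k * x ^+ J.+1 <= k by rewrite ler_piMr// exprn_ile1// ltW.
rewrite -/k; lra.
Qed.

Lemma expRN_lt1 (y : R) : 0 < y -> 0 <= expR (- y) /\ expR (- y) < 1.
Proof. by move=> y0; rewrite expR_ge0 -[ltRHS]expR0 ltr_expR oppr_lt0. Qed.

Lemma hlog_series J (y : R) : 0 < y ->
  \sum_(1 <= j < J.+1) expR (- (j%:R * y)) / j%:R <= hlog y <=
  \sum_(1 <= j < J.+1) expR (- (j%:R * y)) / j%:R + (J.+1%:R * (1 - expR (- y)))^-1.
Proof.
move=> y0; have [h1 h2] := expRN_lt1 y0.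
have := ln_series J h1 h2; rewrite /lser /hlog.
have -> // : \sum_(1 <= j < J.+1) expR (- y) ^+ j / j%:R = \sum_(1 <= j < J.+1) expR (- (j%:R * y)) / j%:R.
by apply: eq_bigr => j _; rewrite -expRM_natl mulrN.
Qed.

Lemma hlog_ge0 (y : R) : 0 < y -> 0 <= hlog y.
Proof. by move=> y0; have := hlog_series 0 y0; rewrite big_geq// => /andP[]. Qed.

Lemma hlog_le (y z : R) : 0 < y -> y <= z -> hlog z <= hlog y.
Proof.
move=> y0 yz; have [_ h1] := expRN_lt1 y0; have [_ h2] := expRN_lt1 (lt_le_trans y0 yz).
by rewrite lerN2 ler_ln ?posrE ?subr_gt0// lerD2l lerN2 ler_expR lerN2.
Qed.

Lemma hlog_small (L : R) : 0 <= L -> hlog (expR (- L)) <= L + 1.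
Proof.
move=> L0; have e0 := expR_gt0 (- L); set t := expR (- L) in e0 *.
have t1 : t <= 1 by rewrite -[leRHS]expR0 ler_expR oppr_le0.
have [_ h] := expRN_lt1 e0.
rewrite /hlog -[leRHS]opprK lerN2 -[leLHS]expRK ler_ln ?posrE ?expR_gt0 ?subr_gt0//.
rewrite opprD expRD -/t.
have h1 : t * expR (- t) <= 1 - expR (- t).
  have := ler_wpM2r (expR_ge0 (- t)) (expR_ge1Dx t).
  by rewrite -expRD subrr expR0 mulrDl mul1r; lra.
apply: le_trans h1; rewrite ler_wpM2l ?(ltW e0)// ler_expR; lra.
Qed.

(** The sum is (1 - exp (- B s)) / (exp s - 1), and 1 / (exp s - 1) lies between 1 / s - 1 and 1 /
    s. *)
Lemma geom_expR (s : R) B : 0 < s ->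
  (1 - expR (- (B%:R * s))) * (s^-1 - 1) <= \sum_(1 <= m < B.+1) expR (- (m%:R * s)) <= (1 - expR (- (B%:R * s))) / s.
Proof.
move=> s0; elim: B => [|B IH].
  by rewrite big_geq// mul0r oppr0 expR0 subrr !mul0r lexx.
rewrite big_nat_recr //=; move: IH.
have -> : expR (- (B%:R * s)) = expR (- (B.+1%:R * s)) * expR s.
  by rewrite -expRD; congr expR; rewrite -natr1; ring.
have e0 := expR_ge0 (- (B.+1%:R * s)); have es := expR_ge1Dx s.
have es2 : expR s * (1 - s) <= 1.
  have := ler_wpM2l (expR_ge0 s) (expR_ge1Dx (- s)).
  by rewrite -expRD subrr expR0.
move: (\sum_(_ <= _ < _) _) (expR (- (B.+1%:R * s))) (expR s) e0 es es2 => S e x e0 es es2 /andP[h1 h2].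
have a1 : e * (x - 1) * (s^-1 - 1) <= e.
  have e1 : (s^-1 - 1) * s = 1 - s by field; rewrite gt_eqF.
  rewrite -mulrA ler_piMr// -(ler_pM2r s0) mul1r -mulrA e1; lra.
have a2 : e <= e * (x - 1) / s by rewrite -mulrA ler_peMr// ler_pdivlMr// mul1r; lra.
apply/andP; split.
  apply: le_trans (lerD h1 a1); rewrite le_eqVlt; apply/orP; left; apply/eqP; ring.
by apply: le_trans (lerD h2 a2) _; rewrite le_eqVlt; apply/orP; left; apply/eqP; ring.
Qed.

(** After expanding the logarithms, summing over [m] first leaves 1 / (j^2 t). The truncation [J] is
    taken after [B] and [ep], so the [B] remainders together stay below [ep]. *)
Lemma sum_hlog_le (t : R) B : 0 < t -> \sum_(1 <= m < B.+1) hlog (m%:R * t) <= pi ^+ 2 / 6 / t.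
Proof.
move=> t0; have [_ h1] := expRN_lt1 t0.
have c0 : 0 < 1 - expR (- t) by rewrite subr_gt0.
apply/ler_addgt0Pr => ep ep0.
pose J := Num.truncn (B%:R / (1 - expR (- t)) / ep).
have JB : B%:R * (J.+1%:R * (1 - expR (- t)))^-1 <= ep.
  have := truncnS_gt (B%:R / (1 - expR (- t)) / ep); rewrite -/J => h.
  have := ltW h; rewrite ler_pdivrMr// => h'.
  by rewrite (mulrC J.+1%:R) invfM mulrA ler_pdivrMr ?ltr0n// [leRHS]mulrC.
apply: le_trans (lerD (lexx _) JB).
apply: (@le_trans _ _ (\sum_(1 <= m < B.+1) (\sum_(1 <= j < J.+1) expR (- (j%:R * (m%:R * t))) / j%:R
    + (J.+1%:R * (1 - expR (- t)))^-1))).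
  rewrite !big_nat; apply: ler_sum => m /andP[m0 _].
  have mt : t <= m%:R * t by rewrite ler_peMl ?(ltW t0)// ler1n.
  have mt0 := lt_le_trans t0 mt.
  have /andP[_ h] := hlog_series J mt0; apply: le_trans h _; rewrite lerD2l.
  have [_ h2] := expRN_lt1 mt0.
  rewrite lef_pV2 ?posrE ?mulr_gt0 ?ltr0n ?subr_gt0// ler_pM2l ?ltr0n// lerD2l lerN2 ler_expR lerN2//.
rewrite big_split /=; apply: lerD; last first.
  by rewrite sumr_const_nat subn1 /= -[leLHS]mulr_natl.
rewrite exchange_big /=.
apply: (@le_trans _ _ (zsum R J / t)); last by rewrite ler_pM2r ?invr_gt0// zsum_le.
rewrite /zsum mulr_suml !big_nat; apply: ler_sum => j /andP[j0 _].
have jp : 0 < j%:R :> R by rewrite ltr0n.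
have jt0 : 0 < j%:R * t by rewrite mulr_gt0.
have /andP[_ h] := geom_expR B jt0.
rewrite -mulr_suml (eq_bigr (fun m => expR (- (m%:R * (j%:R * t))))); last first.
  by move=> m _; congr expR; ring.
rewrite ler_pdivrMr//; apply: le_trans h _.
rewrite (_ : _ * j%:R = (j%:R * t)^-1); last by field; rewrite !gt_eqF.
by rewrite ler_piMl ?invr_ge0 ?(ltW jt0)// gerBl expR_ge0.
Qed.

(** The same exchange with a fixed number of terms; [J%:R * t <= 1] keeps each 1 / (j t) - 1
    nonnegative. *)
Lemma sum_hlog_ge (t : R) B J : 0 < t -> J%:R * t <= 1 ->
  (zsum R J - J%:R * t) * (1 - expR (- (B%:R * t))) / t <= \sum_(1 <= m < B.+1) hlog (m%:R * t).
Proof.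
move=> t0 Jt.
have c0 : 0 <= 1 - expR (- (B%:R * t)).
  by rewrite subr_ge0 -[leRHS]expR0 ler_expR oppr_le0 mulr_ge0// ltW.
apply: (@le_trans _ _ (\sum_(1 <= m < B.+1) \sum_(1 <= j < J.+1) expR (- (j%:R * (m%:R * t))) / j%:R)); last first.
  rewrite !big_nat; apply: ler_sum => m /andP[m0 _].
  have mt0 : 0 < m%:R * t by rewrite mulr_gt0// ltr0n.
  by have /andP[] := hlog_series J mt0.
rewrite exchange_big /=.
apply: (@le_trans _ _ (\sum_(1 <= j < J.+1) ((j%:R ^+ 2)^-1 - t) * (1 - expR (- (B%:R * t))) / t)).
  rewrite -mulr_suml -mulr_suml sumrB sumr_const_nat subn1 /= -(mulr_natl t).
  by rewrite ler_pM2r ?invr_gt0.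
rewrite !big_nat; apply: ler_sum => j /andP[j0 jJ].
have j1 : 1 <= j%:R :> R by rewrite ler1n.
have jp : 0 < j%:R :> R by rewrite ltr0n.
have jt0 : 0 < j%:R * t by rewrite mulr_gt0.
have jJt : j%:R * t <= 1 by apply: le_trans Jt; rewrite ler_pM2r// ler_nat.
have /andP[h _] := geom_expR B jt0.
rewrite -mulr_suml (eq_bigr (fun m => expR (- (m%:R * (j%:R * t))))); last first.
  by move=> m _; congr expR; ring.
rewrite ler_pdivlMr//; apply: le_trans h.
have a1 : 1 - expR (- (B%:R * t)) <= 1 - expR (- (B%:R * (j%:R * t))).
  by rewrite lerD2l lerN2 ler_expR lerN2 ler_wpM2l// ler_peMl// ltW.
have a2 : 0 <= (j%:R * t)^-1 - 1 by rewrite subr_ge0 invf_ge1.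
apply: le_trans (ler_wpM2r a2 a1).
have -> : ((j%:R ^+ 2)^-1 - t) * (1 - expR (- (B%:R * t))) / t * j%:R =
   (1 - expR (- (B%:R * t))) * ((j%:R * t)^-1 - j%:R) by field; rewrite !gt_eqF.
by rewrite ler_wpM2l// lerD2l lerN2.
Qed.

(** One-sided Abel summation; with [a = k - f] and [a = f - k] it turns one-sided counting bounds
    into the two bounds on [Phi]. *)
Lemma abel_lower (a w : nat -> R) X B : 0 <= X ->
  (forall m, (0 < m)%N -> (m <= B)%N -> - X <= \sum_(1 <= i < m.+1) a i) ->
  (forall m, (0 < m)%N -> w m.+1 <= w m) -> (forall m, (0 < m)%N -> 0 <= w m) ->
  - X * w 1%N <= \sum_(1 <= i < B.+1) a i * w i.
Proof.
move=> X0 HA mono pos; case: B HA => [|B] HA.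
  by rewrite big_geq// mulNr oppr_le0 mulr_ge0// pos.
have inv n : (n <= B)%N ->
   (\sum_(1 <= i < n.+2) a i) * w n.+1 - X * (w 1%N - w n.+1) <= \sum_(1 <= i < n.+2) a i * w i.
  elim: n => [|n IH] nB; first by rewrite !big_nat1 subrr mulr0 subr0.
  have {}IH := IH (ltnW nB); rewrite big_nat_recr //= [leRHS]big_nat_recr //=.
  have A := HA n.+1 isT (ltnW nB).
  have w1 : 0 <= w n.+1 - w n.+2 by rewrite subr_ge0 mono.
  move: A IH; move: (\sum_(1 <= i < n.+2) a i) (\sum_(1 <= i < n.+2) a i * w i) => A S hA IH.
  have : 0 <= (A + X) * (w n.+1 - w n.+2) by rewrite mulr_ge0//; lra.
  lra.
apply: le_trans (inv B (leqnn _)).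
have := ler_wpM2r (pos B.+1 isT) (HA B.+1 isT (leqnn _)); lra.
Qed.

Notation f := (@sqf R).
Notation K := (landau_ramanujan R).

Definition Phi B (t : R) : R := \sum_(1 <= m < B.+1) f m * hlog (m%:R * t).

Let hw (t : R) : 0 < t -> (forall m, (0 < m)%N -> hlog (m.+1%:R * t) <= hlog (m%:R * t)) /\
  (forall m, (0 < m)%N -> 0 <= hlog (m%:R * t)).
Proof.
move=> t0; split=> m m0.
  by apply: hlog_le; [rewrite mulr_gt0// ltr0n|rewrite ler_pM2r// ler_nat].
by apply: hlog_ge0; rewrite mulr_gt0// ltr0n.
Qed.

(** [k] is a constant density valid for large [m], and [X] pays for the small [m] where it fails. *)
Lemma Phi_le (t k X : R) B : 0 < t -> 0 <= X ->
  (forall m, (0 < m)%N -> (m <= B)%N -> Mr R 2 m <= k * m%:R + X) ->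
  Phi B t <= k * \sum_(1 <= m < B.+1) hlog (m%:R * t) + X * hlog t.
Proof.
move=> t0 X0 H; have [w1 w2] := hw t0.
have := @abel_lower (fun i => k - f i) (fun m => hlog (m%:R * t)) X B X0 _ w1 w2.
rewrite mul1r => Ab; rewrite -subr_ge0 -lerBlDr sub0r.
have {}Ab : - X * hlog t <= \sum_(1 <= i < B.+1) (k - f i) * hlog (i%:R * t).
  apply: Ab => m m0 mB; have := H m m0 mB; rewrite Mr2E sumrB sumr_const_nat subn1 /= -mulr_natr; lra.
rewrite /Phi; move: Ab; rewrite (eq_bigr (fun i => k * hlog (i%:R * t) - f i * hlog (i%:R * t))).
  by rewrite sumrB -mulr_sumr; lra.
by move=> i _; ring.
Qed.

Lemma Phi_ge (t k X : R) B : 0 < t -> 0 <= X ->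
  (forall m, (0 < m)%N -> (m <= B)%N -> k * m%:R - X <= Mr R 2 m) ->
  k * \sum_(1 <= m < B.+1) hlog (m%:R * t) - X * hlog t <= Phi B t.
Proof.
move=> t0 X0 H; have [w1 w2] := hw t0.
have := @abel_lower (fun i => f i - k) (fun m => hlog (m%:R * t)) X B X0 _ w1 w2.
rewrite mul1r => Ab.
have {}Ab : - X * hlog t <= \sum_(1 <= i < B.+1) (f i - k) * hlog (i%:R * t).
  apply: Ab => m m0 mB; have := H m m0 mB; rewrite Mr2E sumrB sumr_const_nat subn1 /= -mulr_natr; lra.
rewrite /Phi; move: Ab; rewrite (eq_bigr (fun i => f i * hlog (i%:R * t) - k * hlog (i%:R * t))).
  by rewrite sumrB -mulr_sumr; lra.
by move=> i _; ring.
Qed.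

Lemma landau_nat (ep : R) : 0 < ep -> exists2 T, 1 <= T & forall m, (0 < m)%N -> T <= ln (m%:R : R) ->
  (K - ep) * m%:R <= Mr R 2 m * Num.sqrt (ln m%:R) /\ Mr R 2 m * Num.sqrt (ln m%:R) <= (K + ep) * m%:R.
Proof.
move=> /(@landau R)[T T1 H]; exists T => // m m0 Tm.
have mp : 0 < m%:R :> R by rewrite ltr0n.
have := H _ Tm; rewrite /ms /fl lnK// natrK expRN lnK// ler_distl => /andP[h1 h2].
have -> : Mr R 2 m * Num.sqrt (ln m%:R) = Num.sqrt (ln m%:R) * (m%:R^-1 * Mr R 2 m) * m%:R.
  by field; rewrite gt_eqF.
by rewrite !ler_pM2r//; split=> //; lra.
Qed.

Lemma error_small (ep e : R) : 0 < ep -> 0 < e -> exists2 L0, 1 <= L0 & forall L, L0 <= L ->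
  expR (- (ep * L)) * (L + 1) * Num.sqrt L <= e.
Proof.
move=> ep0 e0; have [C C0 H] := @pow_exp_bound R ep 3 ep0.
have Ce : 0 <= C / e by rewrite divr_ge0// ltW.
exists (1 + C / e); first by rewrite lerDl.
move=> L hL; have L1 : 1 <= L by lra.
have sL : Num.sqrt L <= L + 1.
  rewrite -[leRHS]ger0_norm -?sqrtr_sqr; last lra.
  by rewrite ler_wsqrtr// sqrrD expr1n mulr1; have := sqr_ge0 L; lra.
have h := H L ltac:(lra).
apply: (@le_trans _ _ (expR (- (ep * L)) * (1 + L) ^+ 2)).
  by rewrite expr2 -mulrA ler_wpM2l ?expR_ge0// addrC ler_wpM2l//; lra.
have p : 0 < 1 + L by lra.
rewrite -(ler_pM2r p) -mulrA -exprSr.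
apply: (@le_trans _ _ C).
  have := ler_wpM2l (expR_ge0 (- (ep * L))) h.
  by rewrite [leRHS]mulrCA -expRD addNr expR0 mulr1.
by rewrite mulrC -ler_pdivrMr//; lra.
Qed.

Lemma small_m_bound (ep L : R) m : (0 < m)%N -> ln m%:R <= (1 - ep) * L -> m%:R <= expR ((1 - ep) * L).
Proof. by move=> m0 h; rewrite -[leLHS]lnK ?posrE ?ltr0n// ler_expR. Qed.

(** Integers up to exp ((1 - ep) L) go into the error, a factor exp (- ep L) below the main term up
    to powers of L; beyond them sqrt (ln m) is nearly at least sqrt L. *)
Lemma Phi_upper (e : R) : 0 < e -> exists2 L0, 1 <= L0 & forall L B, L0 <= L ->
  Phi B (expR (- L)) <= (K * (pi ^+ 2 / 6) + e) * expR L / Num.sqrt L.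
Proof.
move=> e0; have K0 := landau_gt0 R.
pose ep := Num.min 2^-1 (e / (8 * (2 + K))).
have d0 : 0 < 8 * (2 + K) by rewrite mulr_gt0//; lra.
have ep0 : 0 < ep by rewrite lt_min invr_gt0 ltr0n divr_gt0.
have ep2 : ep <= 2^-1 by rewrite ge_min lexx.
have epe : ep * (8 * (2 + K)) <= e by rewrite -ler_pdivlMr// ge_min lexx orbT.
have [T T1 HT] := landau_nat ep0.
have e20 : 0 < e / 2 by lra.
have [L1 L11 HL1] := error_small ep0 e20.
exists (2 * T + L1); first lra.
move=> L B hL; have L0 : 0 < L by lra.
have LT : T <= (1 - ep) * L.
  apply: (@le_trans _ _ (2^-1 * L)); first lra.
  by rewrite ler_pM2r//; lra.
have sL : 0 < Num.sqrt L by rewrite sqrtr_gt0.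
pose k := (K + ep) * (1 + ep) / Num.sqrt L.
have k0 : 0 <= k by rewrite divr_ge0 ?mulr_ge0//; lra.
have t0 := expR_gt0 (- L).
have X0 := expR_ge0 ((1 - ep) * L).
have := @Phi_le (expR (- L)) k (expR ((1 - ep) * L)) B t0 X0.
have bound m : (0 < m)%N -> (m <= B)%N -> Mr R 2 m <= k * m%:R + expR ((1 - ep) * L).
  move=> m0 _; have [h|h] := leP (ln m%:R) ((1 - ep) * L).
    apply: ler_wpDl; first by rewrite mulr_ge0.
    have /andP[_ h'] := Mr_bound R 2 m; apply: le_trans h' _; exact: small_m_bound.
  apply: ler_wpDr => //.
  have [_ h'] := HT m m0 (le_trans LT (ltW h)).
  have M0 : 0 <= Mr R 2 m by have /andP[] := Mr_bound R 2 m.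
  have s1 : Num.sqrt L <= (1 + ep) * Num.sqrt (ln m%:R).
    have r0 : 0 <= 1 + ep by lra.
    rewrite -[X in X * _](ger0_norm r0) -sqrtr_sqr -sqrtrM ?sqr_ge0// ler_wsqrtr//.
    apply: (@le_trans _ _ ((1 + ep) ^+ 2 * ((1 - ep) * L))); last by rewrite ler_wpM2l ?sqr_ge0// ltW.
    rewrite mulrA ler_peMl ?(ltW L0)//.
    have : 0 <= ep * (1 - ep - ep * ep).
      apply: mulr_ge0; first exact: ltW.
      have : ep * ep <= 2^-1 * 2^-1 by apply: ler_pM => //; exact: ltW.
      lra.
    by rewrite expr2; lra.
  rewrite /k mulrAC ler_pdivlMr//.
  apply: le_trans (ler_wpM2l M0 s1) _.
  rewrite mulrCA mulrAC [leRHS]mulrC; apply: ler_wpM2l => //; lra.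
move/(_ bound) => h; apply: le_trans h _.
have h1 := ler_wpM2l k0 (sum_hlog_le B t0).
have h2 := ler_wpM2l X0 (hlog_small (ltW L0)).
apply: le_trans (lerD h1 h2) _.
have eL : (expR (- L))^-1 = expR L by rewrite expRN invrK.
rewrite eL ler_pdivlMr//.
have -> : (k * (pi ^+ 2 / 6 * expR L) + expR ((1 - ep) * L) * (L + 1)) * Num.sqrt L =
  ((K + ep) * (1 + ep) * (pi ^+ 2 / 6) + expR (- (ep * L)) * (L + 1) * Num.sqrt L) * expR L.
  have -> : expR ((1 - ep) * L) = expR (- (ep * L)) * expR L by rewrite -expRD; congr expR; ring.
  by rewrite /k; field; rewrite gt_eqF.
rewrite ler_pM2r ?expR_gt0//.
have h3 := HL1 L ltac:(lra).
have z2 : pi ^+ 2 / 6 <= 2 :> R.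
  apply: (@seqto_le _ _ _ _ 0%N (@zeta2 R)) => n _; exact: zsum_le2.
have z0 : 0 <= pi ^+ 2 / 6 :> R by rewrite divr_ge0 ?sqr_ge0.
have h4 : (ep + K * ep + ep * ep) * (pi ^+ 2 / 6) <= e / 2.
  apply: (@le_trans _ _ ((ep + K * ep + ep * ep) * 2)).
    have e1 := ltW ep0; have k1 := ltW K0.
    by rewrite ler_wpM2l//; apply: addr_ge0; [apply: addr_ge0|] => //; exact: mulr_ge0.
  have : ep * ep <= ep * 1 by rewrite ler_wpM2l ?(ltW ep0)//; lra.
  lra.
move: h3 h4; move: (expR _ * _ * _) (pi ^+ 2 / 6 : R) => a z h3 h4.
lra.
Qed.

Lemma Phi_lower_arith (k ep e z a Z D : R) : 0 < k -> 0 < ep -> ep <= 2^-1 -> ep <= k ->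
  ep * (2 * (2 + 6 * k)) <= e -> a <= e / 2 -> z <= 2 -> 1 <= z -> z - 2 * ep <= Z -> 1 - ep <= D ->
  k * z - e <= (k - ep) * (1 - ep) * Z * D - a.
Proof.
move=> K0 ep0 ep2 epK epe h3 z2 z1 hZ hD.
have q0 : 0 <= k - ep by lra.
have q1 : (k - ep) * (z - 2 * ep) <= (k - ep) * Z by rewrite ler_wpM2l.
have q2 : k * z - 2 * ep - 2 * ep * k <= (k - ep) * (z - 2 * ep).
  have := mulr_ge0 (ltW ep0) (ltW ep0); have : ep * z <= ep * 2 by rewrite ler_pM2l.
  lra.
have Z0 : 0 <= (k - ep) * Z by rewrite mulr_ge0//; lra.
have q3 : (k - ep) * Z * ((1 - ep) * (1 - ep)) <= (k - ep) * Z * ((1 - ep) * D).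
  by rewrite ler_wpM2l// ler_wpM2l//; lra.
have q4 : (k - ep) * Z * (1 - 2 * ep) <= (k - ep) * Z * ((1 - ep) * (1 - ep)).
  by rewrite ler_wpM2l//; have := mulr_ge0 (ltW ep0) (ltW ep0); lra.
have q5 : (k * z - 2 * ep - 2 * ep * k) * (1 - 2 * ep) <= (k - ep) * Z * (1 - 2 * ep).
  by rewrite ler_wpM2r; lra.
have q6 : k * z - 2 * ep - 2 * ep * k - 4 * ep * k <= (k * z - 2 * ep - 2 * ep * k) * (1 - 2 * ep).
  have := mulr_ge0 (ltW ep0) (ltW ep0); have := mulr_ge0 (mulr_ge0 (ltW ep0) (ltW ep0)) (ltW K0).
  have : ep * k * z <= ep * k * 2 by rewrite ler_wpM2l// mulr_ge0// ltW.
  lra.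
have -> : (k - ep) * (1 - ep) * Z * D = (k - ep) * Z * ((1 - ep) * D) by ring.
lra.
Qed.

(** A constant density from below fails for very large m, since sqrt (ln m) grows, so the sum stops
    at B = exp ((1 + ep) L). Then B t >= ep L, and the truncated sum of [hlog] misses only a
    proportion [ep]. *)
Lemma Phi_lower (e : R) : 0 < e -> exists2 L0, 1 <= L0 & forall L, L0 <= L -> exists B,
  (K * (pi ^+ 2 / 6) - e) * expR L / Num.sqrt L <= Phi B (expR (- L)).
Proof.
move=> e0; have K0 := landau_gt0 R.
pose ep := Num.min (Num.min 2^-1 K) (e / (2 * (2 + 6 * K))).
have d0 : 0 < 2 * (2 + 6 * K) by rewrite mulr_gt0//; lra.
have ep0 : 0 < ep by rewrite !lt_min invr_gt0 ltr0n K0 divr_gt0.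
have ep2 : ep <= 2^-1 by rewrite !ge_min lexx.
have epK : ep <= K by rewrite !ge_min lexx orbT.
have epe : ep * (2 * (2 + 6 * K)) <= e by rewrite -ler_pdivlMr// !ge_min lexx !orbT.
clearbody ep.
have [T T1 HT] := landau_nat ep0.
have e20 : 0 < e / 2 by lra.
have [L1 L11 HL1] := error_small ep0 e20.
have [J HJ] := @zeta2 R _ ep0; have zJ := HJ J (leqnn _); clear HJ.
rewrite ler_distl in zJ; move/andP: zJ => [zJ _].
have Je0 : 0 <= J%:R / ep by rewrite divr_ge0// ltW.
have ep20 : 0 < (ep ^+ 2)^-1 by rewrite invr_gt0 exprn_gt0.
have K2 : 0 <= K ^+ 2 by rewrite sqr_ge0.
exists (2 * T + L1 + J%:R / ep + (ep ^+ 2)^-1 + K ^+ 2); first lra.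
move=> L hL; have L0 : 0 < L by lra.
have LT : T <= (1 - ep) * L.
  apply: (@le_trans _ _ (2^-1 * L)); first lra.
  by rewrite ler_pM2r//; lra.
have LJ : J%:R / ep <= L by lra.
have Lep : (ep ^+ 2)^-1 <= L by lra.
have LK : K ^+ 2 <= L by lra.
have LL1 : L1 <= L by lra.
clear hL.
have sL : 0 < Num.sqrt L by rewrite sqrtr_gt0.
pose k := (K - ep) * (1 - ep) / Num.sqrt L.
have k0 : 0 <= k by rewrite divr_ge0 ?mulr_ge0//; lra.
have k1 : k <= 1.
  rewrite ler_pdivrMr// mul1r; apply: (@le_trans _ _ K); last first.
    by rewrite -[leLHS]ger0_norm ?(ltW K0)// -sqrtr_sqr ler_wsqrtr.
  by rewrite -[leRHS]mulr1; apply: ler_pM; lra.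
have t0 := expR_gt0 (- L).
have X0 := expR_ge0 ((1 - ep) * L).
pose B := fl ((1 + ep) * L); exists B.
have bound m : (0 < m)%N -> (m <= B)%N -> k * m%:R - expR ((1 - ep) * L) <= Mr R 2 m.
  move=> m0 mB; have /andP[M0 _] := Mr_bound R 2 m.
  have [h|h] := leP (ln m%:R) ((1 - ep) * L).
    apply: le_trans M0; rewrite subr_le0; apply: le_trans (small_m_bound m0 h).
    by rewrite ler_piMl.
  rewrite lerBlDr; apply: ler_wpDr => //.
  have [h' _] := HT m m0 (le_trans LT (ltW h)).
  have lm : ln m%:R <= (1 + ep) * L by rewrite -fl_geln.
  have s1 : (1 - ep) * Num.sqrt (ln m%:R) <= Num.sqrt L.
    have r0 : 0 <= 1 - ep by lra.
    rewrite -[X in X * _](ger0_norm r0) -sqrtr_sqr -sqrtrM ?sqr_ge0// ler_wsqrtr//.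
    apply: (@le_trans _ _ ((1 - ep) ^+ 2 * ((1 + ep) * L))); first by rewrite ler_wpM2l ?sqr_ge0.
    rewrite mulrA ler_piMl ?(ltW L0)//.
    have : 0 <= ep * (1 + ep - ep * ep).
      apply: mulr_ge0; first exact: ltW.
      have : ep * ep <= 2^-1 * 2^-1 by apply: ler_pM => //; exact: ltW.
      lra.
    by rewrite expr2; lra.
  rewrite /k mulrAC ler_pdivrMr//.
  apply: le_trans (ler_wpM2l M0 s1).
  rewrite mulrCA mulrAC mulrC; apply: ler_wpM2l => //; lra.
have h := Phi_ge t0 X0 bound; apply: le_trans h.
have eL : (expR (- L))^-1 = expR L by rewrite expRN invrK.
have eLe : expR (- L) <= L^-1.
  rewrite expRN lef_pV2 ?posrE ?expR_gt0//; have := expR_ge1Dx L; lra.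
have Jt : J%:R * expR (- L) <= ep.
  apply: le_trans (ler_wpM2l (ler0n _ J) eLe) _.
  by rewrite ler_pdivrMr// mulrC -ler_pdivrMr.
have Jt1 : J%:R * expR (- L) <= 1 by lra.
have h1 := ler_wpM2l k0 (sum_hlog_ge B t0 Jt1).
have h2 := ler_wpM2l X0 (hlog_small (ltW L0)).
have BL : ep * L <= B%:R * expR (- L).
  have /andP[_ b1] := fl_itv ((1 + ep) * L); rewrite -/B in b1.
  have b2 : expR (ep * L) - expR (- L) <= B%:R * expR (- L).
    have -> : expR (ep * L) = expR ((1 + ep) * L) * expR (- L) by rewrite -expRD; congr expR; ring.
    rewrite lerBlDr -{3}[expR (- L)]mul1r -mulrDl ler_pM2r// natr1; exact: ltW.
  apply: le_trans b2; have := expR_ge1Dx (ep * L).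
  have : expR (- L) <= 1 by rewrite -[leRHS]expR0 ler_expR oppr_le0 ltW.
  lra.
have eB : expR (- (B%:R * expR (- L))) <= ep.
  apply: (@le_trans _ _ (expR (- (ep * L)))); first by rewrite ler_expR lerN2.
  rewrite expRN -[leRHS]invrK lef_pV2 ?posrE ?expR_gt0 ?invr_gt0//.
  apply: (@le_trans _ _ (ep * L)); last by have := expR_ge1Dx (ep * L); lra.
  by rewrite -ler_pdivrMl//; apply: le_trans Lep; rewrite expr2 invfM.
apply: le_trans (_ : k * ((zsum R J - J%:R * expR (- L)) * (1 - expR (- (B%:R * expR (- L)))) / expR (- L))
   - expR ((1 - ep) * L) * (L + 1) <= _); last by apply: lerD => //; rewrite lerN2.
rewrite eL ler_pdivrMr//.
set Z := zsum R J - _; set D := 1 - expR (- (B%:R * _)).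
have -> : (k * (Z * D * expR L) - expR ((1 - ep) * L) * (L + 1)) * Num.sqrt L =
  ((K - ep) * (1 - ep) * Z * D - expR (- (ep * L)) * (L + 1) * Num.sqrt L) * expR L.
  have -> : expR ((1 - ep) * L) = expR (- (ep * L)) * expR L by rewrite -expRD; congr expR; ring.
  by rewrite /k; field; rewrite gt_eqF.
rewrite ler_pM2r ?expR_gt0//.
have h3 := HL1 L LL1.
have z2 : pi ^+ 2 / 6 <= 2 :> R.
  apply: (@seqto_le _ _ _ _ 0%N (@zeta2 R)) => n _; exact: zsum_le2.
have z1 : 1 <= pi ^+ 2 / 6 :> R.
  by apply: le_trans (zsum_le R 1); rewrite /zsum big_nat1 expr1n invr1.
have hZ : pi ^+ 2 / 6 - 2 * ep <= Z by rewrite /Z; lra.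
have hD : 1 - ep <= D by rewrite /D lerD2l lerN2.
move: h3 z2 z1 hZ hD; move: (expR _ * _ * _) (pi ^+ 2 / 6 : R) Z D => a z Z D h3 z2 z1 hZ hD.
exact: (Phi_lower_arith K0 ep0 ep2 epK epe h3 z2 z1 hZ hD).
Qed.

End EulerProductLog.

(** * Partitions *)

Section PartitionRecursion.
Implicit Types (S T : set nat) (b k n : nat) (s : seq nat).

Lemma sorted_geq_cons b s : sorted geq (b :: s) = all (leq^~ b) s && sorted geq s.
Proof.
rewrite /= path_sortedE//.
by move=> y x z /= xy yz; exact: leq_trans yz xy.
Qed.

(** Parts are at most [b] on the left; as the sequence is sorted downwards, [b] occurs exactly when
    it is the head. *)
Lemma partitions_in_cons S b k : S b -> (0 < b <= k)%N ->
  partitions_in (S `&` `I_b.+1) k =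
  partitions_in (S `&` `I_b) k `|` cons b @` partitions_in (S `&` `I_b.+1) (k - b).
Proof.
move=> Sb /andP[b0 bk]; apply/seteqP; split=> [[|x s]|s [[ps h]|[s' [/and3P[so po /eqP su] h] <-]]].
- by move=> [ps _]; left; split.
- rewrite /partitions_in /= => -[]; rewrite /is_partition sorted_geq_cons => /and3P[/andP[xs so] /= /andP[x0 po] /eqP su] h.
  have [_ /=] := h x (mem_head _ _); rewrite ltnS leq_eqVlt => /orP[/eqP xb|xb].
    right; exists s; last by rewrite xb.
    split; last by move=> m ms; apply: h; rewrite inE ms orbT.
    by rewrite /is_partition so po -su xb addKn eqxx.
  left; split; first by rewrite xs so x0 po su eqxx.
  move=> m mx; split; first by have [] := h m mx.
  move: mx; rewrite inE => /orP[/eqP -> //|ms].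
  exact: leq_ltn_trans (allP xs _ ms) xb.
- by split=> // m ms; have [Sm /= mb] := h m ms; split => //; exact: ltnW.
- split; last first.
    move=> m; rewrite inE => /orP[/eqP ->|/h//]; by split => /=.
  rewrite /is_partition sorted_geq_cons so /= b0 po su subnKC// eqxx !andbT.
  by apply/allP => m /h [_ /=].
Qed.

Lemma eq_partitions_in S T k : (forall m, (0 < m <= k)%N -> S m <-> T m) ->
  partitions_in S k = partitions_in T k.
Proof.
suff H A B : (forall m, (0 < m <= k)%N -> A m -> B m) -> partitions_in A k `<=` partitions_in B k.
  by move=> ST; apply/seteqP; split; apply: H => m /ST [].
move=> AB s [ps h]; split=> // m ms; apply: AB (h m ms).
have /and3P[_ /allP po /eqP <-] := ps; rewrite po//=.
elim: s ms {ps h po} => //= x s IH; rewrite inE => /orP[/eqP ->|/IH ms]; first exact: leq_addr.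
exact: leq_trans ms (leq_addl _ _).
Qed.

Lemma npartitions_in_cons S b k : S b -> (0 < b <= k)%N ->
  npartitions_in (S `&` `I_b.+1) k =
  (npartitions_in (S `&` `I_b) k + npartitions_in (S `&` `I_b.+1) (k - b))%N.
Proof.
move=> Sb bk; rewrite /npartitions_in partitions_in_cons//.
rewrite fset_setU; [|exact: finite_partitions_in|exact/finite_image/finite_partitions_in].
rewrite cardfsU fset_set_image; last exact: finite_partitions_in.
rewrite card_imfset /=; last by move=> s s' [].
rewrite [X in (_ - X)%N](_ : _ = 0%N) ?subn0//; apply/eqP; rewrite cardfs_eq0.
rewrite -fset_set_image; last exact: finite_partitions_in.
rewrite -fset_setI; [|exact: finite_partitions_in|exact/finite_image/finite_partitions_in].
rewrite (_ : _ `&` _ = set0) ?fset_set0//.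
apply/seteqP; split => // s [[_ h] [s' _ e]].
by have := h b; rewrite -e mem_head => /(_ isT)[_ /=]; rewrite ltnn.
Qed.

Lemma npartitions_in_sub S T k : S `<=` T -> (npartitions_in S k <= npartitions_in T k)%N.
Proof.
move=> ST; apply/fsubset_leq_card/fsubsetP => s.
rewrite !in_fset_set ?inE; [|exact: finite_partitions_in|exact: finite_partitions_in].
by move=> [ps h]; split=> // m /h /ST.
Qed.

Lemma npartitions_in_skip S b k : ~ S b \/ (k < b)%N \/ b = 0%N ->
  npartitions_in (S `&` `I_b.+1) k = npartitions_in (S `&` `I_b) k.
Proof.
move=> h; rewrite /npartitions_in; congr (#|` fset_set _|).
apply: eq_partitions_in => m /andP[m0 mk]; split=> -[Sm /= mb]; split=> //=; last exact: ltnW.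
rewrite ltn_neqAle -ltnS mb andbT; apply/eqP => e.
by case: h => [|[kb|b0]]; [rewrite -e|move: mk; rewrite e leqNgt kb|rewrite e b0 in m0].
Qed.

Lemma npartitions_in_I S b k : (k < b)%N -> npartitions_in (S `&` `I_b) k = npartitions_in S k.
Proof.
move=> kb; rewrite /npartitions_in; congr (#|` fset_set _|).
apply: eq_partitions_in => m /andP[m0 mk]; split=> [[]//|Sm]; split=> //=.
exact: leq_ltn_trans kb.
Qed.

Lemma npartitions_in0 S : npartitions_in S 0 = 1%N.
Proof.
rewrite /npartitions_in (_ : partitions_in S 0 = [set [::]]) ?fset_set1 ?cardfs1//.
apply/seteqP; split => [[|x s] [/and3P[_ /= ]]//|s ->]; last by split.
by case: x.
Qed.

Lemma npartitions_in_small S b k : (b <= 1)%N -> npartitions_in (S `&` `I_b) k = (k == 0%N).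
Proof.
case: k => [|k] b1; first by rewrite npartitions_in0.
rewrite /npartitions_in (_ : partitions_in _ _ = set0) ?fset_set0//.
apply/seteqP; split => // -[|x s] [/and3P[_ /=]]// /andP[x0 _] _ h.
have [_ /= xb] := h x (mem_head _ _).
by have := leq_trans xb b1; rewrite ltnS leqNgt x0.
Qed.

(** Appending a part 1 at the end is injective and keeps the sequence sorted. *)
Lemma npartitions_in_mono S k : S 1%N -> (npartitions_in S k <= npartitions_in S k.+1)%N.
Proof.
move=> S1; rewrite /npartitions_in.
have inj : injective (fun s : seq nat => rcons s 1%N) by move=> s s' /eqP; rewrite eqseq_rcons => /andP[/eqP].
have <- : #|` [fset rcons s 1%N | s in fset_set (partitions_in S k)]%fset| = #|` fset_set (partitions_in S k)|.
  by rewrite card_imfset.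
apply/fsubset_leq_card/fsubsetP => s /imfsetP[s' /=].
rewrite in_fset_set ?inE; last exact: finite_partitions_in.
move=> [/and3P[so po /eqP su] h ->]; rewrite in_fset_set ?inE; last exact: finite_partitions_in.
split.
  rewrite /is_partition all_rcons po /= sumn_rcons su addn1 eqxx !andbT.
  case: s' so po {su h} => //= x s' so /andP[x0 po]; rewrite rcons_path so /=.
  by elim: s' x so po x0 => //= y s' IH x /andP[_ so] /andP[y0 po] _; exact: IH.
by move=> m; rewrite mem_rcons inE => /orP[/eqP -> //|/h].
Qed.

Lemma npartitions_in_le S k n : S 1%N -> (k <= n)%N -> (npartitions_in S k <= npartitions_in S n)%N.
Proof.
move=> S1 /subnK <-; elim: (n - k)%N => // d IH.
by apply: leq_trans IH _; rewrite addSn; exact: npartitions_in_mono.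
Qed.

Lemma npartitions_in_gt0 S n : S 1%N -> (0 < npartitions_in S n)%N.
Proof. by move=> S1; rewrite -(npartitions_in0 S); exact: npartitions_in_le. Qed.

End PartitionRecursion.

(** * Euler's product for the generating function at a real point *)

Section GeneratingFunction.
Variables (R : realType) (S : set nat) (x : R).
Hypotheses (x0 : 0 < x) (x1 : x < 1).

Definition pgf N : R := \sum_(0 <= k < N) (npartitions_in S k)%:R * x ^+ k.

Definition eprod B : R := \prod_(1 <= m < B) (1 - (`[< S m >])%:R * x ^+ m)^-1.

Let W B N : R := \sum_(0 <= k < N) (npartitions_in (S `&` `I_B) k)%:R * x ^+ k.

Let WS B N : (0 < B)%N -> W B.+1 N = W B N + (`[< S B >])%:R * x ^+ B * W B.+1 (N - B).
Proof.
move=> B0; have [SB|SB] := pselect (S B); last first.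
  rewrite (asboolF SB) mul0r mul0r addr0; apply: eq_bigr => k _.
  by rewrite npartitions_in_skip//; left.
rewrite (asboolT SB) mul1r /W.
have tail N' : (N' <= B)%N -> \sum_(0 <= k < N') (npartitions_in (S `&` `I_B.+1) k)%:R * x ^+ k =
    \sum_(0 <= k < N') (npartitions_in (S `&` `I_B) k)%:R * x ^+ k.
  move=> NB; apply: eq_big_nat => k /andP[_ kN]; rewrite npartitions_in_skip//; right; left.
  exact: leq_trans kN NB.
have [NB|BN] := leqP N B.
  by rewrite (eqP (NB : N - B == 0)%N) [X in _ * X]big_geq// mulr0 addr0 tail.
rewrite (big_cat_nat (n := B)) //=; last exact: ltnW.
rewrite [in RHS](big_cat_nat (n := B)) //=; last exact: ltnW.
rewrite tail// -addrA; congr (_ + _).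
rewrite mulr_sumr -{1 3}(add0n B) !big_addn -big_split /=.
apply: eq_big_nat => k _; rewrite npartitions_in_cons//; last by rewrite B0 leq_addl.
by rewrite addnK natrD mulrDl exprD; congr (_ + _); rewrite mulrA mulrC.
Qed.

Let W_mono B N : W B N <= W B N.+1.
Proof. by rewrite /W big_nat_recr//= lerDl mulr_ge0// exprn_ge0// ltW. Qed.

Let W_le B N N' : (N <= N')%N -> W B N <= W B N'.
Proof. by move=> /subnK <-; elim: (N' - N)%N => // d IH; exact: le_trans IH (W_mono _ _). Qed.

(** As N grows, the recursion [WS] becomes l = eprod + y l, one more factor 1 / (1 - y). The upper
    bound is proved alongside because it is what makes the partial sums converge. *)
Let W_eprod B : (forall N, W B.+1 N <= eprod B.+1) /\ seqto (W B.+1) (eprod B.+1).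
Proof.
elim: B => [|B [U L]].
  have e N : W 1 N.+1 = 1.
    rewrite /W big_nat_recl//= npartitions_in_small// eqxx expr0 mulr1 big1 ?addr0// => k _.
    by rewrite npartitions_in_small// mul0r.
  rewrite /eprod big_geq//; split.
    by case=> [|N]; rewrite ?e// /W big_geq.
  by move=> ep ep0; exists 1%N => -[//|N] _; rewrite e subrr normr0 ltW.
have -> : eprod B.+2 = eprod B.+1 / (1 - (`[< S B.+1 >])%:R * x ^+ B.+1) by rewrite /eprod big_nat_recr.
have := WS _ (ltn0Sn B); set y := _ * x ^+ _ => hW.
have [y0 y1] : 0 <= y /\ y < 1.
  split; first by rewrite mulr_ge0// exprn_ge0// ltW.
  apply: (@le_lt_trans _ _ (x ^+ B.+1)); last by rewrite exprn_ilt1// ltW.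
  by rewrite ler_piMl ?exprn_ge0 ?(ltW x0)//; case: `[< _ >].
have y1' : 0 < 1 - y by rewrite subr_gt0.
have U' N : W B.+2 N <= eprod B.+1 / (1 - y).
  rewrite ler_pdivlMr// mulrBr mulr1 lerBlDr {1}hW mulrC; apply: lerD => //.
  by rewrite ler_wpM2r// W_le// leq_subr.
split=> //; have [l Hl] := seqto_monotone (W_mono B.+2) U'.
suff e : l = eprod B.+1 + y * l.
  rewrite (_ : _ / _ = l)//; apply: (mulIf (lt0r_neq0 y1')).
  by rewrite divfK ?gt_eqF//; lra.
apply: (seqto_unique Hl).
apply: (eq_seqto (fun N => esym (hW N))).
have shift : seqto (fun N => W B.+2 (N - B.+1)) l.
  by move=> ep /Hl [M HM]; exists (M + B.+1)%N => N MN; apply: HM; rewrite leq_subRL ?(leq_trans (leq_addl _ _) MN)// addnC.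
apply/seqtoP; apply: cvgD; first exact/seqtoP.
by apply/seqtoP; exact: seqtoM (seqto_cst y) shift.
Qed.

Lemma pgf_le_eprod N : pgf N <= eprod N.+1.
Proof.
have [U _] := W_eprod N; apply: le_trans (U N).
rewrite le_eqVlt; apply/orP; left; apply/eqP; apply: eq_big_nat => k /andP[_ kN].
by rewrite npartitions_in_I// ltnS ltnW.
Qed.

Lemma eprod_le Y B : (forall N, pgf N <= Y) -> eprod B.+1 <= Y.
Proof.
move=> H; have [_ L] := W_eprod B; apply: (seqto_le (N := 0) L) => N _.
apply: le_trans (H N); apply: ler_sum => k _.
rewrite ler_wpM2r ?exprn_ge0 ?(ltW x0)// ler_nat; apply: npartitions_in_sub.
by move=> m [].
Qed.

End GeneratingFunction.

(** * Saddle-point inequalities for the coefficients *)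

Section EulerProductPhi.
Variable R : realType.

Lemma eprod_Phi B (t : R) : 0 < t -> eprod sum_two_squares (expR (- t)) B.+1 = expR (Phi B t).
Proof.
move=> t0; rewrite /eprod /Phi.
rewrite expR_sum; apply: eq_big_nat => m /andP[m0 _].
have -> : `[< sum_two_squares m >] = `[< is_sumsq m >].
  by apply: asbool_equiv_eq; split=> [[]//|]; split.
rewrite /sqf; case: `[< _ >]; last by rewrite !mul0r subr0 invr1 expR0.
rewrite !mul1r /hlog [RHS]expRN lnK -?expRM_natl ?mulrN//.
rewrite posrE subr_gt0.
by have [] := expRN_lt1 (_ : 0 < m%:R * t); rewrite ?mulr_gt0 ?ltr0n.
Qed.

Lemma mul_expR_le_pgf S (t : R) n : (npartitions_in S n)%:R * expR (- (n%:R * t)) <= pgf S (expR (- t)) n.+1.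
Proof.
rewrite /pgf big_nat_recr//= -expRM_natl mulrN lerDr.
by apply: sumr_ge0 => k _; rewrite mulr_ge0// exprn_ge0// expR_ge0.
Qed.

(* Splitting the series at [k = n / mu^2] and [k = n]: the two outer ranges
   are dominated by the series at [mu t] and at [t]. *)
Lemma pgf_split S (t la mu : R) n N : S 1%N -> 0 < t -> 1 < la -> la < mu ->
  pgf S (expR (- (la * t))) N <=
  expR ((mu - la) / mu ^+ 2 * (n%:R * t)) * pgf S (expR (- (mu * t))) N +
  expR (- ((la - 1) * (n%:R * t))) * pgf S (expR (- t)) N +
  n.+1%:R * ((npartitions_in S n)%:R * expR (- (la / mu ^+ 2 * (n%:R * t)))).
Proof.
move=> S1 t0 la1 lamu.
have mu0 : 0 < mu by lra.
have mu2 : 0 < mu ^+ 2 by rewrite exprn_gt0.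
set E1 := expR ((mu - la) / _ * _); set E2 := expR (- ((la - 1) * _)); set E3 := _%:R * expR _.
have E30 : 0 <= E3 by rewrite mulr_ge0// expR_ge0.
apply: (@le_trans _ _ (\sum_(0 <= k < N) (E1 * ((npartitions_in S k)%:R * expR (- (mu * t)) ^+ k) +
   E2 * ((npartitions_in S k)%:R * expR (- t) ^+ k) + (k < n.+1)%:R * E3))); last first.
  rewrite !big_split /= -!mulr_sumr -mulr_suml lerD2l ler_wpM2r// -natr_sum ler_nat.
  suff -> : (\sum_(0 <= k < N) (k < n.+1) = minn N n.+1)%N by exact: geq_minr.
  elim: N => [|N IH]; first by rewrite big_geq// min0n.
  by rewrite big_nat_recr//= IH; lia.
apply: ler_sum => k _.
have e (a : R) : expR (- (a * t)) ^+ k = expR (- (a * (k%:R * t))).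
  by rewrite -expRM_natl mulrN mulrCA.
have -> : expR (- t) ^+ k = expR (- (k%:R * t)) by rewrite -expRM_natl mulrN.
rewrite (e la) (e mu).
set p := (npartitions_in S k)%:R.
have p0 : 0 <= p by [].
have T1 : 0 <= E1 * (p * expR (- (mu * (k%:R * t)))) by rewrite !mulr_ge0// expR_ge0.
have T2 : 0 <= E2 * (p * expR (- (k%:R * t))) by rewrite !mulr_ge0// expR_ge0.
have T3 : 0 <= (k < n.+1)%:R * E3 by rewrite mulr_ge0.
have [h1|h1] := leP (k%:R * mu ^+ 2) (n%:R : R).
  apply: le_trans (_ : _ <= E1 * (p * expR (- (mu * (k%:R * t))))) _; last by lra.
  rewrite [leRHS]mulrCA -expRD ler_wpM2l// ler_expR.
  have : k%:R * t <= n%:R * t / mu ^+ 2 by rewrite ler_pdivlMr// mulrAC ler_wpM2r// ltW.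
  move=> /(ler_wpM2l (_ : 0 <= mu - la)) h; have := h ltac:(lra).
  by rewrite mulrBl; move: (k%:R * t) (n%:R * t) (mu ^+ 2)^-1 => a b c; lra.
have [h2|h2] := leqP k n.
  apply: le_trans (_ : _ <= (k < n.+1)%:R * E3) _; last by lra.
  rewrite ltnS h2 mul1r; apply: ler_pM; rewrite ?expR_ge0//.
    by rewrite ler_nat npartitions_in_le.
  rewrite ler_expR lerN2 -mulrA; apply: ler_wpM2l; first by lra.
  by rewrite ler_pdivrMl// [leRHS]mulrA ler_wpM2r ?(ltW t0)// mulrC ltW.
apply: le_trans (_ : _ <= E2 * (p * expR (- (k%:R * t)))) _; last by lra.
rewrite [leRHS]mulrCA -expRD ler_wpM2l// ler_expR.
have h : n%:R * t <= k%:R * t by rewrite ler_wpM2r ?(ltW t0)// ler_nat ltnW.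
have /(ler_wpM2l (_ : 0 <= la - 1)) := h.
by move=> /(_ ltac:(lra)); move: (k%:R * t) (n%:R * t) => a b; lra.
Qed.

(** In units of A, the outer ranges of [pgf_split] have exponents below 1 / la by (mu - la)^2 / (la
    mu^2) and (la - 1)^2 / la. These gaps absorb the errors [de] and a factor 4, so the middle range
    carries at least half of the series; 1 / la + la / mu^2 is at least (1 - s) + (1 - 3 s). *)
Lemma saddle_lower_bound S (t s de : R) n B : S 1%N -> 0 < t -> 0 < s ->
  let A := n%:R * t in let la := 1 + s in let mu := 1 + 2 * s in
  4 * de <= (la - 1) ^+ 2 / la -> 4 * de <= (mu - la) ^+ 2 / (la * mu ^+ 2) -> 3 <= 2 * de * A ->
  (forall N, pgf S (expR (- (mu * t))) N <= expR ((1 / mu + de) * A)) ->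
  (forall N, pgf S (expR (- t)) N <= expR ((1 + de) * A)) ->
  expR ((1 / la - de) * A) <= eprod S (expR (- (la * t))) B.+1 ->
  (2 - 4 * s - de) * A <= ln (2 * n.+1%:R * (npartitions_in S n)%:R).
Proof.
move=> S1 t0 s0 A la mu g1 g2 deA Umu U1 Lla.
have la1 : 1 < la by rewrite /la; lra.
have lamu : la < mu by rewrite /la /mu; lra.
have la0 : 0 < la by lra.
have mu0 : 0 < mu by lra.
have A0 : 0 <= A by rewrite mulr_ge0// ltW.
set X := expR ((1 / la - de) * A).
set p := (npartitions_in S n)%:R.
have p0 : 0 < p by rewrite ltr0n npartitions_in_gt0.
have n0 : 0 < n.+1%:R :> R by rewrite ltr0n.
have small (a : R) : a + 2 * de <= 1 / la - de -> expR (a * A) <= X / 4.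
  move=> h; rewrite ler_pdivlMr//; apply: (@le_trans _ _ (expR (a * A) * expR (2 * de * A))).
    by rewrite ler_wpM2l ?expR_ge0//; have := expR_ge1Dx (2 * de * A); lra.
  by rewrite -expRD ler_expR -mulrDl ler_wpM2r.
have h1 : expR ((mu - la) / mu ^+ 2 * A) * expR ((1 / mu + de) * A) <= X / 4.
  rewrite -expRD -mulrDl; apply: small.
  have e : (mu - la) ^+ 2 / (la * mu ^+ 2) = 1 / la - ((mu - la) / mu ^+ 2 + 1 / mu).
    by field; rewrite !gt_eqF.
  by move: g2; rewrite e; move: (_ / mu ^+ 2) (1 / mu) (1 / la) => a b c; lra.
have h2 : expR (- ((la - 1) * A)) * expR ((1 + de) * A) <= X / 4.
  rewrite -expRD -mulNr -mulrDl; apply: small.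
  have e : (la - 1) ^+ 2 / la = 1 / la - (2 - la) by field; rewrite gt_eqF.
  by move: g1; rewrite e; move: (1 / la) => c; lra.
have h3 : X <= X / 4 + X / 4 + n.+1%:R * (p * expR (- (la / mu ^+ 2 * A))).
  apply: le_trans Lla _; apply: eprod_le.
  - exact: expR_gt0.
  - by have [] := expRN_lt1 (mulr_gt0 la0 t0).
  - move=> N; apply: le_trans (pgf_split n N S1 t0 la1 lamu) _.
    apply: lerD => //; apply: lerD.
      by apply: le_trans h1; rewrite ler_wpM2l ?expR_ge0.
    by apply: le_trans h2; rewrite ler_wpM2l ?expR_ge0.
have h4 : expR ((1 / la - de + la / mu ^+ 2) * A) <= 2 * n.+1%:R * p.
  rewrite mulrDl expRD -/X -[X in _ * expR X]opprK expRN ler_pdivrMr ?expR_gt0//.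
  by move: h3; rewrite -!mulrA; move: (n.+1%:R * _) => Z; lra.
rewrite -ler_expR lnK; last by rewrite posrE !mulr_gt0.
apply: le_trans h4; rewrite ler_expR; apply: ler_wpM2r => //.
have l1 : 1 - s <= 1 / la.
  by rewrite ler_pdivlMr// /la; have := sqr_ge0 s; rewrite expr2; lra.
have l2 : 1 - 3 * s <= la / mu ^+ 2.
  rewrite ler_pdivlMr ?exprn_gt0// /la /mu !expr2.
  have : 0 <= s * s by rewrite mulr_ge0// ltW.
  have : 0 <= s * s * s by rewrite !mulr_ge0// ltW.
  lra.
lra.
Qed.

End EulerProductPhi.

(** * Asymptotics of the logarithm of the partition function *)

Section GrowthOfPartitions.
Variable R : realType.
Local Notation K := (landau_ramanujan R).
Local Notation p n := ((npartitions_in sum_two_squares n)%:R : R).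

(* With [v = ln n / 2], the saddle point is [saddle 1 v] and
   [ln (p n)] is asymptotic to [2 * growth v]. *)
Definition phi_const : R := K * (pi ^+ 2 / 6).
Definition growth (v : R) : R := Num.sqrt phi_const * expR v / rt4 v.
Definition saddle (la v : R) : R := la * Num.sqrt phi_const * expR (- v) / rt4 v.

Lemma phi_const_gt0 : 0 < phi_const.
Proof. by rewrite /phi_const mulr_gt0 ?landau_gt0// divr_gt0// exprn_gt0// pi_gt0. Qed.

Lemma sqrt_phi_const_gt0 : 0 < Num.sqrt phi_const.
Proof. by rewrite sqrtr_gt0 phi_const_gt0. Qed.

Lemma growth_gt0 v : 0 < v -> 0 < growth v.
Proof. by move=> v0; rewrite /growth divr_gt0 ?rt4_gt0// mulr_gt0 ?sqrt_phi_const_gt0 ?expR_gt0. Qed.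

Lemma saddle_gt0 la v : 0 < la -> 0 < v -> 0 < saddle la v.
Proof. by move=> l0 v0; rewrite /saddle divr_gt0 ?rt4_gt0// !mulr_gt0 ?sqrt_phi_const_gt0 ?expR_gt0. Qed.

Lemma saddleE la v : saddle la v = la * saddle 1 v.
Proof. by rewrite /saddle mul1r !mulrA. Qed.

(** With v = ln n / 2, anything of order ln n is negligible: the factor n + 1 lost in the lower
    bound, and later the prefactor. *)
Lemma growth_large C : exists2 V, 1 <= V & forall v, V <= v -> C * (1 + v) <= growth v.
Proof.
have [C3 C30 HC] := @pow_exp_bound R 1 3 ltr01.
have b0 := sqrt_phi_const_gt0.
exists (1 + `|C| * C3 / Num.sqrt phi_const).
  by rewrite lerDl divr_ge0 ?mulr_ge0// ltW.
move=> v vV.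
have v1 : 1 <= v by apply: le_trans vV; rewrite lerDl divr_ge0 ?mulr_ge0// ltW.
have v0 : 0 < v by lra.
have r0 := rt4_gt0 v0.
have rv : rt4 v <= 1 + v.
  have := rt4_ge1 v1 => r1; have := rt4_X4 (ltW v0).
  have : rt4 v <= rt4 v ^+ 4 by rewrite exprS ler_peMr ?(ltW r0)// exprn_ege1.
  lra.
have h : `|C| * (1 + v) * rt4 v * C3 <= Num.sqrt phi_const * (1 + v) ^+ 3.
  apply: (@le_trans _ _ (`|C| * C3 * (1 + v) ^+ 2)).
    have -> : `|C| * (1 + v) * rt4 v * C3 = `|C| * C3 * ((1 + v) * rt4 v) by ring.
    by apply: ler_wpM2l; rewrite ?mulr_ge0// expr2 ler_wpM2l//; lra.
  have -> : Num.sqrt phi_const * (1 + v) ^+ 3 = Num.sqrt phi_const * (1 + v) * (1 + v) ^+ 2 by ring.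
  apply: ler_wpM2r; first by rewrite exprn_ge0//; lra.
  rewrite -ler_pdivrMl// mulrC; lra.
have C3p : 0 < C3 by have := HC 0 (lexx _); rewrite addr0 expr1n mulr0 expR0 mulr1; lra.
apply: (@le_trans _ _ (`|C| * (1 + v))); first by rewrite ler_wpM2r ?ler_norm//; lra.
rewrite /growth ler_pdivlMr// -(ler_pM2r C3p); apply: le_trans h _.
by rewrite -mulrA ler_wpM2l ?(ltW b0)// mulrC -{2}[v]mul1r HC// ltW.
Qed.

(** The bounds on [Phi] are stated at exp (- L); this shows L ~ v at the saddle. *)
Lemma saddle_log la d : 0 < la -> 0 < d -> exists2 V, 1 <= V &
  forall v, V <= v -> (1 - d) * v <= - ln (saddle la v) <= (1 + d) * v.
Proof.
move=> l0 d0; pose c := ln (la * Num.sqrt phi_const).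
exists (1 + (2 / d) ^+ 2 + 2 * `|c| / d).
  by rewrite -addrA lerDl addr_ge0 ?sqr_ge0// divr_ge0 ?mulr_ge0// ltW.
move=> v vV; have sq0 := sqr_ge0 (2 / d).
have c0 : 0 <= 2 * `|c| / d by rewrite divr_ge0 ?mulr_ge0// ltW.
have v1 : 1 <= v by lra.
have v0 : 0 < v by lra.
have r1 := rt4_ge1 v1.
have r0 : 0 < rt4 v by lra.
have -> : saddle la v = expR (c - v - ln (rt4 v)).
  rewrite !expRD !expRN !lnK ?posrE ?mulr_gt0 ?sqrt_phi_const_gt0//.
  by rewrite /saddle expRN.
rewrite expRK.
have cd : `|c| <= d * v / 2.
  have : 2 * `|c| / d <= v by lra.
  by rewrite ler_pdivrMr// => h; lra.
have sd : Num.sqrt v <= d * v / 2.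
  have h : 2 / d <= Num.sqrt v.
    rewrite -[leLHS]ger0_norm ?divr_ge0 ?(ltW d0)// -sqrtr_sqr ler_wsqrtr//; lra.
  have := ler_wpM2r (sqrtr_ge0 v) h; rewrite -expr2 sqr_sqrtr ?(ltW v0)//.
  by rewrite mulrAC ler_pdivrMr// => h'; lra.
have ln1 : ln (rt4 v) <= Num.sqrt v.
  apply: (@le_trans _ _ (rt4 v)).
    by rewrite -ler_expR lnK ?posrE//; have := expR_ge1Dx (rt4 v); lra.
  by rewrite -rt4_X2 expr2 ler_peMr// ltW.
have ln0 : 0 <= ln (rt4 v) by rewrite ln_ge0.
have := ler_norm c; have := ler_norm (- c); rewrite normrN => h1 h2.
by apply/andP; split; lra.
Qed.

(** At the saddle [phi_const * expR L / Num.sqrt v] is exactly [growth v / la], so only sqrt L has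
    to be exchanged for sqrt v. *)
Lemma Phi_growth la de : 0 < la -> 0 < de -> exists2 V, 1 <= V & forall v, V <= v ->
  (forall B, Phi B (saddle la v) <= (1 / la + de) * growth v) /\
  exists B, (1 / la - de) * growth v <= Phi B (saddle la v).
Proof.
move=> l0 de0; have b0 := phi_const_gt0.
pose k := Num.min (la * de) 1.
have k0 : 0 < k by rewrite /k lt_min mulr_gt0//=.
have k1 : k <= 1 by rewrite /k ge_min lexx orbT.
have kde : k / la <= de by rewrite ler_pdivrMr// mulrC /k ge_min lexx.
have e0 : 0 < phi_const * k / 4 by rewrite divr_gt0// mulr_gt0.
have [U HU1 HU] := Phi_upper e0; have [U' HU'1 HU'] := Phi_lower e0.
have d0 : 0 < k / 4 by rewrite divr_gt0.
have [V V1 HV] := saddle_log l0 d0.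
exists (V + 2 * U + 2 * U'); first by lra.
move=> v vV.
have Vv : V <= v by lra.
have v0 : 0 < v by lra.
have /andP[L1 L2] := HV v Vv.
have s0 := saddle_gt0 l0 v0.
set L := - ln (saddle la v) in L1 L2.
have es : expR (- L) = saddle la v by rewrite /L opprK lnK// posrE.
have hv : v / 2 <= L.
  apply: le_trans L1; have : v * (k / 4) <= v * (1 / 2) by rewrite ler_wpM2l ?(ltW v0)//; lra.
  lra.
have UL : U <= L by lra.
have U'L : U' <= L by lra.
have L0 : 0 < L by lra.
have sL := L0; rewrite -sqrtr_gt0 in sL.
have sv := v0; rewrite -sqrtr_gt0 in sv.
have r0 := rt4_gt0 v0.
have eL : expR L = expR v * rt4 v / (la * Num.sqrt phi_const).
  rewrite -[L]opprK expRN es /saddle expRN; have := expR_gt0 v.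
  by move: (expR v) sqrt_phi_const_gt0 => z p0 z0; field; rewrite !gt_eqF.
have ge : growth v / la = phi_const * expR L / Num.sqrt v.
  rewrite eL /growth -(rt4_X2 v) -{2}(sqr_sqrtr (ltW b0)).
  move: (Num.sqrt phi_const) sqrt_phi_const_gt0 (expR v) => z z0 y.
  by field; rewrite !gt_eqF.
have g0 := growth_gt0 v0.
have eLv : 0 < expR L / Num.sqrt v by rewrite divr_gt0// expR_gt0.
have key (w : R) : w * expR L / Num.sqrt L = (w * (Num.sqrt v / Num.sqrt L)) * (expR L / Num.sqrt v).
  by field; rewrite !gt_eqF.
have sq1 : (1 - k / 4) * Num.sqrt v <= Num.sqrt L.
  have h : 0 <= 1 - k / 4 by lra.
  rewrite -[X in X * _](ger0_norm h) -sqrtr_sqr -sqrtrM ?sqr_ge0// ler_wsqrtr//.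
  apply: le_trans L1; rewrite ler_wpM2r ?(ltW v0)// expr2 ler_piMl//; lra.
have sq2 : Num.sqrt L <= (1 + k / 4) * Num.sqrt v.
  have h : 0 <= 1 + k / 4 by lra.
  rewrite -[X in X * _](ger0_norm h) -sqrtr_sqr -sqrtrM ?sqr_ge0// ler_wsqrtr//.
  apply: le_trans L2 _; rewrite ler_wpM2r ?(ltW v0)// expr2 ler_peMl//; lra.
have rg (z : R) : (1 / la + z) * growth v = growth v / la + z * growth v by ring.
split=> [B|].
  rewrite -es; apply: le_trans (HU _ B UL) _; rewrite -/phi_const key.
  apply: (@le_trans _ _ ((1 + k) * phi_const * (expR L / Num.sqrt v))).
    rewrite ler_wpM2r ?(ltW eLv)// mulrA ler_pdivrMr//.
    apply: (@le_trans _ _ ((1 + k) * phi_const * ((1 - k / 4) * Num.sqrt v))); last first.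
      by rewrite ler_wpM2l// mulr_ge0 ?(ltW b0)//; lra.
    rewrite mulrA ler_wpM2r ?(ltW sv)//.
    have -> : phi_const + phi_const * k / 4 = phi_const * (1 + k / 4) by ring.
    rewrite [leRHS]mulrAC mulrC ler_wpM2r ?(ltW b0)//.
    have : k * k <= k * 1 by rewrite ler_wpM2l// ltW.
    lra.
  have -> : (1 + k) * phi_const * (expR L / Num.sqrt v) = (1 + k) * (growth v / la) by rewrite ge; ring.
  rewrite rg mulrDl mul1r lerD2l mulrCA mulrC; apply: ler_wpM2r => //; exact: ltW.
have [B HB] := HU' L U'L; exists B; rewrite -es; apply: le_trans HB; rewrite -/phi_const key.
apply: (@le_trans _ _ ((1 - k) * phi_const * (expR L / Num.sqrt v))); last first.
  rewrite ler_wpM2r ?(ltW eLv)// [leRHS]mulrA ler_pdivlMr//.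
  apply: (@le_trans _ _ ((1 - k) * phi_const * ((1 + k / 4) * Num.sqrt v))).
    by rewrite ler_wpM2l// mulr_ge0 ?(ltW b0)//; lra.
  rewrite mulrA ler_wpM2r ?(ltW sv)//.
  have -> : phi_const - phi_const * k / 4 = phi_const * (1 - k / 4) by ring.
  rewrite mulrAC [leRHS]mulrC ler_wpM2r ?(ltW b0)//.
  have : 0 <= k * k by rewrite mulr_ge0// ltW.
  lra.
have -> : (1 - k) * phi_const * (expR L / Num.sqrt v) = (1 - k) * (growth v / la) by rewrite ge; ring.
rewrite rg mulrBl mul1r lerD2l mulNr lerN2 mulrCA mulrC; apply: ler_wpM2r => //; exact: ltW.
Qed.

Lemma sum_two_squares1 : sum_two_squares 1.
Proof. by split=> //; exists 1, 0. Qed.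

Lemma npartitions_in_pos n : 0 < p n.
Proof. by rewrite ltr0n npartitions_in_gt0//; exact: sum_two_squares1. Qed.

(** At [la = 1] the exponent n t equals the leading value of [Phi]; the two equal contributions make
    the 2 in 2 growth. *)
Lemma growth_saddle n : (0 < n)%N ->
  n%:R * saddle 1 (ln n%:R / 2) = growth (ln n%:R / 2).
Proof.
move=> n0; have e : n%:R * expR (- (ln n%:R / 2)) = expR (ln n%:R / 2) :> R.
  by rewrite -[X in X * _]lnK ?posrE ?ltr0n// -expRD; congr expR; lra.
by rewrite /growth -e /saddle mul1r; ring.
Qed.

Lemma ln_npartitions_upper de : 0 < de -> exists2 V, 1 <= V & forall n, V <= ln n%:R / 2 :> R ->
  ln (p n) <= (2 + de) * growth (ln n%:R / 2).
Proof.
move=> de0; have [V V1 HV] := Phi_growth ltr01 de0.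
exists V => // n vV; set v := ln n%:R / 2 in vV *.
have n0 : (0 < n)%N by case: n @v vV => // /=; rewrite ln0// mul0r => h; lra.
have v0 : 0 < v by lra.
have s0 := saddle_gt0 ltr01 v0.
have [hU _] := HV v vV.
rewrite -ler_expR lnK ?posrE ?npartitions_in_pos//.
have h : p n * expR (- growth v) <= expR ((1 + de) * growth v).
  rewrite -growth_saddle// -/v; apply: le_trans (mul_expR_le_pgf _ _ _) _.
  apply: le_trans (pgf_le_eprod _ _ _ _) _; [exact: expR_gt0|by have [] := expRN_lt1 s0|].
  rewrite eprod_Phi// ler_expR growth_saddle// -/v; apply: le_trans (hU _) _.
  by rewrite divr1.
move: h; rewrite expRN ler_pdivrMr ?expR_gt0// -expRD => h; apply: le_trans h _.
by rewrite ler_expR; lra.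
Qed.

Lemma ln_npartitions_lower et : 0 < et -> exists2 V, 1 <= V & forall n, V <= ln n%:R / 2 :> R ->
  (2 - et) * growth (ln n%:R / 2) <= ln (p n).
Proof.
move=> et0; pose s := et / 8.
have s0 : 0 < s by rewrite /s divr_gt0.
pose la := 1 + s; pose mu := 1 + 2 * s.
have la0 : 0 < la by rewrite /la; lra.
have mu0 : 0 < mu by rewrite /mu; lra.
have g1 : 0 < (la - 1) ^+ 2 / la by rewrite divr_gt0// exprn_gt0// /la; lra.
have g2 : 0 < (mu - la) ^+ 2 / (la * mu ^+ 2).
  by rewrite divr_gt0 ?mulr_gt0 ?exprn_gt0// /la /mu; lra.
pose g := Num.min ((la - 1) ^+ 2 / la) ((mu - la) ^+ 2 / (la * mu ^+ 2)).
pose de := Num.min (et / 4) (g / 4).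
have gg0 : 0 < g by rewrite lt_min g1.
have de0 : 0 < de by rewrite lt_min !divr_gt0.
have de1 : de <= et / 4 by rewrite ge_min lexx.
have deg : 4 * de <= g.
  have : de <= g / 4 by rewrite ge_min lexx orbT.
  lra.
have gle1 : g <= (la - 1) ^+ 2 / la by rewrite ge_min lexx.
have gle2 : g <= (mu - la) ^+ 2 / (la * mu ^+ 2) by rewrite ge_min lexx orbT.
have [V1 V11 H1] := Phi_growth ltr01 de0.
have [Vl Vl1 Hl] := Phi_growth la0 de0.
have [Vm Vm1 Hm] := Phi_growth mu0 de0.
have [Vg Vg1 Hg] := growth_large (3 / de + 12 / et).
exists (V1 + Vl + Vm + Vg); first by lra.
move=> n vV; set v := ln n%:R / 2 in vV *.
have n0 : (0 < n)%N by case: n @v vV => // /=; rewrite ln0// mul0r => h; lra.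
have v0 : 0 < v by lra.
have s1 := saddle_gt0 ltr01 v0.
have [] := H1 v ltac:(lra); have [] := Hl v ltac:(lra); have [] := Hm v ltac:(lra).
have := Hg v ltac:(lra); rewrite !(saddleE la) !(saddleE mu).
move=> big hm _ _ [B hB] h1 _.
have A0 := growth_gt0 v0.
have bigd : 3 <= de * growth v.
  rewrite mulrC -ler_pdivrMr//; apply: le_trans big.
  have a0 : 0 <= 3 / de by rewrite divr_ge0// ltW.
  have b0 : 0 <= 12 / et * (1 + v) by rewrite mulr_ge0 ?divr_ge0 ?(ltW et0)//; lra.
  rewrite mulrDl mulrDr mulr1.
  have : 0 <= 3 / de * v by rewrite mulr_ge0 ?(ltW v0).
  lra.
have bige : 3 + 3 * v <= et / 4 * growth v.
  have : 12 / et * (1 + v) <= growth v.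
    apply: le_trans big; rewrite ler_wpM2r//; first by lra.
    by rewrite lerDr divr_ge0// ltW.
  by rewrite mulrAC ler_pdivrMr// => h; lra.
have := @saddle_lower_bound R sum_two_squares (saddle 1 v) s de n B sum_two_squares1 s1 s0.
rewrite growth_saddle// -/v -/la -/mu /= => H.
have {H} : (2 - 4 * s - de) * growth v <= ln (2 * n.+1%:R * p n).
  apply: H => //; first exact: le_trans deg gle1.
  - exact: le_trans deg gle2.
  - by rewrite -mulrA; lra.
  - move=> N; apply: le_trans (pgf_le_eprod _ _ _ _) _; [exact: expR_gt0|by have [] := expRN_lt1 (mulr_gt0 mu0 s1)|].
    by rewrite (eprod_Phi _ (mulr_gt0 mu0 s1)) ler_expR; exact: hm.
  - move=> N; apply: le_trans (pgf_le_eprod _ _ _ _) _; [exact: expR_gt0|by have [] := expRN_lt1 s1|].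
    by rewrite eprod_Phi// ler_expR; have := h1 N; rewrite divr1.
  - by rewrite (eprod_Phi _ (mulr_gt0 la0 s1)) ler_expR.
have pn0 := npartitions_in_pos n.
have n1 : 0 < n%:R :> R by rewrite ltr0n.
rewrite lnM ?posrE ?mulr_gt0// => h.
have lnn : ln (2 * n.+1%:R : R) <= 3 + 3 * v.
  apply: (@le_trans _ _ (ln (4 * n%:R))).
    rewrite ler_ln ?posrE ?mulr_gt0//.
    have : 1 <= n%:R :> R by rewrite ler1n.
    by rewrite -natr1; lra.
  rewrite lnM ?posrE// (_ : ln n%:R = 2 * v); last by rewrite /v; lra.
  have : ln 4 <= 3 :> R.
    by rewrite -ler_expR lnK ?posrE//; have := expR_ge1Dx (3 : R); lra.
  lra.
have sE : 4 * s = et / 2 by rewrite /s; lra.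
rewrite sE in h.
have : 0 <= (et / 4 - de) * growth v by rewrite mulr_ge0 ?(ltW A0)//; lra.
lra.
Qed.

End GrowthOfPartitions.

(** * The explicit exponent and prefactor *)

Section LeadingTerm.
Variable R : realType.
Local Notation K := (landau_ramanujan R).

Lemma powR14 (x : R) : 0 <= x -> x `^ (1 / 4) = rt4 x.
Proof.
move=> x0; rewrite (_ : 1 / 4 = 2^-1 * 2^-1); last by field.
by rewrite powRrM !powR12_sqrt// powR_ge0.
Qed.

Definition exponent (n : nat) : R :=
  2 `^ (3 / 4) * pi * Num.sqrt (K / 3) * n%:R `^ (1 / 2) * ln n%:R `^ (- (1 / 4)).

Definition prefactor (n : nat) : R :=
  2 `^ (- (9 / 8)) * (K / 3) `^ (1 / 4) * n%:R `^ (- (3 / 4)) * ln n%:R `^ (- (1 / 8)).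

Lemma exponent_growth n : (1 < n)%N -> exponent n = 2 * growth (ln n%:R / 2).
Proof.
move=> n1; have n0 : 0 < n%:R :> R by rewrite ltr0n ltnW.
have l0 : 0 < ln n%:R :> R by rewrite ln_gt0// ltr1n.
have K0 := landau_gt0 R; have p0 := pi_gt0 R.
rewrite /exponent /growth powRN (powR14 (ltW l0)) div1r (powR12_sqrt (ltW n0)).
have -> : expR (ln n%:R / 2) = Num.sqrt n%:R :> R.
  by rewrite -[X in Num.sqrt X]lnK ?posrE// {2}(splitr (ln n%:R)) expRD -expr2 sqrtr_sqr ger0_norm// expR_ge0.
have -> : 2 `^ (3 / 4) = Num.sqrt 2 * rt4 2 :> R.
  rewrite (_ : 3 / 4 = 2^-1 + 1 / 4); last by field.
  rewrite powRD ?powR12_sqrt ?powR14//.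
  by apply/implyP => _; rewrite pnatr_eq0.
have -> : rt4 (ln n%:R / 2) = rt4 (ln n%:R) / rt4 2 :> R.
  by rewrite /rt4 !sqrtrM ?sqrtr_ge0 ?(ltW l0)// !sqrtrV ?sqrtr_ge0.
have -> : Num.sqrt (phi_const R) = pi * Num.sqrt (K / 3) / Num.sqrt 2.
  rewrite /phi_const (_ : _ * _ = pi ^+ 2 * (K / 3) / 2); last by field.
  have K3 : 0 <= K / 3 by rewrite divr_ge0// ltW.
  rewrite sqrtrM; last by rewrite mulr_ge0 ?sqr_ge0.
  by rewrite (sqrtrM _ (sqr_ge0 _)) sqrtr_sqr sqrtrV// (ger0_norm (ltW p0)).
have r2 : 0 < rt4 2 :> R by rewrite rt4_gt0.
have rl : 0 < rt4 (ln n%:R) :> R by rewrite rt4_gt0.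
have s2 : 0 < Num.sqrt 2 :> R by rewrite sqrtr_gt0.
have : Num.sqrt 2 ^+ 2 = 2 :> R by rewrite sqr_sqrtr.
move: (Num.sqrt 2) (Num.sqrt (K / 3)) (Num.sqrt n%:R) (rt4 2) r2 s2 => s k m r r2 s2 e.
rewrite -[in RHS]e.
by field; rewrite !gt_eqF.
Qed.

Lemma prefactor_gt0 n : (1 < n)%N -> 0 < prefactor n.
Proof.
move=> n1; have n0 : 0 < n%:R :> R by rewrite ltr0n ltnW.
have l0 : 0 < ln n%:R :> R by rewrite ln_gt0// ltr1n.
by rewrite /prefactor !mulr_gt0 ?powR_gt0// divr_gt0// landau_gt0.
Qed.

(** Linear in v = ln n / 2, hence negligible by [growth_large]. *)
Lemma ln_prefactor_bound : exists2 C, 0 <= C & forall n, 1 <= ln n%:R / 2 :> R ->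
  `|ln (prefactor n)| <= C * (1 + ln n%:R / 2).
Proof.
pose c : R := ln (2 `^ (- (9 / 8)) * (K / 3) `^ (1 / 4)).
exists (`|c| + 2); first by rewrite addr_ge0.
move=> n v1; set v := ln n%:R / 2 in v1 *.
have l0 : 2 <= ln n%:R :> R by move: v1; rewrite /v; lra.
have n0 : 0 < n%:R :> R by case: n @v v1 l0 => // v _; rewrite ln0//; lra.
have K3 : 0 < K / 3 by rewrite divr_gt0// landau_gt0.
have -> : ln (prefactor n) = c - 3 / 4 * ln n%:R - 1 / 8 * ln (ln n%:R).
  rewrite /prefactor lnM ?posrE ?mulr_gt0 ?powR_gt0//; last by lra.
  rewrite lnM ?posrE ?mulr_gt0 ?powR_gt0// -/c !ln_powR; lra.
have ll0 : 0 <= ln (ln n%:R) :> R by rewrite ln_ge0//; lra.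
have ll1 : ln (ln n%:R) <= ln n%:R :> R.
  rewrite -ler_expR lnK ?posrE; last by lra.
  by have := expR_ge1Dx (ln n%:R : R); lra.
have e : ln n%:R = 2 * v by rewrite /v; lra.
rewrite e in ll0 ll1 *; move: (ln (2 * v)) ll0 ll1 => w w0 w1.
have cv : 0 <= `|c| * v by rewrite mulr_ge0//; lra.
have := ler_norm c; have := ler_norm (- c); rewrite normrN => h1 h2.
by rewrite ler_norml; apply/andP; split; lra.
Qed.

Lemma ln_ge_eventually (V : R) : exists N, forall n, (N <= n)%N -> V <= ln n%:R / 2.
Proof.
exists (Num.truncn (expR (2 * V))).+1 => n hn.
have h : expR (2 * V) < n%:R.
  apply: lt_le_trans (_ : (Num.truncn (expR (2 * V))).+1%:R <= _); last by rewrite ler_nat.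
  by have /andP[] := truncn_itv (expR_ge0 (2 * V)).
have n0 : 0 < n%:R :> R by apply: lt_trans h; exact: expR_gt0.
have : expR (2 * V) <= expR (ln n%:R) by rewrite lnK ?posrE// ltW.
by rewrite ler_expR; lra.
Qed.

End LeadingTerm.

Theorem theorem1p1 (R : realType) :
  exists2 eps : nat -> R, eps n @[n --> \oo] --> 0 &
    (fun n : nat => (npartitions_in sum_two_squares n)%:R : R) ~_\oo
    (fun n : nat =>
       2 `^ (- (9 / 8)) * (landau_ramanujan R / 3) `^ (1 / 4)
       * n%:R `^ (- (3 / 4)) * (ln n%:R) `^ (- (1 / 8))
       * expR (2 `^ (3 / 4) * pi * Num.sqrt (landau_ramanujan R / 3)
               * n%:R `^ (1 / 2) * (ln n%:R) `^ (- (1 / 4))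
               * (1 + eps n))).
Proof.
pose p n : R := (npartitions_in sum_two_squares n)%:R.
(* Solving for [eps] makes both sides equal for n > 1; the content is that this [eps] tends to 0. *)
pose eps n : R := (ln (p n) - ln (prefactor R n)) / exponent R n - 1.
exists eps.
  apply/seqtoP => et et0.
  have [C C0 HC] := ln_prefactor_bound R.
  have [V1 V11 H1] := ln_npartitions_upper et0.
  have [V2 V21 H2] := ln_npartitions_lower et0.
  have [V3 V31 H3] := growth_large (C / et).
  have [N HN] := ln_ge_eventually (V1 + V2 + V3).
  exists (N + 2)%N => n Nn.
  have n1 : (1 < n)%N by apply: leq_trans Nn; exact: leq_addl.
  have := HN n (leq_trans (leq_addr _ _) Nn); rewrite /eps (exponent_growth _ n1).
  set v := ln n%:R / 2 => vV; rewrite subr0.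
  have A0 : 0 < growth v by apply: growth_gt0; lra.
  have := H1 n; have := H2 n; have := H3 v; have := HC n; rewrite -/v -/(p n).
  move=> /(_ ltac:(lra)) h4 /(_ ltac:(lra)) h3 /(_ ltac:(lra)) h2 /(_ ltac:(lra)) h1.
  have {}h3 : C * (1 + v) <= et * growth v.
    by move: h3; rewrite mulrAC ler_pdivrMr// [leRHS]mulrC.
  have e : (ln (p n) - ln (prefactor R n)) / (2 * growth v) - 1 =
      (ln (p n) - 2 * growth v - ln (prefactor R n)) / (2 * growth v).
    by field; rewrite gt_eqF.
  have g2 : 0 < 2 * growth v by exact: mulr_gt0.
  rewrite e normrM normfV (gtr0_norm g2) ler_pdivrMr// ler_norml.
  move: h4; rewrite ler_norml => /andP[h4 h5].
  by apply/andP; split; lra.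
apply/eqaddoP => e e0; near=> n.
have n1 : (1 < n)%N by near: n; exists 2%N.
have v0 : 0 < ln n%:R / 2 :> R by rewrite divr_gt0// ln_gt0// ltr1n.
have pn0 := npartitions_in_pos R n.
have D0 : exponent R n != 0 by rewrite exponent_growth// gt_eqF// mulr_gt0// growth_gt0.
rewrite [X in `|X|](_ : _ = 0) ?normr0 ?mulr_ge0 ?(ltW e0)//.
have q0 := prefactor_gt0 R n1.
change (p n - prefactor R n * expR (exponent R n * (1 + eps n)) = 0).
have -> : expR (exponent R n * (1 + eps n)) = p n / prefactor R n.
  have -> : exponent R n * (1 + eps n) = ln (p n) - ln (prefactor R n) by rewrite /eps; field.
  by rewrite expRD expRN !lnK ?posrE.
by rewrite mulrCA divff ?gt_eqF// mulr1 subrr.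
Unshelve. all: by end_near. Qed.
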